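(* Let $(S^6,g,J)$ be the six-sphere with its standard nearly Kähler structure (inherited from the imaginary octonions $\mathbb R^7$), with the $SU(3)$-structure whose $\Psi^+$ is the constant multiple of $dF$ of the appropriate norm, and let $\nabla$ be its $SU(3)$-connection with torsion 3-form. The nearly Kähler 6-sphere solves the gravitino equation, the gaugino equation with $F^A=R^\nabla$, and satisfies the Bianchi identities (B1) and (B2) with negative $\alpha'$. Consequently: (a) The product $(S^6\times\mathbb R,\ \omega,\ A=\nabla^7)$ with the $G_2$-structure $\omega=-F\wedge e_7-\Psi^+$ solves all the supersymmetry equations (gravitino, dilatino, gaugino) with non-zero flux and non-constant dilaton and satisfies (B1), (B2). Therefore it solves the equations of motion in dimension 7. The product $(S^6\times S^1,\omega,A=\nabla^7)$ is a compact space solving locally the supersymmetry equations and satisfying (B1), (B2) in dimension 7. (b) The product $(S^6\times\mathbb R\times\mathbb R,\ \Phi,\ A=\nabla^8)$ with the $Spin(7)$-structure $\Phi=e_0\wedge\omega+{*^7\omega}$ solves the supersymmetry equations with non-zero flux and non-constant dilaton and satisfies (B1), (B2). Therefore it solves the equations of motion in dimension 8. The product $(S^6\times S^1\times S^1,\Phi,A=\nabla^8)$ is a compact space solving locally the supersymmetry equations and satisfying (B1), (B2) in dimension 8.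
   Context: Here $e_7$ and $e_0$ are the standard 1-forms on the first and second $\mathbb R$ (or $S^1$) factor; forms on factors are pulled back. **Dimension 6.** An $SU(3)$-structure: almost Hermitian $(g,J)$, $F=g(\cdot,J\cdot)$, and a $(3,0)$-form $\Psi=\Psi^++\sqrt{-1}\Psi^-$, with local orthonormal coframes in which $F=-e_{12}-e_{34}-e_{56}$, $\Psi=-(e_1+\sqrt{-1}e_2)\wedge(e_3+\sqrt{-1}e_4)\wedge(e_5+\sqrt{-1}e_6)$ ($e_{ij\dots}=e_i\wedge e_j\wedge\cdots$), orientation $e_{123456}$. An $SU(3)$-connection with torsion 3-form is $\nabla=\nabla^g+\frac12T$ (i.e. $g(\nabla_XY,Z)=g(\nabla^g_XY,Z)+\frac12T(X,Y,Z)$), $T$ a 3-form, with $\nabla g=\nabla J=\nabla\Psi=0$; it is unique. For the nearly Kähler $S^6$ it exists. **Dimension 7.** A $G_2$-structure is a 3-form locally equal to $\omega=e_{127}-e_{236}+e_{347}+e_{567}-e_{146}-e_{245}+e_{135}$ in an oriented orthonormal coframe (fixing metric, orientation $e_{1\dots7}$ and Hodge star $*^7$). Lee form $\theta^7=-\frac13{*^7({*^7d\omega}\wedge\omega)}$. $\nabla^7=\nabla^g+\frac12T^7$ is the unique connection with torsion 3-form and $\nabla^7\omega=0$ (exists iff $d{*^7\omega}=\theta^7\wedge{*^7\omega}$). Dilaton: $2d\phi=\theta^7$. **Dimension 8.** A $Spin(7)$-structure is a 4-form locally of the form $e_0\wedge\omega+{*^7\omega}$ in an oriented orthonormal coframe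 $e_0,\dots,e_7$. Lee form $\theta^8=-\frac17{*({*d\Phi}\wedge\Phi)}$. $\nabla^8=\nabla^g+\frac12T^8$ is the unique connection with torsion 3-form and $\nabla^8\Phi=0$. Dilaton: $\theta^8=\frac{12}7d\phi$. **Supersymmetry equations** (flux $H=T$, dilaton $\phi$, gauge connection $A$ with curvature $F^A$, Clifford relation $e_me_n+e_ne_m=-2\delta_{mn}$, $\varepsilon$ the nowhere zero spinor defining the structure): gravitino $\nabla^g_m\varepsilon+\frac18H_{mnp}e_ne_p\varepsilon=0$; dilatino $(\partial_m\phi\,e_m+\frac1{12}H_{mnp}e_me_ne_p)\varepsilon=0$; gaugino $F^A_{mn}e_me_n\varepsilon=0$ (the 2-form part of $F^A$ lies in $su(3)$, $g_2$, $spin(7)$ respectively). ''Solving locally'' means that the Lee form is closed, so that $\phi$ is only a locally defined function. **Bianchi identities**, with $\tilde\nabla=\nabla^g-\frac12T$ and $T$ the torsion of $\nabla$: (B1) $dT=2\alpha'\,\mathrm{Tr}(F^A\wedge F^A)$; (B2) $dT=2\alpha'\big(\mathrm{Tr}(F^A\wedge F^A)-\mathrm{Tr}(R^{\tilde\nabla}\wedge R^{\tilde\nabla})\big)$. For a metric connection with curvature 2-forms $\Omega_{ab}=g(R(\cdot,\cdot)e_a,e_b)$, $\mathrm{Tr}(R\wedge R)=\sum_{a<b}\Omega_{ab}\wedge\Omega_{ab}$. ''Satisfies with negative $\alpha'$'' means that (B1) holds for some constant $\alpha'<0$ and (B2) holds for some constant $\alpha'<0$ (possibly a different one); equivalently,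 for a prescribed $\alpha'<0$ each identity is achieved after a constant homothetic rescaling of the structure. **Equations of motion** (for $H=T$, $A=\nabla$, and the constant $\alpha'$ of (B1)): $\mathrm{Ric}_{mn}-\frac14H_{mpq}H_n{}^{pq}+2\nabla^g_m\nabla^g_n\phi+2\alpha'\,\mathrm{Tr}(F^A_{mp}F^A_n{}^p)=0$; $\nabla^{g,m}(e^{-2\phi}H_{mnp})=0$; $D^m(e^{-2\phi}F^A_{mn})+\frac12e^{-2\phi}H_{npq}F^{A\,pq}=0$ ($D$ = Levi-Civita on form indices coupled to $A$); $s^g+4\,\mathrm{div}\,\mathrm{grad}\,\phi-4\|d\phi\|^2-\frac1{12}H_{mnp}H^{mnp}+\alpha'\,\mathrm{Tr}(F^A_{mn}F^{A\,mn})=0$, with $\mathrm{Tr}(F_{mp}F_{nq})=\sum_{a<b}(F_{mp})_{ab}(F_{nq})_{ab}$. *)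

(* Defs.v *)
From HB Require Import structures.
From mathcomp Require Import all_boot all_order all_algebra all_fingroup.
From mathcomp Require Import all_classical all_reals all_analysis.
From mathcomp Require Import ring lra.

Set Implicit Arguments.
Unset Strict Implicit.
Unset Printing Implicit Defensive.

Import Order.TTheory GRing.Theory Num.Theory.
Import numFieldNormedType.Exports.

Local Open Scope classical_set_scope.
Local Open Scope ring_scope.

(******************************************************************************)
(* Manifolds are embedded submanifolds M of a Euclidean space R^N, with the   *)
(* induced metric.  All tensor calculus is done in Cartan style: a local      *)
(* parametrization p : U -> M (U open in R^n, n = dim M) carries an           *)
(* orthonormal frame e_0, ..., e_(n-1) of vector fields on U, and every       *)
(* equation is the equality of components required in all such frames that    *)
(* are adapted to the geometric structure.  Frame vectors of 'I_6 and 'I_7    *)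
(* are numbered from 1 in the classical formulas (index i is e_(i+1)), those  *)
(* of 'I_8 from 0 (index i is e_i).                                           *)
(******************************************************************************)

Definition upd (k : nat) (X : Type) (I : 'I_k -> X) (s : 'I_k) (x : X) :
  'I_k -> X := fun u => if u == s then x else I u.

(* For X a vector space these are k-forms; for X = 'I_n they are the          *)
(* components of k-forms.  Convention: (a /\ b)(u, v) = a u * b v - a v * b u *)
(* for 1-forms.                                                               *)
Definition wedge (R : realType) (X : Type) (k l : nat)
    (a : ('I_k -> X) -> R) (b : ('I_l -> X) -> R) (v : 'I_(k + l) -> X) : R :=
  (k`!)%:R^-1 * (l`!)%:R^-1 * \sum_(s : 'S_(k + l)) (-1) ^+ s *
    a (fun i => v (s (lshift l i))) * b (fun i => v (s (rshift k i))).

Definition catidx (X : Type) (k l : nat) (I : 'I_k -> X) (J : 'I_l -> X) :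
    'I_(k + l) -> X :=
  fun a => match fintype.split a with inl s => I s | inr t => J t end.

(* Hodge star in an oriented orthonormal frame of R^(k + l):                  *)
(* a /\ hodge a = |a|^2 vol.                                                   *)
Definition hodge (R : realType) (k l : nat)
    (a : ('I_k -> 'I_(k + l)) -> R) (J : 'I_l -> 'I_(k + l)) : R :=
  (k`!)%:R^-1 * \sum_(I : {ffun 'I_k -> 'I_(k + l)})
    a I * \det (\matrix_(i, j) (catidx I J i == j)%:R).

(* Components of e_{s_0} /\ e_{s_1} /\ ..., where i : 'I_n carries the label  *)
(* i + o.                                                                     *)
Definition ebasis (R : realType) (n o k : nat) (s : seq nat)
    (I : 'I_k -> 'I_n) : R :=
  \det (\matrix_(a < k, b < k) ((I a + o)%N == nth 0%N s b)%:R).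

Definition F_std (R : realType) (I : 'I_2 -> 'I_6) : R :=
  - ebasis R 1 [:: 1; 2]%N I - ebasis R 1 [:: 3; 4]%N I
  - ebasis R 1 [:: 5; 6]%N I.

(* Real and imaginary part of - (e1 + i e2) /\ (e3 + i e4) /\ (e5 + i e6) *)
Definition Psip_std (R : realType) (I : 'I_3 -> 'I_6) : R :=
  - (ebasis R 1 [:: 1; 3; 5]%N I - ebasis R 1 [:: 1; 4; 6]%N I
     - ebasis R 1 [:: 2; 3; 6]%N I - ebasis R 1 [:: 2; 4; 5]%N I).

Definition Psim_std (R : realType) (I : 'I_3 -> 'I_6) : R :=
  - (ebasis R 1 [:: 1; 3; 6]%N I + ebasis R 1 [:: 1; 4; 5]%N I
     + ebasis R 1 [:: 2; 3; 5]%N I - ebasis R 1 [:: 2; 4; 6]%N I).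

Definition omega_std (R : realType) (I : 'I_3 -> 'I_7) : R :=
  ebasis R 1 [:: 1; 2; 7]%N I - ebasis R 1 [:: 2; 3; 6]%N I
  + ebasis R 1 [:: 3; 4; 7]%N I + ebasis R 1 [:: 5; 6; 7]%N I
  - ebasis R 1 [:: 1; 4; 6]%N I - ebasis R 1 [:: 2; 4; 5]%N I
  + ebasis R 1 [:: 1; 3; 5]%N I.

(* Extension by zero along e_0; e_i of R^7 is index i of 'I_8. *)
Definition ext8 (R : realType) (k : nat) (a : ('I_k -> 'I_7) -> R)
    (J : 'I_k -> 'I_8) : R :=
  if [forall s, J s != ord0]
  then a (fun s => odflt ord0 (unlift ord0 (J s))) else 0.

Definition Phi_std (R : realType) : ('I_4 -> 'I_8) -> R :=
  fun I => wedge (k := 1) (l := 3) (ebasis R 0 [:: 0]%N)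
             (ext8 (@omega_std R)) I
           + ext8 (hodge (k := 3) (l := 4) (@omega_std R)) I.

Definition iterder (R : realType) (n : nat) (W : normedModType R)
    (vs : seq 'rV[R]_n) (f : 'rV[R]_n -> W) : 'rV[R]_n -> W :=
  foldr (fun v g => fun y => 'D_v g y) f vs.

Definition smooth_on (R : realType) (n : nat) (W : normedModType R)
    (U : set 'rV[R]_n) (f : 'rV[R]_n -> W) : Prop :=
  forall (vs : seq 'rV[R]_n) (y : 'rV[R]_n), U y ->
    differentiable (iterder vs f) y.

Definition frame (R : realType) (n : nat) := 'I_n -> 'rV[R]_n -> 'rV[R]_n.

(* y |-> components of a k-form (or k-tensor) in a frame *)
Definition lform (R : realType) (n k : nat) :=
  'rV[R]_n -> ('I_k -> 'I_n) -> R.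

(* y i j k |-> g (nabla_{e_i} e_j, e_k) *)
Definition coefs (R : realType) (n : nat) :=
  'rV[R]_n -> 'I_n -> 'I_n -> 'I_n -> R.

Definition pd (R : realType) (n : nat) (W : normedModType R) (e : frame R n)
    (m : 'I_n) (f : 'rV[R]_n -> W) (y : 'rV[R]_n) : W := 'D_(e m y) f y.

Definition bracket (R : realType) (n : nat) (e : frame R n) (i j : 'I_n)
    (y : 'rV[R]_n) : 'rV[R]_n := pd e i (e j) y - pd e j (e i) y.

(* [e_i, e_j] = \sum_k strc e y i j k e_k *)
Definition strc (R : realType) (n : nat) (e : frame R n) : coefs R n :=
  fun y i j k => (bracket e i j y *m invmx (\matrix_l e l y)) 0 k.

(* Levi-Civita connection of the metric for which e is orthonormal (Koszul) *)
Definition LC (R : realType) (n : nat) (e : frame R n) : coefs R n :=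
  fun y i j k =>
    2^-1 * (strc e y i j k - strc e y j k i + strc e y k i j).

Lemma strcC (R : realType) (n : nat) (e : frame R n) y i j k :
  strc e y i j k = - strc e y j i k.
Proof. by rewrite /strc /bracket -[X in X *m _]opprB mulNmx mxE. Qed.

Lemma LC_metric (R : realType) (n : nat) (e : frame R n) y i j k :
  LC e y i j k + LC e y i k j = 0.
Proof.
rewrite /LC (strcC e y k i j) (strcC e y k j i) (strcC e y j i k); ring.
Qed.

Lemma LC_torsion_free (R : realType) (n : nat) (e : frame R n) y i j k :
  LC e y i j k - LC e y j i k = strc e y i j k.
Proof.
rewrite /LC (strcC e y j i k) (strcC e y i k j) (strcC e y k j i); lra.
Qed.

(* Exterior derivative by Cartan's formula; [e_s, e_t] is put in the slot of  *)
(* e_t instead of the first one, which accounts for the sign.                 *)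
Definition ext_d (R : realType) (n k : nat) (e : frame R n)
    (a : lform R n k) : lform R n k.+1 :=
  fun y I => \sum_(s < k.+1) (-1) ^+ s *
    (pd e (I s) (fun z => a z (fun u => I (lift s u))) y
     - \sum_(t < k.+1 | (s < t)%N) \sum_l
         strc e y (I s) (I t) l * a y (fun u => upd I t l (lift s u))).

(* (nabla_{e_m} a)_I for the connection w *)
Definition cov (R : realType) (n k : nat) (e : frame R n) (w : coefs R n)
    (a : lform R n k) (y : 'rV[R]_n) (m : 'I_n) (I : 'I_k -> 'I_n) : R :=
  pd e m (fun z => a z I) y
  - \sum_(s < k) \sum_l w y m (I s) l * a y (upd I s l).

Definition metric_comps (R : realType) (n : nat) : lform R n 2 :=
  fun _ I => (I 0 == I 1)%:R.

Definition idx2 (n : nat) (i j : 'I_n) : 'I_2 -> 'I_n := tnth [tuple i; j].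
Definition idx3 (n : nat) (i j k : 'I_n) : 'I_3 -> 'I_n :=
  tnth [tuple i; j; k].

Definition conn (R : realType) (n : nat) (e : frame R n) (c : R)
    (T : lform R n 3) : coefs R n :=
  fun y i j k => LC e y i j k + c * T y (idx3 i j k).

(* curv e w y m q a b = g (R(e_m, e_q) e_a, e_b), with                        *)
(* R(X, Y) = [nabla_X, nabla_Y] - nabla_[X, Y].                               *)
Definition curv (R : realType) (n : nat) (e : frame R n) (w : coefs R n)
    (y : 'rV[R]_n) (m q a b : 'I_n) : R :=
  pd e m (fun z => w z q a b) y - pd e q (fun z => w z m a b) y
  + \sum_c (w y q a c * w y m c b - w y m a c * w y q c b)
  - \sum_l strc e y m q l * w y l a b.

Definition curv2 (R : realType) (n : nat) (e : frame R n) (w : coefs R n)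
    (y : 'rV[R]_n) (a b : 'I_n) : ('I_2 -> 'I_n) -> R :=
  fun I => curv e w y (I 0) (I 1) a b.

Definition tr_wedge (R : realType) (n : nat) (e : frame R n) (w : coefs R n) :
    lform R n 4 :=
  fun y I => \sum_(a < n) \sum_(b < n | (a < b)%N)
    wedge (curv2 e w y a b) (curv2 e w y a b) I.

(* Tr (F_{mp} F_{nq}) *)
Definition tr_curv (R : realType) (n : nat) (e : frame R n) (w : coefs R n)
    (y : 'rV[R]_n) (m p m' q : 'I_n) : R :=
  \sum_(a < n) \sum_(b < n | (a < b)%N) curv e w y m p a b * curv e w y m' q a b.

Definition ricci (R : realType) (n : nat) (e : frame R n) (y : 'rV[R]_n)
    (m q : 'I_n) : R := \sum_p curv e (LC e) y p m q p.

Definition scal (R : realType) (n : nat) (e : frame R n) (y : 'rV[R]_n) : R :=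
  \sum_m ricci e y m m.

Definition hess (R : realType) (n : nat) (e : frame R n)
    (phi : 'rV[R]_n -> R) (y : 'rV[R]_n) (m q : 'I_n) : R :=
  cov e (LC e) (fun z (I : 'I_1 -> 'I_n) => pd e (I 0) phi z) y m (fun=> q).

(* Below H is the flux, w the gauge connection (on the tangent bundle), gam   *)
(* the Clifford matrices and eps a spinor field in the given frame.           *)

Definition clifford (R : realType) (n K : nat) (gam : 'I_n -> 'M[R]_K) : Prop :=
  forall i j, gam i *m gam j + gam j *m gam i = (- 2 * (i == j)%:R)%:M.

(* A_{ab} e_a e_b eps *)
Definition cliff2 (R : realType) (n K : nat) (gam : 'I_n -> 'M[R]_K)
    (A : 'I_n -> 'I_n -> R) (eps : 'cV[R]_K) : 'cV[R]_K :=
  \sum_a \sum_b A a b *: (gam a *m gam b *m eps).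

Definition gravitino_at (R : realType) (n K : nat) (gam : 'I_n -> 'M[R]_K)
    (e : frame R n) (H : lform R n 3) (eps : 'rV[R]_n -> 'cV[R]_K)
    (y : 'rV[R]_n) : Prop :=
  forall m, pd e m eps y + 4^-1 *: cliff2 gam (LC e y m) (eps y)
    + 8^-1 *: cliff2 gam (fun a b => H y (idx3 m a b)) (eps y) = 0.

Definition dilatino_at (R : realType) (n K : nat) (gam : 'I_n -> 'M[R]_K)
    (e : frame R n) (H : lform R n 3) (phi : 'rV[R]_n -> R)
    (eps : 'rV[R]_n -> 'cV[R]_K) (y : 'rV[R]_n) : Prop :=
  \sum_m pd e m phi y *: (gam m *m eps y)
  + 12^-1 *: \sum_m gam m *m
      cliff2 gam (fun a b => H y (idx3 m a b)) (eps y) = 0.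

Definition gaugino_at (R : realType) (n K : nat) (gam : 'I_n -> 'M[R]_K)
    (e : frame R n) (w : coefs R n) (eps : 'rV[R]_n -> 'cV[R]_K)
    (y : 'rV[R]_n) : Prop :=
  forall a b, cliff2 gam (fun m q => curv e w y m q a b) (eps y) = 0.

Definition bianchi1_at (R : realType) (n : nat) (e : frame R n)
    (T : lform R n 3) (w : coefs R n) (al : R) (y : 'rV[R]_n) : Prop :=
  forall I, ext_d e T y I = 2 * al * tr_wedge e w y I.

Definition bianchi2_at (R : realType) (n : nat) (e : frame R n)
    (T : lform R n 3) (w : coefs R n) (al : R) (y : 'rV[R]_n) : Prop :=
  forall I, ext_d e T y I =
    2 * al * (tr_wedge e w y I - tr_wedge e (conn e (- 2^-1) T) y I).

(* D_m X_{pq} for a 2-form X with values in the endomorphisms of the tangent  *)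
(* bundle, Levi-Civita on p, q and w on the endomorphism indices a, b         *)
Definition covF (R : realType) (n : nat) (e : frame R n) (w : coefs R n)
    (X : 'rV[R]_n -> 'I_n -> 'I_n -> 'I_n -> 'I_n -> R) (y : 'rV[R]_n)
    (m p q a b : 'I_n) : R :=
  pd e m (fun z => X z p q a b) y
  - \sum_l (LC e y m p l * X y l q a b + LC e y m q l * X y p l a b)
  - \sum_c (w y m a c * X y p q c b + w y m b c * X y p q a c).

Definition eom_at (R : realType) (n : nat) (e : frame R n)
    (H : lform R n 3) (phi : 'rV[R]_n -> R) (w : coefs R n) (al : R)
    (y : 'rV[R]_n) : Prop :=
  [/\ forall m q : 'I_n,
        ricci e y m q
        - 4^-1 * (\sum_a \sum_b H y (idx3 m a b) * H y (idx3 q a b))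
        + 2 * hess e phi y m q
        + 2 * al * (\sum_p tr_curv e w y m p q p) = 0,
      forall p q : 'I_n,
        \sum_m cov e (LC e) (fun z I => expR (- 2 * phi z) * H z I) y m
          (idx3 m p q) = 0,
      forall q a b : 'I_n,
        \sum_m covF e w
          (fun z i j c d => expR (- 2 * phi z) * curv e w z i j c d)
          y m m q a b
        + 2^-1 * expR (- 2 * phi y) *
          (\sum_i \sum_j H y (idx3 q i j) * curv e w y i j a b) = 0
    & scal e y + 4 * (\sum_m hess e phi y m m)
      - 4 * (\sum_m pd e m phi y ^+ 2)
      - 12^-1 * (\sum_m \sum_a \sum_b H y (idx3 m a b) ^+ 2)
      + al * (\sum_m \sum_q tr_curv e w y m q m q) = 0].

Definition dotv (R : realType) (N : nat) (u v : 'rV[R]_N) : R :=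
  \sum_i u 0 i * v 0 i.

Definition tangent (R : realType) (N : nat) (M : set 'rV[R]_N)
    (x v : 'rV[R]_N) : Prop :=
  exists c : R -> 'rV[R]_N,
    [/\ c 0 = x, forall t, M (c t) & is_derive (0 : R) (1 : R) c v].

(* Only the values on tangent vectors at points of M are meaningful. *)
Definition dform (R : realType) (N k : nat) :=
  'rV[R]_N -> ('I_k -> 'rV[R]_N) -> R.

(* dp (e_i) *)
Definition push (R : realType) (N n : nat) (p : 'rV[R]_n -> 'rV[R]_N)
    (e : frame R n) (i : 'I_n) (y : 'rV[R]_n) : 'rV[R]_N := 'D_(e i y) p y.

Definition comps (R : realType) (N n k : nat) (p : 'rV[R]_n -> 'rV[R]_N)
    (e : frame R n) (a : dform R N k) : lform R n k :=
  fun y I => a (p y) (fun s => push p e (I s) y).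

Definition frames (R : realType) (N n : nat) :=
  set 'rV[R]_n -> ('rV[R]_n -> 'rV[R]_N) -> frame R n -> Prop.

(* For n = dim M: orthonormality makes p an immersion, hence a local          *)
(* diffeomorphism onto an open part of M.                                     *)
Definition onframe (R : realType) (N n : nat) (M : set 'rV[R]_N) :
    frames R N n :=
  fun U p e =>
    [/\ open U, smooth_on U p, forall i, smooth_on U (e i),
        forall y, U y -> M (p y) &
        forall y i j, U y -> dotv (push p e i y) (push p e j y) = (i == j)%:R].

Definition framed_around (R : realType) (N n : nat) (M : set 'rV[R]_N)
    (A : frames R N n) : Prop :=
  forall x, M x -> exists U p e y, [/\ A U p e, U y & p y = x].

Definition is_form (R : realType) (N n k : nat) (M : set 'rV[R]_N)
    (a : dform R N k) : Prop :=
  [/\ forall x v s c u u', M x -> (forall t, tangent M x (v t)) ->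
        tangent M x u -> tangent M x u' ->
        a x (upd v s (c *: u + u')) = c * a x (upd v s u) + a x (upd v s u'),
      forall x v s t, M x -> (forall r, tangent M x (v r)) ->
        s != t -> v s = v t -> a x v = 0 &
      forall U p e, onframe (n := n) M U p e ->
        forall I, smooth_on U (fun y => comps p e a y I)].

Definition smooth_fun (R : realType) (N n : nat) (M : set 'rV[R]_N)
    (phi : 'rV[R]_N -> R) : Prop :=
  forall U p e, onframe (n := n) M U p e -> smooth_on U (fun y => phi (p y)).

Definition nonzero_form (R : realType) (N k : nat) (M : set 'rV[R]_N)
    (a : dform R N k) : Prop :=
  exists x v, [/\ M x, forall s, tangent M x (v s) & a x v != 0].

Definition nonconstant (R : realType) (N : nat) (M : set 'rV[R]_N)
    (phi : 'rV[R]_N -> R) : Prop :=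
  exists x x', [/\ M x, M x' & phi x != phi x'].

Definition su3_frame (R : realType) (N : nat) (M : set 'rV[R]_N)
    (F : dform R N 2) (Psip Psim : dform R N 3) : frames R N 6 :=
  fun U p e => onframe M U p e /\
    forall y, U y ->
      [/\ forall I, comps p e F y I = F_std R I,
          forall I, comps p e Psip y I = Psip_std R I &
          forall I, comps p e Psim y I = Psim_std R I].

Definition g2_frame (R : realType) (N : nat) (M : set 'rV[R]_N)
    (omega : dform R N 3) : frames R N 7 :=
  fun U p e => onframe M U p e /\
    forall y I, U y -> comps p e omega y I = omega_std R I.

Definition spin7_frame (R : realType) (N : nat) (M : set 'rV[R]_N)
    (Phi : dform R N 4) : frames R N 8 :=
  fun U p e => onframe M U p e /\
    forall y I, U y -> comps p e Phi y I = Phi_std R I.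

Definition kahler_form (R : realType) (N : nat)
    (J : 'rV[R]_N -> 'rV[R]_N -> 'rV[R]_N) : dform R N 2 :=
  fun x v => dotv (v 0) (J x (v 1)).

Definition almost_hermitian (R : realType) (N : nat) (M : set 'rV[R]_N)
    (J : 'rV[R]_N -> 'rV[R]_N -> 'rV[R]_N) : Prop :=
  forall x u v, M x -> tangent M x u -> tangent M x v ->
    [/\ tangent M x (J x u), forall c, J x (c *: u + v) = c *: J x u + J x v,
        J x (J x u) = - u & dotv (J x u) (J x v) = dotv u v].

Definition su3_structure (R : realType) (N : nat) (M : set 'rV[R]_N)
    (J : 'rV[R]_N -> 'rV[R]_N -> 'rV[R]_N) (Psip Psim : dform R N 3) : Prop :=
  [/\ almost_hermitian M J, is_form 6 M (kahler_form J), is_form 6 M Psip,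
      is_form 6 M Psim &
      framed_around M (su3_frame M (kahler_form J) Psip Psim)].

Definition g2_structure (R : realType) (N : nat) (M : set 'rV[R]_N)
    (omega : dform R N 3) : Prop :=
  is_form 7 M omega /\ framed_around M (g2_frame M omega).

Definition spin7_structure (R : realType) (N : nat) (M : set 'rV[R]_N)
    (Phi : dform R N 4) : Prop :=
  is_form 8 M Phi /\ framed_around M (spin7_frame M Phi).

Definition tconn (R : realType) (N n : nat) (p : 'rV[R]_n -> 'rV[R]_N)
    (e : frame R n) (T : dform R N 3) : coefs R n :=
  conn e 2^-1 (comps p e T).

Definition parallel (R : realType) (N n k : nat) (A : frames R N n)
    (T : dform R N 3) (a : dform R N k) : Prop :=
  forall U p e y, A U p e -> U y ->
    forall m I, cov e (tconn p e T) (comps p e a) y m I = 0.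

Definition metric_connection (R : realType) (N n : nat) (A : frames R N n)
    (T : dform R N 3) : Prop :=
  forall U p e y, A U p e -> U y ->
    forall m I, cov e (tconn p e T) (@metric_comps R n) y m I = 0.

(* T is the torsion 3-form of an SU(3)-connection; as nabla g = 0, the        *)
(* conditions nabla J = 0 and nabla F = 0, F = g (., J .), are the same.      *)
Definition su3_torsion (R : realType) (N : nat) (M : set 'rV[R]_N)
    (J : 'rV[R]_N -> 'rV[R]_N -> 'rV[R]_N) (Psip Psim T : dform R N 3) : Prop :=
  let A := su3_frame M (kahler_form J) Psip Psim in
  [/\ is_form 6 M T, metric_connection A T, parallel A T (kahler_form J),
      parallel A T Psip & parallel A T Psim].

Definition g2_torsion (R : realType) (N : nat) (M : set 'rV[R]_N)
    (omega T : dform R N 3) : Prop :=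
  [/\ is_form 7 M T, metric_connection (g2_frame M omega) T &
      parallel (g2_frame M omega) T omega].

Definition spin7_torsion (R : realType) (N : nat) (M : set 'rV[R]_N)
    (Phi : dform R N 4) (T : dform R N 3) : Prop :=
  [/\ is_form 8 M T, metric_connection (spin7_frame M Phi) T &
      parallel (spin7_frame M Phi) T Phi].

Definition lee7 (R : realType) (e : frame R 7) (omega : lform R 7 3) :
    lform R 7 1 :=
  fun y => fun I => - 3^-1 *
    hodge (k := 6) (l := 1)
      (wedge (hodge (k := 4) (l := 3) (ext_d e omega y)) (omega y)) I.

Definition lee8 (R : realType) (e : frame R 8) (Phi : lform R 8 4) :
    lform R 8 1 :=
  fun y => fun I => - 7^-1 *
    hodge (k := 7) (l := 1)
      (wedge (hodge (k := 5) (l := 3) (ext_d e Phi y)) (Phi y)) I.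

(* theta = kappa d phi *)
Definition dilaton_at (R : realType) (n : nat) (e : frame R n)
    (theta : lform R n 1) (kappa : R) (phi : 'rV[R]_n -> R)
    (y : 'rV[R]_n) : Prop :=
  forall m, theta y (fun=> m) = kappa * pd e m phi y.

(* Derivation action of A in so(n) on k-tensors *)
Definition so_act (R : realType) (n k : nat) (A : 'M[R]_n)
    (a : ('I_k -> 'I_n) -> R) (I : 'I_k -> 'I_n) : R :=
  \sum_(s < k) \sum_l A (I s) l * a (upd I s l).

Definition in_su3 (R : realType) (A : 'M[R]_6) : Prop :=
  [/\ forall I, so_act A (@F_std R) I = 0,
      forall I, so_act A (@Psip_std R) I = 0 &
      forall I, so_act A (@Psim_std R) I = 0].

Definition in_g2 (R : realType) (A : 'M[R]_7) : Prop :=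
  forall I, so_act A (@omega_std R) I = 0.

Definition in_spin7 (R : realType) (A : 'M[R]_8) : Prop :=
  forall I, so_act A (@Phi_std R) I = 0.

(* The spinor defining a G-structure (G = SU(3), G_2, Spin(7), all simply     *)
(* connected, so that adapted frames lift canonically to Spin(n)) is, in      *)
(* every adapted frame, one and the same element eta of the spinor module,    *)
(* whose isotropy algebra in so(n) is the Lie algebra g of G.  The spinor     *)
(* module is real, of dimension K = 8, 8, 16 for n = 6, 7, 8.                 *)
Definition defining_spinor (R : realType) (n K : nat) (g : 'M[R]_n -> Prop)
    (gam : 'I_n -> 'M[R]_K) (eta : 'cV[R]_K) : Prop :=
  [/\ clifford gam, eta != 0 &
      forall A : 'M[R]_n, A^T = - A -> (cliff2 gam A eta = 0 <-> g A)].

Definition has_spinor (R : realType) (n K : nat) (g : 'M[R]_n -> Prop) : Prop :=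
  exists (gam : 'I_n -> 'M[R]_K) (eta : 'cV[R]_K), defining_spinor g gam eta.

(* Below T is the torsion of the connection nabla^g + T / 2, which is also    *)
(* the gauge connection, and the flux is H = T.                               *)

Definition solves_gravitino (R : realType) (N n K : nat) (A : frames R N n)
    (g : 'M[R]_n -> Prop) (T : dform R N 3) : Prop :=
  has_spinor K g /\
  forall (gam : 'I_n -> 'M[R]_K) (eta : 'cV[R]_K), defining_spinor g gam eta ->
  forall U p e y, A U p e -> U y ->
    gravitino_at gam e (comps p e T) (fun=> eta) y.

Definition solves_gaugino (R : realType) (N n K : nat) (A : frames R N n)
    (g : 'M[R]_n -> Prop) (T : dform R N 3) : Prop :=
  has_spinor K g /\
  forall (gam : 'I_n -> 'M[R]_K) (eta : 'cV[R]_K), defining_spinor g gam eta ->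
  forall U p e y, A U p e -> U y ->
    gaugino_at gam e (tconn p e T) (fun=> eta) y.

Definition solves_dilatino (R : realType) (N n K : nat) (A : frames R N n)
    (g : 'M[R]_n -> Prop) (T : dform R N 3) (phi : 'rV[R]_N -> R) : Prop :=
  has_spinor K g /\
  forall (gam : 'I_n -> 'M[R]_K) (eta : 'cV[R]_K), defining_spinor g gam eta ->
  forall U p e y, A U p e -> U y ->
    dilatino_at gam e (comps p e T) (phi \o p) (fun=> eta) y.

Definition solves_susy (R : realType) (N n K : nat) (A : frames R N n)
    (g : 'M[R]_n -> Prop) (T : dform R N 3) (phi : 'rV[R]_N -> R) : Prop :=
  [/\ solves_gravitino K A g T, solves_dilatino K A g T phi &
      solves_gaugino K A g T].

Definition bianchi1 (R : realType) (N n : nat) (A : frames R N n)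
    (T : dform R N 3) (al : R) : Prop :=
  forall U p e y, A U p e -> U y ->
    bianchi1_at e (comps p e T) (tconn p e T) al y.

Definition bianchi2 (R : realType) (N n : nat) (A : frames R N n)
    (T : dform R N 3) (al : R) : Prop :=
  forall U p e y, A U p e -> U y ->
    bianchi2_at e (comps p e T) (tconn p e T) al y.

Definition solves_eom (R : realType) (N n : nat) (A : frames R N n)
    (T : dform R N 3) (phi : 'rV[R]_N -> R) (al : R) : Prop :=
  forall U p e y, A U p e -> U y ->
    eom_at e (comps p e T) (phi \o p) (tconn p e T) al y.

(* theta_S = kappa d phi for the Lee form of the structure form S *)
Definition is_dilaton (R : realType) (N n k : nat) (A : frames R N n)
    (lee : frame R n -> lform R n k -> lform R n 1) (S : dform R N k)
    (kappa : R) (phi : 'rV[R]_N -> R) : Prop :=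
  forall U p e y, A U p e -> U y ->
    dilaton_at e (lee e (comps p e S)) kappa (phi \o p) y.

(* The Lee form is closed, dilatons exist around every point, and every local *)
(* dilaton solves the equations.                                              *)
Definition solves_susy_locally (R : realType) (N n K k : nat)
    (M : set 'rV[R]_N) (A : frames R N n) (g : 'M[R]_n -> Prop)
    (lee : frame R n -> lform R n k -> lform R n 1) (S : dform R N k)
    (kappa : R) (T : dform R N 3) : Prop :=
  [/\ forall U p e y, A U p e -> U y ->
        forall I, ext_d e (lee e (comps p e S)) y I = 0,
      framed_around M (fun U p e => A U p e /\
        exists phi : 'rV[R]_n -> R, smooth_on U phi /\
          forall y, U y -> dilaton_at e (lee e (comps p e S)) kappa phi y),
      solves_gravitino K A g T, solves_gaugino K A g T &
      forall (gam : 'I_n -> 'M[R]_K) (eta : 'cV[R]_K),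
      defining_spinor g gam eta ->
      forall U p e (phi : 'rV[R]_n -> R), A U p e -> smooth_on U phi ->
        (forall y, U y -> dilaton_at e (lee e (comps p e S)) kappa phi y) ->
        forall y, U y -> dilatino_at gam e (comps p e T) phi (fun=> eta) y].

Definition sphere (R : realType) (n : nat) : set 'rV[R]_n.+1 :=
  [set x | dotv x x = 1].

(* Cross product of the imaginary octonions R^7: <x * v, w> = omega(x, v, w) *)
Definition cross (R : realType) (x v : 'rV[R]_7) : 'rV[R]_7 :=
  \row_k \sum_i \sum_j omega_std R (idx3 i j k) * x 0 i * v 0 j.

Definition F_S6 (R : realType) : dform R 7 2 := kahler_form (@cross R).

(* Psi^+ = c dF; the norm of Psi^+ is fixed by the SU(3)-structure. *)
Definition nearly_kahler_S6 (R : realType) (Psip Psim : dform R 7 3) : Prop :=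
  su3_structure (@sphere R 6) (@cross R) Psip Psim /\
  exists c : R, forall U p e y,
    onframe (n := 6) (@sphere R 6) U p e -> U y ->
    forall I, comps p e Psip y I = c * ext_d e (comps p e (@F_S6 R)) y I.

Definition prodM (R : realType) (N N' : nat) (M : set 'rV[R]_N)
    (L : set 'rV[R]_N') : set 'rV[R]_(N + N') :=
  [set x | M (lsubmx x) /\ L (rsubmx x)].

Definition pull1 (R : realType) (N N' k : nat) (a : dform R N k) :
    dform R (N + N') k :=
  fun x v => a (lsubmx x) (fun s => lsubmx (v s)).

Definition pull2 (R : realType) (N N' k : nat) (a : dform R N' k) :
    dform R (N + N') k :=
  fun x v => a (rsubmx x) (fun s => rsubmx (v s)).

Definition line (R : realType) : set 'rV[R]_1 := setT.
Definition line_form (R : realType) : dform R 1 1 := fun _ v => v 0 0 0.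

(* S^1 as the unit circle, with its form x dy - y dx of unit length *)
Definition circle (R : realType) : set 'rV[R]_2 := @sphere R 1.
Definition circle_form (R : realType) : dform R 2 1 :=
  fun x v => x 0 0 * v 0 0 1 - x 0 1 * v 0 0 0.

(* omega = - F /\ e_7 - Psi^+ *)
Definition g2_product (R : realType) (N N' : nat) (F : dform R N 2)
    (Psip : dform R N 3) (e7 : dform R N' 1) : dform R (N + N') 3 :=
  fun x v => - wedge (pull1 (N' := N') F x) (pull2 (N := N) e7 x) v
             - pull1 (N' := N') Psip x v.

(* The rows of E are an orthonormal basis of T_x M in which omega has its     *)
(* standard form.                                                             *)
Definition g2_basis (R : realType) (N : nat) (M : set 'rV[R]_N)
    (omega : dform R N 3) (x : 'rV[R]_N) (E : 'M[R]_(7, N)) : Prop :=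
  [/\ forall i, tangent M x (row i E),
      forall i j, dotv (row i E) (row j E) = (i == j)%:R &
      forall I : 'I_3 -> 'I_7,
        omega x (fun s => row (I s) E) = omega_std R I].

(* Hodge dual of omega for the metric and orientation defined by omega; it    *)
(* does not depend on the chosen basis.                                       *)
Definition hodge7 (R : realType) (N : nat) (M : set 'rV[R]_N)
    (omega : dform R N 3) : dform R N 4 :=
  fun x v =>
    let E := xget 0 [set E | g2_basis M omega x E] in
    \sum_(J : {ffun 'I_4 -> 'I_7})
      hodge (k := 3) (l := 4)
        (fun I : 'I_3 -> 'I_7 => omega x (fun s => row (I s) E)) J
      * \prod_(s < 4) dotv (row (J s) E) (v s).

(* Phi = e_0 /\ omega + *omega *)
Definition spin7_product (R : realType) (N N' : nat) (M : set 'rV[R]_N)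
    (omega : dform R N 3) (e0 : dform R N' 1) : dform R (N + N') 4 :=
  fun x v => wedge (pull2 (N := N) e0 x) (pull1 (N' := N') omega x) v
             + pull1 (N' := N') (hodge7 M omega) x v.

(* Main.v *)
(* The point q of the sphere and the unit forms of the one-dimensional factors
give a product frame e. Sending e_i to s e_i(q) + t_i q, with t the Lee direction,
identifies the structure with the constant one on the imaginary octonions (plus a
line in dimension 8); hence the torsion is the contraction of q with *omega and is
parallel. The connection is unique because the stabilizer algebras have no first
prolongation. The curvature reduces to integer identities between octonionic
structure constants: dT and both traces are multiples of one parallel four-form,
with negative ratio. The Lee form is a multiple of the arc length form, so the
dilaton is linear on a line and only locally defined on a circle. *)

Require Import Defs.
From mathcomp Require Import all_boot all_order all_algebra all_fingroup.
From mathcomp Require Import all_classical all_reals all_analysis.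
From mathcomp Require Import ring lra zify.

Set Implicit Arguments.
Unset Strict Implicit.
Unset Printing Implicit Defensive.

Import Order.TTheory GRing.Theory Num.Theory.
Import numFieldNormedType.Exports.

Local Open Scope classical_set_scope.
Local Open Scope ring_scope.

Implicit Types R : realType.

(* Every equation is demanded in all adapted frames, so no convenient frame may be chosen. Hence the
   tensors are written for an arbitrary frame through a_i = e_i(q): the torsion is *omega(q, a_i,
   a_j, a_k), and an octonionic basis is chosen only at a single point, to evaluate contractions.
   Along e_m the vectors s a_i + t_i q move by the connection and by one element of g2 depending on
   q and a_m; invariant forms do not see the latter, which puts the connection into the stabilizer
   algebra. The same element, read in the frame, yields the dilatino equation and the Lee form. With
   psi = *omega on tangent vectors, dT = 4 psi, while the trace is -6 psi for nabla and 18 psi for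
   the opposite torsion, so alpha' = -1/3 in (B1) and -1/12 in (B2). The relation Psi^+ = c dF and
   the norm of Psi^+ only give c = 1/3 or c = -1/3; the sign s = 3c is carried along everywhere, and
   the dilaton is -2s times the arc length. *)
Tactic Notation "eq_sum" ident(i) := apply: eq_bigr => i _.
Tactic Notation "mul_sum" ident(i) := rewrite mulr_sumr; eq_sum i.
Tactic Notation "ext" ident(i) := apply/funext => i.

Local Notation Bil n R := ('I_n -> 'I_n -> R).
Local Notation Tri n R := ('I_n -> 'I_n -> 'I_n -> R).
Local Notation Quad n R := ('I_n -> 'I_n -> 'I_n -> 'I_n -> R).

(** * Calculus: symmetry of second derivatives, smooth functions, derivatives along a frame *)

Lemma differentiable_estimate R (n : nat) (f : 'rV[R]_n -> R) (y : 'rV[R]_n) : differentiable f y ->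
 forall e : R, 0 < e -> exists2 d : R, 0 < d & forall h, `|h| < d -> `|f (y + h) - f y - 'd f y h| <= e * `|h|.
move=> /diff_locallyP[_ /eqaddoP +] e e0=> /(_ e e0) /nbhs_ballP[d /= d0 H].
exists d=> // h hd; have := H h.
rewrite -ball_normE /ball_ /= sub0r normrN=> /(_ hd).
by rewrite !fctE opprD addrA (addrC h).
Qed.

Lemma is_derive_line R (n : nat) (f : 'rV[R]_n -> R) (a v : 'rV[R]_n) (x : R) : differentiable f (a + x *: v) ->
 is_derive x 1 (fun s : R=> f (a + s *: v)) ('D_v f (a + x *: v)).
move=> df.
have E : (fun h=> h^-1 *: ((f \o shift (a + x *: v)) (h *: v) - f (a + x *: v))) =
  (fun h=> h^-1 *: (((fun s : R=> f (a + s *: v)) \o shift x) (h *: 1) - f (a + x *: v))).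
 apply/funext=> h /=; congr (_ *: (f _ - _)).
 by rewrite [h *: 1]mulr1 scalerDl addrCA.
have D : derivable (fun s : R=> f (a + s *: v)) x 1.
 by have := diff_derivable (v := v) df; rewrite /derivable E.
apply: DeriveDef=> //.
by rewrite /derive -E.
Qed.

Section Schwarz.
Variables (R : realType) (n : nat).
Implicit Types (f : 'rV[R]_n -> R) (U : set 'rV[R]_n).

(** The mean value theorem in the direction u turns the second difference into h times a difference
    of two values of ['D_u f]; expanding ['D_u f] to first order at y gives the mixed derivative.
    Only differentiability of ['D_u f] at the one point y enters. *)
Lemma second_difference_estimate f U (y u v : 'rV[R]_n) : open U -> U y ->
 (forall z, U z -> differentiable f z) -> differentiable ('D_u f) y ->
 forall e : R, 0 < e -> exists2 d : R, 0 < d & forall h : R, 0 < h -> h < d ->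
  `|f (y + h *: u + h *: v) - f (y + h *: u) - f (y + h *: v) + f y
   - h * h * 'D_v ('D_u f) y| <= e * (h * h).
move=> oU Uy df dDf e e0.
pose c := `|u| + `|v| + 1.
have c0 : 0 < c by rewrite /c ltr_wpDl// addr_ge0.
have e'0 : 0 < e / (2 * c) by rewrite divr_gt0// mulr_gt0.
(* The expansion of ['D_u f] is used at two points within h c of y, so each may cost an error e / (2
   c) times that distance. *)
have [d1 d10 H1] := differentiable_estimate dDf e'0.
have /nbhs_ballP[d2 /= d20 H2] : nbhs y U by exact: open_nbhs_nbhs.
exists (Num.min d1 d2 / c)=> [|h h0 hd].
 by rewrite divr_gt0// lt_min d10 d20.
have hc : h * c < Num.min d1 d2 by rewrite -ltr_pdivlMr.
have inU s r : 0 <= s -> s <= h -> 0 <= r -> r <= h -> `|s *: u + r *: v| <= h * c /\ U (y + s *: u + r *: v).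
 move=> s0 sh r0 rh.
 have B : `|s *: u + r *: v| <= h * c.
  apply: (le_trans (ler_normD _ _)); rewrite !normrZ !ger0_norm//.
  have A1 : s * `|u| <= h * `|u| by rewrite ler_wpM2r.
  have A2 : r * `|v| <= h * `|v| by rewrite ler_wpM2r.
  by rewrite /c !mulrDr mulr1; lra.
 split=> //; apply: H2; rewrite -ball_normE /ball_ /=.
 rewrite -addrA opprD addrA subrr sub0r normrN (le_lt_trans B)//.
 by rewrite (lt_le_trans hc)// ge_min lexx orbT.
pose g s := f (y + h *: v + s *: u) - f (y + s *: u).
have dg s : s \in `[0, h]%R -> is_derive s 1 g ('D_u f (y + h *: v + s *: u) - 'D_u f (y + s *: u)).
 rewrite in_itv /= => /andP[s0 sh]; apply: is_deriveB.
  apply: is_derive_line; apply: df.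
  by rewrite addrAC; apply: (inU s h s0 sh _ _).2=> //; exact: ltW.
 apply: is_derive_line; apply: df.
 have := (inU s 0 s0 sh (lexx _) (ltW h0)).2.
 by rewrite scale0r addr0.
have [x] := MVT_segment (ltW h0) (f := g) (df := fun s=> 'D_u f (y + h *: v + s *: u) - 'D_u f (y + s *: u))
 (fun s hs=> dg s (subset_itv_oo_cc hs))
 (derivable_within_continuous (fun s hs=> ex_derive (is_derive := dg s hs))).
rewrite in_itv /= => /andP[x0 xh]; rewrite /g subr0 scale0r !addr0=> E.
have -> : f (y + h *: u + h *: v) - f (y + h *: u) - f (y + h *: v) + f y =
 ('D_u f (y + h *: v + x *: u) - 'D_u f (y + x *: u)) * h.
 by rewrite -E (addrAC y (h *: v)); ring.
have [B1 _] := inU x h x0 xh (ltW h0) (lexx _).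
have [B2 _] := inU x 0 x0 xh (lexx _) (ltW h0).
have hd1 : h * c < d1 by rewrite (lt_le_trans hc)// ge_min lexx.
have C1 := H1 _ (le_lt_trans B1 hd1).
have C2 := H1 _ (le_lt_trans B2 hd1).
have -> : 'D_v ('D_u f) y = 'd ('D_u f) y v by rewrite deriveE.
have Lu : 'd ('D_u f) y (x *: u + 0 *: v) = x * 'd ('D_u f) y u.
 by rewrite scale0r addr0 linearZ.
have Luv : 'd ('D_u f) y (x *: u + h *: v) = x * 'd ('D_u f) y u + h * 'd ('D_u f) y v.
 by rewrite linearD !linearZ.
move: C1 C2; rewrite Lu Luv scale0r addr0 addrA (addrAC y (x *: u))=> C1 C2.
set p := 'd ('D_u f) y u in C1 C2 *; set r := 'd ('D_u f) y v in C1 C2 *.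
set P := 'D_u f _ in C1 *; set Q := 'D_u f (y + x *: u) in C2 *.
set S := 'D_u f y in C1 C2.
have -> : (P - Q) * h - h * h * r = h * ((P - S - (x * p + h * r)) - (Q - S - x * p)).
 by ring.
rewrite normrM (gtr0_norm h0) [e * _]mulrCA ler_pM2l//.
apply: (le_trans (ler_normB _ _)).
have -> : e * h = e / (2 * c) * (h * c) + e / (2 * c) * (h * c).
 by field; rewrite gt_eqF.
rewrite scale0r addr0 in B2.
apply: lerD; first exact: le_trans C1 (ler_wpM2l (ltW e'0) B1).
exact: le_trans C2 (ler_wpM2l (ltW e'0) B2).
Qed.

(** The second difference is symmetric in u and v, so both mixed derivatives are within e / 2 of the
    same quotient. *)
Lemma derive_comm f U (y u v : 'rV[R]_n) : open U -> U y -> (forall z, U z -> differentiable f z) ->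
 differentiable ('D_u f) y -> differentiable ('D_v f) y -> 'D_u ('D_v f) y = 'D_v ('D_u f) y.
move=> oU Uy df du dv.
apply/eqP; rewrite -subr_eq0 -normr_le0; apply/ler_addgt0Pl=> e e0.
have e20 : 0 < e / 2 by rewrite divr_gt0.
have [d1 d10 H1] := second_difference_estimate v oU Uy df du e20.
have [d2 d20 H2] := second_difference_estimate u oU Uy df dv e20.
pose h := Num.min d1 d2 / 2.
have h0 : 0 < h by rewrite divr_gt0// lt_min d10 d20.
have hm : h < Num.min d1 d2 by rewrite /h ltr_pdivrMr// ltr_pMr ?lt_min ?d10 ?d20// ltr1n.
have [hd1 hd2] : h < d1 /\ h < d2 by apply/andP; rewrite -lt_min.
have := H1 h h0 hd1; have := H2 h h0 hd2.
rewrite (addrAC y (h *: v)).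
set X := f _; set Y := f _; set Z := f _; set A := 'D_u _ _; set B := 'D_v _ _.
move=> K1 K2.
have hh : 0 < h * h by rewrite mulr_gt0.
rewrite addr0 -(ler_pM2r hh).
rewrite -[X in `|_| * X](gtr0_norm hh) -normrM.
have -> : (A - B) * (h * h) = (X - Z - Y + f y - h * h * B) - (X - Y - Z + f y - h * h * A).
 by ring.
apply: (le_trans (ler_normB _ _)); apply: (le_trans (lerD K2 K1)).
by rewrite -mulrDl -splitr.
Qed.

End Schwarz.

Section Smooth.
Variables (R : realType) (n : nat) (U : set 'rV[R]_n).
Hypothesis oU : open U.

Lemma derive_eqon (W : normedModType R) (f g : 'rV[R]_n -> W) v y :
 (forall z, U z -> f z = g z) -> U y -> 'D_v f y = 'D_v g y.
move=> fg Uy; apply: near_eq_derive.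
by have := open_nbhs_nbhs (conj oU Uy); apply: filterS.
Qed.

(** The difference g - f vanishes near y, hence has the zero map as differential; g is f plus this
    function. *)
Lemma diff_eqon (W : normedModType R) (f g : 'rV[R]_n -> W) y :
 (forall z, U z -> f z = g z) -> U y -> differentiable f y -> differentiable g y.
move=> fg Uy df.
pose k := g - f.
have kE : k \o shift y = cst (k y) + (0 : 'rV[R]_n -> W) +o_ (0 : 'rV[R]_n) id.
 apply/eqaddoP=> e e0; near=> h.
 rewrite !fctE /k !fctE /=.
 have -> : g (h + y) = f (h + y).
  apply/esym/fg; near: h.
  have /nbhs_ballP[d /= d0 dU] := open_nbhs_nbhs (conj oU Uy).
  apply/nbhs_ballP; exists d=> // h; rewrite -!ball_normE /= => hd.
  apply: dU; rewrite -ball_normE /=; move: hd.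
  by rewrite sub0r opprD addrCA subrr addr0.
 have -> : g y - f y + (0 : 'rV[R]_n -> W) h = 0 by rewrite fg// subrr add0r.
 by rewrite subrr subr0 normr0 mulr_ge0// ltW.
have dk0 : 'd k y = (0 : 'rV[R]_n -> W) :> ('rV[R]_n -> W).
 by apply/diff_unique=> //; exact: cst_continuous.
have dk : differentiable k y.
 apply/diff_locallyP; rewrite dk0; split; last exact: kE.
 exact: cst_continuous.
have -> : g = f + k by ext z; rewrite /k !fctE addrC subrK.
exact: differentiableD.
Unshelve. all: by end_near. Qed.

Lemma iterder_eqon (W : normedModType R) (f g : 'rV[R]_n -> W) vs y :
 (forall z, U z -> f z = g z) -> U y -> iterder vs f y = iterder vs g y.
move=> fg; elim: vs y=> [|v vs IH] y Uy /=; first exact: fg.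
exact: derive_eqon.
Qed.

Lemma smooth_eqon (W : normedModType R) (f g : 'rV[R]_n -> W) :
 (forall z, U z -> f z = g z) -> smooth_on U f -> smooth_on U g.
move=> fg sf vs y Uy; apply: diff_eqon (sf vs y Uy)=> // z Uz.
exact: iterder_eqon.
Qed.
Lemma smooth_diff (W : normedModType R) (f : 'rV[R]_n -> W) y : smooth_on U f -> U y -> differentiable f y.
by move=> sf; apply: (sf [::]). Qed.

Lemma smooth_derive (W : normedModType R) (f : 'rV[R]_n -> W) v : smooth_on U f -> smooth_on U ('D_v f).
move=> sf vs y Uy; have := sf (rcons vs v) y Uy.
by rewrite /iterder foldr_rcons.
Qed.

Lemma smooth_cst (W : normedModType R) (c : W) : smooth_on U (cst c).
move=> vs y _.
have : iterder vs (cst c) = cst c \/ iterder vs (cst c) = cst 0.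
 elim: vs=> [|v vs [IH|IH]] /=; first by left.
  by right; rewrite IH; ext z; exact: derive_cst.
 by right; rewrite IH; ext z; exact: derive_cst.
by case=> ->; exact: differentiable_cst.
Qed.

(* Closing a family of smooth functions under algebraic operations and
composition with x^(-1/2), sin and cos gives a family closed under
differentiation; this is how smoothness is propagated. *)
Inductive smooth_expr : ('rV[R]_n -> R) -> Prop :=
| SmoothBase f : smooth_on U f -> smooth_expr f
| SmoothAdd f g : smooth_expr f -> smooth_expr g -> smooth_expr (f + g)
| SmoothMul f g : smooth_expr f -> smooth_expr g -> smooth_expr (f * g)
| SmoothIsqrt f : smooth_expr f -> (forall y, U y -> 0 < f y) -> smooth_expr (fun y => (Num.sqrt (f y))^-1)
| SmoothSin f : smooth_expr f -> smooth_expr (sin \o f)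
| SmoothCos f : smooth_expr f -> smooth_expr (cos \o f)
| SmoothEq f g : (forall y, U y -> f y = g y) -> smooth_expr f -> smooth_expr g.

Lemma is_derive_comp1 (f : 'rV[R]_n -> R) (g : R -> R) y v (df dg : R) :
 differentiable f y -> is_derive (f y) 1 g dg -> 'D_v f y = df ->
 differentiable (g \o f) y /\ 'D_v (g \o f) y = dg * df.
move=> Df [Dg dgE] <-.
have Dg' : differentiable g (f y) by apply/derivable1_diffP.
have D : differentiable (g \o f) y by exact: differentiable_comp.
split=> //; rewrite !deriveE// diff_comp//= -dgE deriveE//.
rewrite -[in LHS](mulr1 ('d f y v)) -[_ * 1]/(_ *: (1 : R^o)).
by rewrite linearZ /= mulrC.
Qed.

Lemma is_derive_isqrt (x : R) : 0 < x -> is_derive x 1 (fun z=> (Num.sqrt z)^-1) (- 2^-1 * (Num.sqrt x)^-1 ^+ 3).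
move=> x0; have s0 : Num.sqrt x != 0 by rewrite gt_eqF// sqrtr_gt0.
have D := is_derive1_sqrt x0.
apply: DeriveDef; first exact: derivableV s0 (ex_derive (is_derive := D)).
rewrite (deriveV s0 (ex_derive (is_derive := D))) (derive_val (is_derive := D)).
by rewrite /GRing.scale /=; field; rewrite s0.
Qed.

Lemma smooth_expr_derive f : smooth_expr f ->
 (forall y, U y -> differentiable f y) /\ (forall v, smooth_expr ('D_v f)).
elim=> {f} [f sf|f g _ [df Df] _ [dg Dg]|f g ef [df Df] eg [dg Dg]|
 f ef [df Df] f0|f ef [df Df]|f ef [df Df]|f g fg ef [df Df]].
- split=> [y Uy|v]; first exact: smooth_diff sf Uy.
 exact/SmoothBase/smooth_derive.
- split=> [y Uy|v]; first by apply: differentiableD; [exact: df|exact: dg].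
 apply: SmoothEq (SmoothAdd (Df v) (Dg v))=> y Uy.
 by rewrite deriveD//; apply: diff_derivable; [exact: df|exact: dg].
- split=> [y Uy|v]; first by apply: differentiableM; [exact: df|exact: dg].
 apply: SmoothEq (SmoothAdd (SmoothMul ef (Dg v)) (SmoothMul eg (Df v))).
 move=> y Uy; rewrite deriveM//; apply: diff_derivable; [exact: df|exact: dg].
- have H y v : U y -> differentiable (fun z=> (Num.sqrt (f z))^-1) y /\
   'D_v (fun z=> (Num.sqrt (f z))^-1) y =
   - 2^-1 * (Num.sqrt (f y))^-1 ^+ 3 * 'D_v f y.
  move=> Uy; apply: (is_derive_comp1 (g := fun z=> (Num.sqrt z)^-1))=> //.
   exact: df.
  exact/is_derive_isqrt/f0.
 split=> [y Uy|v]; first by have [] := H y 0 Uy.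
 have sI := SmoothIsqrt ef f0.
 apply: SmoothEq (SmoothMul (SmoothMul (SmoothBase (smooth_cst (- 2^-1 : R)))
  (SmoothMul sI (SmoothMul sI sI))) (Df v))=> y Uy.
 by have [_ ->] := H y v Uy; rewrite !fctE !exprS expr0 mulr1.
- have H y v : U y -> differentiable (sin \o f) y /\
   'D_v (sin \o f) y = cos (f y) * 'D_v f y.
  by move=> Uy; apply: is_derive_comp1=> //; exact: df.
 split=> [y Uy|v]; first by have [] := H y 0 Uy.
 apply: SmoothEq (SmoothMul (SmoothCos ef) (Df v))=> y Uy.
 by have [_ ->] := H y v Uy.
- have H y v : U y -> differentiable (cos \o f) y /\
   'D_v (cos \o f) y = - sin (f y) * 'D_v f y.
  by move=> Uy; apply: is_derive_comp1=> //; exact: df.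
 split=> [y Uy|v]; first by have [] := H y 0 Uy.
 apply: SmoothEq (SmoothMul (SmoothBase (smooth_cst (-1 : R))) (SmoothMul (SmoothSin ef) (Df v)))=> y Uy.
 by have [_ ->] := H y v Uy; rewrite !fctE /=; ring.
- split=> [y Uy|v]; first exact: diff_eqon fg Uy (df y Uy).
 apply: SmoothEq (Df v)=> y Uy; exact: derive_eqon.
Qed.

Lemma smooth_exprP f : smooth_expr f <-> smooth_on U f.
split=> [ef vs|]; last exact: SmoothBase.
suff : smooth_expr (iterder vs f) by case/smooth_expr_derive.
elim: vs=> //= v vs; by case/smooth_expr_derive=> _; apply.
Qed.
Lemma smoothD (f g : 'rV[R]_n -> R) : smooth_on U f -> smooth_on U g -> smooth_on U (fun y=> f y + g y).
by move=> /smooth_exprP ? /smooth_exprP ?; apply/smooth_exprP/SmoothAdd. Qed.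
Lemma smoothM (f g : 'rV[R]_n -> R) : smooth_on U f -> smooth_on U g -> smooth_on U (fun y=> f y * g y).
by move=> /smooth_exprP ? /smooth_exprP ?; apply/smooth_exprP/SmoothMul. Qed.

Lemma smoothN (f : 'rV[R]_n -> R) : smooth_on U f -> smooth_on U (fun y=> - f y).
move=> sf; have := smoothM (smooth_cst (-1 : R)) sf.
by apply: smooth_eqon=> y _; rewrite /= mulN1r.
Qed.

Lemma smooth_isqrt (f : 'rV[R]_n -> R) : smooth_on U f ->
 (forall y, U y -> 0 < f y) -> smooth_on U (fun y=> (Num.sqrt (f y))^-1).
by move=> /smooth_exprP ? ?; apply/smooth_exprP/SmoothIsqrt. Qed.
Lemma smooth_sin (f : 'rV[R]_n -> R) : smooth_on U f -> smooth_on U (fun y=> sin (f y)).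
by move=> /smooth_exprP ?; apply/smooth_exprP/SmoothSin. Qed.
Lemma smooth_cos (f : 'rV[R]_n -> R) : smooth_on U f -> smooth_on U (fun y=> cos (f y)).
by move=> /smooth_exprP ?; apply/smooth_exprP/SmoothCos. Qed.

Lemma smooth_sum (I : Type) (r : seq I) (P : pred I)
  (f : I -> 'rV[R]_n -> R) : (forall i, P i -> smooth_on U (f i)) ->
 smooth_on U (fun y=> \sum_(i <- r | P i) f i y).
move=> sf; elim: r=> [|i r IH].
 by apply: smooth_eqon (smooth_cst (0 : R))=> y _; rewrite big_nil.
case: (boolP (P i))=> Pi.
 apply: smooth_eqon (smoothD (sf i Pi) IH)=> y _; by rewrite big_cons Pi.
by apply: smooth_eqon IH=> y _; rewrite big_cons (negPf Pi).
Qed.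

Lemma smooth_onS (W : normedModType R) (f : 'rV[R]_n -> W) : (forall y, U y -> differentiable f y) ->
 (forall v, smooth_on U ('D_v f)) -> smooth_on U f.
move=> df Df; elim/last_ind=> [|vs v _] y Uy; first exact: df.
by rewrite /iterder foldr_rcons; apply: Df.
Qed.

Lemma derive_coord (k : 'I_n) v (y : 'rV[R]_n) : 'D_v (fun y : 'rV[R]_n=> y 0 k) y = v 0 k.
have H : is_derive y v (id : 'rV[R]_n -> 'rV[R]_n) v by exact: is_derive_id.
have := derive_mx (ex_derive (is_derive := H)).
by rewrite (derive_val (is_derive := H))=> /matrixP/(_ 0 k); rewrite mxE.
Qed.

Lemma smooth_coord (k : 'I_n) : smooth_on U (fun y : 'rV[R]_n=> y 0 k).
apply: smooth_onS=> [y _|v]; first exact: differentiable_coord.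
by apply: smooth_eqon (smooth_cst (v 0 k))=> y _; rewrite derive_coord.
Qed.

Lemma derive_mxE (N : nat) (p : 'rV[R]_n -> 'rV[R]_N) y v k :
 differentiable p y -> ('D_v p y) 0 k = 'D_v (fun z=> p z 0 k) y.
by move=> dp; rewrite derive_mx ?mxE//; exact: diff_derivable. Qed.

Lemma smooth_comp_coord (N : nat) (p : 'rV[R]_n -> 'rV[R]_N) k : smooth_on U p -> smooth_on U (fun y=> p y 0 k).
move=> sp vs y Uy.
have E z : U z -> iterder vs (fun y=> p y 0 k) z = iterder vs p z 0 k.
 elim: vs z=> [//|v vs IH] z Uz /=.
 rewrite (derive_eqon (g := fun z=> iterder vs p z 0 k))//.
 by rewrite derive_mxE//; exact: sp.
apply: (diff_eqon (f := fun z=> iterder vs p z 0 k))=> //.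
 by move=> z Uz; rewrite E.
exact: (differentiable_comp (g := fun M : 'rV[R]_N=> M 0 k) (sp vs y Uy) (differentiable_coord _ _ _)).
Qed.

Lemma smooth_mx (N : nat) (p : 'rV[R]_n -> 'rV[R]_N) : (forall k, smooth_on U (fun y=> p y 0 k)) -> smooth_on U p.
move=> sp vs y Uy.
have E z : U z -> iterder vs p z = \row_k iterder vs (fun y=> p y 0 k) z.
 elim: vs z=> [|v vs IH] z Uz /=; first by apply/rowP=> k; rewrite mxE.
 rewrite (derive_eqon (g := fun z=> \row_k iterder vs (fun y=> p y 0 k) z))//.
 rewrite derive_mx; last first.
  apply/derivable_mxP=> i j; rewrite (ord1 i).
  have -> : (fun x=> (\row_k iterder vs (fun y=> p y 0 k) x) 0 j) =
   iterder vs (fun y=> p y 0 j) by ext x; rewrite mxE.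
  by apply: diff_derivable; exact: sp.
 apply/rowP=> k; rewrite !mxE; congr ('D_v _ z).
 by ext x; rewrite mxE.
apply: (diff_eqon (f := \sum_k (fun z=> iterder vs (fun y=> p y 0 k) z *: delta_mx 0 k)))=> //.
 move=> z Uz; rewrite E// [RHS]row_sum_delta fct_sumE; eq_sum k.
 by rewrite mxE.
by apply: differentiable_sum=> k; apply: differentiableZl; exact: sp.
Qed.

End Smooth.

Section FrameDerivative.
Variables (R : realType) (n : nat) (U : set 'rV[R]_n) (e : frame R n).
Hypotheses (oU : open U) (se : forall i, smooth_on U (e i)).
Implicit Types (f g : 'rV[R]_n -> R).

Lemma pd_eqon f g m y : (forall z, U z -> f z = g z) -> U y -> pd e m f y = pd e m g y.
exact: derive_eqon. Qed.

Lemma pd_cst c m y : pd e m (fun=> c : R) y = 0.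
exact: derive_cst. Qed.

Lemma pdD f g m y : differentiable f y -> differentiable g y ->
 pd e m (fun z=> f z + g z) y = pd e m f y + pd e m g y.
by move=> df dg; rewrite /pd deriveD//; exact: diff_derivable. Qed.

Lemma pdM f g m y : differentiable f y -> differentiable g y ->
 pd e m (fun z=> f z * g z) y = pd e m f y * g y + f y * pd e m g y.
move=> df dg; rewrite /pd deriveM; [|exact: diff_derivable..].
by rewrite addrC [_ *: _]mulrC.
Qed.
Lemma pdN f m y : differentiable f y -> pd e m (fun z=> - f z) y = - pd e m f y.
by move=> df; rewrite /pd deriveN//; exact: diff_derivable. Qed.

Lemma pdB f g m y : differentiable f y -> differentiable g y ->
 pd e m (fun z=> f z - g z) y = pd e m f y - pd e m g y.
by move=> df dg; rewrite /pd deriveB//; exact: diff_derivable. Qed.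

Lemma pdZ (c : R) f m y : differentiable f y -> pd e m (fun z=> c * f z) y = c * pd e m f y.
by move=> df; rewrite pdM// pd_cst mul0r add0r.
Qed.

Lemma diff_bigsum (I : Type) (r : seq I) (P : pred I)
  (f : I -> 'rV[R]_n -> R) y : (forall i, differentiable (f i) y) ->
 differentiable (fun z=> \sum_(i <- r | P i) f i z) y.
move=> df; elim: r=> [|i r IH].
 rewrite (_ : (fun _=> _) = cst 0); first exact: differentiable_cst.
 by ext z; rewrite big_nil.
rewrite (_ : (fun _=> _) = (fun z=> (if P i then f i z else 0) + \sum_(i <- r | P i) f i z)); last first.
 by ext z; rewrite big_cons; case: ifP=> // _; rewrite add0r.
by apply: differentiableD=> //; case: (P i).
Qed.

Lemma pd_sum (I : Type) (r : seq I) (P : pred I) (f : I -> 'rV[R]_n -> R) m y : (forall i, differentiable (f i) y) ->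
 pd e m (fun z=> \sum_(i <- r | P i) f i z) y = \sum_(i <- r | P i) pd e m (f i) y.
move=> df; elim: r=> [|i r IH].
 rewrite big_nil -[RHS](pd_cst 0 m y); congr (pd e m _ y).
 by ext z; rewrite big_nil.
rewrite (_ : (fun _=> _) = (fun z=> (if P i then f i z else 0) + \sum_(i <- r | P i) f i z)); last first.
 by ext z; rewrite big_cons; case: ifP=> // _; rewrite add0r.
rewrite pdD ?IH ?big_cons//; last exact: diff_bigsum.
 by case: (P i)=> //; rewrite pd_cst add0r.
by case: (P i).
Qed.

Lemma pdE f m y : differentiable f y -> pd e m f y = \sum_k e m y 0 k * 'D_(delta_mx 0 k) f y.
move=> df; rewrite /pd deriveE// [in LHS](row_sum_delta (e m y)) linear_sum.
by eq_sum k; rewrite linearZ /= deriveE.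
Qed.

Lemma smooth_pd f m : smooth_on U f -> smooth_on U (pd e m f).
move=> sf; apply: (smooth_eqon oU (f := fun y=> \sum_k e m y 0 k * 'D_(delta_mx 0 k) f y)).
 by move=> y Uy; rewrite pdE//; exact: smooth_diff sf Uy.
apply: smooth_sum=> // k _; apply: smoothM=> //.
 exact: smooth_comp_coord.
exact: smooth_derive.
Qed.

(** In coordinates the second derivatives of f cancel by symmetry, and what remains differentiates
    the coefficients of the two frame vectors. *)
Lemma pd_bracket f i j y : U y -> smooth_on U f ->
 pd e i (pd e j f) y - pd e j (pd e i f) y = 'D_(bracket e i j y) f y.
move=> Uy sf.
have df z : U z -> differentiable f z by move=> Uz; exact: smooth_diff sf Uz.
have dD v z : U z -> differentiable ('D_v f) z.
 by move=> Uz; exact: smooth_diff (smooth_derive v sf) Uz.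
have de l k z : U z -> differentiable (fun z=> e l z 0 k) z.
 by move=> Uz; apply: smooth_diff Uz; apply: smooth_comp_coord.
have E l m : pd e l (pd e m f) y = \sum_k pd e l (fun z=> e m z 0 k) y * 'D_(delta_mx 0 k) f y +
  \sum_k \sum_k' e m y 0 k * e l y 0 k' * 'D_(delta_mx 0 k') ('D_(delta_mx 0 k) f) y.
 rewrite (pd_eqon (g := fun z=> \sum_k e m z 0 k * 'D_(delta_mx 0 k) f z))//.
  rewrite pd_sum; last first.
   by move=> k; apply: differentiableM; [exact: de|exact: dD].
  rewrite -big_split; eq_sum k=> /=.
  rewrite pdM; [|exact: de|exact: dD]; congr (_ + _).
  rewrite pdE; last exact: dD.
  by rewrite mulr_sumr; apply: eq_bigr=> k' _; rewrite mulrA.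
 by move=> z Uz; rewrite pdE//; exact: df.
rewrite !E [X in _ - (_ + X)]exchange_big /=.
rewrite opprD addrACA -[X in _ + X]sumrB [X in _ + X]big1 ?addr0; last first.
 move=> k _; rewrite -sumrB big1// => k' _.
 rewrite (derive_comm (u := delta_mx 0 k') (v := delta_mx 0 k) oU Uy df); [by ring|exact: dD..].
rewrite deriveE; last exact: df.
rewrite -sumrB [bracket e i j y]row_sum_delta linear_sum.
eq_sum k; rewrite -mulrBl [RHS]linearZ -deriveE /=; last exact: df.
congr (_ * _).
by rewrite /bracket !mxE /pd !derive_mxE//; exact: smooth_diff (se _) Uy.
Qed.

Lemma pd_commutator f i j y : U y -> smooth_on U f -> \matrix_l e l y \in unitmx ->
 pd e i (pd e j f) y - pd e j (pd e i f) y = \sum_l strc e y i j l * pd e l f y.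
move=> Uy sf eu; rewrite pd_bracket//.
have df : differentiable f y by exact: smooth_diff sf Uy.
have {1}-> : bracket e i j y = \sum_l strc e y i j l *: e l y.
 rewrite -[LHS](mulmxKV eu) [LHS]mulmx_sum_row.
 by eq_sum l; rewrite rowK.
rewrite deriveE// linear_sum; eq_sum l.
by rewrite linearZ /= /pd deriveE.
Qed.

End FrameDerivative.

(** * Index tuples, alternating sums and integer components of the standard forms *)

Definition idx4 (X : Type) (i j k l : X) : 'I_4 -> X := tnth [tuple i; j; k; l].
Definition idx5 (X : Type) (i j k l m : X) : 'I_5 -> X :=
 tnth [tuple i; j; k; l; m].

(** Convertible to [idx2] and [idx3], but over any type, so that tuples of tangent vectors are
    covered as well as tuples of indices. *)
Definition tup2 (X : Type) (i j : X) : 'I_2 -> X := tnth [tuple i; j].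
Definition tup3 (X : Type) (i j k : X) : 'I_3 -> X := tnth [tuple i; j; k].

(** Numerals as ordinals of any size; reduction modulo the size keeps [od k] computable without a
    proof of the bound. *)
Notation od := inZp.

Ltac od_norm := repeat match goal with
 | |- context [@lift ?n ?h ?i] => let k := eval vm_compute in (nat_of_ord (@lift n h i)) in
  rewrite (_ : @lift n h i = od k); last exact: val_inj
 | |- context [@ord0 ?n] => rewrite (_ : @ord0 n = od 0); last exact: val_inj end.

Lemma tup2_eta (X : Type) (J : 'I_2 -> X) : J = tup2 (J (od 0)) (J (od 1)).
apply/funext; case=> [[|[|//]] p]; rewrite /tup2 (tnth_nth (J (od 0))) /=; by congr J; apply/val_inj.
Qed.

Lemma tup3_eta (X : Type) (J : 'I_3 -> X) : J = tup3 (J (od 0)) (J (od 1)) (J (od 2)).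
apply/funext; case=> [[|[|[|//]]] p]; rewrite /tup3 (tnth_nth (J (od 0))) /=; by congr J; apply/val_inj.
Qed.

Lemma idx4_eta (X : Type) (J : 'I_4 -> X) : J = idx4 (J (od 0)) (J (od 1)) (J (od 2)) (J (od 3)).
apply/funext; case=> [[|[|[|[|//]]]] p]; rewrite /idx4 (tnth_nth (J (od 0))) /=; by congr J; apply/val_inj.
Qed.

Lemma idx5_eta (X : Type) (J : 'I_5 -> X) : J = idx5 (J (od 0)) (J (od 1)) (J (od 2)) (J (od 3)) (J (od 4)).
apply/funext; case=> [[|[|[|[|[|//]]]]] p]; rewrite /idx5 (tnth_nth (J (od 0))) /=; by congr J; apply/val_inj.
Qed.

Section Altsum.
Variables (R : realType) (X : Type).

(** Permutations are sorted by the image of 0, as in the Laplace expansion; this is what makes sums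
    over permutations unfold by recursion. *)
Lemma sum_perm_recl (V : nmodType) n (F : 'S_n.+1 -> V) : \sum_s F s = \sum_j \sum_(s : 'S_n) F (lift_perm ord0 j s).
rewrite (partition_big (fun s : 'S_n.+1=> s ord0) xpredT) //=.
eq_sum j.
pose liftp := lift_perm (n := n) ord0 j.
rewrite (reindex liftp) /=; last first.
 pose ulsf i (s : 'S_n.+1) k := odflt k (unlift (s i) (s (lift i k))).
 have ulsfK i (s : 'S_n.+1) k : lift (s i) (ulsf i s k) = s (lift i k).
  rewrite /ulsf; have:= neq_lift i k.
  by rewrite -(can_eq (permK s))=> /unlift_some[] ? ? ->.
 have inj_ulsf : injective (ulsf ord0 _).
  move=> s; apply: can_inj (ulsf (s ord0) s^-1%g) _=> k'.
  by rewrite {1}/ulsf ulsfK !permK liftK.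
 exists (fun s=> perm (inj_ulsf s))=> [s _ | s].
  by apply/permP=> k'; rewrite permE /ulsf lift_perm_lift lift_perm_id liftK.
 move/(s _ =P _)=> si0; apply/permP=> k.
 case: (unliftP ord0 k)=> [k'|] ->; rewrite ?lift_perm_id //.
 by rewrite lift_perm_lift -si0 permE ulsfK.
by apply: eq_bigl=> s; rewrite lift_perm_id eqxx.
Qed.

(** The permutation sum in [wedge] with its form-valued part abstracted; [altsum2], [altsum3] and
    [altsum4] turn it into an explicit signed sum. *)
Definition altsum n (G : ('I_n -> X) -> R) (v : 'I_n -> X) : R :=
 \sum_(s : 'S_n) (-1) ^+ s * G (fun i=> v (s i)).

Definition fcons n (x : X) (u : 'I_n -> X) : 'I_n.+1 -> X :=
 fun i=> oapp u x (unlift ord0 i).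

Lemma altsum0 (G : ('I_0 -> X) -> R) v : altsum G v = G v.
rewrite /altsum (bigD1 (1%g : 'S_0))//= big1 ?addr0.
 by rewrite odd_perm1 mul1r; congr G; apply/funext=> -[].
by move=> s /eqP[]; apply/permP=> -[].
Qed.

Lemma altsumS n (G : ('I_n.+1 -> X) -> R) v : altsum G v = \sum_(j < n.+1) (-1) ^+ j *
  altsum (fun u=> G (fcons (v j) u)) (fun i=> v (lift j i)).
rewrite /altsum sum_perm_recl; eq_sum j.
mul_sum s.
rewrite odd_lift_perm /= signr_addb signr_odd -mulrA.
congr (_ * (_ * G _)); ext i; rewrite /fcons.
by case: (unliftP ord0 i)=> [k|] -> /=; rewrite ?lift_perm_id ?lift_perm_lift.
Qed.

Lemma altsum1 (g : X -> R) (v : 'I_1 -> X) : altsum (fun u=> g (u (od 0))) v = g (v (od 0)).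
rewrite altsumS big_ord1 altsum0 mul1r /fcons (_ : od 0 = ord0); last exact/val_inj.
by rewrite unlift_none.
Qed.
Lemma fcons0 n x (u : 'I_n -> X) : fcons x u (od 0) = x.
by rewrite /fcons (_ : od 0 = ord0) ?unlift_none//; apply/val_inj. Qed.

Lemma fconsS n x (u : 'I_n.+1 -> X) k : (k < n.+1)%N -> fcons x u (od k.+1) = u (od k).
move=> kn; rewrite /fcons (_ : od k.+1 = lift ord0 (od k)) ?liftK//.
by apply/val_inj; rewrite /= /bump /= !modn_small.
Qed.

End Altsum.
Section Altsum2.
Variables (R : realType) (X : Type).

Lemma eq_altsum n (G H : ('I_n -> X) -> R) v : (forall u, G u = H u) -> altsum G v = altsum H v.
by move=> E; eq_sum s; rewrite E. Qed.

Lemma altsum2 (g : X -> X -> R) (v : 'I_2 -> X) : altsum (fun u=> g (u (od 0)) (u (od 1))) v =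
 g (v (od 0)) (v (od 1)) - g (v (od 1)) (v (od 0)).
rewrite altsumS !big_ord_recl big_ord0 addr0 /= expr0 expr1 mul1r mulN1r.
have E x (w : 'I_1 -> X) : altsum (fun u=> g (fcons x u (od 0)) (fcons x u (od 1))) w = g x (w (od 0)).
 rewrite -(altsum1 (fun z=> g x z)); apply: eq_altsum=> u.
 by rewrite fcons0 fconsS.
rewrite !E; congr (g (v _) (v _) - g (v _) (v _)); exact: val_inj.
Qed.

Lemma altsum3 (g : X -> X -> X -> R) (v : 'I_3 -> X) : altsum (fun u=> g (u (od 0)) (u (od 1)) (u (od 2))) v =
 let a := v (od 0) in let b := v (od 1) in let c := v (od 2) in
 g a b c - g a c b - g b a c + g b c a + g c a b - g c b a.
rewrite altsumS !big_ord_recl big_ord0 addr0.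
have E x (w : 'I_2 -> X) : altsum (fun u=> g (fcons x u (od 0)) (fcons x u (od 1)) (fcons x u (od 2))) w
  = g x (w (od 0)) (w (od 1)) - g x (w (od 1)) (w (od 0)).
 rewrite -(altsum2 (fun y z=> g x y z)); apply: eq_altsum=> u.
 by rewrite fcons0 !fconsS.
rewrite !E /=.
od_norm.
rewrite /bump /= !exprS expr0; ring.
Qed.

Lemma altsum4 (g : X -> X -> X -> X -> R) (v : 'I_4 -> X) :
 altsum (fun u=> g (u (od 0)) (u (od 1)) (u (od 2)) (u (od 3))) v =
 let a := v (od 0) in let b := v (od 1) in let c := v (od 2) in let d := v (od 3) in
 g a b c d - g a b d c - g a c b d + g a c d b + g a d b c - g a d c b
 - (g b a c d - g b a d c - g b c a d + g b c d a + g b d a c - g b d c a)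
 + (g c a b d - g c a d b - g c b a d + g c b d a + g c d a b - g c d b a)
 - (g d a b c - g d a c b - g d b a c + g d b c a + g d c a b - g d c b a).
rewrite altsumS !big_ord_recl big_ord0 addr0.
have E x (w : 'I_3 -> X) : altsum (fun u=> g (fcons x u (od 0))
   (fcons x u (od 1)) (fcons x u (od 2)) (fcons x u (od 3))) w
  = altsum (fun u=> g x (u (od 0)) (u (od 1)) (u (od 2))) w.
 by apply: eq_altsum=> u; rewrite fcons0 !fconsS.
rewrite !E !altsum3 /=.
od_norm.
rewrite /bump /= !exprS expr0; ring.
Qed.

Lemma wedge_altsum k l (a : ('I_k -> X) -> R) (b : ('I_l -> X) -> R) v : wedge a b v = (k`!)%:R^-1 * (l`!)%:R^-1 *
  altsum (fun u=> a (fun i=> u (lshift l i)) * b (fun i=> u (rshift k i))) v.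
by congr (_ * _); eq_sum s; rewrite mulrA. Qed.

End Altsum2.

(* Signed multiplication table of the imaginary octonions: the entry in row
i and column j is +-k when e_i e_j = +-e_k. *)
Definition octonion_table : seq (seq int) :=
 [:: [:: 0; 7; 5; -6; -3; 4; -2]; [:: -7; 0; -6; -5; 4; 3; 1]; [:: -5; 6; 0; 7; 1; -2; -4];
   [:: 6; 5; -7; 0; -2; -1; 3]; [:: 3; -4; -1; 2; 0; 7; -6]; [:: -4; -3; 2; 1; -7; 0; 5];
   [:: 2; -1; 4; -3; 6; -5; 0]].

Definition oprod (i j : nat) : int := nth 0 (nth [::] octonion_table i) j.

(* Integer components of omega, *omega (indices 0..6) and Phi (indices 0..7) *)
Definition om (i j k : nat) : int :=
 let p := oprod i j in if p == k.+1 :> int then 1 else if p == - (k.+1 : int) then -1 else 0.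

Definition ps (i j k l : nat) : int :=
 match oprod i j with
 | Posz 0 => 0 | Posz m.+1 => om m k l | Negz m => - om m k l end - (if (i == k) && (j == l) then 1 else 0)
   + (if (i == l) && (j == k) then 1 else 0).

Definition ph (a b c d : nat) : int :=
 match a, b, c, d with
 | 0, j.+1, k.+1, l.+1 => om j k l
 | j.+1, 0, k.+1, l.+1 => - om j k l
 | j.+1, k.+1, 0, l.+1 => om j k l
 | j.+1, k.+1, l.+1, 0 => - om j k l
 | i.+1, j.+1, k.+1, l.+1 => ps i j k l
 | _, _, _, _ => 0 end.

(** Boolean quantification and integer sums over [iota] evaluate under [vm_compute]; real identities
    between structure constants are then obtained by casting these integer checks. *)
Definition alln (n : nat) (P : nat -> bool) : bool := all P (iota 0 n).
Definition isum (n : nat) (f : nat -> int) : int :=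
 foldr (fun i s=> f i + s) 0 (iota 0 n).

Lemma allnP n P : alln n P -> forall i : 'I_n, P i.
by move=> /allP H i; apply: H; rewrite mem_iota /= ltn_ord. Qed.

Lemma isumE n f : isum n f = \sum_(i < n) f i.
rewrite /isum -[in RHS](big_mkord xpredT f) /index_iota subn0 unlock.
by [].
Qed.

Tactic Notation "cast_sum" ident(i) := rewrite isumE rmorph_sum; eq_sum i.

Lemma det3E R (A : 'M[R]_3) : \det A = A (od 0) (od 0) * A (od 1) (od 1) * A (od 2) (od 2)
  - A (od 0) (od 0) * A (od 1) (od 2) * A (od 2) (od 1)
  - A (od 0) (od 1) * A (od 1) (od 0) * A (od 2) (od 2)
  + A (od 0) (od 1) * A (od 1) (od 2) * A (od 2) (od 0)
  + A (od 0) (od 2) * A (od 1) (od 0) * A (od 2) (od 1)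
  - A (od 0) (od 2) * A (od 1) (od 1) * A (od 2) (od 0).
have := altsum3 (fun x y z=> A (od 0) x * A (od 1) y * A (od 2) z) id.
move=> /= <-; eq_sum s; congr (_ * _).
by rewrite !big_ord_recl big_ord0 mulr1; od_norm; rewrite mulrA.
Qed.

Definition det3z (i j k a b c : nat) : int :=
 let d (x y : nat) : int := if x == y then 1 else 0 in
 d i a * d j b * d k c - d i a * d j c * d k b - d i b * d j a * d k c
 + d i b * d j c * d k a + d i c * d j a * d k b - d i c * d j b * d k a.

Lemma natb_intr R (b : bool) : (b%:R : R) = ((if b then 1 else 0) : int)%:~R.
by case: b. Qed.

Lemma ebasis3E R n a b c (i j k : 'I_n) : ebasis R 1 [:: a; b; c] (tup3 i j k) = (det3z i.+1 j.+1 k.+1 a b c)%:~R.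
rewrite /ebasis det3E !mxE /= !natb_intr /det3z !addn1.
by rewrite !(intrD, intrM, mulrNz).
Qed.

Lemma om_check : alln 7 (fun i=> alln 7 (fun j=> alln 7 (fun k=> let d a b c := det3z i.+1 j.+1 k.+1 a b c in
 om i j k == d 1%N 2%N 7%N - d 2%N 3%N 6%N + d 3%N 4%N 7%N + d 5%N 6%N 7%N - d 1%N 4%N 6%N - d 2%N 4%N 5%N
       + d 1%N 3%N 5%N))).
by vm_compute. Qed.

Lemma omega_stdE R (i j k : 'I_7) : omega_std R (tup3 i j k) = (om i j k)%:~R.
rewrite /omega_std !ebasis3E.
have /eqP -> := allnP (allnP (allnP om_check i) j) k.
by rewrite !(intrD, mulrNz).
Qed.

Lemma sum_ffun3 (V : nmodType) (T : finType) (F : ('I_3 -> T) -> V) :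
 \sum_(I : {ffun 'I_3 -> T}) F I = \sum_i \sum_j \sum_k F (tup3 i j k).
under [RHS]eq_bigr do rewrite pair_bigA /=.
rewrite pair_bigA /=.
rewrite (reindex (fun p : T * (T * T)=> [ffun x=> tup3 p.1 p.2.1 p.2.2 x])) /=.
 by eq_sum p; congr F; ext x; rewrite ffunE.
exists (fun I : {ffun 'I_3 -> T}=> (I (od 0), (I (od 1), I (od 2)))).
 by case=> i [j k] _; rewrite !ffunE.
by move=> I _; apply/ffunP=> x; rewrite ffunE -tup3_eta.
Qed.

(* Sign of the permutation i |-> s_i of 0 .. (size s - 1); 0 if s is not one *)
Fixpoint eps (n : nat) (s : seq nat) : int :=
 if n is n'.+1 then if s is x :: s' then if x \in s' then 0 else (-1) ^+ x * eps n' [seq unbump x y | y <- s'] else 1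
 else 1.

(** The first row has a single 1, in column f 0. The cofactor has the same shape for f with this
    value removed, which is the recursion of [eps]; a repeated value gives two equal rows. *)
Lemma det_eps R n (f : 'I_n -> 'I_n) : \det (\matrix_(i, j) (f i == j)%:R : 'M[R]_n) =
 (eps n [seq val (f i) | i <- enum 'I_n])%:~R.
elim: n f=> [|n IH] f; first by rewrite det_mx00.
rewrite enum_ordSl /= -map_comp.
case: ifP=> [/mapP[i _ /= E]|N].
 rewrite (determinant_alternate (i1 := ord0) (i2 := lift ord0 i))//.
 by move=> j; rewrite !mxE; congr (_ == _)%:R; exact: val_inj.
have ne i : f ord0 != f (lift ord0 i).
 apply/eqP=> E; move/negP: N; apply; apply/mapP; exists i=> /=.
  by rewrite mem_enum.
 by rewrite E.
rewrite (expand_det_row _ ord0) (bigD1 (f ord0))//= mxE eqxx mul1r.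
rewrite big1 ?addr0; last first.
 by move=> j; rewrite mxE eq_sym=> /negPf ->; rewrite mul0r.
rewrite /cofactor add0n intrM rmorphXn rmorphN1; congr (_ * _).
pose g i := odflt i (unlift (f ord0) (f (lift ord0 i))).
have gE i : f (lift ord0 i) = lift (f ord0) (g i).
 by rewrite /g; case: unliftP (ne i)=> [j ->|->]//=; rewrite eqxx.
have -> : row' ord0 (col' (f ord0) (\matrix_(i, j) (f i == j)%:R)) = \matrix_(i, j) (g i == j)%:R :> 'M[R]_n.
 by apply/matrixP=> i j; rewrite !mxE gE (inj_eq (lift_inj (h := f ord0))).
rewrite IH; congr (eps _ _)%:~R; rewrite -map_comp; apply: eq_map=> i /=.
by rewrite gE bumpK.
Qed.

(** The factor 6 = 3! is the normalization of [hodge] on three-forms. Zero entries of [om] are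
    skipped so that few signs have to be computed. *)
Lemma hodge_check : alln 7 (fun a=> alln 7 (fun b=> alln 7 (fun c =>
 alln 7 (fun d=> isum 7 (fun i=> isum 7 (fun j=> isum 7 (fun k =>
  if om i j k == 0 then 0 else om i j k * eps 7 [:: i; j; k; a; b; c; d]))) == 6 * ps a b c d)))).
by vm_compute. Qed.

Lemma hodge_omegaE R (a b c d : 'I_7) : hodge (k := 3) (l := 4) (@omega_std R) (idx4 a b c d) = (ps a b c d)%:~R.
rewrite /hodge (sum_ffun3 (fun I=> omega_std R I * \det (\matrix_(i, j) (catidx I (idx4 a b c d) i == j)%:R))).
have E (i j k : 'I_7) : omega_std R (tup3 i j k) *
  \det (\matrix_(x, y) (catidx (tup3 i j k) (idx4 a b c d) x == y)%:R) =
 (if om i j k == 0 then 0 else om i j k * eps 7 [:: val i; val j; val k; val a; val b; val c; val d])%:~R.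
 rewrite omega_stdE; case: eqP=> [->|_]; first by rewrite mul0r.
 rewrite intrM; congr (_ * _).
 rewrite det_eps; congr (eps _ _)%:~R.
 have -> : [:: val i; val j; val k; val a; val b; val c; val d] =
   map (nth 0%N [:: val i; val j; val k; val a; val b; val c; val d])
    (map val (enum 'I_7)) by rewrite val_enum_ord.
 rewrite -map_comp; apply: eq_map=> x /=; rewrite /catidx.
 by case: split_ordP=> -[m pm] -> /=; rewrite /tup3 /idx4 (tnth_nth a) /=; case: m pm=> [|[|[|[|m]]]].
apply: (@mulfI _ (6 : R))=> //; rewrite mulrA divff// mul1r.
have /eqP chk := allnP (allnP (allnP (allnP hodge_check a) b) c) d.
rewrite -[X in _ = X * _]/(6%:~R) -intrM -chk.
cast_sum i.
cast_sum j.
by cast_sum k; rewrite E.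
Qed.

Lemma tup3_neq0 (b c d : 'I_8) : [forall s, tup3 b c d s != ord0] = [&& b != ord0, c != ord0 & d != ord0].
apply/forallP/and3P=> [H|[b0 c0 d0]].
 by split; [exact: (H (od 0))|exact: (H (od 1))|exact: (H (od 2))].
by move=> s; rewrite [s](_ : s = od s) ?valZpK//; case: s=> [[|[|[|//]]] p].
Qed.

Definition om8 (b c d : nat) : int :=
 match b, c, d with j.+1, k.+1, l.+1=> om j k l | _, _, _=> 0 end.

Lemma ext8_omegaE R (b c d : 'I_8) : ext8 (@omega_std R) (tup3 b c d) = (om8 b c d)%:~R.
rewrite /ext8 tup3_neq0.
case: (unliftP ord0 b)=> [b'|] -> /=; last by [].
case: (unliftP ord0 c)=> [c'|] -> /=; last by [].
case: (unliftP ord0 d)=> [d'|] -> /=; last by [].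
rewrite -omega_stdE; congr (omega_std R _).
by apply/funext; case=> -[|[|[|//]]] p; rewrite /tup3 !(tnth_nth b') /= (tnth_nth ord0) /= liftK.
Qed.

Lemma ext8_hodgeE R (a b c d : 'I_8) : ext8 (hodge (k := 3) (l := 4) (@omega_std R)) (idx4 a b c d) =
 (match val a, val b, val c, val d with
  | i.+1, j.+1, k.+1, l.+1 => ps i j k l | _, _, _, _ => 0 end)%:~R.
have E : [forall s, idx4 a b c d s != ord0] = [&& a != ord0, b != ord0, c != ord0 & d != ord0].
 apply/forallP/and4P=> [H|[a0 b0 c0 d0]].
  by split; [exact: (H (od 0))|exact: (H (od 1))|exact: (H (od 2))|exact: (H (od 3))].
 by move=> s; rewrite [s](_ : s = od s) ?valZpK//; case: s=> [[|[|[|[|//]]]] p].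
rewrite /ext8 E.
case: (unliftP ord0 a)=> [a'|] -> /=; last by [].
case: (unliftP ord0 b)=> [b'|] -> /=; last by [].
case: (unliftP ord0 c)=> [c'|] -> /=; last by [].
case: (unliftP ord0 d)=> [d'|] -> /=; last by [].
rewrite -hodge_omegaE; congr (hodge _ _).
by apply/funext; case=> -[|[|[|[|//]]]] p; rewrite /idx4 !(tnth_nth b') /= (tnth_nth ord0) /= liftK.
Qed.

(** Only the 24 signed terms of the wedge with e_0 in the one-form slot survive; they come in 3!
    equal copies, whence the factor 6 on both sides. *)
Lemma ph_check : alln 8 (fun a=> alln 8 (fun b=> alln 8 (fun c=> alln 8 (fun d =>
 let g (a b c d : nat) : int := if a == 0%N then om8 b c d else 0 in
 g a b c d - g a b d c - g a c b d + g a c d b + g a d b c - g a d c b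
 - (g b a c d - g b a d c - g b c a d + g b c d a + g b d a c - g b d c a)
 + (g c a b d - g c a d b - g c b a d + g c b d a + g c d a b - g c d b a)
 - (g d a b c - g d a c b - g d b a c + g d b c a + g d c a b - g d c b a)
 + 6 * (match a, b, c, d with
  | i.+1, j.+1, k.+1, l.+1 => ps i j k l | _, _, _, _ => 0 end) == 6 * ph a b c d)))).
by vm_compute. Qed.

Lemma Phi_stdE R (a b c d : 'I_8) : Phi_std R (idx4 a b c d) = (ph a b c d)%:~R.
rewrite /Phi_std ext8_hodgeE wedge_altsum.
pose g (a b c d : 'I_8) : R :=
 (if val a == 0%N then om8 b c d else 0)%:~R.
rewrite (eq_altsum (H := fun u=> g (u (od 0)) (u (od 1)) (u (od 2)) (u (od 3)))).
 rewrite (altsum4 g) /= /g.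
 apply: (@mulfI _ (6 : R))=> //.
 have /eqP E := allnP (allnP (allnP (allnP ph_check a) b) c) d.
 rewrite mulrDr -[X in X * (ph _ _ _ _)%:~R]/(6%:~R) -intrM -E.
 rewrite (_ : (1`!)%:R = 1 :> R)// (_ : (3`!)%:R = 6 :> R)// invr1 mul1r mulrA.
 by rewrite divff// mul1r !(intrD, mulrNz, intrM).
move=> u; rewrite /ebasis det_mx11 mxE /= addn0 /g.
rewrite (tup3_eta (fun i=> u (rshift 1 i))) ext8_omegaE.
have -> : lshift 3 (0 : 'I_1) = od 0 :> 'I_4 by exact: val_inj.
have -> : rshift 1 (od 0 : 'I_3) = od 1 :> 'I_4 by exact: val_inj.
have -> : rshift 1 (od 1 : 'I_3) = od 2 :> 'I_4 by exact: val_inj.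
have -> : rshift 1 (od 2 : 'I_3) = od 3 :> 'I_4 by exact: val_inj.
by case: (_ == _); rewrite ?mul1r ?mul0r.
Qed.

(** Since omega = -F /\ e_7 - Psi^+, the form F is minus the contraction of omega with e_7 and Psi^+
    is minus omega on the other six directions, while Psi^- is the contraction of *omega with e_7.
    These three dictionary entries reduce SU(3) to G_2. *)
Lemma F_stdE R (i j : 'I_6) : F_std R (tup2 i j) = - (om 6 i j)%:~R.
have det2E (A : 'M[R]_2) : \det A = A (od 0) (od 0) * A (od 1) (od 1) - A (od 0) (od 1) * A (od 1) (od 0).
 have := altsum2 (fun x y=> A (od 0) x * A (od 1) y) id.
 move=> /= <-; eq_sum s; congr (_ * _).
 by rewrite !big_ord_recl big_ord0 mulr1; od_norm.
pose dz (i j a b : nat) : int := let d (x y : nat) : int := if x == y then 1 else 0 in d i a * d j b - d i b * d j a.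
have chk : alln 6 (fun i=> alln 6 (fun j=> om 6 i j ==
  dz i.+1 j.+1 1%N 2%N + dz i.+1 j.+1 3%N 4%N + dz i.+1 j.+1 5%N 6%N)).
 by vm_compute.
have E a b : ebasis R 1 [:: a; b] (tup2 i j) = (dz i.+1 j.+1 a b)%:~R.
 rewrite /ebasis det2E !mxE /= !natb_intr /dz !addn1.
 by rewrite !(intrD, intrM, mulrNz).
have /eqP -> := allnP (allnP chk i) j.
by rewrite /F_std !E !intrD !opprD.
Qed.

Lemma Psip_check : alln 6 (fun i=> alln 6 (fun j=> alln 6 (fun k=> let d a b c := det3z i.+1 j.+1 k.+1 a b c in
 (om i j k == d 1%N 3%N 5%N - d 1%N 4%N 6%N - d 2%N 3%N 6%N - d 2%N 4%N 5%N) &&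
 (ps 6 i j k == - (d 1%N 3%N 6%N + d 1%N 4%N 5%N + d 2%N 3%N 5%N - d 2%N 4%N 6%N))))).
by vm_compute. Qed.

Lemma Psip_stdE R (i j k : 'I_6) : Psip_std R (tup3 i j k) = - (om i j k)%:~R.
rewrite /Psip_std !ebasis3E.
have /andP[/eqP -> _] := allnP (allnP (allnP Psip_check i) j) k.
by rewrite !(intrD, mulrNz).
Qed.

Lemma Psim_stdE R (i j k : 'I_6) : Psim_std R (tup3 i j k) = (ps 6 i j k)%:~R.
rewrite /Psim_std !ebasis3E.
have /andP[_ /eqP ->] := allnP (allnP (allnP Psip_check i) j) k.
by rewrite !(intrD, mulrNz).
Qed.

(** * Iterated linear combinations as multilinear forms *)

Section LinearCombination.
Variable R : realType.
Implicit Types m n : nat.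

(** Serves both as the inner product of R^m and as the contraction of one tensor slot; nested, it
    evaluates a tensor on vectors, and exchanging slots is [lcC]. *)
Definition lc m (c x : 'I_m -> R) : R := \sum_i c i * x i.

Lemma eq_lc m (c x y : 'I_m -> R) : (forall i, x i = y i) -> lc c x = lc c y.
by move=> E; eq_sum i; rewrite E. Qed.
Lemma lc_sym m (c x : 'I_m -> R) : lc c x = lc x c.
by eq_sum i; rewrite mulrC. Qed.
Lemma lcD m (c x y : 'I_m -> R) : lc c (fun i=> x i + y i) = lc c x + lc c y.
by rewrite /lc -big_split; eq_sum i; rewrite mulrDr. Qed.
Lemma lcN m (c x : 'I_m -> R) : lc c (fun i=> - x i) = - lc c x.
by rewrite /lc -sumrN; eq_sum i; rewrite mulrN. Qed.
Lemma lcB m (c x y : 'I_m -> R) : lc c (fun i=> x i - y i) = lc c x - lc c y.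
by rewrite lcD lcN. Qed.
Lemma lcZ m a (c x : 'I_m -> R) : lc c (fun i=> a * x i) = a * lc c x.
by rewrite /lc mulr_sumr; eq_sum i; rewrite mulrCA. Qed.
Lemma lcZr m a (c x : 'I_m -> R) : lc c (fun i=> x i * a) = lc c x * a.
by rewrite mulrC -lcZ; apply: eq_lc=> i; rewrite mulrC. Qed.
Lemma lc0 m (c : 'I_m -> R) : lc c (fun=> 0) = 0.
by rewrite /lc big1// => i _; rewrite mulr0. Qed.

Lemma lc_sum m (I : Type) (r : seq I) (P : pred I) (c : 'I_m -> R) (x : I -> 'I_m -> R) :
 lc c (fun i=> \sum_(k <- r | P k) x k i) = \sum_(k <- r | P k) lc c (x k).
by rewrite /lc exchange_big /=; eq_sum i; rewrite mulr_sumr.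
Qed.
Lemma eq_lcl m (c x y : 'I_m -> R) : (forall i, x i = y i) -> lc x c = lc y c.
by move=> E; eq_sum i; rewrite E. Qed.
Lemma lcBl m (c x y : 'I_m -> R) : lc (fun i=> x i - y i) c = lc x c - lc y c.
by rewrite /lc -sumrB; eq_sum i; rewrite mulrBl. Qed.
Lemma lcDl m (c x y : 'I_m -> R) : lc (fun i=> x i + y i) c = lc x c + lc y c.
by rewrite /lc -big_split; eq_sum i; rewrite mulrDl. Qed.
Lemma lcZl m a (c x : 'I_m -> R) : lc (fun i=> a * x i) c = a * lc x c.
by rewrite /lc mulr_sumr; eq_sum i; rewrite mulrA. Qed.

Lemma lc_suml m (I : Type) (r : seq I) (P : pred I) (c : 'I_m -> R) (x : I -> 'I_m -> R) :
 lc (fun i=> \sum_(k <- r | P k) x k i) c = \sum_(k <- r | P k) lc (x k) c.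
by rewrite lc_sym lc_sum; eq_sum k; rewrite lc_sym. Qed.

Lemma lcC m n (c : 'I_m -> R) (d : 'I_n -> R) (X : 'I_m -> 'I_n -> R) :
 lc c (fun i=> lc d (X i)) = lc d (fun j=> lc c (fun i=> X i j)).
rewrite /lc; under eq_bigr do rewrite mulr_sumr.
rewrite exchange_big; eq_sum j; rewrite mulr_sumr.
by eq_sum i; rewrite mulrCA.
Qed.

Lemma lc_comp m n (A : 'I_m -> R) (B : 'I_m -> 'I_n -> R) (x : 'I_n -> R) :
 lc (fun k=> lc A (B^~ k)) x = lc A (fun i=> lc (B i) x).
by rewrite lc_sym lcC; apply: eq_lc=> i; exact: lc_sym. Qed.

Lemma lc_delta m (c : 'I_m -> R) k : lc c (fun i=> (i == k)%:R) = c k.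
rewrite /lc (bigD1 k)//= eqxx mulr1 big1 ?addr0// => i /negPf ->.
by rewrite mulr0.
Qed.
Lemma lc_deltal m (x : 'I_m -> R) k : lc (fun i=> (i == k)%:R) x = x k.
by rewrite lc_sym lc_delta. Qed.

(** Parseval identity for a tight frame: the n vectors A_i of R^m need not be a basis. It is applied
    to the projections of the frame vectors of the product to the six-dimensional tangent space of
    the sphere. *)
Lemma lc_sum_mul m n (A : 'I_n -> 'I_m -> R) (x y : 'I_m -> R) : (forall a b, \sum_i A i a * A i b = (a == b)%:R) ->
 \sum_i lc (A i) x * lc (A i) y = \sum_a x a * y a.
move=> AA; rewrite (eq_bigr (fun i=> \sum_a \sum_b x a * y b * (A i a * A i b))).
 rewrite exchange_big; eq_sum a=> /=.
 rewrite exchange_big (bigD1 a)//= -mulr_sumr AA eqxx mulr1 big1 ?addr0//.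
 by move=> b /negPf ab; rewrite -mulr_sumr AA eq_sym ab mulr0.
move=> i _; rewrite /lc mulr_suml; eq_sum a.
by mul_sum b; ring.
Qed.

Definition lc2 m (c d : 'I_m -> R) (X : Bil m R) : R :=
 lc c (fun i=> lc d (X i)).
Definition lc3 m (c d e : 'I_m -> R) (X : Tri m R) : R :=
 lc c (fun i=> lc2 d e (X i)).
Definition lc4 m (c d e f : 'I_m -> R) (X : Quad m R) : R :=
 lc c (fun i=> lc3 d e f (X i)).

Lemma eq_lc2 m (c d : 'I_m -> R) X Y : (forall i j, X i j = Y i j) -> lc2 c d X = lc2 c d Y.
by move=> E; apply: eq_lc=> i; apply: eq_lc. Qed.
Lemma eq_lc3 m (c d e : 'I_m -> R) X Y : (forall i j k, X i j k = Y i j k) -> lc3 c d e X = lc3 c d e Y.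
by move=> E; apply: eq_lc=> i; apply: eq_lc2. Qed.
Lemma eq_lc4 m (c d e f : 'I_m -> R) X Y : (forall i j k l, X i j k l = Y i j k l) -> lc4 c d e f X = lc4 c d e f Y.
by move=> E; apply: eq_lc=> i; apply: eq_lc3. Qed.

Lemma lc2C m (c d : 'I_m -> R) X : lc2 c d X = lc2 d c (fun i j=> X j i).
exact: lcC. Qed.
Lemma lc3C12 m (c d e : 'I_m -> R) X : lc3 c d e X = lc3 d c e (fun i j k=> X j i k).
by rewrite /lc3 /lc2 lcC. Qed.
Lemma lc3C23 m (c d e : 'I_m -> R) X : lc3 c d e X = lc3 c e d (fun i j k=> X i k j).
by apply: eq_lc=> i; exact: lc2C. Qed.
Lemma lc4C12 m (c d e f : 'I_m -> R) X : lc4 c d e f X = lc4 d c e f (fun i j k l=> X j i k l).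
by rewrite /lc4 /lc3 lcC. Qed.
Lemma lc4C23 m (c d e f : 'I_m -> R) X : lc4 c d e f X = lc4 c e d f (fun i j k l=> X i k j l).
by apply: eq_lc=> i; exact: lc3C12. Qed.
Lemma lc4C34 m (c d e f : 'I_m -> R) X : lc4 c d e f X = lc4 c d f e (fun i j k l=> X i j l k).
by apply: eq_lc=> i; exact: lc3C23. Qed.
Lemma lc2D m (c d : 'I_m -> R) X Y : lc2 c d (fun i j=> X i j + Y i j) = lc2 c d X + lc2 c d Y.
by rewrite -lcD; apply: eq_lc=> i; rewrite lcD. Qed.
Lemma lc3D m (c d e : 'I_m -> R) X Y : lc3 c d e (fun i j k=> X i j k + Y i j k) = lc3 c d e X + lc3 c d e Y.
by rewrite -lcD; apply: eq_lc=> i; rewrite lc2D. Qed.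
Lemma lc4D m (c d e f : 'I_m -> R) X Y : lc4 c d e f (fun i j k l=> X i j k l + Y i j k l) =
 lc4 c d e f X + lc4 c d e f Y.
by rewrite -lcD; apply: eq_lc=> i; rewrite lc3D. Qed.
Lemma lc2Z m a (c d : 'I_m -> R) X : lc2 c d (fun i j=> a * X i j) = a * lc2 c d X.
by rewrite -lcZ; apply: eq_lc=> i; rewrite lcZ. Qed.
Lemma lc3Z m a (c d e : 'I_m -> R) X : lc3 c d e (fun i j k=> a * X i j k) = a * lc3 c d e X.
by rewrite -lcZ; apply: eq_lc=> i; rewrite lc2Z. Qed.
Lemma lc4Z m a (c d e f : 'I_m -> R) X : lc4 c d e f (fun i j k l=> a * X i j k l) = a * lc4 c d e f X.
by rewrite -lcZ; apply: eq_lc=> i; rewrite lc3Z. Qed.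
Lemma lc2N m (c d : 'I_m -> R) X : lc2 c d (fun i j=> - X i j) = - lc2 c d X.
by rewrite -mulN1r -lc2Z; apply: eq_lc2=> i j; rewrite mulN1r. Qed.
Lemma lc3N m (c d e : 'I_m -> R) X : lc3 c d e (fun i j k=> - X i j k) = - lc3 c d e X.
by rewrite -mulN1r -lc3Z; apply: eq_lc3=> i j k; rewrite mulN1r. Qed.
Lemma lc4N m (c d e f : 'I_m -> R) X : lc4 c d e f (fun i j k l=> - X i j k l) = - lc4 c d e f X.
by rewrite -mulN1r -lc4Z; apply: eq_lc4=> i j k l; rewrite mulN1r. Qed.

Lemma lc2_mul m (c d e f : 'I_m -> R) X Y : lc2 c d X * lc2 e f Y = lc4 c d e f (fun i j k l=> X i j * Y k l).
rewrite /lc4 /lc3 /lc2 -lcZr; apply: eq_lc=> i; rewrite -lcZr.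
by apply: eq_lc=> j; rewrite -lcZ; apply: eq_lc=> k; rewrite -lcZ.
Qed.

Lemma lc2_sum m (I : Type) (r : seq I) (P : pred I) (c d : 'I_m -> R) (X : I -> 'I_m -> 'I_m -> R) :
 \sum_(a <- r | P a) lc2 c d (X a) = lc2 c d (fun i j=> \sum_(a <- r | P a) X a i j).
by rewrite -lc_sum; apply: eq_lc=> i; rewrite lc_sum. Qed.

Lemma lc4_sum m (I : Type) (r : seq I) (P : pred I) (c d e f : 'I_m -> R)
  (X : I -> 'I_m -> 'I_m -> 'I_m -> 'I_m -> R) : \sum_(a <- r | P a) lc4 c d e f (X a) =
 lc4 c d e f (fun i j k l=> \sum_(a <- r | P a) X a i j k l).
rewrite /lc4 -lc_sum; apply: eq_lc=> i; rewrite /lc3 -lc_sum.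
by apply: eq_lc=> j; rewrite lc2_sum.
Qed.

End LinearCombination.

(** * Cross product, associated forms and adapted bases of the imaginary octonions *)

Section Octonions.
Variable R : realType.
Implicit Types u v w x : 'I_7 -> R.

Definition omr (i j k : 'I_7) : R := (om i j k)%:~R.
Definition psr (i j k l : 'I_7) : R := (ps i j k l)%:~R.

Definition om3 u v w : R := lc3 u v w omr.
Definition ps4 u v w x : R := lc4 u v w x psr.
Definition cr u v (k : 'I_7) : R := lc2 u v (fun i j=> omr i j k).

Lemma om_anti : alln 7 (fun i=> alln 7 (fun j=> alln 7 (fun k =>
 (om j i k == - om i j k) && (om i k j == - om i j k)))).
by vm_compute. Qed.

Lemma ps_anti : alln 7 (fun i=> alln 7 (fun j=> alln 7 (fun k =>
 alln 7 (fun l=> [&& ps j i k l == - ps i j k l, ps i k j l == - ps i j k l & ps i j l k == - ps i j k l])))).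
by vm_compute. Qed.

(** The contraction of omega with itself: the failure of the cross product to satisfy the
    three-dimensional formula is exactly *omega. *)
Lemma om_om : alln 7 (fun i=> alln 7 (fun j=> alln 7 (fun k =>
 alln 7 (fun l=> isum 7 (fun m=> om i j m * om k l m) == (if (i == k) && (j == l) then 1 else 0)
  - (if (i == l) && (j == k) then 1 else 0) + ps i j k l)))).
by vm_compute. Qed.

Lemma omr12 i j k : omr j i k = - omr i j k.
rewrite /omr; have /andP[/eqP -> _] := allnP (allnP (allnP om_anti i) j) k.
by rewrite mulrNz.
Qed.

Lemma omr23 i j k : omr i k j = - omr i j k.
rewrite /omr; have /andP[_ /eqP ->] := allnP (allnP (allnP om_anti i) j) k.
by rewrite mulrNz.
Qed.

Lemma psr12 i j k l : psr j i k l = - psr i j k l.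
rewrite /psr.
have /and3P[/eqP -> _ _] := allnP (allnP (allnP (allnP ps_anti i) j) k) l.
by rewrite mulrNz.
Qed.

Lemma psr23 i j k l : psr i k j l = - psr i j k l.
rewrite /psr.
have /and3P[_ /eqP -> _] := allnP (allnP (allnP (allnP ps_anti i) j) k) l.
by rewrite mulrNz.
Qed.

Lemma psr34 i j k l : psr i j l k = - psr i j k l.
rewrite /psr.
have /and3P[_ _ /eqP ->] := allnP (allnP (allnP (allnP ps_anti i) j) k) l.
by rewrite mulrNz.
Qed.

Lemma sum_omr_omr i j k l : \sum_m omr i j m * omr k l m =
 (i == k)%:R * (j == l)%:R - (i == l)%:R * (j == k)%:R + psr i j k l.
have /eqP E := allnP (allnP (allnP (allnP om_om i) j) k) l.
transitivity ((isum 7 (fun m=> om i j m * om k l m))%:~R : R).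
 by cast_sum m; rewrite /omr -intrM.
rewrite E intrD intrB /psr -!val_eqE /=; congr (_ - _ + _); by do 2 case: (_ == _); rewrite ?mulr0 ?mul0r ?mulr1.
Qed.
Lemma om3_12 u v w : om3 v u w = - om3 u v w.
by rewrite /om3 lc3C12 -lc3N; apply: eq_lc3=> i j k; rewrite omr12. Qed.
Lemma om3_23 u v w : om3 u w v = - om3 u v w.
by rewrite /om3 lc3C23 -lc3N; apply: eq_lc3=> i j k; rewrite omr23. Qed.
Lemma om3_cycle u v w : om3 v w u = om3 u v w.
by rewrite om3_23 om3_12 opprK. Qed.
Lemma ps4_12 u v w x : ps4 v u w x = - ps4 u v w x.
by rewrite /ps4 lc4C12 -lc4N; apply: eq_lc4=> *; rewrite psr12. Qed.
Lemma ps4_23 u v w x : ps4 u w v x = - ps4 u v w x.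
by rewrite /ps4 lc4C23 -lc4N; apply: eq_lc4=> *; rewrite psr23. Qed.
Lemma ps4_34 u v w x : ps4 u v x w = - ps4 u v w x.
by rewrite /ps4 lc4C34 -lc4N; apply: eq_lc4=> *; rewrite psr34. Qed.

Lemma om3_cr u v w : lc (cr u v) w = om3 u v w.
rewrite lc_sym /cr /om3 /lc3 /lc2 lcC; apply: eq_lc=> i.
by rewrite lcC.
Qed.

(** This expresses *omega through the metric and the cross product, so whatever preserves omega and
    the metric preserves *omega. *)
Lemma ps4_cr u v w x : lc (cr u v) (cr w x) = lc u w * lc v x - lc u x * lc v w + ps4 u v w x.
have -> : lc (cr u v) (cr w x) = lc4 u v w x (fun i j k l=> \sum_m omr i j m * omr k l m).
 rewrite -lc4_sum; eq_sum m.
 by rewrite /cr lc2_mul.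
have D (a b : 'I_7 -> R) : lc a b = lc2 a b (fun i j=> (i == j)%:R).
 by rewrite /lc2; apply: eq_lc=> i; rewrite -(lc_delta b i); apply: eq_lc=> j; rewrite eq_sym.
rewrite !D !lc2_mul (eq_lc4 _ _ _ _ sum_omr_omr) lc4D; congr (_ + _).
rewrite lc4D lc4N; congr (_ - _).
 by rewrite [RHS]lc4C23.
by rewrite [RHS]lc4C23 [RHS]lc4C34.
Qed.

(* The six-dimensional adapted basis: B 6 is the base point of the sphere. *)
Definition g2b (B : Bil 7 R) : Prop :=
 (forall i j, lc (B i) (B j) = (i == j)%:R) /\ (forall i j k, om3 (B i) (B j) (B k) = omr i j k).

(** A right inverse of a square matrix is a left inverse; orthonormal rows thus give completeness
    relations between columns. *)
Lemma orthonormal_complete m (B : Bil m R) : (forall i j, lc (B i) (B j) = (i == j)%:R) ->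
 forall k l, \sum_i B i k * B i l = (k == l)%:R.
move=> BB k l; pose M := \matrix_(i, j) B i j.
have : M *m M^T = 1%:M.
 apply/matrixP=> i j; rewrite !mxE -BB.
 by eq_sum a; rewrite !mxE.
move/mulmx1C/matrixP/(_ k l); rewrite !mxE=> <-.
by eq_sum a; rewrite !mxE.
Qed.

Lemma orthonormal_decomp m (B : Bil m R) : (forall i j, lc (B i) (B j) = (i == j)%:R) ->
 forall (z : 'I_m -> R) k, z k = lc (fun i=> lc (B i) z) (fun i=> B i k).
move=> BB z k; rewrite -[LHS](lc_delta z k).
transitivity (lc z (fun l=> \sum_i B i l * B i k)).
 by apply: eq_lc=> l; rewrite (orthonormal_complete BB).
rewrite lc_sum; eq_sum i.
by rewrite lcZr (lc_sym z).
Qed.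

Definition comb m p (A : 'I_m -> R) (B : 'I_m -> 'I_p -> R) (k : 'I_p) : R :=
 lc A (fun i=> B i k).

Lemma lc_combl m p (A : 'I_m -> R) (B : 'I_m -> 'I_p -> R) (z : 'I_p -> R) :
 lc (comb A B) z = lc A (fun i=> lc (B i) z).
exact: lc_comp. Qed.

Lemma lc_combr m p (A : 'I_m -> R) (B : 'I_m -> 'I_p -> R) (z : 'I_p -> R) :
 lc z (comb A B) = lc A (fun i=> lc z (B i)).
by rewrite lc_sym lc_combl; apply: eq_lc=> i; exact: lc_sym. Qed.

Lemma om3_comb1 m (A : 'I_m -> R) B v w : om3 (comb A B) v w = lc A (fun i=> om3 (B i) v w).
exact: lc_comp. Qed.
Lemma om3_comb2 m (A : 'I_m -> R) B v w : om3 v (comb A B) w = lc A (fun i=> om3 v (B i) w).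
by rewrite om3_12 om3_comb1 -lcN; apply: eq_lc=> i; rewrite om3_12 opprK. Qed.
Lemma om3_comb3 m (A : 'I_m -> R) B v w : om3 v w (comb A B) = lc A (fun i=> om3 v w (B i)).
by rewrite om3_23 om3_comb2 -lcN; apply: eq_lc=> i; rewrite om3_23 opprK. Qed.

Lemma ps4_comb1 m (A : 'I_m -> R) B v w x : ps4 (comb A B) v w x = lc A (fun i=> ps4 (B i) v w x).
exact: lc_comp. Qed.
Lemma ps4_comb2 m (A : 'I_m -> R) B v w x : ps4 v (comb A B) w x = lc A (fun i=> ps4 v (B i) w x).
by rewrite ps4_12 ps4_comb1 -lcN; apply: eq_lc=> i; rewrite ps4_12 opprK. Qed.
Lemma ps4_comb3 m (A : 'I_m -> R) B v w x : ps4 v w (comb A B) x = lc A (fun i=> ps4 v w (B i) x).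
by rewrite ps4_23 ps4_comb2 -lcN; apply: eq_lc=> i; rewrite ps4_23 opprK. Qed.
Lemma ps4_comb4 m (A : 'I_m -> R) B v w x : ps4 v w x (comb A B) = lc A (fun i=> ps4 v w x (B i)).
by rewrite ps4_34 ps4_comb3 -lcN; apply: eq_lc=> i; rewrite ps4_34 opprK. Qed.

Lemma ps4_comb m (A C D E : 'I_m -> R) B : ps4 (comb A B) (comb C B) (comb D B) (comb E B) =
 lc4 A C D E (fun i j k l=> ps4 (B i) (B j) (B k) (B l)).
rewrite ps4_comb1; apply: eq_lc=> i; rewrite ps4_comb2; apply: eq_lc=> j.
rewrite ps4_comb3; apply: eq_lc=> k; exact: ps4_comb4.
Qed.

Lemma ps4_comb_r m (A C D : 'I_m -> R) B v : ps4 v (comb A B) (comb C B) (comb D B) =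
 lc3 A C D (fun i j k=> ps4 v (B i) (B j) (B k)).
rewrite ps4_comb2; apply: eq_lc=> i; rewrite ps4_comb3; apply: eq_lc=> j.
exact: ps4_comb4.
Qed.

Lemma dot_comb m p (A C : 'I_m -> R) (B : 'I_m -> 'I_p -> R) :
 lc (comb A B) (comb C B) = lc2 A C (fun i j=> lc (B i) (B j)).
by rewrite lc_combl; apply: eq_lc=> i; rewrite lc_combr. Qed.

Lemma lc2_delta m (A C : 'I_m -> R) : lc2 A C (fun i j=> (i == j)%:R) = lc A C.
apply: eq_lc=> i; rewrite -[RHS](lc_delta C i).
by apply: eq_lc=> j; rewrite eq_sym.
Qed.

Lemma g2b_cr B i j k : g2b B -> cr (B i) (B j) k = comb (omr i j) B k.
case=> BB BO; rewrite (orthonormal_decomp BB (cr _ _) k).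
by eq_sum l; rewrite lc_sym om3_cr BO.
Qed.

(** By [ps4_cr] the value is determined by inner products of cross products, and these are computed
    in the basis from its omega components. *)
Lemma g2b_ps B i j k l : g2b B -> ps4 (B i) (B j) (B k) (B l) = psr i j k l.
move=> gB; have [BB BO] := gB.
have := ps4_cr (B i) (B j) (B k) (B l); rewrite !BB.
have -> : cr (B i) (B j) = comb (omr i j) B by ext m; exact: g2b_cr.
have -> : cr (B k) (B l) = comb (omr k l) B by ext m; exact: g2b_cr.
rewrite dot_comb (eq_lc2 _ _ BB) lc2_delta [lc _ _]sum_omr_omr.
by move/addrI=> ->.
Qed.
Lemma ps4_alt12 u w x : ps4 u u w x = 0.
by have := ps4_12 u u w x; lra. Qed.
Lemma ps4_alt13 u w x : ps4 u w u x = 0.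
by rewrite ps4_23 ps4_alt12 oppr0. Qed.
Lemma ps4_alt14 u w x : ps4 u w x u = 0.
by rewrite ps4_34 ps4_alt13 oppr0. Qed.
Lemma om3_alt12 u w : om3 u u w = 0.
by have := om3_12 u u w; lra. Qed.
Lemma om3_alt23 u w : om3 w u u = 0.
by have := om3_23 w u u; lra. Qed.
Lemma om3_alt13 u w : om3 u w u = 0.
by rewrite om3_23 om3_alt12 oppr0. Qed.

(* Polarization of u x (u x w) = <u,w> u - <u,u> w. *)
Lemma cr_cr u v w k : cr u (cr v w) k + cr v (cr u w) k = lc u w * v k + lc v w * u k - 2 * lc u v * w k.
pose z : 'I_7 -> R := fun i=> (i == k)%:R.
have E a b : cr a b k = om3 a b z by rewrite -om3_cr lc_delta.
have F a : a k = lc a z by rewrite lc_delta.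
rewrite !E !F (om3_cycle z u) (om3_cycle z v) -!om3_cr.
have := ps4_cr z u v w; have := ps4_cr z v u w.
rewrite (ps4_23 z u v w)=> -> ->.
rewrite (lc_sym z u) (lc_sym z v) (lc_sym z w) (lc_sym v u); ring.
Qed.

Lemma cr_sym u v k : cr v u k = - cr u v k.
by rewrite /cr lc2C -lc2N; apply: eq_lc2=> i j; rewrite omr12.
Qed.

End Octonions.

Section Generation.
Variable R : realType.
Implicit Types x y z : 'I_7 -> R.

Lemma crNr x y : cr x (- y) = - cr x y.
ext k; rewrite -[RHS]/(- cr x y k) /cr -lc2N; apply: eq_lc=> i.
by eq_sum j; rewrite mulrN -mulNr.
Qed.
Lemma cr_symf x y : cr y x = - cr x y.
by ext k; rewrite fctE cr_sym. Qed.

Lemma cr_anti x y z : lc x z = 0 -> lc y z = 0 -> lc x y = 0 -> cr x (cr y z) = - cr y (cr x z).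
move=> xz yz xy; ext k; rewrite fctE.
have := cr_cr x y z k; rewrite xz yz xy; lra.
Qed.

Lemma cr_double x y : lc x x = 1 -> lc x y = 0 -> cr x (cr x y) = - y.
move=> xx xy; ext k; rewrite fctE.
have := cr_cr x x y k; rewrite xx xy; lra.
Qed.
Lemma dot_cr x y z : lc (cr x y) (cr x z) = lc x x * lc y z - lc x z * lc y x.
by rewrite ps4_cr ps4_alt13 addr0. Qed.
Lemma lc_cr_l x y : lc (cr x y) x = 0.
by rewrite om3_cr om3_alt13. Qed.
Lemma lc_cr_r x y : lc (cr x y) y = 0.
by rewrite om3_cr om3_alt23. Qed.
Lemma lc_crl x y : lc x (cr x y) = 0.
by rewrite lc_sym lc_cr_l. Qed.
Lemma lc_crr x y : lc y (cr x y) = 0.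
by rewrite lc_sym lc_cr_r. Qed.

(** Each product of two basis octonions is plus or minus a single basis element or has no imaginary
    part, so the combination collapses to one term. *)
Lemma comb_omr (B : Bil 7 R) (i j : nat) (s : int) (L : nat) (pi : (i < 7)%N) (pj : (j < 7)%N) (pL : (L < 7)%N) :
 alln 7 (fun l=> om i j l == if l == L then s else 0) ->
 comb (omr R (Ordinal pi) (Ordinal pj)) B = (fun k=> s%:~R * B (Ordinal pL) k).
move=> H; ext k.
rewrite /comb /lc (bigD1 (Ordinal pL))//= big1 ?addr0=> [|l].
 by rewrite /omr /=; have /eqP -> := allnP H (Ordinal pL); rewrite eqxx.
rewrite /omr -val_eqE /= => /negPf lL.
by have /eqP -> := allnP H l; rewrite lL mul0r.
Qed.

(* The basis e_1, ..., e_7 generated by e_7 = u, e_1 = a and e_3 = c *)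
Definition g2gen (u a c : 'I_7 -> R) (i : 'I_7) : 'I_7 -> R :=
 nth u [:: a; cr u a; c; cr u c; cr a c; cr u (cr a c)] i.

(** Three orthonormal elements with c also orthogonal to u x a generate the octonions. All other
    products follow from x x (x x y) = -y for a unit x orthogonal to y, and from anticommutation of
    cross products by orthogonal vectors. *)
Lemma g2genP u a c : lc u u = 1 -> lc a a = 1 -> lc c c = 1 ->
 lc u a = 0 -> lc u c = 0 -> lc a c = 0 -> om3 u a c = 0 -> g2b (g2gen u a c).
move=> uu aa cc ua uc ac uac.
have au : lc a u = 0 by rewrite lc_sym.
have cu : lc c u = 0 by rewrite lc_sym.
have ca : lc c a = 0 by rewrite lc_sym.
have u_ac : lc u (cr a c) = 0 by rewrite lc_sym om3_cr om3_cycle.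
have a_uc : lc a (cr u c) = 0 by rewrite lc_sym om3_cr om3_23 uac oppr0.
have c_ua : lc (cr u a) c = 0 by rewrite om3_cr.
have ua_ac : lc (cr u a) (cr a c) = 0.
 by rewrite cr_symf lc_sym lcN lc_sym dot_cr aa uc ac; ring.
have uc_ac : lc (cr u c) (cr a c) = 0.
 rewrite (cr_symf c u) (cr_symf c a) lcN lc_sym lcN opprK dot_cr cc au cu; ring.
have nua : lc (cr u a) (cr u a) = 1 by rewrite dot_cr uu aa ua; ring.
have nuc : lc (cr u c) (cr u c) = 1 by rewrite dot_cr uu cc uc; ring.
have nac : lc (cr a c) (cr a c) = 1 by rewrite dot_cr aa cc ac; ring.
have nuac : lc (cr u (cr a c)) (cr u (cr a c)) = 1.
 by rewrite dot_cr uu nac u_ac; ring.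
have ua_uc : lc (cr u a) (cr u c) = 0 by rewrite dot_cr uu ac uc; ring.
have ua_uac : lc (cr u a) (cr u (cr a c)) = 0.
 by rewrite dot_cr u_ac lc_crl; ring.
have uc_uac : lc (cr u c) (cr u (cr a c)) = 0.
 by rewrite dot_cr u_ac lc_crr; ring.
have a_uac : lc a (cr u (cr a c)) = 0.
 by rewrite lc_sym om3_cr om3_cycle -om3_cr cr_symf lc_sym lcN lc_sym ua_ac oppr0.
have c_uac : lc c (cr u (cr a c)) = 0.
 by rewrite lc_sym om3_cr om3_cycle -om3_cr cr_symf lc_sym lcN lc_sym uc_ac oppr0.
have ac_uac : lc (cr a c) (cr u (cr a c)) = 0 by rewrite lc_crr.
have BB i j : lc (g2gen u a c i) (g2gen u a c j) = (i == j)%:R.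
 have H := (uu, aa, cc, ua, uc, ac, au, cu, ca, u_ac, a_uc, c_ua, ua_ac,
  uc_ac, (nua, nuc, nac, nuac, ua_uc, ua_uac, uc_uac, a_uac, c_uac, ac_uac), (lc_crl, lc_crr, lc_cr_l, lc_cr_r)).
 by case: i=> [[|[|[|[|[|[|[|//]]]]]]] pi]; case: j=> [[|[|[|[|[|[|[|//]]]]]]] pj];
  rewrite /g2gen /=; first [by rewrite H|by rewrite lc_sym H].
have u_ua : cr u (cr u a) = - a by exact: cr_double.
have u_uc : cr u (cr u c) = - c by exact: cr_double.
have u_uac : cr u (cr u (cr a c)) = - cr a c by exact: cr_double.
have a_ua : cr a (cr u a) = u by rewrite (cr_symf a u) crNr cr_double// opprK.
have c_uc' : cr c (cr u c) = u by rewrite (cr_symf c u) crNr cr_double// opprK.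
have a_ac : cr a (cr a c) = - c by exact: cr_double.
have c_ac : cr c (cr a c) = a by rewrite (cr_symf c a) crNr cr_double// opprK.
have a_uc' : cr a (cr u c) = - cr u (cr a c) by exact: cr_anti.
have a_uac' : cr a (cr u (cr a c)) = cr u c.
 by rewrite cr_anti// ?lc_crl// a_ac crNr opprK.
have ua_c : cr (cr u a) c = - cr u (cr a c).
 by rewrite cr_symf cr_anti// (cr_symf a c) crNr !opprK.
have c_uac' : cr c (cr u (cr a c)) = - cr u a.
 by rewrite cr_anti// ?lc_crr// c_ac.
have ac_a : cr (cr a c) a = c by rewrite cr_symf a_ac opprK.
have ac_c : cr (cr a c) c = - a by rewrite cr_symf c_ac.
have ua_ac' : cr (cr u a) (cr a c) = cr u c.
 by rewrite cr_symf cr_anti// ?lc_cr_l 1?lc_sym// ac_a opprK.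
have uc_ac' : cr (cr u c) (cr a c) = - cr u a.
 by rewrite cr_symf cr_anti// ?lc_cr_r 1?lc_sym// ac_c crNr opprK.
have ac_uac' : cr (cr a c) (cr u (cr a c)) = u.
 by rewrite (cr_symf (cr a c) u) crNr cr_double// 1?lc_sym// opprK.
have ua_uc' : cr (cr u a) (cr u c) = - cr a c.
 by rewrite cr_anti// ?lc_cr_l// ua_c crNr u_uac !opprK.
have ua_uac' : cr (cr u a) (cr u (cr a c)) = c.
 by rewrite cr_anti// ?lc_cr_l// ua_ac' u_uc opprK.
have uc_uac' : cr (cr u c) (cr u (cr a c)) = - a.
 by rewrite cr_anti// ?lc_cr_l// uc_ac' crNr u_ua opprK.
have cr0 x : cr x x = 0.
 ext k; rewrite -[RHS]/(0 : R); have := cr_sym x x k; lra.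
(* All 49 products are compared with the multiplication table; for each pair the tactic reads sign
   and index of the table entry and picks the matching identity above, possibly after swapping the
   factors. *)
have T i j : cr (g2gen u a c i) (g2gen u a c j) = comb (omr R i j) (g2gen u a c).
 have P y : (fun k=> (1%:~R : R) * y k) = y.
  by ext k; rewrite mul1r.
 have N y : (fun k=> ((-1)%:~R : R) * y k) = - y.
  by ext k; rewrite mulN1r.
 have Z y : (fun k=> (0%:~R : R) * y k) = 0.
  by ext k; rewrite mul0r.
 have H := (u_ua, u_uc, u_uac, a_ua, c_uc', a_ac, c_ac, a_uc', a_uac', ua_c,
  c_uac', ua_ac', (uc_ac', ac_uac', ua_uc', ua_uac', uc_uac', cr0)).
 case: i=> [[|[|[|[|[|[|[|//]]]]]]] pi]; case: j=> [[|[|[|[|[|[|[|//]]]]]]] pj];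
 let go s L := rewrite (@comb_omr _ _ _ s L) // ?P ?N ?Z /g2gen /=;
   first [by []|by rewrite H|by rewrite cr_symf ?H ?opprK|by rewrite H|by rewrite cr_symf] in
 match goal with |- _ = comb (omr R ?x ?y) _=> let p := eval vm_compute in (oprod x y) in
  let L := eval vm_compute in (`|p|.-1)%N in match p with
  | Posz 0 => go (0 : int) L | Posz _ => go (1 : int) L | _ => go (-1 : int) L end end.
split=> // i j k; rewrite -om3_cr T lc_combl.
by rewrite -[RHS](lc_delta (omr R i j) k); apply: eq_lc=> l; rewrite BB.
Qed.

End Generation.

(** * Smoothness and product rules for the octonionic forms; sealed coefficients of a frame *)

Section SmoothForms.
Variables (R : realType) (n : nat) (U : set 'rV[R]_n).
Hypothesis oU : open U.

Lemma smooth_lc m (c x : 'I_m -> 'rV[R]_n -> R) : (forall i, smooth_on U (c i)) ->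
 (forall i, smooth_on U (x i)) -> smooth_on U (fun z=> lc (c^~ z) (x^~ z)).
by move=> sc sx; apply: smooth_sum=> // i _; exact: smoothM. Qed.

Lemma smooth_om3 (u v w : 'I_7 -> 'rV[R]_n -> R) : (forall i, smooth_on U (u i)) ->
 (forall i, smooth_on U (v i)) -> (forall i, smooth_on U (w i)) ->
 smooth_on U (fun z=> om3 (u^~ z) (v^~ z) (w^~ z)).
move=> su sv sw; apply: (smooth_lc su (x := fun i z=> lc2 (v^~ z) (w^~ z) (omr R i)))=> i.
apply: (smooth_lc sv (x := fun j z=> lc (w^~ z) (omr R i j)))=> j.
by apply: (smooth_lc sw (x := fun k z=> omr R i j k))=> k; exact: smooth_cst.
Qed.

Lemma smooth_ps4 (u v w x : 'I_7 -> 'rV[R]_n -> R) : (forall i, smooth_on U (u i)) ->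
 (forall i, smooth_on U (v i)) -> (forall i, smooth_on U (w i)) -> (forall i, smooth_on U (x i)) ->
 smooth_on U (fun z=> ps4 (u^~ z) (v^~ z) (w^~ z) (x^~ z)).
move=> su sv sw sx; apply: (smooth_lc su (x := fun i z=> lc3 (v^~ z) (w^~ z) (x^~ z) (psr R i)))=> i.
apply: (smooth_lc sv (x := fun j z=> lc2 (w^~ z) (x^~ z) (psr R i j)))=> j.
apply: (smooth_lc sw (x := fun k z=> lc (x^~ z) (psr R i j k)))=> k.
by apply: (smooth_lc sx (x := fun l z=> psr R i j k l))=> l; exact: smooth_cst.
Qed.

End SmoothForms.

Section DerivativeOfProducts.
Variables (R : realType) (n : nat) (e : frame R n).

Lemma diff_lc p (c x : 'I_p -> 'rV[R]_n -> R) y :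
 (forall i, differentiable (c i) y) -> (forall i, differentiable (x i) y) ->
 differentiable (fun z=> lc (c^~ z) (x^~ z)) y.
by move=> dc dx; apply: diff_bigsum=> i; apply: differentiableM.
Qed.

Lemma pd_lc p (c x : 'I_p -> 'rV[R]_n -> R) m y :
 (forall i, differentiable (c i) y) -> (forall i, differentiable (x i) y) -> pd e m (fun z=> lc (c^~ z) (x^~ z)) y =
 lc (fun i=> pd e m (c i) y) (x^~ y) + lc (c^~ y) (fun i=> pd e m (x i) y).
move=> dc dx; rewrite pd_sum=> [|i]; last exact: differentiableM.
by rewrite /lc -big_split; eq_sum i; rewrite pdM.
Qed.

Lemma pd_om3 (u v w : 'I_7 -> 'rV[R]_n -> R) m y :
 (forall i, differentiable (u i) y) -> (forall i, differentiable (v i) y) -> (forall i, differentiable (w i) y) ->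
 pd e m (fun z=> om3 (u^~ z) (v^~ z) (w^~ z)) y = om3 (fun i=> pd e m (u i) y) (v^~ y) (w^~ y) +
 om3 (u^~ y) (fun i=> pd e m (v i) y) (w^~ y) + om3 (u^~ y) (v^~ y) (fun i=> pd e m (w i) y).
move=> du dv dw.
have cst (c : R) : differentiable (fun=> c : R) y by exact: differentiable_cst.
have d1 i j : differentiable (fun z=> lc (w^~ z) (omr R i j)) y.
 exact: (diff_lc (x := fun k z=> omr R i j k)).
have d2 i : differentiable (fun z=> lc (v^~ z) (fun j=> lc (w^~ z) (omr R i j))) y.
 exact: (diff_lc (x := fun j z=> lc (w^~ z) (omr R i j))).
rewrite /om3 /lc3 /lc2 (pd_lc (x := fun i z=> lc (v^~ z) (fun j=> lc (w^~ z) (omr R i j))))//.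
rewrite -addrA; congr (_ + _); rewrite -lcD; apply: eq_lc=> i.
rewrite (pd_lc (x := fun j z=> lc (w^~ z) (omr R i j)))//.
congr (_ + _); apply: eq_lc=> j.
rewrite (pd_lc (x := fun k z=> omr R i j k))//.
by rewrite [X in _ + X](eq_lc _ (y := fun=> 0)) ?lc0 ?addr0// => k; rewrite pd_cst.
Qed.

Lemma pd_ps4 (u v w x : 'I_7 -> 'rV[R]_n -> R) m y :
 (forall i, differentiable (u i) y) -> (forall i, differentiable (v i) y) ->
 (forall i, differentiable (w i) y) -> (forall i, differentiable (x i) y) ->
 pd e m (fun z=> ps4 (u^~ z) (v^~ z) (w^~ z) (x^~ z)) y = ps4 (fun i=> pd e m (u i) y) (v^~ y) (w^~ y) (x^~ y) +
 ps4 (u^~ y) (fun i=> pd e m (v i) y) (w^~ y) (x^~ y) + ps4 (u^~ y) (v^~ y) (fun i=> pd e m (w i) y) (x^~ y) +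
 ps4 (u^~ y) (v^~ y) (w^~ y) (fun i=> pd e m (x i) y).
move=> du dv dw dx.
have cst (c : R) : differentiable (fun=> c : R) y by exact: differentiable_cst.
have d1 i j k : differentiable (fun z=> lc (x^~ z) (psr R i j k)) y.
 exact: (diff_lc (x := fun l z=> psr R i j k l)).
have d2 i j : differentiable (fun z=> lc (w^~ z) (fun k=> lc (x^~ z) (psr R i j k))) y.
 exact: (diff_lc (x := fun k z=> lc (x^~ z) (psr R i j k))).
have d3 i : differentiable (fun z=> lc (v^~ z) (fun j=> lc (w^~ z) (fun k=> lc (x^~ z) (psr R i j k)))) y.
 exact: (diff_lc (x := fun j z=> lc (w^~ z) (fun k=> lc (x^~ z) (psr R i j k)))).
rewrite /ps4 /lc4 /lc3 /lc2.
rewrite (pd_lc (x := fun i z=> lc (v^~ z) (fun j=> lc (w^~ z) (fun k=> lc (x^~ z) (psr R i j k)))))//.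
rewrite -!addrA; congr (_ + _); rewrite -!lcD; apply: eq_lc=> i.
rewrite (pd_lc (x := fun j z=> lc (w^~ z) (fun k=> lc (x^~ z) (psr R i j k))))//.
congr (_ + _); rewrite -lcD; apply: eq_lc=> j.
rewrite (pd_lc (x := fun k z=> lc (x^~ z) (psr R i j k)))//.
congr (_ + _); apply: eq_lc=> k.
rewrite (pd_lc (x := fun l z=> psr R i j k l))//.
by rewrite [X in _ + X](eq_lc _ (y := fun=> 0)) ?lc0 ?addr0// => l; rewrite pd_cst.
Qed.

End DerivativeOfProducts.

(* Sealed copies of the geometric coefficients: comparing two unsealed ones
up to conversion unfolds matrix inverses and limits. *)
Fact coef_key : unit. Proof. exact: tt. Qed.

Definition strck R n (e : frame R n) : coefs R n :=
 let: tt := coef_key in strc e.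
Definition LCk R n (e : frame R n) : coefs R n :=
 let: tt := coef_key in LC e.
Definition curvk R n (e : frame R n) (w : coefs R n) :=
 let: tt := coef_key in curv e w.

Section Sealed.
Variables (R : realType) (n : nat).
Implicit Type e : frame R n.

Lemma strck_eq e : strck e = strc e.
by rewrite /strck; case: coef_key. Qed.
Lemma LCk_eq e : LCk e = LC e.
by rewrite /LCk; case: coef_key. Qed.
Lemma curvk_eq e w : curvk e w = curv e w.
by rewrite /curvk; case: coef_key. Qed.
Lemma LCk_koszul e y i j k : LCk e y i j k = 2^-1 * (strck e y i j k - strck e y j k i + strck e y k i j).
by rewrite strck_eq LCk_eq. Qed.
Lemma LCk_metric e y i j k : LCk e y i j k + LCk e y i k j = 0.
by rewrite LCk_eq LC_metric. Qed.
Lemma LCk_torsion_free e y i j k : LCk e y i j k - LCk e y j i k = strck e y i j k.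
by rewrite LCk_eq strck_eq LC_torsion_free. Qed.

Lemma curvkE e w y m q a b : curvk e w y m q a b = pd e m (fun z=> w z q a b) y - pd e q (fun z=> w z m a b) y
 + \sum_c (w y q a c * w y m c b - w y m a c * w y q c b)
 - \sum_l strck e y m q l * w y l a b.
by rewrite curvk_eq strck_eq. Qed.

Lemma pd_commutatork (U : set 'rV[R]_n) e f i j y : open U -> (forall i, smooth_on U (e i)) -> U y -> smooth_on U f ->
 \matrix_l e l y \in unitmx -> pd e i (pd e j f) y - pd e j (pd e i f) y = \sum_l strck e y i j l * pd e l f y.
by move=> oU se Uy sf eu; rewrite strck_eq; exact: (pd_commutator oU). Qed.

End Sealed.

(** * Exterior derivatives written out in degrees one to four *)

Section ExteriorDerivative.
Variables (R : realType) (n : nat) (e : frame R n) (y : 'rV[R]_n).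

Lemma ext_d1E (a : lform R n 1) i j : ext_d e a y (tup2 i j) = (pd e i (fun z=> a z (fun=> j)) y
  - (\sum_p strck e y i j p * a y (fun=> p)))
 - pd e j (fun z=> a z (fun=> i)) y.
have -> : a = fun z J=> a z (fun=> J (od 0)).
 ext z; ext J.
 by rewrite [J in LHS](_ : J = fun=> J (od 0))//; ext u; congr J; apply/val_inj; rewrite (ord1 u).
rewrite /ext_d -strck_eq.
under eq_bigr do rewrite big_mkcond.
rewrite !big_ord_recl !big_ord0 /= ?expr0 !addr0 !add0r mul1r.
rewrite /bump /= ?addn0 ?add0n !exprS !expr0 ?mulr1 ?mul1r ?mulN1r ?mulNr ?opprK ?mul1r.
by rewrite ?subr0 -?addrA.
Qed.

Lemma ext_d2E (a : lform R n 2) i j k : ext_d e a y (tup3 i j k) = (pd e i (fun z=> a z (tup2 j k)) y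
  - (\sum_p strck e y i j p * a y (tup2 p k)
    + \sum_p strck e y i k p * a y (tup2 j p)))
 - (pd e j (fun z=> a z (tup2 i k)) y
  - (\sum_p strck e y j k p * a y (tup2 i p)))
 + pd e k (fun z=> a z (tup2 i j)) y.
have -> : a = fun z J=> a z (tup2 (J (od 0)) (J (od 1))).
 ext z; ext J.
 by rewrite -tup2_eta.
rewrite /ext_d -strck_eq.
under eq_bigr do rewrite big_mkcond.
rewrite !big_ord_recl !big_ord0 /= ?expr0 !addr0 !add0r mul1r.
rewrite /bump /= ?addn0 ?add0n !exprS !expr0 ?mulr1 ?mul1r ?mulN1r ?mulNr ?opprK ?mul1r.
by rewrite ?subr0 -?addrA.
Qed.

Lemma ext_d3E (a : lform R n 3) i j k l : ext_d e a y (idx4 i j k l) = (pd e i (fun z=> a z (tup3 j k l)) y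
  - (\sum_p strck e y i j p * a y (tup3 p k l)
    + \sum_p strck e y i k p * a y (tup3 j p l)
    + \sum_p strck e y i l p * a y (tup3 j k p)))
 - (pd e j (fun z=> a z (tup3 i k l)) y
  - (\sum_p strck e y j k p * a y (tup3 i p l)
    + \sum_p strck e y j l p * a y (tup3 i k p)))
 + (pd e k (fun z=> a z (tup3 i j l)) y
  - (\sum_p strck e y k l p * a y (tup3 i j p)))
 - pd e l (fun z=> a z (tup3 i j k)) y.
have -> : a = fun z J=> a z (tup3 (J (od 0)) (J (od 1)) (J (od 2))).
 ext z; ext J.
 by rewrite -tup3_eta.
rewrite /ext_d -strck_eq.
under eq_bigr do rewrite big_mkcond.
rewrite !big_ord_recl !big_ord0 /= ?expr0 !addr0 !add0r mul1r.
rewrite /bump /= ?addn0 ?add0n !exprS !expr0 ?mulr1 ?mul1r ?mulN1r ?mulNr ?opprK ?mul1r.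
by rewrite ?subr0 -?addrA.
Qed.

Lemma ext_d4E (a : lform R n 4) i j k l m : ext_d e a y (idx5 i j k l m) = (pd e i (fun z=> a z (idx4 j k l m)) y
  - (\sum_p strck e y i j p * a y (idx4 p k l m)
    + \sum_p strck e y i k p * a y (idx4 j p l m)
    + \sum_p strck e y i l p * a y (idx4 j k p m)
    + \sum_p strck e y i m p * a y (idx4 j k l p)))
 - (pd e j (fun z=> a z (idx4 i k l m)) y
  - (\sum_p strck e y j k p * a y (idx4 i p l m)
    + \sum_p strck e y j l p * a y (idx4 i k p m)
    + \sum_p strck e y j m p * a y (idx4 i k l p)))
 + (pd e k (fun z=> a z (idx4 i j l m)) y
  - (\sum_p strck e y k l p * a y (idx4 i j p m)
    + \sum_p strck e y k m p * a y (idx4 i j l p)))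
 - (pd e l (fun z=> a z (idx4 i j k m)) y
  - (\sum_p strck e y l m p * a y (idx4 i j k p)))
 + pd e m (fun z=> a z (idx4 i j k l)) y.
have -> : a = fun z J=> a z (idx4 (J (od 0)) (J (od 1)) (J (od 2)) (J (od 3))).
 ext z; ext J.
 by rewrite -idx4_eta.
rewrite /ext_d -strck_eq.
under eq_bigr do rewrite big_mkcond.
rewrite !big_ord_recl !big_ord0 /= ?expr0 !addr0 !add0r mul1r.
rewrite /bump /= ?addn0 ?add0n !exprS !expr0 ?mulr1 ?mul1r ?mulN1r ?mulNr ?opprK ?mul1r.
by rewrite ?subr0 -?addrA.
Qed.

End ExteriorDerivative.

(* A product of the six-sphere with r lines or circles, in an orthonormal
frame e: q is the point of the sphere and t s i is the component of e_i
along the s-th one-dimensional factor. *)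
Record product_frame R (r : nat) (U : set 'rV[R]_(6 + r)) (e : frame R (6 + r)) (q : 'I_7 -> 'rV[R]_(6 + r) -> R)
  (t : 'I_r -> 'I_(6 + r) -> 'rV[R]_(6 + r) -> R) : Prop := ProductFrame { pf_open : open U;
 pf_smooth : forall i, smooth_on U (e i); pf_unit : forall y, U y -> \matrix_l e l y \in unitmx;
 pf_q : forall k, smooth_on U (q k); pf_t : forall s i, smooth_on U (t s i);
 pf_q1 : forall y, U y -> lc (q^~ y) (q^~ y) = 1; pf_on : forall y i j, U y ->
  lc (fun k=> pd e i (q k) y) (fun k=> pd e j (q k) y) + \sum_s t s i y * t s j y = (i == j)%:R;
 pf_closed : forall y s i j, U y -> pd e i (t s j) y - pd e j (t s i) y = \sum_l strck e y i j l * t s l y }.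

(** Regroups the commutator identity for a system e_i V_l = Gamma V + N into curvature applied to V
    on one side and derivatives of N on the other. *)
Lemma commutator_algebra R n (A B Gp Gm S V Nm Np Ns : 'I_n -> R) (Tm Tp Ts : Bil n R) (dNp dNm : R) :
 \sum_b A b * V b + \sum_l Gp l * (\sum_b Tm l b * V b + Nm l) + dNp
 - (\sum_b B b * V b + \sum_l Gm l * (\sum_b Tp l b * V b + Np l) + dNm) =
  \sum_l S l * (\sum_b Ts l b * V b + Ns l) -> \sum_b (A b - B b + \sum_l (Gp l * Tm l b - Gm l * Tp l b)
     - \sum_l S l * Ts l b) * V b =
 - (dNp - dNm + \sum_l (Gp l * Nm l - Gm l * Np l) - \sum_l S l * Ns l).
have E (C N : 'I_n -> R) (T : Bil n R) : \sum_l C l * (\sum_b T l b * V b + N l) =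
  \sum_b (\sum_l C l * T l b) * V b + \sum_l C l * N l.
 under eq_bigr do rewrite mulrDr mulr_sumr.
 rewrite big_split exchange_big /=; congr (_ + _).
 eq_sum b; rewrite mulr_suml.
 by eq_sum l; rewrite mulrA.
rewrite !E=> H.
rewrite (eq_bigr (fun b=> A b * V b - B b * V b + ((\sum_l Gp l * Tm l b) * V b
  - (\sum_l Gm l * Tp l b) * V b) - (\sum_l S l * Ts l b) * V b)).
 rewrite !(sumrB, big_split) /=; move: H; rewrite opprD; lra.
by move=> b _; rewrite sumrB; ring.
Qed.

Lemma remainder_algebra R n (Gp Gm S Hm Hp Hs : 'I_n -> R) (x1 x2 k1 k2 am ap qk : R) :
 - (- (x1 * qk + k1 * am) - - (x2 * qk + k2 * ap) +
   \sum_l (Gp l * - (Hm l * qk) - Gm l * - (Hp l * qk)) - \sum_l S l * - (Hs l * qk)) =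
 k1 * am - k2 * ap + (x1 - x2 + \sum_l (Gp l * Hm l - Gm l * Hp l)
   - \sum_l S l * Hs l) * qk.
have -> : \sum_l (Gp l * - (Hm l * qk) - Gm l * - (Hp l * qk)) =
  - ((\sum_l (Gp l * Hm l - Gm l * Hp l)) * qk).
 by rewrite [in RHS]mulr_suml -sumrN; eq_sum l; ring.
have -> : \sum_l S l * - (Hs l * qk) = - ((\sum_l S l * Hs l) * qk).
 by rewrite mulr_suml -sumrN; eq_sum l; ring.
ring.
Qed.

(** * Levi-Civita connection, Gauss equation and torsion of a product frame *)

Section ProductFrameTheory.
Variables (R : realType) (r : nat).
Notation n := (6 + r)%N.
Context (U : set 'rV[R]_n) (e : frame R n) q t (pf : product_frame (r := r) U e q t).

(** The sphere component of e_i, as a vector of R^7 orthogonal to q; [hp] is the metric of the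
    sphere factor, that is, the projection of the tangent space onto the tangent space of the
    sphere. *)
Definition av (y : 'rV[R]_n) (i : 'I_n) (k : 'I_7) : R := pd e i (q k) y.
Definition hp (y : 'rV[R]_n) (i j : 'I_n) : R := lc (av y i) (av y j).

Let oU := pf_open pf.
Let se := pf_smooth pf.

Lemma dq y k : U y -> differentiable (q k) y.
by move=> Uy; exact: smooth_diff (pf_q pf k) Uy. Qed.

Lemma sa i k : smooth_on U (fun y=> av y i k).
exact: smooth_pd (pf_q pf k). Qed.
Lemma da y i k : U y -> differentiable (fun y=> av y i k) y.
by move=> Uy; exact: smooth_diff (sa i k) Uy. Qed.
Lemma dt y s i : U y -> differentiable (t s i) y.
by move=> Uy; exact: smooth_diff (pf_t pf s i) Uy. Qed.

Lemma hp_sym y i j : hp y i j = hp y j i.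
exact: lc_sym. Qed.

Lemma qa y i : U y -> lc (q^~ y) (av y i) = 0.
move=> Uy; have : pd e i (fun z=> lc (q^~ z) (q^~ z)) y = 0.
 rewrite (@pd_eqon _ _ _ _ oU _ (fun=> 1))// ?pd_cst//.
 by move=> z Uz; exact: (pf_q1 pf Uz).
rewrite pd_lc=> [|k|k]; [|exact: dq..].
by rewrite [X in X + _]lc_sym -[fun k=> pd e i (q k) y]/(av y i); lra.
Qed.

(** The normal vector (q, 0) followed by the frame vectors (a_i, t_i) is a square orthonormal system
    in R^7 x R^r. Its completeness relations give the sums over the frame index needed later. *)
Definition obase (y : 'rV[R]_n) (x c : 'I_(7 + r)) : R :=
 match fintype.split (x : 'I_(1 + (6 + r))), fintype.split c with
 | inl _, inl k => q k y | inl _, inr s => 0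
 | inr i, inl k => av y i k | inr i, inr s => t s i y end.

Lemma split_lshift m p (i : 'I_m) : fintype.split (lshift p i) = inl i.
by case: split_ordP=> [j /lshift_inj ->|j /eqP]; rewrite ?eq_lrshift. Qed.
Lemma split_rshift m p (i : 'I_p) : fintype.split (rshift m i) = inr i.
by case: split_ordP=> [j /eqP|j /rshift_inj ->]; rewrite ?eq_rlshift. Qed.

Lemma obase_on y : U y -> forall x x', lc (obase y x) (obase y x') = (x == x')%:R.
move=> Uy x x'; rewrite /lc big_split_ord /= /obase.
under eq_bigr do rewrite !split_lshift.
under [X in _ + X]eq_bigr do rewrite !split_rshift.
case: (split_ordP (x : 'I_(1 + (6 + r))))=> i ->; case: (split_ordP (x' : 'I_(1 + (6 + r))))=> j ->.
- rewrite [X in _ + X]big1 ?addr0=> [|s _]; last by rewrite mulr0.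
 rewrite !ord1 eqxx; exact: (pf_q1 pf Uy).
- rewrite [X in _ + X]big1 ?addr0=> [|s _]; last by rewrite mul0r.
 have -> : (lshift n i == rshift 1 j :> 'I_(7 + r)) = false by exact: eq_lrshift.
 exact: (qa j Uy).
- rewrite [X in _ + X]big1 ?addr0=> [|s _]; last by rewrite mulr0.
 have -> : (rshift 1 i == lshift n j :> 'I_(7 + r)) = false.
  by apply/negbTE/eqP=> /(congr1 val) /=; rewrite ord1.
 by rewrite -[RHS](qa i Uy); exact: lc_sym.
- have -> : (rshift 1 i == rshift 1 j :> 'I_(7 + r)) = (i == j).
  exact: (inj_eq (@rshift_inj 1 (6 + r))).
 exact: (pf_on pf i j Uy).
Qed.

Lemma av_complete y k l : U y -> \sum_i av y i k * av y i l = (k == l)%:R - q k y * q l y.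
move=> Uy; have := orthonormal_complete (obase_on Uy) (lshift r k) (lshift r l).
rewrite (@big_split_ord _ _ _ 1 (6 + r)) /= big_ord1.
rewrite (inj_eq (@lshift_inj _ _))=> <-.
rewrite {1 2}/obase !split_lshift addrC addrK.
by eq_sum i; rewrite /obase !split_lshift !split_rshift.
Qed.

Lemma tv_av y s k : U y -> \sum_i t s i y * av y i k = 0.
move=> Uy; have := orthonormal_complete (obase_on Uy) (rshift 7 s) (lshift r k).
rewrite (@big_split_ord _ _ _ 1 (6 + r)) /= big_ord1.
rewrite [rshift _ _ == _]eq_rlshift=> H.
transitivity (false%:R : R)=> //; rewrite -H {H}.
rewrite {1}/obase !split_lshift split_rshift mul0r add0r.
by eq_sum i; rewrite /obase !split_lshift !split_rshift.
Qed.

Lemma tv_tv y s s' : U y -> \sum_i t s i y * t s' i y = (s == s')%:R.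
move=> Uy; have := orthonormal_complete (obase_on Uy) (rshift 7 s) (rshift 7 s').
rewrite (@big_split_ord _ _ _ 1 (6 + r)) /= big_ord1.
rewrite (inj_eq (@rshift_inj _ _))=> <-.
rewrite {1}/obase !split_lshift split_rshift mul0r add0r.
by eq_sum i; rewrite /obase !split_rshift.
Qed.

Lemma frame_decomp y (v : 'I_7 -> R) (w : 'I_r -> R) : U y -> let c l := lc v (av y l) + \sum_s w s * t s l y in
 (forall k, v k = \sum_l c l * av y l k + lc v (q^~ y) * q k y) /\ (forall s, w s = \sum_l c l * t s l y).
move=> Uy c.
pose z (x : 'I_(7 + r)) := match fintype.split x with inl k=> v k | inr s=> w s end.
have D := orthonormal_decomp (obase_on Uy) z.
have E0 : lc (obase y (lshift (6 + r) (0 : 'I_1))) z = lc v (q^~ y).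
 rewrite {1}/lc big_split_ord /= [X in _ + X]big1 ?addr0=> [|s _].
  rewrite /obase /z; eq_sum k; rewrite !split_lshift.
  exact: mulrC.
 by rewrite /obase (split_lshift (6 + r) (0 : 'I_1)) split_rshift mul0r.
have E1 i : lc (obase y (rshift 1 i)) z = c i.
 rewrite {1}/lc big_split_ord /=; congr (_ + _); eq_sum k.
  by rewrite /obase /z (split_rshift 1 i) !split_lshift mulrC.
 by rewrite /obase /z (split_rshift 1 i) !split_rshift mulrC.
split=> [k|s].
 have := D (lshift r k); rewrite {1}/z split_lshift=> ->.
 rewrite {1}/lc (@big_split_ord _ _ _ 1 (6 + r)) /= big_ord1 addrC E0.
 congr (_ + _ * _).
  eq_sum i; rewrite E1.
  by rewrite /obase (split_rshift 1 i) split_lshift.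
 by rewrite /obase (split_lshift (6 + r) (0 : 'I_1)) split_lshift.
have := D (rshift 7 s); rewrite {1}/z split_rshift=> ->.
rewrite {1}/lc (@big_split_ord _ _ _ 1 (6 + r)) /= big_ord1 E0.
rewrite {1}/obase (split_lshift (6 + r) (0 : 'I_1)) split_rshift mulr0 add0r.
eq_sum i; rewrite E1.
by rewrite /obase (split_rshift 1 i) split_rshift.
Qed.

(** The flat derivative in R^7 x R^r of the frame vector e_j along e_m, projected on e_l. *)
Definition gam (y : 'rV[R]_n) (m j l : 'I_n) : R :=
 lc (fun k=> pd e m (fun z=> av z j k) y) (av y l) + \sum_s pd e m (t s j) y * t s l y.

Lemma gam_anti y m j l : U y -> gam y m j l + gam y m l j = 0.
move=> Uy; have : pd e m (fun z=> lc (av z j) (av z l) + \sum_s t s j z * t s l z) y = 0.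
 rewrite (@pd_eqon _ _ _ _ oU _ (fun=> (j == l)%:R)) ?pd_cst//.
 by move=> z Uz; exact: (pf_on pf).
rewrite pdD; last first.
- apply: diff_bigsum=> s; apply: differentiableM; exact: dt.
- apply: (diff_lc (c := fun k z=> av z j k) (x := fun k z=> av z l k))=> k;
  exact: da.
rewrite (pd_lc e (c := fun k z=> av z j k) (x := fun k z=> av z l k))=> [|k|k]; [|exact: da..].
rewrite pd_sum=> [|s]; last by apply: differentiableM; exact: dt.
move=> <-; rewrite /gam (lc_sym (av y j)) addrACA -!addrA; congr (_ + (_ + _)).
rewrite -big_split; eq_sum s=> /=.
by rewrite pdM; [rewrite [X in _ + X]mulrC|exact: dt..].
Qed.

(** On the sphere part this is symmetry of the second derivatives of q, on the other part closedness
    of the unit forms t_s. *)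
Lemma gam_torsion y m j l : U y -> gam y m j l - gam y j m l = strck e y m j l.
move=> Uy; rewrite /gam opprD addrACA.
have -> : lc (fun k=> pd e m (fun z=> av z j k) y) (av y l) - lc (fun k=> pd e j (fun z=> av z m k) y) (av y l) =
  \sum_p strck e y m j p * lc (av y p) (av y l).
 rewrite -lcBl (eq_lcl _ (y := fun k=> \sum_p strck e y m j p * av y p k)).
  by rewrite lc_suml; eq_sum p; rewrite lcZl.
 move=> k; exact: (pd_commutatork m j oU se Uy (pf_q pf k) (pf_unit pf Uy)).
have -> : \sum_s pd e m (t s j) y * t s l y - \sum_s pd e j (t s m) y * t s l y =
  \sum_p strck e y m j p * \sum_s t s p y * t s l y.
 under [RHS]eq_bigr do rewrite mulr_sumr.
 rewrite -sumrB exchange_big /=; eq_sum s.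
 rewrite -mulrBl (pf_closed pf)// mulr_suml.
 by eq_sum p; rewrite mulrA.
rewrite -big_split /=.
rewrite (eq_bigr (fun p=> strck e y m j p * (p == l)%:R))=> [|p _].
 by rewrite -[RHS](lc_delta (strck e y m j) l).
by rewrite -(pf_on pf p l Uy) mulrDr.
Qed.

(** Uniqueness of the metric torsion-free connection, through the Koszul formula. It also makes the
    coefficients visibly smooth, which the matrix inverse in [strc] hides. *)
Lemma LC_gam y m j l : U y -> LCk e y m j l = gam y m j l.
move=> Uy; rewrite LCk_koszul -!gam_torsion//.
have := gam_anti m j l Uy; have := gam_anti j l m Uy; have := gam_anti l m j Uy.
lra.
Qed.

Lemma smooth_LC m j l : smooth_on U (fun y=> LCk e y m j l).
apply: (smooth_eqon oU (f := fun y=> gam y m j l))=> [y Uy|].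
 by rewrite LC_gam.
apply: smoothD=> //.
 apply: smooth_sum=> // k _; apply: smoothM=> //; last exact: sa.
 apply: smooth_pd=> //; exact: sa.
by apply: smooth_sum=> // s _; apply: smoothM=> //; [apply: smooth_pd|]=> //; exact: (pf_t pf).
Qed.
Lemma dLC y m j l : U y -> differentiable (fun y=> LCk e y m j l) y.
by move=> Uy; exact: smooth_diff (smooth_LC m j l) Uy. Qed.

(** Gauss formula: the normal component is found by differentiating the orthogonality of q and
    a_j. *)
Lemma pd_av y m j k : U y -> pd e m (fun z=> av z j k) y = \sum_l LCk e y m j l * av y l k - hp y m j * q k y.
move=> Uy.
have [D _] := frame_decomp (fun k=> pd e m (fun z=> av z j k) y) (fun s=> pd e m (t s j) y) Uy.
rewrite [LHS]D -mulNr; congr (_ + _ * _).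
 by eq_sum l; rewrite LC_gam.
rewrite /= lc_sym; have : pd e m (fun z=> lc (q^~ z) (av z j)) y = 0.
 rewrite (@pd_eqon _ _ _ _ oU _ (fun=> 0)) ?pd_cst//.
 by move=> z Uz; exact: qa.
rewrite (pd_lc e (x := fun k z=> av z j k))=> [|k'|k']; [|exact: dq|exact: da].
by rewrite -[fun k=> pd e m (q k) y]/(av y m) -/(hp _ _ _); lra.
Qed.

Lemma pd_t y m s j : U y -> pd e m (t s j) y = \sum_l LCk e y m j l * t s l y.
move=> Uy.
have [_ D] := frame_decomp (fun k=> pd e m (fun z=> av z j k) y) (fun s=> pd e m (t s j) y) Uy.
by rewrite [LHS]D; eq_sum l; rewrite LC_gam.
Qed.

Lemma pd_hp y m i j : U y -> pd e m (fun z=> hp z i j) y =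
 \sum_l (LCk e y m i l * hp y l j + LCk e y m j l * hp y i l).
move=> Uy; rewrite /hp.
rewrite (pd_lc e (c := fun k z=> av z i k) (x := fun k z=> av z j k))=> [|k|k]; [|exact: da..].
rewrite big_split /=; congr (_ + _).
 rewrite (eq_lcl _ (y := fun k=> \sum_l LCk e y m i l * av y l k - hp y m i * q k y));
  last by move=> k; exact: pd_av.
 rewrite lcBl lc_suml lcZl qa// mulr0 subr0.
 by eq_sum l; rewrite lcZl.
rewrite (eq_lc _ (y := fun k=> \sum_l LCk e y m j l * av y l k - hp y m j * q k y)); last by move=> k; exact: pd_av.
rewrite lcB lc_sum lcZ (lc_sym (av y i) (q^~ y)) qa// mulr0 subr0.
by eq_sum l; rewrite lcZ.
Qed.

(** If V is parallel up to an inhomogeneous term N, the commutator of derivatives expresses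
    curvature applied to V by N alone. It is used with the parallel t_s, where N = 0, and with a_j,
    where N is the second fundamental form. *)
Lemma curv_commutator (V : 'I_n -> 'rV[R]_n -> R) (N : 'I_n -> 'I_n -> 'rV[R]_n -> R) y m p j :
 U y -> (forall l, smooth_on U (V l)) -> (forall i l, smooth_on U (N i l)) -> (forall z i l, U z ->
   pd e i (V l) z = \sum_b LCk e z i l b * V b z + N i l z) -> \sum_b curvk e (LCk e) y m p j b * V b y =
 - (pd e m (N p j) y - pd e p (N m j) y
   + \sum_l (LCk e y p j l * N m l y - LCk e y m j l * N p l y)
   - \sum_l strck e y m p l * N l j y).
move=> Uy sV sN dV.
have dVd l : differentiable (V l) y by exact: smooth_diff (sV l) Uy.
have dNd i l : differentiable (N i l) y by exact: smooth_diff (sN i l) Uy.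
have dd i k : pd e i (pd e k (V j)) y = \sum_b pd e i (fun z=> LCk e z k j b) y * V b y +
  \sum_l LCk e y k j l * (\sum_b LCk e y i l b * V b y + N i l y) + pd e i (N k j) y.
 rewrite (@pd_eqon _ _ _ _ oU _ (fun z=> \sum_b LCk e z k j b * V b z + N k j z))//; last by move=> z Uz; exact: dV.
 rewrite pdD//; last first.
  by apply: diff_bigsum=> b; apply: differentiableM=> //; exact: dLC.
 rewrite pd_sum=> [|b]; last by apply: differentiableM=> //; exact: dLC.
 congr (_ + _); rewrite -big_split; eq_sum b=> /=.
 by rewrite pdM ?dV//; exact: dLC.
have := pd_commutatork m p oU se Uy (sV j) (pf_unit pf Uy).
have -> : \sum_l strck e y m p l * pd e l (V j) y = \sum_l strck e y m p l * (\sum_b LCk e y l j b * V b y + N l j y).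
 by eq_sum l; rewrite dV.
rewrite !dd=> /commutator_algebra <-; eq_sum b.
by rewrite curvkE.
Qed.

(** Gauss equation. The curvature kills the parallel forms t_s, so it is determined by its
    contraction with the a_c. *)
Lemma curv_LC y m p a b : U y -> curvk e (LCk e) y m p a b = hp y p a * hp y m b - hp y m a * hp y p b.
move=> Uy.
have St s : \sum_c curvk e (LCk e) y m p a c * t s c y = 0.
 rewrite (@curv_commutator (t s) (fun _ _=> fun=> 0))//.
 - have Z1 : \sum_l (LCk e y p a l * 0 - LCk e y m a l * 0) = 0.
   by apply: big1=> l _; rewrite !mulr0 subr0.
  have Z2 : \sum_l strck e y m p l * 0 = 0.
   by apply: big1=> l _; rewrite mulr0.
  by rewrite !pd_cst Z1 Z2 !(subr0, addr0) oppr0.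
 - move=> l; exact: (pf_t pf).
 - move=> i l; exact: (smooth_cst (0 : R)).
 - by move=> z i l Uz; rewrite pd_t// addr0.
have shp i j : smooth_on U (fun z=> hp z i j).
 by apply: smooth_sum=> // k _; apply: smoothM=> //; exact: sa.
(* Coefficient of the normal q; it disappears on pairing with the tangent vector a_b. *)
pose f := \sum_l (LCk e y m p l * hp y l a + LCk e y m a l * hp y p l) -
 \sum_l (LCk e y p m l * hp y l a + LCk e y p a l * hp y m l)
 + \sum_l (LCk e y p a l * hp y m l - LCk e y m a l * hp y p l)
 - \sum_l strck e y m p l * hp y l a.
have Sa k : \sum_c curvk e (LCk e) y m p a c * av y c k = hp y p a * av y m k - hp y m a * av y p k + f * q k y.
 rewrite (@curv_commutator (fun c z=> av z c k) (fun i j z=> - (hp z i j * q k z)))//.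
 - have dh i j z : U z -> differentiable (fun z=> hp z i j) z.
   by move=> Uz; exact: smooth_diff (shp i j) Uz.
  rewrite !pdN; try (by apply: differentiableM; [exact: dh|exact: dq]).
  rewrite !pdM; try (by [exact: dh|exact: dq]).
  rewrite !pd_hp// -![pd e _ (q k) y]/(av y _ k).
  exact: remainder_algebra.
 - by move=> l; exact: sa.
 - by move=> i l; apply: smoothN=> //; apply: smoothM=> //; exact: (pf_q pf).
 - by move=> z i l Uz; rewrite pd_av.
have Sb : \sum_c curvk e (LCk e) y m p a c * hp y c b = hp y p a * hp y m b - hp y m a * hp y p b.
 rewrite /hp; under eq_bigr do rewrite -lcZl.
 rewrite -lc_suml (eq_lcl _ Sa) lcDl lcBl !lcZl (qa b Uy).
 by rewrite mulr0 addr0.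
rewrite -Sb -[LHS](lc_delta (fun c=> curvk e (LCk e) y m p a c) b).
(* The identity is split as the projection [hp] plus the projections on the flat directions t_s. *)
transitivity (\sum_c (curvk e (LCk e) y m p a c * hp y c b + \sum_s curvk e (LCk e) y m p a c * t s c y * t s b y)).
 eq_sum c; rewrite -(pf_on pf c b Uy) mulrDr; congr (_ + _).
 by mul_sum s; rewrite mulrA.
rewrite big_split /= [X in _ + X]exchange_big /= [X in _ + X]big1 ?addr0// => s _.
by rewrite -mulr_suml St mul0r.
Qed.

(** The contraction of *omega with the position vector q; on the sphere itself it is Psi^- up to the
    sign convention of the SU(3)-structure. *)
Definition tor (y : 'rV[R]_n) (i j k : 'I_n) : R :=
 ps4 (q^~ y) (av y i) (av y j) (av y k).
Definition psa (y : 'rV[R]_n) (m i j k : 'I_n) : R :=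
 ps4 (av y m) (av y i) (av y j) (av y k).

Lemma pd_av_comb y m j : U y -> (fun k=> pd e m (fun z=> av z j k) y) =
 (fun k=> comb (LCk e y m j) (av y) k - hp y m j * q k y).
by move=> Uy; ext k; rewrite pd_av. Qed.

Lemma ps4_sub2 v (x : 'I_7 -> R) a z w w' : ps4 v (fun k=> x k - a * z k) w w' = ps4 v x w w' - a * ps4 v z w w'.
rewrite !(ps4_12 _ v) /ps4 /lc4 lcBl lcZl; ring.
Qed.

Lemma ps4_sub3 v (x : 'I_7 -> R) a z w w' : ps4 v w (fun k=> x k - a * z k) w' = ps4 v w x w' - a * ps4 v w z w'.
rewrite !(ps4_23 _ _ w) ps4_sub2; ring. Qed.

Lemma ps4_sub4 v (x : 'I_7 -> R) a z w w' : ps4 v w w' (fun k=> x k - a * z k) = ps4 v w w' x - a * ps4 v w w' z.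
rewrite !(ps4_34 _ _ _ w') ps4_sub3; ring. Qed.

(** Differentiating q produces [psa]. The normal parts of the derivatives of the a's are multiples
    of q and vanish because q already fills the first slot. *)
Lemma pd_tor y m i j k : U y -> pd e m (fun z=> tor z i j k) y = psa y m i j k + \sum_l (LCk e y m i l * tor y l j k
  + LCk e y m j l * tor y i l k + LCk e y m k l * tor y i j l).
move=> Uy; rewrite /tor (pd_ps4 e (v := fun c z=> av z i c)
 (w := fun c z=> av z j c) (x := fun c z=> av z k c))=> [|c|c|c|c]; [|exact: dq|exact: da..].
pose D c' := fun k=> comb (LCk e y m c') (av y) k - hp y m c' * q k y.
transitivity (ps4 (av y m) (av y i) (av y j) (av y k)
 + ps4 (q^~ y) (D i) (av y j) (av y k) + ps4 (q^~ y) (av y i) (D j) (av y k)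
 + ps4 (q^~ y) (av y i) (av y j) (D k)).
 congr (_ + ps4 _ _ _ _ + ps4 _ _ _ _ + ps4 _ _ _ _); exact: pd_av_comb.
rewrite /D; set Q := q^~ y; set Ai := av y i; set Aj := av y j; set Ak := av y k.
have E2 x a : ps4 Q (fun c=> x c - a * q c y) Aj Ak = ps4 Q x Aj Ak.
 by rewrite ps4_sub2 (ps4_alt12 Q) mulr0 subr0.
have E3 x a : ps4 Q Ai (fun c=> x c - a * q c y) Ak = ps4 Q Ai x Ak.
 by rewrite ps4_sub3 (ps4_alt13 Q) mulr0 subr0.
have E4 x a : ps4 Q Ai Aj (fun c=> x c - a * q c y) = ps4 Q Ai Aj x.
 by rewrite ps4_sub4 (ps4_alt14 Q) mulr0 subr0.
by rewrite E2 E3 E4 !big_split /= ps4_comb2 ps4_comb3 ps4_comb4 !addrA.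
Qed.

Lemma dtor y i j k : U y -> differentiable (fun z=> tor z i j k) y.
move=> Uy; apply: smooth_diff Uy.
apply: (smooth_ps4 oU (u := q) (v := fun c z=> av z i c)
 (w := fun c z=> av z j c) (x := fun c z=> av z k c))=> c; try exact: sa.
exact: (pf_q pf).
Qed.

Lemma tor12 y i j k : tor y j i k = - tor y i j k.
exact: ps4_23. Qed.

Lemma tor23 y i j k : tor y i k j = - tor y i j k.
exact: ps4_34. Qed.

Lemma psa12 y m i j k : psa y i m j k = - psa y m i j k.
exact: ps4_12. Qed.

Lemma psa23 y m i j k : psa y m j i k = - psa y m i j k.
exact: ps4_23. Qed.

Lemma psa34 y m i j k : psa y m i k j = - psa y m i j k.
exact: ps4_34. Qed.

End ProductFrameTheory.

Lemma exists_unit_orth R (p m : nat) (v : 'I_p -> 'I_m -> R) :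
 (p < m)%N -> exists u : 'I_m -> R, lc u u = 1 /\ forall i, lc u (v i) = 0.
move=> pm; pose V : 'M[R]_(m, p) := \matrix_(i, j) v j i.
have : kermx V != 0.
 by rewrite kermx_eq0 /row_free; apply/eqP=> E; move: (rank_leq_col V); rewrite E leqNgt pm.
case/rowV0Pn=> w /sub_kermxP wV w0.
pose s := lc (w 0) (w 0).
have s0 : 0 < s.
 have [k wk] : exists k, w 0 k != 0.
  by apply/existsP; apply: contraNT w0; rewrite negb_exists=> /forallP H;
   apply/eqP/rowP=> k; rewrite mxE; apply/eqP; move: (H k); rewrite negbK.
 rewrite /s /lc (bigD1 k)//= ltr_wpDr//; last by rewrite -expr2 exprn_even_gt0//= orbC wk.
 by apply: sumr_ge0=> i _; rewrite -expr2 sqr_ge0.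
exists (fun k=> (Num.sqrt s)^-1 * w 0 k); split=> [|i].
 rewrite lcZ lcZl -/s mulrA -invfM -expr2 sqr_sqrtr ?ltW// mulVf//.
 by rewrite gt_eqF.
rewrite lcZl (_ : lc _ _ = (w *m V) 0 i); first by rewrite wV mxE mulr0.
by rewrite mxE; eq_sum k; rewrite mxE.
Qed.

Lemma exists_g2b R (q : 'I_7 -> R) : lc q q = 1 -> exists B : 'I_7 -> 'I_7 -> R, g2b B /\ B (od 6) = q.
move=> qq.
have [a [aa aq]] := @exists_unit_orth R 1 7 (fun=> q) isT.
(* Three orthogonality conditions in R^7: the third one, against q x a, is what keeps c outside the
   quaternions generated by q and a. *)
have [c [cc cq]] := @exists_unit_orth R 3 7 (tup3 q a (cr q a)) isT.
exists (g2gen q a c); split=> //.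
have := cq (od 0); have := cq (od 1); have := cq (od 2); rewrite /tup3 /= => h2 h1 h0.
apply: g2genP=> //.
- by rewrite lc_sym; exact: aq ord0.
- by rewrite lc_sym; exact: h0.
- by rewrite lc_sym; exact: h1.
- by rewrite -om3_cr lc_sym; exact: h2.
Qed.

(** * Contractions at a point, reduced to integer identities on R^6 *)

Section PointwiseAlgebra.
Variables (R : realType) (n : nat) (A : 'I_n -> 'I_6 -> R).
Hypothesis AA : forall a b, \sum_i A i a * A i b = (a == b)%:R.

(** Torsion and four-form in an octonionic basis whose seventh vector is q. The rows [A i] hold the
    coordinates of the a_i there; as they form a tight frame, sums over the n frame indices become
    sums over six. *)
Definition thr (a b c : 'I_6) : R := (ps 6 a b c)%:~R.
Definition psr6 (a b c d : 'I_6) : R := (ps a b c d)%:~R.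

Definition hA i j : R := lc (A i) (A j).
Definition tA i j k : R := lc3 (A i) (A j) (A k) thr.
Definition pA i j k l : R := lc4 (A i) (A j) (A k) (A l) psr6.

Lemma lc3_rot m (a b c : 'I_m -> R) X : lc3 a b c X = lc c (fun g=> lc2 a b (fun x y=> X x y g)).
by rewrite lc3C23 lc3C12. Qed.
Lemma hA2 i j : hA i j = lc2 (A i) (A j) (fun a b=> (a == b)%:R).
by rewrite lc2_delta. Qed.
Lemma hA_hA i j k l : hA i j * hA k l = lc4 (A i) (A j) (A k) (A l) (fun a b c d=> (a == b)%:R * (c == d)%:R).
by rewrite !hA2 lc2_mul. Qed.

Definition tt6 (i j k l : nat) : int := isum 6 (fun m=> ps 6 i j m * ps 6 m k l).

Lemma tA_tA i j k l : \sum_m tA i j m * tA m k l = lc4 (A i) (A j) (A k) (A l) (fun a b c d=> (tt6 a b c d)%:~R).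
under eq_bigr do rewrite /tA lc3_rot.
rewrite (lc_sum_mul _ _ AA); under eq_bigr do rewrite lc2_mul.
rewrite lc4_sum; apply: eq_lc4=> a b c d.
rewrite /tt6; cast_sum g.
by rewrite /thr -intrM.
Qed.

Lemma hA_sum i j : \sum_l hA i l * hA l j = hA i j.
under eq_bigr do rewrite /hA lc_sym.
by rewrite (lc_sum_mul _ _ AA).
Qed.

Lemma hA_trace : \sum_l hA l l = 6.
rewrite /hA /lc exchange_big /= (eq_bigr (fun=> 1))=> [|a _].
 by rewrite sumr_const card_ord.
by rewrite AA eqxx.
Qed.

Lemma hA_tA i j k : \sum_l hA i l * tA l j k = tA i j k.
under eq_bigr do rewrite /hA lc_sym /tA /lc3.
by rewrite (lc_sum_mul _ _ AA).
Qed.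

(* 2 *om = (T T summed cyclically): parallelism of T *)
Lemma psi_tt_check : alln 6 (fun m=> alln 6 (fun i=> alln 6 (fun j=> alln 6 (fun k=> 2 * ps m i j k ==
  tt6 m i j k + tt6 m j k i + tt6 m k i j)))).
by vm_compute. Qed.

Lemma pA_tt m i j k : 2 * pA m i j k = \sum_l (tA m i l * tA l j k + tA m j l * tA l k i + tA m k l * tA l i j).
rewrite !big_split /= !tA_tA.
rewrite (lc4C34 (A m) (A j)) (lc4C23 (A m) (A j)) (lc4C23 (A m) (A k)).
rewrite (lc4C34 (A m) (A i) (A k)).
rewrite -!lc4D /pA -lc4Z; apply: eq_lc4=> a b c d.
have /eqP E := allnP (allnP (allnP (allnP psi_tt_check a) b) c) d.
rewrite -[X in X * _ = _]/(2%:~R) /psr6 -intrM E.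
by rewrite !intrD.
Qed.

(** Curvature of nabla^g + (s/2) T for s = 1 or s = -1: the round curvature, the part from the
    derivative of T, and the part quadratic in T, which is even in s. *)
Definition cvA (s : R) m q a b : R :=
 hA q a * hA m b - hA m a * hA q b + s * pA m q a b
 + 4^-1 * (\sum_c tA q a c * tA c b m - \sum_c tA m a c * tA c b q).

Definition cv6 (s : int) (m q a b : nat) : int :=
 4 * ((if (q == a) && (m == b) then 1 else 0) - (if (m == a) && (q == b) then 1 else 0) + s * ps m q a b)
 + (tt6 q a b m - tt6 m a b q).

Lemma cvA_lc4 (s : int) m q a b : cvA s%:~R m q a b =
 4^-1 * lc4 (A m) (A q) (A a) (A b) (fun x y z w=> (cv6 s x y z w)%:~R).
rewrite /cvA !hA_hA !tA_tA.
rewrite (lc4C23 (A q) (A a) (A m)) (lc4C12 (A q) (A m)) (lc4C23 (A m) (A a) (A q)).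
rewrite (lc4C34 (A q) (A a) (A b)) (lc4C23 (A q) (A a) (A m)) (lc4C12 (A q) (A m)).
rewrite (lc4C34 (A m) (A a) (A b)) (lc4C23 (A m) (A a) (A q)).
apply: (@mulfI _ (4 : R))=> //.
rewrite [RHS]mulrA mulfV// mul1r [LHS]mulrDr mulVKf//.
rewrite /pA -!lc4N -lc4Z -!lc4D -lc4Z -lc4D; apply: eq_lc4=> x y z w.
rewrite /psr6 /cv6; move: (tt6 y z w x) (tt6 x z w y) (ps x y z w)=> t1 t2 p.
rewrite !(intrD, intrM, mulrNz) -!val_eqE /=.
by do 4 case: (_ == _); rewrite /= ?(mulr1, mulr0, mul0r); ring.
Qed.

Lemma lc4_tail2 m (c d a b : 'I_m -> R) X : lc4 c d a b X =
 lc a (fun g=> lc b (fun h=> lc2 c d (fun x y=> X x y g h))).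
rewrite lc4C23 lc4C12 lc4C34 lc4C23.
by apply: eq_lc=> x; apply: eq_lc.
Qed.

Lemma lc4_contract2 i j k l (X Y : Quad 6 R) :
 \sum_a \sum_b lc4 (A i) (A j) (A a) (A b) X * lc4 (A k) (A l) (A a) (A b) Y =
 lc4 (A i) (A j) (A k) (A l) (fun x y z w=> \sum_g \sum_h X x y g h * Y z w g h).
under eq_bigr do under eq_bigr do rewrite !lc4_tail2 lcC [X in _ * X]lcC.
under eq_bigr do rewrite (lc_sum_mul _ _ AA).
rewrite exchange_big /=; under eq_bigr do rewrite (lc_sum_mul _ _ AA).
under eq_bigr do under eq_bigr do rewrite lc2_mul.
rewrite exchange_big /= -lc4_sum; eq_sum g.
by rewrite lc4_sum.
Qed.

(** The curvature is tabulated once, so that the checks below look entries up instead of recomputing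
    nested sums in their inner loops. *)
Definition cvtab (s : int) : seq (seq (seq (seq int))) :=
 [seq [seq [seq [seq cv6 s m q a b | b <- iota 0 6] | a <- iota 0 6]
   | q <- iota 0 6] | m <- iota 0 6].

Definition nth4 (t : seq (seq (seq (seq int)))) (m q a b : nat) : int :=
 nth 0 (nth [::] (nth [::] (nth [::] t m) q) a) b.

Lemma cvtabE s m q a b : (m < 6)%N -> (q < 6)%N -> (a < 6)%N -> (b < 6)%N -> nth4 (cvtab s) m q a b = cv6 s m q a b.
move=> m6 q6 a6 b6; rewrite /nth4 /cvtab.
rewrite (nth_map 0%N) ?size_iota// nth_iota// (nth_map 0%N) ?size_iota// nth_iota//.
by rewrite (nth_map 0%N) ?size_iota// nth_iota// (nth_map 0%N) ?size_iota// nth_iota.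
Qed.

Lemma cv6_sym_check : alln 6 (fun m=> alln 6 (fun q=> alln 6 (fun a =>
 alln 6 (fun b=> [&& cv6 1 q m a b == - cv6 1 m q a b,
   cv6 1 m q b a == - cv6 1 m q a b, cv6 1 a b m q == cv6 1 m q a b, cv6 (-1) q m a b == - cv6 (-1) m q a b &
   cv6 (-1) m q b a == - cv6 (-1) m q a b])))).
by vm_compute. Qed.

(** The three terms are the pairings of four indices in the wedge square of a two-form. As [cv6] is
    four times the curvature, -96 and 288 stand for -6 and 18. *)
Lemma trace_check : let t1 := cvtab 1 in let t2 := cvtab (-1) in
 alln 6 (fun i=> alln 6 (fun j=> alln 6 (fun k=> alln 6 (fun l=> let f t := isum 6 (fun a=> isum 6 (fun b =>
  nth4 t i j a b * nth4 t k l a b - nth4 t i k a b * nth4 t j l a b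
  + nth4 t i l a b * nth4 t j k a b)) in
 (f t1 == - (96 * ps i j k l)) && (f t2 == 288 * ps i j k l))))).
by vm_compute. Qed.

Lemma trace2_check : let t1 := cvtab 1 in alln 6 (fun m=> alln 6 (fun q=> isum 6 (fun p=> isum 6 (fun a =>
  isum 6 (fun b=> nth4 t1 m p a b * nth4 t1 q p a b))) == if m == q then 192 else 0)).
by vm_compute. Qed.

Lemma tt_check : alln 6 (fun i=> alln 6 (fun j=> isum 6 (fun a=> isum 6 (fun b =>
  ps 6 a b i * ps 6 a b j)) == if i == j then 4 else 0)).
by vm_compute. Qed.

Lemma cvA_anti12 m q a b : cvA 1%:~R q m a b = - cvA 1%:~R m q a b.
rewrite !cvA_lc4 lc4C12 -mulrN -lc4N; congr (_ * _); apply: eq_lc4=> x y z w.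
have /and5P[/eqP -> _ _ _ _] :=
 allnP (allnP (allnP (allnP cv6_sym_check x) y) z) w.
by rewrite mulrNz.
Qed.

Lemma cvA_anti34 m q a b : cvA 1%:~R m q b a = - cvA 1%:~R m q a b.
rewrite !cvA_lc4 lc4C34 -mulrN -lc4N; congr (_ * _); apply: eq_lc4=> x y z w.
have /and5P[_ /eqP -> _ _ _] :=
 allnP (allnP (allnP (allnP cv6_sym_check x) y) z) w.
by rewrite mulrNz.
Qed.

(** Pair symmetry as for Levi-Civita, here for the torsion connection with s = 1. It lets the
    gaugino equation be read off from the holonomy. *)
Lemma cvA_pair m q a b : cvA 1%:~R a b m q = cvA 1%:~R m q a b.
rewrite !cvA_lc4 (lc4C23 (A a)) (lc4C12 (A a)) (lc4C34 (A m) (A a)) (lc4C23 (A m)).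
congr (_ * _); apply: eq_lc4=> x y z w.
by have /and5P[_ _ /eqP -> _ _] :=
 allnP (allnP (allnP (allnP cv6_sym_check x) y) z) w.
Qed.

Lemma cvN_anti12 m q a b : cvA (-1)%:~R q m a b = - cvA (-1)%:~R m q a b.
rewrite !cvA_lc4 lc4C12 -mulrN -lc4N; congr (_ * _); apply: eq_lc4=> x y z w.
have /and5P[_ _ _ /eqP -> _] :=
 allnP (allnP (allnP (allnP cv6_sym_check x) y) z) w.
by rewrite mulrNz.
Qed.

Lemma cvN_anti34 m q a b : cvA (-1)%:~R m q b a = - cvA (-1)%:~R m q a b.
rewrite !cvA_lc4 lc4C34 -mulrN -lc4N; congr (_ * _); apply: eq_lc4=> x y z w.
have /and5P[_ _ _ _ /eqP ->] :=
 allnP (allnP (allnP (allnP cv6_sym_check x) y) z) w.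
by rewrite mulrNz.
Qed.

Definition trA (s : int) i j k l : R := \sum_a \sum_b
 (cvA s%:~R i j a b * cvA s%:~R k l a b - cvA s%:~R i k a b * cvA s%:~R j l a b
  + cvA s%:~R i l a b * cvA s%:~R j k a b).

Lemma cvA_mul (s : int) i j k l : \sum_a \sum_b cvA s%:~R i j a b * cvA s%:~R k l a b =
 16^-1 * lc4 (A i) (A j) (A k) (A l) (fun x y z w=> (\sum_(g < 6) \sum_(h < 6) cv6 s x y g h * cv6 s z w g h)%:~R).
transitivity (16^-1 * \sum_a \sum_b lc4 (A i) (A j) (A a) (A b) (fun x y z w=> (cv6 s x y z w)%:~R) *
  lc4 (A k) (A l) (A a) (A b) (fun x y z w=> (cv6 s x y z w)%:~R)).
 mul_sum a; rewrite mulr_sumr.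
 by eq_sum b; rewrite !cvA_lc4; field.
congr (_ * _); rewrite lc4_contract2; apply: eq_lc4=> x y z w.
rewrite rmorph_sum; eq_sum g; rewrite rmorph_sum.
by eq_sum h; rewrite -intrM.
Qed.

Lemma trA_lc4 (s : int) i j k l : trA s i j k l = 16^-1 * lc4 (A i) (A j) (A k) (A l) (fun x y z w =>
  (isum 6 (fun a=> isum 6 (fun b=> nth4 (cvtab s) x y a b * nth4 (cvtab s) z w a b
  - nth4 (cvtab s) x z a b * nth4 (cvtab s) y w a b
  + nth4 (cvtab s) x w a b * nth4 (cvtab s) y z a b)))%:~R).
rewrite /trA; under eq_bigr do rewrite big_split sumrB.
rewrite big_split sumrB /= !cvA_mul.
rewrite (lc4C23 (A i) (A k)) (lc4C23 (A i) (A l)) (lc4C34 (A i) (A j) (A l)).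
rewrite -mulrBr -mulrDr -lc4N -!lc4D; congr (_ * _); apply: eq_lc4=> x y z w.
rewrite -mulrNz -!intrD; congr (_ %:~R).
rewrite isumE -sumrB -big_split; eq_sum g=> /=.
rewrite isumE -sumrB -big_split; eq_sum h=> /=.
by rewrite !cvtabE.
Qed.

Lemma trA1 i j k l : trA 1 i j k l = - 6 * pA i j k l.
rewrite trA_lc4 /pA -lc4Z -lc4Z; apply: eq_lc4=> x y z w.
have /andP[/eqP -> _] := allnP (allnP (allnP (allnP trace_check x) y) z) w.
by rewrite /psr6 mulrNz intrM; field.
Qed.

Lemma trAN1 i j k l : trA (-1) i j k l = 18 * pA i j k l.
rewrite trA_lc4 /pA -lc4Z -lc4Z; apply: eq_lc4=> x y z w.
have /andP[_ /eqP ->] := allnP (allnP (allnP (allnP trace_check x) y) z) w.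
by rewrite /psr6 intrM; field.
Qed.

Lemma lc_trace (Z : Bil 6 R) : \sum_p lc (A p) (fun g=> lc (A p) (Z g)) = \sum_g Z g g.
rewrite /lc; under eq_bigr do under eq_bigr do rewrite mulr_sumr.
rewrite exchange_big; eq_sum g=> /=.
rewrite exchange_big (bigD1 g)//= [X in _ + X]big1 ?addr0=> [|h hg].
 under eq_bigr do rewrite mulrA.
 by rewrite -mulr_suml AA eqxx mul1r.
under eq_bigr do rewrite mulrA.
by rewrite -mulr_suml AA eq_sym (negPf hg) mul0r.
Qed.

Lemma cvA_trace m q : \sum_p \sum_a \sum_b cvA 1%:~R m p a b * cvA 1%:~R q p a b = 12 * hA m q.
under eq_bigr do rewrite cvA_mul lc4C23 lc4_tail2.
rewrite -mulr_sumr lc_trace lc2_sum hA2 -lc2Z -lc2Z; apply: eq_lc2=> x y.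
have /eqP E := allnP (allnP trace2_check x) y.
rewrite -rmorph_sum /=; transitivity (16^-1 * (isum 6 (fun p=> isum 6 (fun a =>
  isum 6 (fun b=> nth4 (cvtab 1) x p a b * nth4 (cvtab 1) y p a b))))%:~R : R).
 congr (_ * _%:~R); rewrite isumE; eq_sum p.
 rewrite isumE; eq_sum g; rewrite isumE; eq_sum h.
 by rewrite !cvtabE.
rewrite E -val_eqE /=; case: (_ == _); last by rewrite !mulr0.
by rewrite mulr1 (_ : 192%:~R = 16 * 12 :> R) ?mulKf// -natrM.
Qed.

Lemma tA_tA_trace m q : \sum_a \sum_b tA m a b * tA q a b = 4 * hA m q.
have E i j k : tA i j k = lc (A j) (fun g=> lc (A k) (fun h=> lc (A i) (fun x=> thr x g h))).
 by rewrite /tA lc3C12; apply: eq_lc=> g; rewrite /lc2 lcC.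
under eq_bigr do under eq_bigr do rewrite !E lcC [X in _ * X]lcC.
under eq_bigr do rewrite (lc_sum_mul _ _ AA).
rewrite exchange_big /=; under eq_bigr do rewrite (lc_sum_mul _ _ AA).
rewrite exchange_big /= hA2 -lc2Z.
transitivity (\sum_g \sum_h lc2 (A m) (A q) (fun x y=> thr x g h * thr y g h)).
 eq_sum g; eq_sum h.
 by rewrite /lc2 -lcZr; apply: eq_lc=> x; rewrite -lcZ.
under eq_bigr do rewrite lc2_sum.
rewrite lc2_sum; apply: eq_lc2=> x y.
have /eqP E2 := allnP (allnP tt_check x) y.
transitivity ((isum 6 (fun a=> isum 6 (fun b=> ps 6 a b x * ps 6 a b y)))%:~R : R).
 cast_sum g.
 cast_sum h.
 have C z : thr z g h = (ps 6 g h z)%:~R.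
  rewrite /thr; have -> : ps 6 g h z = ps 6 z g h.
   have := allnP (allnP (allnP (_ : alln 6 (fun a=> alln 6 (fun b=> alln 6 (fun c=> ps 6 b c a == ps 6 a b c)))) z) g) h.
   by move=> /(_ isT)/eqP.
  by [].
 by rewrite !C -intrM.
rewrite E2 -val_eqE /=; case: (_ == _); last by rewrite mulr0.
by rewrite mulr1.
Qed.

End PointwiseAlgebra.

(** * Curvature of the torsion connections and exterior derivative of the torsion *)

Lemma conn_curv_algebra R n (G T : Tri n R) (c dm dq pm pq : R) m q a b :
 (forall i j k, G i k j = - G i j k) -> (forall i j k, T j i k = - T i j k) -> (forall i j k, T i k j = - T i j k) ->
 dm + c * (pm + \sum_l (G m q l * T l a b + G m a l * T q l b + G m b l * T q a l))
 - (dq + c * (pq + \sum_l (G q m l * T l a b + G q a l * T m l b + G q b l * T m a l)))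
 + \sum_l ((G q a l + c * T q a l) * (G m l b + c * T m l b)
      - (G m a l + c * T m a l) * (G q l b + c * T q l b))
 - \sum_l (G m q l - G q m l) * (G l a b + c * T l a b) =
 (dm - dq + \sum_l (G q a l * G m l b - G m a l * G q l b)
  - \sum_l (G m q l - G q m l) * G l a b)
 + c * (pm - pq) + c ^+ 2 * (\sum_l T q a l * T l b m - \sum_l T m a l * T l b q).
move=> Ga T12 T23.
rewrite mulrDr -[c * (pm - pq)]/(c * (pm + - pq)).
set Sm := \sum_l (G m q l * T l a b + _ + _); set Sq := \sum_l (G q m l * T l a b + _ + _).
set S1 := \sum_l ((G q a l + _) * _ - _); set S2 := \sum_l _ * (G l a b + _).
set S3 := \sum_l (G q a l * _ - _); set S4 := \sum_l _ * G l a b.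
have -> : \sum_l T q a l * T l b m - \sum_l T m a l * T l b q =
  \sum_l (T q a l * T l b m - T m a l * T l b q) by rewrite sumrB.
set S5 := \sum_l (_ - _).
(* Terms linear in both G and T cancel by skewness; only the curvature of G and the terms quadratic
   in T survive. *)
suff H : c * Sm - c * Sq + S1 - S2 = S3 - S4 + c ^+ 2 * S5 by lra.
rewrite /Sm /Sq /S1 /S2 /S3 /S4 /S5 !mulr_sumr -!sumrN -!big_split /=.
eq_sum l.
have E x y : T l x y = T x y l by rewrite (T12 x l y) (T23 x y l) opprK.
rewrite (E a b) (E b m) (E b q).
rewrite (Ga m b l) (Ga q b l) ?(T23 m b l) ?(T23 q b l).
have -> : T b m l = - T m b l by rewrite T12.
have -> : T b q l = - T q b l by rewrite T12.
by ring.
Qed.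

Lemma ext_d3_algebra R n (G T : Tri n R) (pi pj pk pl : R) i j k l :
 (forall a b c, T b a c = - T a b c) -> (forall a b c, T a c b = - T a b c) ->
 (pi + \sum_p (G i j p * T p k l + G i k p * T j p l + G i l p * T j k p)
  - (\sum_p (G i j p - G j i p) * T p k l + \sum_p (G i k p - G k i p) * T j p l
   + \sum_p (G i l p - G l i p) * T j k p))
 - (pj + \sum_p (G j i p * T p k l + G j k p * T i p l + G j l p * T i k p)
   - (\sum_p (G j k p - G k j p) * T i p l + \sum_p (G j l p - G l j p) * T i k p))
 + (pk + \sum_p (G k i p * T p j l + G k j p * T i p l + G k l p * T i j p)
   - (\sum_p (G k l p - G l k p) * T i j p))
 - (pl + \sum_p (G l i p * T p j k + G l j p * T i p k + G l k p * T i j p)) =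
 pi - pj + pk - pl.
move=> T12 T23.
set S1 := \sum_p (G i j p * _ + _ + _); set S2 := \sum_p (G i j p - _) * _.
set S3 := \sum_p (G i k p - _) * _; set S4 := \sum_p (G i l p - _) * _.
set S5 := \sum_p (G j i p * _ + _ + _); set S6 := \sum_p (G j k p - _) * _.
set S7 := \sum_p (G j l p - _) * _; set S8 := \sum_p (G k i p * _ + _ + _).
set S9 := \sum_p (G k l p - _) * _; set S0 := \sum_p (G l i p * _ + _ + _).
suff : S1 - (S2 + S3 + S4) - (S5 - (S6 + S7)) + (S8 - S9) - S0 = 0 by lra.
rewrite /S1 /S2 /S3 /S4 /S5 /S6 /S7 /S8 /S9 /S0.
rewrite !opprB !opprD -!sumrN -!big_split /=.
rewrite big1// => p _.
have R1 x y : T x y p = T p x y by rewrite (T23 x p y) (T12 p x y) opprK.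
rewrite !R1 ?(T12 p j l) ?(T12 p j k) ?(T12 p i l) ?(T12 p i k); ring.
Qed.

(** The 24 permutations fall into three pairings of eight equal terms, divided by 2! 2!, which
    leaves the factor 2. *)
Lemma wedge22 R (X : Type) (a : ('I_2 -> X) -> R) i j k l : (forall x y, a (tup2 y x) = - a (tup2 x y)) ->
 wedge (k := 2) (l := 2) a a (idx4 i j k l) = 2 * (a (tup2 i j) * a (tup2 k l) - a (tup2 i k) * a (tup2 j l)
    + a (tup2 i l) * a (tup2 j k)).
move=> anti; rewrite wedge_altsum.
pose g (x y z w : X) := a (tup2 x y) * a (tup2 z w).
rewrite (eq_altsum (H := fun u=> g (u (od 0)) (u (od 1)) (u (od 2)) (u (od 3)))).
 rewrite (altsum4 g) /= /g -[idx4 i j k l (od 0)]/i -[idx4 i j k l (od 1)]/j.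
 rewrite -[idx4 i j k l (od 2)]/k -[idx4 i j k l (od 3)]/l.
 rewrite (_ : (2`!)%:R = 2 :> R)//.
 rewrite (anti i j) (anti i k) (anti i l) (anti j k) (anti j l) (anti k l).
 by field.
move=> u; rewrite /g [fun s : 'I_2=> u (lshift 2 s)]tup2_eta.
rewrite [fun s : 'I_2=> u (rshift 2 s)]tup2_eta.
by congr (a (tup2 (u _) (u _)) * a (tup2 (u _) (u _))); exact: val_inj.
Qed.

(** Absorbs the factor 2 of [wedge22], so that the trace over a < b becomes a full double sum to
    which Parseval applies. *)
Lemma sum_lt_sym R n (f : Bil n R) : (forall a b, f b a = f a b) -> (forall a, f a a = 0) ->
 \sum_(a < n) \sum_(b < n | (a < b)%N) 2 * f a b = \sum_a \sum_b f a b.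
move=> fs f0.
have E : \sum_(a < n) \sum_(b < n | (b < a)%N) f a b = \sum_(a < n) \sum_(b < n | (a < b)%N) f a b.
 rewrite (exchange_big_dep xpredT)//=; eq_sum a.
 by eq_sum b.
transitivity (\sum_(a < n) (\sum_(b < n | (a < b)%N) f a b + \sum_(b < n | (b < a)%N) f a b)).
 under eq_bigr do rewrite -mulr_sumr.
 by rewrite -mulr_sumr mulr_natl mulr2n big_split /= E.
eq_sum a; rewrite [RHS](bigID (fun b : 'I_n=> (a < b)%N)) /=; congr (_ + _).
rewrite [RHS](bigD1 a) ?ltnn//= f0 add0r; apply: eq_bigl=> b.
by rewrite -leqNgt ltn_neqAle andbC.
Qed.

Section BianchiEom.
Variables (R : realType) (r : nat).
Notation n := (6 + r)%N.
Context (U : set 'rV[R]_n) (e : frame R n) q t (pf : product_frame (r := r) U e q t).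
Let oU := pf_open pf.

Notation av := (av e q).
Notation hp := (hp e q).
Notation tor := (tor e q).
Notation psa := (psa e q).

Definition w67 (a : 'I_6) : 'I_7 := widen_ord (isT : (6 <= 7)%N) a.

Lemma sum_I7 (V : nmodType) (F : 'I_7 -> V) : \sum_i F i = \sum_(a < 6) F (w67 a) + F (od 6).
rewrite big_ord_recr /=; congr (_ + _); last by congr F; exact: val_inj.
by eq_sum a; congr F; exact: val_inj.
Qed.

(** The basis is adapted only at the point y; this suffices because it is used to evaluate tensors,
    never to differentiate them. *)
Lemma adapted_basis y : U y -> exists B : 'I_7 -> 'I_7 -> R, exists A : 'I_n -> 'I_6 -> R,
 [/\ g2b B, B (od 6) = q^~ y, forall i, av y i = comb (A i) (fun a=> B (w67 a)) &
   forall a b, \sum_i A i a * A i b = (a == b)%:R].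
move=> Uy; have [B [gB B6]] := exists_g2b (pf_q1 pf Uy).
have [BB _] := gB.
exists B, (fun i a=> lc (B (w67 a)) (av y i)); split=> // [i|a b].
 ext k; rewrite (orthonormal_decomp BB (av y i) k) {1}/lc sum_I7 B6.
 by rewrite (qa pf i Uy) mul0r addr0.
transitivity (lc2 (B (w67 a)) (B (w67 b)) (fun k l=> (k == l)%:R - q k y * q l y)).
 transitivity (\sum_i lc2 (B (w67 a)) (B (w67 b)) (fun k l=> av y i k * av y i l)).
  eq_sum i; rewrite /lc2 -lcZr; apply: eq_lc=> k.
  by rewrite -lcZ.
 by rewrite lc2_sum; apply: eq_lc2=> k l; rewrite (av_complete pf).
have -> : lc2 (B (w67 a)) (B (w67 b)) (fun k l=> (k == l)%:R - q k y * q l y) =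
  lc (B (w67 a)) (B (w67 b)) - lc (B (w67 a)) (q^~ y) * lc (B (w67 b)) (q^~ y).
 rewrite -lc2_delta /lc2 -lcZr -lcB; apply: eq_lc=> k.
 by rewrite lcB lcZ.
have W a' : (w67 a' == od 6) = false.
 by apply/negbTE/eqP=> /(congr1 val) /=; have := ltn_ord a'; lia.
by rewrite -B6 !BB !W mul0r subr0.
Qed.

Lemma hp_hA y B A : g2b B -> (forall i, av y i = comb (A i) (fun a=> B (w67 a))) -> forall i j, hp y i j = hA A i j.
move=> [BB _] E i j; rewrite /hp !E dot_comb hA2.
by apply: eq_lc2=> a b; rewrite BB.
Qed.

Lemma tor_tA y B A : g2b B -> B (od 6) = q^~ y -> (forall i, av y i = comb (A i) (fun a=> B (w67 a))) ->
 forall i j k, tor y i j k = tA A i j k.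
move=> gB B6 E i j k; rewrite /tor !E -B6 ps4_comb_r.
by apply: eq_lc3=> a b c; rewrite g2b_ps.
Qed.

Lemma psa_pA y B A : g2b B -> (forall i, av y i = comb (A i) (fun a=> B (w67 a))) ->
 forall m i j k, psa y m i j k = pA A m i j k.
move=> gB E m i j k; rewrite /psa !E ps4_comb.
by apply: eq_lc4=> a b c d; rewrite g2b_ps.
Qed.

(** The four-form is a cyclic sum of products of torsions. Hence [psa] in the derivative of T is
    compensated by half of T acting on itself, and T is parallel. *)
Lemma psa_tor y m i j k : U y -> 2 * psa y m i j k = \sum_l (tor y m i l * tor y l j k + tor y m j l * tor y l k i
     + tor y m k l * tor y l i j).
move=> Uy; have [B [A [gB B6 E AA]]] := adapted_basis Uy.
rewrite (psa_pA gB E) (pA_tt AA).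
by eq_sum l; rewrite !(tor_tA gB B6 E).
Qed.

Definition cvf (s : R) y m p a b : R :=
 hp y p a * hp y m b - hp y m a * hp y p b + s * psa y m p a b
 + 4^-1 * (\sum_c tor y p a c * tor y c b m - \sum_c tor y m a c * tor y c b p).

(** The condition s^2 = 1 turns the coefficient (s/2)^2 of the quadratic part into 1/4, while the
    derivative terms contribute [psa] twice with weight s/2. *)
Lemma curv_wconn (w : coefs R n) (s : R) y m p a b : U y -> s ^+ 2 = 1 ->
 (forall z i j k, U z -> w z i j k = LCk e z i j k + s / 2 * tor z i j k) -> curvk e w y m p a b = cvf s y m p a b.
move=> Uy s2 wE; rewrite curvkE.
have dw i j k l : pd e l (fun z=> w z i j k) y = pd e l (fun z=> LCk e z i j k) y + s / 2 * (psa y l i j k +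
  \sum_x (LCk e y l i x * tor y x j k
  + LCk e y l j x * tor y i x k + LCk e y l k x * tor y i j x)).
 rewrite (@pd_eqon _ _ _ _ oU _ (fun z=> LCk e z i j k + s / 2 * tor z i j k)).
 - rewrite pdD; [|exact: (dLC pf)|].
   by rewrite pdZ; [rewrite (pd_tor pf)|exact: (dtor pf)].
  by apply: differentiableM=> //; exact: (dtor pf).
 - by move=> z Uz; exact: wE.
 - by [].
rewrite !dw.
have -> : \sum_c (w y p a c * w y m c b - w y m a c * w y p c b) = \sum_c ((LCk e y p a c + s / 2 * tor y p a c) *
   (LCk e y m c b + s / 2 * tor y m c b)
  - (LCk e y m a c + s / 2 * tor y m a c) * (LCk e y p c b + s / 2 * tor y p c b)).
 by eq_sum c; rewrite !(wE _ _ _ _ Uy).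
have -> : \sum_l strck e y m p l * w y l a b = \sum_l (LCk e y m p l - LCk e y p m l) *
   (LCk e y l a b + s / 2 * tor y l a b).
 by eq_sum l; rewrite (wE _ _ _ _ Uy) LCk_torsion_free.
rewrite conn_curv_algebra; last first.
- by move=> i j k; exact: tor23.
- by move=> i j k; exact: tor12.
- by move=> i j k; have := LCk_metric e y i j k; lra.
have -> : \sum_l (LCk e y m p l - LCk e y p m l) * LCk e y l a b = \sum_l strck e y m p l * LCk e y l a b.
 by eq_sum l; rewrite LCk_torsion_free.
rewrite -curvkE (curv_LC pf)// /cvf.
have -> : psa y p m a b = - psa y m p a b by exact: psa12.
have -> : (s / 2) ^+ 2 = 4^-1 by rewrite expr_div_n s2; field.
congr (_ + _ + _); set P := psa _ _ _ _ _; by rewrite opprK; field.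
Qed.

(** The Levi-Civita terms cancel, and alternating the four-form [psa] over its first slot gives four
    equal contributions. *)
Lemma ext_d_tor (T : lform R n 3) y i j k l : U y -> (forall z i j k, U z -> T z (tup3 i j k) = tor z i j k) ->
 ext_d e T y (idx4 i j k l) = 4 * psa y i j k l.
move=> Uy TE; rewrite ext_d3E.
have dT m a b c : pd e m (fun z=> T z (tup3 a b c)) y = psa y m a b c + \sum_x (LCk e y m a x * tor y x b c
  + LCk e y m b x * tor y a x c + LCk e y m c x * tor y a b x).
 rewrite (@pd_eqon _ _ _ _ oU _ (fun z=> tor z a b c))//; first exact: (pd_tor pf).
 by move=> z Uz; exact: TE.
rewrite !dT.
have S a b f g : (forall p, T y (f p) = g p) -> \sum_p strck e y a b p * T y (f p) =
  \sum_p (LCk e y a b p - LCk e y b a p) * g p.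
 by move=> E; eq_sum p; rewrite LCk_torsion_free E.
rewrite (S _ _ _ (fun p=> tor y p k l)); last by move=> p; exact: TE.
rewrite (S _ _ _ (fun p=> tor y j p l)); last by move=> p; exact: TE.
rewrite (S _ _ _ (fun p=> tor y j k p)); last by move=> p; exact: TE.
rewrite (S _ _ _ (fun p=> tor y i p l)); last by move=> p; exact: TE.
rewrite (S _ _ _ (fun p=> tor y i k p)); last by move=> p; exact: TE.
rewrite (S _ _ _ (fun p=> tor y i j p)); last by move=> p; exact: TE.
rewrite ext_d3_algebra; last first.
- by move=> a b c; exact: tor23.
- by move=> a b c; exact: tor12.
have -> : psa y j i k l = - psa y i j k l by rewrite psa12.
have -> : psa y k i j l = psa y i j k l by rewrite psa12 psa23 opprK.
have -> : psa y l i j k = - psa y i j k l by rewrite psa12 psa23 psa34 !opprK.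
ring.
Qed.

End BianchiEom.

(** * Parallel tensors and cancellations in the field equations *)

Lemma contraction_algebra R n (W : Bil n R) (X Y : Tri n R) i j k l : (forall a b, W a b = - W b a) ->
 \sum_x ((\sum_z (W i z * X z j x + W j z * X i z x + W x z * X i j z)) * Y x k l
  + X i j x * (\sum_z (W x z * Y z k l + W k z * Y x z l + W l z * Y x k z))) =
 \sum_z (W i z * (\sum_x X z j x * Y x k l) + W j z * (\sum_x X i z x * Y x k l)
  + W k z * (\sum_x X i j x * Y x z l) + W l z * (\sum_x X i j x * Y x k z)).
move=> anti.
(* The terms in which W acts on the contracted index cancel against each other because W is skew. *)
have Z : \sum_x \sum_z (W x z * X i j z * Y x k l + X i j x * W x z * Y z k l) = 0.
 under eq_bigr do rewrite big_split /=.
 rewrite big_split /= [X in _ + X]exchange_big -big_split big1//= => x _.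
 rewrite -big_split big1//= => z _; rewrite (anti z x); ring.
rewrite -[LHS]subr0 -[X in _ - X]Z -[LHS]sumrB.
transitivity (\sum_x \sum_z (W i z * X z j x * Y x k l + W j z * X i z x * Y x k l
  + W k z * X i j x * Y x z l + W l z * X i j x * Y x k z)).
 eq_sum x; rewrite mulr_suml mulr_sumr -big_split -sumrB /=.
 by eq_sum z; ring.
rewrite exchange_big; eq_sum z=> /=.
by rewrite !mulr_sumr -!big_split; eq_sum x=> /=; ring.
Qed.

Section ParallelTensors.
Variables (R : realType) (n : nat) (e : frame R n) (w : coefs R n) (y : 'rV[R]_n).
Hypothesis w_anti : forall m i j, w y m i j = - w y m j i.

(** Parallel components at y for a skew connection. Products, permutations and contractions of such
    tensors are again parallel; this gives the parallel curvature without differentiating its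
    formula. *)
Definition par2 (P : 'I_n -> 'I_n -> 'rV[R]_n -> R) :=
 (forall i j, differentiable (P i j) y) /\ forall m i j, pd e m (P i j) y =
  \sum_x (w y m i x * P x j y + w y m j x * P i x y).

Definition par3 (P : 'I_n -> 'I_n -> 'I_n -> 'rV[R]_n -> R) :=
 (forall i j k, differentiable (P i j k) y) /\ forall m i j k, pd e m (P i j k) y =
  \sum_x (w y m i x * P x j k y + w y m j x * P i x k y + w y m k x * P i j x y).

Definition par4 (P : 'I_n -> 'I_n -> 'I_n -> 'I_n -> 'rV[R]_n -> R) :=
 (forall i j k l, differentiable (P i j k l) y) /\ forall m i j k l, pd e m (P i j k l) y =
  \sum_x (w y m i x * P x j k l y + w y m j x * P i x k l y
      + w y m k x * P i j x l y + w y m l x * P i j k x y).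

Lemma par4D P Q : par4 P -> par4 Q -> par4 (fun i j k l z=> P i j k l z + Q i j k l z).
move=> [dP P'] [dQ Q']; split=> [i j k l|m i j k l]; first exact: differentiableD.
by rewrite pdD// P' Q' -big_split; eq_sum x=> /=; ring.
Qed.

Lemma par4Z (c : R) P : par4 P -> par4 (fun i j k l z=> c * P i j k l z).
move=> [dP P']; split=> [i j k l|m i j k l].
 exact: (differentiableM (differentiable_cst (c : R) _) (dP i j k l)).
by rewrite pdZ// P' mulr_sumr; eq_sum x=> /=; ring.
Qed.

Lemma par4_12 P : par4 P -> par4 (fun i j k l=> P j i k l).
move=> [dP P']; split=> // m i j k l; rewrite P'.
by eq_sum x=> /=; ring.
Qed.

Lemma par4_23 P : par4 P -> par4 (fun i j k l=> P i k j l).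
move=> [dP P']; split=> // m i j k l; rewrite P'.
by eq_sum x=> /=; ring.
Qed.

Lemma par4_34 P : par4 P -> par4 (fun i j k l=> P i j l k).
move=> [dP P']; split=> // m i j k l; rewrite P'.
by eq_sum x=> /=; ring.
Qed.

Lemma eq_par4 U P Q : open U -> U y -> par4 P -> (forall i j k l z, U z -> P i j k l z = Q i j k l z) -> par4 Q.
move=> oU Uy [dP P'] PQ; split=> [i j k l|m i j k l].
 exact: (diff_eqon oU (PQ i j k l) Uy (dP i j k l)).
rewrite -(@pd_eqon _ _ _ e oU _ _ m y (PQ i j k l) Uy) P'.
by eq_sum x; rewrite !PQ.
Qed.

Lemma par2M P Q : par2 P -> par2 Q -> par4 (fun i j k l z=> P i j z * Q k l z).
move=> [dP P'] [dQ Q']; split=> [i j k l|m i j k l]; first exact: differentiableM.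
rewrite pdM// P' Q' mulr_sumr mulr_suml -big_split.
by eq_sum x=> /=; ring.
Qed.

Lemma par3_contract P Q : par3 P -> par3 Q -> par4 (fun i j k l z=> \sum_x P i j x z * Q x k l z).
move=> [dP P'] [dQ Q']; split=> [i j k l|m i j k l].
 by apply: diff_bigsum=> x; apply: differentiableM.
rewrite pd_sum=> [|x]; last exact: differentiableM.
rewrite -(@contraction_algebra _ _ (w y m) (fun i j k=> P i j k y)
 (fun i j k=> Q i j k y))=> [|a b]; last exact: w_anti.
by eq_sum x; rewrite pdM// P' Q'.
Qed.

End ParallelTensors.

Lemma half_algebra2 R (a b c d x y : R) :
 a * b + c * d + 2^-1 * (x * b + y * d) = (a + 2^-1 * x) * b + (c + 2^-1 * y) * d.
ring. Qed.

Lemma half_algebra3 R (a b c d f g x y z : R) : 2^-1 * (x * b + y * d + z * g) + (a * b + c * d + f * g) =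
 (a + 2^-1 * x) * b + (c + 2^-1 * y) * d + (f + 2^-1 * z) * g.
ring. Qed.

Lemma eq_subM R (a b c d : R) : a * b - c * d = a * b - d * c.
ring. Qed.

Lemma mulr_sum3 R (x a b c d f g : R) : a * (x * b) + c * (x * d) + f * (x * g) = x * (a * b + c * d + f * g).
ring. Qed.

Lemma flux_algebra R (k t x T P S : R) :
 - 2 * k * t * x * T + x * (P + S) - x * S = x * P - 2 * k * x * (t * T).
ring. Qed.

Lemma gauge_algebra R n (w1 w2 w3 w4 T1 T2 X1 X2 X3 X4 : 'I_n -> R) (k t x X : R) :
 - 2 * k * t * x * X + x * (\sum_l (w1 l * X1 l + w2 l * X2 l + w3 l * X3 l + w4 l * X4 l))
 - \sum_l ((w1 l - 2^-1 * T1 l) * (x * X1 l) + (w2 l - 2^-1 * T2 l) * (x * X2 l))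
 - \sum_l (w3 l * (x * X3 l) + w4 l * (x * X4 l)) =
 - 2 * k * x * (t * X) + x * \sum_l (2^-1 * T1 l * X1 l + 2^-1 * T2 l * X2 l).
rewrite -!addrA; congr (_ + _); first by ring.
rewrite !mulr_sumr -!sumrN -!big_split; eq_sum l=> /=; ring.
Qed.

Lemma sum_exchange_mul R m n (a : 'I_m -> R) (t : 'I_n -> R) (b : 'I_n -> 'I_m -> R) :
 \sum_c a c * (\sum_m t m * b m c) = \sum_m t m * \sum_c a c * b m c.
under eq_bigr do rewrite mulr_sumr.
rewrite exchange_big; eq_sum k; rewrite mulr_sumr.
by eq_sum c=> /=; rewrite mulrCA.
Qed.

Lemma t_cvf_sum R n (t X h1 h2 p x z : 'I_n -> R) (a b : R) :
 (forall m, X m = a * h1 m - h2 m * b + p m + 4^-1 * (x m - z m)) ->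
 \sum_m t m * X m = a * (\sum_m t m * h1 m) - b * (\sum_m t m * h2 m)
  + \sum_m t m * p m + 4^-1 * (\sum_m t m * x m - \sum_m t m * z m).
move=> E; rewrite -sumrB !mulr_sumr -sumrB -!big_split.
by eq_sum m=> /=; rewrite E; ring.
Qed.

(** In each term the direction t is contracted with [hp], with the torsion or with the four-form,
    all of which vanish on the flat directions. *)
Lemma t_cvf_pure R n (t : 'I_n -> R) (H : Bil n R) (T : Tri n R) (P : Quad n R) p a b :
 (forall i j k, T i j k = T j k i) -> (forall i, \sum_m t m * H m i = 0) -> (forall i j, \sum_m t m * T m i j = 0) ->
 (forall i j k, \sum_m t m * P m i j k = 0) -> \sum_m t m * (H p a * H m b - H m a * H p b + 1 * P m p a b
  + 4^-1 * (\sum_c T p a c * T c b m - \sum_c T m a c * T c b p)) = 0.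
move=> Tc H0 T0 P0.
have [Z1 Z2] : \sum_m t m * (\sum_c T p a c * T c b m) = 0 /\ \sum_m t m * (\sum_c T m a c * T c b p) = 0.
 split.
  rewrite -(sum_exchange_mul (T p a) t (fun m c=> T c b m)).
  rewrite big1// => c _; under eq_bigr do rewrite -Tc.
  by rewrite T0 mulr0.
 transitivity (\sum_m t m * (\sum_c T c b p * T m a c)).
  by eq_sum m; congr (_ * _); eq_sum c; rewrite mulrC.
 rewrite -(sum_exchange_mul (fun c=> T c b p) t (fun m c=> T m a c)).
 by rewrite big1// => c _; rewrite T0 mulr0.
rewrite (t_cvf_sum t (X := fun m=> _) (fun m=> erefl)) Z1 Z2 !H0.
have -> : \sum_m t m * (1 * P m p a b) = 0.
 by rewrite -[RHS](P0 p a b); eq_sum m; rewrite mul1r.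
by rewrite !mulr0 !subr0 mulr0 !addr0.
Qed.

(** The terms where the torsion acts on the second form index cancel against the flux term by
    skewness; the others have a repeated torsion index or contain t contracted with the
    curvature. *)
Lemma gauge_pure R n (t : 'I_n -> R) (T : Tri n R) (C : Bil n R) k (c x : R) :
 (forall i j k, T j i k = - T i j k) -> \sum_m t m * C m k = 0 ->
 \sum_m (c * x * (t m * C m k) + x * \sum_l (2^-1 * T m m l * C l k + 2^-1 * T m k l * C m l))
 + 2^-1 * x * (\sum_i \sum_j T k i j * C i j) = 0.
move=> T12 tC.
rewrite big_split /= -!mulr_sumr tC mulr0 add0r [2^-1 * x]mulrC -mulrA -mulrDr.
rewrite mulr_sumr -big_split big1 ?mulr0//= => m _.
rewrite mulr_sumr -big_split big1//= => l _.
have -> : T m m l = 0 by have := T12 m m l; lra.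
rewrite (T12 k m l); ring.
Qed.

Lemma upd_tup3 (X : Type) (i j k l : X) :
 [/\ upd (tup3 i j k) (od 0) l = tup3 l j k, upd (tup3 i j k) (od 1) l = tup3 i l k &
   upd (tup3 i j k) (od 2) l = tup3 i j l].
by split; rewrite [LHS]tup3_eta. Qed.

Lemma upd_idx4 (X : Type) (i j k l x : X) :
 [/\ upd (idx4 i j k l) (od 0) x = idx4 x j k l, upd (idx4 i j k l) (od 1) x = idx4 i x k l,
   upd (idx4 i j k l) (od 2) x = idx4 i j x l & upd (idx4 i j k l) (od 3) x = idx4 i j k x].
by split; rewrite [LHS]idx4_eta. Qed.

Lemma cov3E R n (e : frame R n) (w : coefs R n) (a : lform R n 3) y m i j k :
 cov e w a y m (tup3 i j k) = pd e m (fun z=> a z (tup3 i j k)) y -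
 \sum_l (w y m i l * a y (tup3 l j k) + w y m j l * a y (tup3 i l k)
      + w y m k l * a y (tup3 i j l)).
rewrite /cov; congr (_ - _).
rewrite big_ord_recl big_ord_recl big_ord_recl big_ord0 addr0 addrA -!big_split.
eq_sum l=> /=; have [<- <- <-] := upd_tup3 i j k l.
by congr (_ + _ + _); congr (_ * a y (upd _ _ _)); exact: val_inj.
Qed.

(** * Bianchi identities, parallel curvature and equations of motion *)

Section FieldEquations.
Variables (R : realType) (r : nat).
Notation n := (6 + r)%N.
Context (U : set 'rV[R]_n) (e : frame R n) q t (pf : product_frame (r := r) U e q t).
Let oU := pf_open pf.

Notation av := (av e q).
Notation hp := (hp e q).
Notation tor := (tor e q).
Notation psa := (psa e q).
Notation cvf := (cvf e q).

Definition tor_form (T : lform R n 3) :=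
 forall z i j k, U z -> T z (tup3 i j k) = tor z i j k.

Definition tor_conn (s : R) (w : coefs R n) :=
 forall z i j k, U z -> w z i j k = LCk e z i j k + s / 2 * tor z i j k.

Lemma conn_tor_conn T s c : tor_form T -> c = s / 2 -> tor_conn s (conn e c T).
move=> TE -> z i j k Uz; rewrite /conn LCk_eq; congr (_ + _ * _).
exact: TE.
Qed.

Lemma cvf_cvA y (s : int) B A : U y -> g2b B -> B (od 6) = q^~ y ->
 (forall i, av y i = comb (A i) (fun a=> B (w67 a))) -> forall m p a b, cvf s%:~R y m p a b = cvA A s%:~R m p a b.
move=> Uy gB B6 E m p a b; rewrite /cvf /cvA !(hp_hA gB E) (psa_pA gB E).
congr (_ + _ * (_ - _)); eq_sum c; by rewrite !(tor_tA gB B6 E).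
Qed.

Lemma tr_wedge_cvA y (s : int) (w : coefs R n) B A i j k l : U y -> g2b B ->
 B (od 6) = q^~ y -> (forall i, av y i = comb (A i) (fun a=> B (w67 a))) -> s ^+ 2 = 1 -> tor_conn s%:~R w ->
 (forall m p a b, cvA A s%:~R p m a b = - cvA A s%:~R m p a b) ->
 (forall m p a b, cvA A s%:~R m p b a = - cvA A s%:~R m p a b) -> tr_wedge e w y (idx4 i j k l) = trA A s i j k l.
move=> Uy gB B6 E s2 wE an12 an34.
have sR : (s%:~R : R) ^+ 2 = 1 by rewrite -rmorphXn s2.
have C m p a b : curv e w y m p a b = cvA A s%:~R m p a b.
 by rewrite -curvk_eq (curv_wconn pf _ _ _ _ Uy sR wE) (cvf_cvA s Uy gB B6 E).
rewrite /tr_wedge /trA -sum_lt_sym; first last.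
- move=> a; have Z m p : cvA A s%:~R m p a a = 0 by have := an34 m p a a; lra.
 by rewrite !Z !mul0r subrr addr0.
- by move=> a b; rewrite !(an34 _ _ a b) !mulrNN.
eq_sum a; eq_sum b.
have K x z : curv2 e w y a b (tup2 x z) = cvA A s%:~R x z a b by exact: C.
by rewrite wedge22=> [|x z]; rewrite !K.
Qed.

(** dT is 4 times the four-form and the trace -6 times, so 4 = 2 alpha' (-6). *)
Lemma bianchi1_tor T y : tor_form T -> U y -> bianchi1_at e T (conn e 2^-1 T) (- 3^-1) y.
move=> TE Uy I; rewrite (idx4_eta I).
have [B [A [gB B6 E AA]]] := adapted_basis pf Uy.
rewrite (ext_d_tor pf _ _ _ _ Uy TE).
rewrite (tr_wedge_cvA (s := 1) _ _ _ _ Uy gB B6 E)//.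
- by rewrite (trA1 AA) (psa_pA gB E); field.
- by apply: conn_tor_conn=> //; rewrite mul1r.
- by move=> *; rewrite (cvA_anti12 AA).
- by move=> *; rewrite (cvA_anti34 AA).
Qed.

(** The two traces are -6 and 18 times the four-form, so 4 = 2 alpha' (-6 - 18). *)
Lemma bianchi2_tor T y : tor_form T -> U y -> bianchi2_at e T (conn e 2^-1 T) (- 12^-1) y.
move=> TE Uy I; rewrite (idx4_eta I).
have [B [A [gB B6 E AA]]] := adapted_basis pf Uy.
rewrite (ext_d_tor pf _ _ _ _ Uy TE).
rewrite (tr_wedge_cvA (s := 1) _ _ _ _ Uy gB B6 E)//; last first.
- by move=> *; rewrite (cvA_anti34 AA).
- by move=> *; rewrite (cvA_anti12 AA).
- by apply: conn_tor_conn=> //; rewrite mul1r.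
rewrite (tr_wedge_cvA (s := -1) _ _ _ _ Uy gB B6 E)//; last first.
- by move=> *; rewrite (cvN_anti34 AA).
- by move=> *; rewrite (cvN_anti12 AA).
- by apply: conn_tor_conn=> //; rewrite mulN1r.
by rewrite (trA1 AA) (trAN1 AA) (psa_pA gB E); field.
Qed.
Lemma tor_rot z i j k : tor z i j k = tor z j k i.
by rewrite [RHS](tor23 _ _ _ j i k) (tor12 _ _ _ i j k) opprK. Qed.

Lemma tor_hp z i j k : U z -> \sum_x tor z i j x * hp z x k = tor z i j k.
move=> Uz; have [B [A [gB B6 E AA]]] := adapted_basis pf Uz.
rewrite -[RHS](tor_rot z k i j) (tor_tA gB B6 E) -(hA_tA AA).
eq_sum x.
by rewrite mulrC hp_sym (hp_hA gB E) -(tor_tA gB B6 E) (tor_rot z x i j).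
Qed.

Section Parallel.
Variable w : coefs R n.
Hypothesis wE : tor_conn 1 w.

Lemma w_anti z m i j : U z -> w z m i j = - w z m j i.
move=> Uz; rewrite !wE// (tor23 _ _ _ m i j).
by have := LCk_metric e z m i j; lra.
Qed.

Lemma pd_hp_w y m i j : U y -> pd e m (fun z=> hp z i j) y = \sum_x (w y m i x * hp y x j + w y m j x * hp y i x).
move=> Uy; rewrite (pd_hp pf)//.
have Z : \sum_x (tor y m i x * hp y x j + tor y m j x * hp y i x) = 0.
 rewrite big_split /= (tor_hp m i j Uy).
 under eq_bigr do rewrite (hp_sym e q y i).
 by rewrite tor_hp// (tor23 _ _ _ m i j) subrr.
transitivity (\sum_l (LCk e y m i l * hp y l j + LCk e y m j l * hp y i l) +
  2^-1 * \sum_x (tor y m i x * hp y x j + tor y m j x * hp y i x)).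
 by rewrite Z mulr0 addr0.
by rewrite mulr_sumr -big_split; eq_sum x=> /=; rewrite !wE// mul1r; exact: half_algebra2.
Qed.

(** [psa_tor] rewrites the four-form in the derivative of T as exactly the half torsion terms by
    which w differs from Levi-Civita. *)
Lemma pd_tor_w y m i j k : U y -> pd e m (fun z=> tor z i j k) y =
 \sum_x (w y m i x * tor y x j k + w y m j x * tor y i x k
      + w y m k x * tor y i j x).
move=> Uy; rewrite (pd_tor pf)//.
have -> : psa y m i j k = 2^-1 * (2 * psa y m i j k) by field.
rewrite (psa_tor pf _ _ _ _ Uy) mulr_sumr -big_split.
eq_sum x=> /=; rewrite !wE// mul1r.
rewrite (tor_rot y i x k) -(tor_rot y x i j); exact: half_algebra3.
Qed.

Lemma par2_hp y : U y -> par2 e w y (fun i j z=> hp z i j).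
move=> Uy; split=> [i j|m i j]; last exact: pd_hp_w.
by apply: diff_lc=> k; exact: (da pf).
Qed.
Lemma par3_tor y : U y -> par3 e w y (fun i j k z=> tor z i j k).
by move=> Uy; split=> [i j k|m i j k]; [exact: (dtor pf)|exact: pd_tor_w]. Qed.

Lemma par4_psa y : U y -> par4 e w y (fun i j k l z=> psa z i j k l).
move=> Uy; have wa m i j : w y m i j = - w y m j i by exact: w_anti.
have p1 := par3_contract wa (par3_tor Uy) (par3_tor Uy).
have p2 := par4_34 (par4_23 p1); have p3 := par4_23 (par4_34 p1).
have p4 := par4Z 2^-1 (par4D (par4D p1 p3) p2).
apply: (eq_par4 oU Uy p4)=> m i j k z Uz; rewrite -!big_split /=.
by rewrite -(psa_tor pf _ _ _ _ Uz) mulKf.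
Qed.

(** The curvature is built from [hp], [psa] and a contraction of two torsions, each of them
    parallel. *)
Lemma par4_cvf y s : U y -> par4 e w y (fun i j k l z=> cvf s z i j k l).
move=> Uy; have wa m i j : w y m i j = - w y m j i by exact: w_anti.
have pT := par3_contract wa (par3_tor Uy) (par3_tor Uy).
have pH := par2M (par2_hp Uy) (par2_hp Uy).
have p1 := par4D (par4D (par4_12 (par4_23 pH)) (par4Z (-1) (par4_23 pH))) (par4Z s (par4_psa Uy)).
have p2 := par4D (par4Z 4^-1 (par4_12 (par4_23 (par4_34 pT)))) (par4Z (- 4^-1) (par4_23 (par4_34 pT))).
apply: (eq_par4 oU Uy (par4D p1 p2))=> m p a b z Uz.
by rewrite mulN1r /cvf mulrBr mulNr.
Qed.

End Parallel.

Lemma hp_trace y : U y -> \sum_p hp y p p = 6.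
move=> Uy; have [B [A [gB B6 E AA]]] := adapted_basis pf Uy.
by rewrite -(hA_trace AA); eq_sum p; rewrite (hp_hA gB E).
Qed.

Lemma hp_idem y m k : U y -> \sum_p hp y m p * hp y p k = hp y m k.
move=> Uy; have [B [A [gB B6 E AA]]] := adapted_basis pf Uy.
by rewrite (hp_hA gB E) -(hA_sum AA); eq_sum p; rewrite !(hp_hA gB E).
Qed.

Lemma tor_tor_trace y m k : U y -> \sum_a \sum_b tor y m a b * tor y k a b = 4 * hp y m k.
move=> Uy; have [B [A [gB B6 E AA]]] := adapted_basis pf Uy.
rewrite (hp_hA gB E) -(tA_tA_trace AA).
by eq_sum a; eq_sum b; rewrite !(tor_tA gB B6 E).
Qed.

(** The trace 6 of the projection minus one for its idempotence: the Einstein constant of the unit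
    six-sphere. *)
Lemma ricci_hp y m k : U y -> ricci e y m k = 5 * hp y m k.
move=> Uy; rewrite /ricci.
transitivity (\sum_p (hp y m k * hp y p p - hp y m p * hp y p k)).
 eq_sum p; rewrite -curvk_eq -LCk_eq (curv_LC pf _ _ _ _ Uy).
 exact: eq_subM.
rewrite sumrB -mulr_sumr (hp_trace Uy) (hp_idem m k Uy) -[X in _ - X]mul1r [X in X - _]mulrC -mulrBl.
by congr (_ * _); ring.
Qed.

Lemma curv_tor_conn (w : coefs R n) z m p a b : tor_conn 1 w -> U z -> curv e w z m p a b = cvf 1 z m p a b.
move=> wE Uz; rewrite -curvk_eq (curv_wconn pf _ _ _ _ Uz _ wE)//.
by rewrite expr1n.
Qed.

Lemma cvf_anti y : U y -> (forall m p a b, cvf 1 y p m a b = - cvf 1 y m p a b) /\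
 (forall m p a b, cvf 1 y m p b a = - cvf 1 y m p a b) /\ (forall m p a b, cvf 1 y a b m p = cvf 1 y m p a b).
move=> Uy; have [B [A [gB B6 E AA]]] := adapted_basis pf Uy.
have C m p a b : cvf 1 y m p a b = cvA A 1%:~R m p a b.
 exact: (cvf_cvA 1 Uy gB B6 E).
split=> [m p a b|]; first by rewrite (C p m a b) (C m p a b) (cvA_anti12 AA).
split=> m p a b; first by rewrite (C m p b a) (C m p a b) (cvA_anti34 AA).
by rewrite (C a b m p) (C m p a b) (cvA_pair AA).
Qed.

Lemma curv_pair (w : coefs R n) y m p a b : tor_conn 1 w -> U y -> curv e w y a b m p = curv e w y m p a b.
by move=> wE Uy; have [_ [_ H]] := cvf_anti Uy; rewrite !curv_tor_conn.
Qed.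

(** The contraction over all pairs is 12 times the projection; restricting to a < b halves it. *)
Lemma tr_curv_hp (w : coefs R n) y m k : tor_conn 1 w -> U y -> \sum_p tr_curv e w y m p k p = 6 * hp y m k.
move=> wE Uy; have [_ [an34 _]] := cvf_anti Uy.
have [B [A [gB B6 E AA]]] := adapted_basis pf Uy.
have C m' p a b : cvf 1 y m' p a b = cvA A 1%:~R m' p a b.
 exact: (cvf_cvA 1 Uy gB B6 E).
apply: (@mulfI _ (2 : R))=> //; rewrite mulr_sumr mulrA -natrM (hp_hA gB E).
rewrite -(cvA_trace AA); eq_sum p.
transitivity (\sum_a \sum_b cvf 1 y m p a b * cvf 1 y k p a b).
 rewrite -sum_lt_sym /tr_curv; first last.
 - move=> a; have -> : cvf 1 y m p a a = 0 by have := an34 m p a a; lra.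
  exact: mul0r.
 - by move=> a b; rewrite (an34 m) (an34 k) mulrNN.
 mul_sum a; rewrite mulr_sumr.
 by eq_sum b; rewrite !curv_tor_conn.
by eq_sum a; eq_sum b; rewrite !C.
Qed.

Section Dilaton.
Variables (phi : 'rV[R]_n -> R) (s0 : 'I_r) (kap : R).
Hypothesis sphi : smooth_on U phi.
Hypothesis dphi : forall z i, U z -> pd e i phi z = kap * t s0 i z.

(** d phi is a constant multiple of the parallel form t. *)
Lemma hess_dilaton y m k : U y -> hess e phi y m k = 0.
move=> Uy; rewrite /hess /cov big_ord1 -LCk_eq.
rewrite (@pd_eqon _ _ _ e oU _ (fun z=> kap * t s0 k z) m y)=> [|z Uz|//]; last exact: dphi.
rewrite pdZ; last exact: (dt pf).
rewrite (pd_t pf)// mulr_sumr -sumrB big1// => l _.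
by rewrite /upd /= dphi// mulrCA subrr.
Qed.

Lemma t_tor y i j : U y -> \sum_m t s0 m y * tor y m i j = 0.
move=> Uy.
transitivity (ps4 (q^~ y) (comb (fun m=> t s0 m y) (av y)) (av y i) (av y j)).
 by rewrite ps4_comb2.
rewrite (_ : comb _ _ = fun=> 0); last first.
 by ext k; rewrite /comb; exact: (tv_av pf).
by rewrite ps4_12 /ps4 /lc4 /lc big1 ?oppr0// => k _; rewrite mul0r.
Qed.

Lemma t_hp y i : U y -> \sum_m t s0 m y * hp y m i = 0.
move=> Uy.
transitivity (lc (comb (fun m=> t s0 m y) (av y)) (av y i)).
 by rewrite lc_combl.
rewrite (_ : comb _ _ = fun=> 0); last first.
 by ext k; rewrite /comb; exact: (tv_av pf).
by rewrite /lc big1// => k _; rewrite mul0r.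
Qed.

Lemma t_psa y i j k : U y -> \sum_m t s0 m y * psa y m i j k = 0.
move=> Uy.
transitivity (ps4 (comb (fun m=> t s0 m y) (av y)) (av y i) (av y j) (av y k)).
 by rewrite ps4_comb1.
rewrite (_ : comb _ _ = fun=> 0); last first.
 by ext l; rewrite /comb; exact: (tv_av pf).
by rewrite /ps4 /lc4 /lc big1// => l _; rewrite mul0r.
Qed.
Lemma psa_trace y i j : \sum_m psa y m m i j = 0.
by apply: big1=> m _; rewrite /psa ps4_alt12. Qed.

Lemma t_cvf y p a b : U y -> \sum_m t s0 m y * cvf 1 y m p a b = 0.
move=> Uy.
exact: (@t_cvf_pure _ _ (fun m=> t s0 m y) (hp y) (tor y) (psa y) p a b
 (tor_rot y) (fun i=> t_hp i Uy) (fun i j=> t_tor i j Uy) (fun i j k=> t_psa i j k Uy)).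
Qed.

Let ex (z : 'rV[R]_n) := expR (- 2 * phi z).

Lemma pd_ex y m : U y -> differentiable ex y /\ pd e m ex y = - 2 * kap * t s0 m y * ex y.
move=> Uy; have dp : differentiable phi y by exact: smooth_diff sphi Uy.
have d2 : differentiable (fun z=> - 2 * phi z) y.
 exact: (differentiableM (differentiable_cst (- 2 : R) _) dp).
have D := @is_derive_comp1 R n _ expR y (e m y) _ _ d2 (is_derive_expR _) (pdZ e (- 2) m dp).
have [d dE] := D; split; first exact: d.
rewrite /pd dE dphi// /ex; ring.
Qed.

Variables (T : lform R n 3) (w : coefs R n).
Hypotheses (TE : tor_form T) (wE : tor_conn 1 w).

Lemma eom_flux y p k : U y -> \sum_m cov e (LC e) (fun z I=> expR (- 2 * phi z) * T z I) y m (tup3 m p k) = 0.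
move=> Uy.
rewrite (eq_bigr (fun m=> ex y * psa y m m p k - 2 * kap * ex y * (t s0 m y * tor y m p k))).
 by rewrite sumrB -!mulr_sumr psa_trace t_tor// !mulr0 subrr.
move=> m _; rewrite cov3E -LCk_eq.
rewrite (@pd_eqon _ _ _ e oU _ (fun z=> ex z * tor z m p k) m y)=> [|z Uz|//]; last by rewrite TE.
have [dx dxE] := pd_ex m Uy.
rewrite pdM//; last exact: (dtor pf).
rewrite dxE (pd_tor pf _ _ _ _ Uy).
have -> : \sum_l (LCk e y m m l * (expR (-2 * phi y) * T y (tup3 l p k)) +
  LCk e y m p l * (expR (-2 * phi y) * T y (tup3 m l k)) + LCk e y m k l * (expR (-2 * phi y) * T y (tup3 m p l))) =
 ex y * \sum_l (LCk e y m m l * tor y l p k + LCk e y m p l * tor y m l k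
  + LCk e y m k l * tor y m p l).
 mul_sum l.
 rewrite (TE l p k Uy) (TE m l k Uy) (TE m p l Uy); exact: mulr_sum3.
exact: flux_algebra.
Qed.

(** The curvature is parallel for w on all four indices, but [covF] uses Levi-Civita on the form
    indices. The difference is a torsion term, which [gauge_pure] cancels against the flux term; the
    derivative of the exponential is killed by [t_cvf]. *)
Lemma eom_gauge y k a b : U y -> \sum_m covF e w
  (fun z i j c d=> expR (- 2 * phi z) * curv e w z i j c d) y m m k a b
 + 2^-1 * expR (- 2 * phi y) *
  (\sum_i \sum_j T y (tup3 k i j) * curv e w y i j a b) = 0.
move=> Uy.
have [dP P'] := par4_cvf wE 1 Uy.
have C i j c d z : U z -> curv e w z i j c d = cvf 1 z i j c d.
 by move=> Uz; exact: curv_tor_conn.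
have F m : covF e w (fun z i j c d=> expR (- 2 * phi z) * curv e w z i j c d) y m m k a b =
  - 2 * kap * ex y * (t s0 m y * cvf 1 y m k a b) +
  ex y * \sum_l (2^-1 * tor y m m l * cvf 1 y l k a b + 2^-1 * tor y m k l * cvf 1 y m l a b).
 have [dx dxE] := pd_ex m Uy.
 rewrite /covF -LCk_eq.
 rewrite (@pd_eqon _ _ _ e oU _ (fun z=> ex z * cvf 1 z m k a b) m y)=> [|z Uz|//]; last by rewrite C.
 rewrite pdM// dxE P'.
 have -> : \sum_l (LCk e y m m l * (expR (-2 * phi y) * curv e w y l k a b) +
   LCk e y m k l * (expR (-2 * phi y) * curv e w y m l a b)) =
   \sum_l ((w y m m l - 2^-1 * tor y m m l) * (ex y * cvf 1 y l k a b) +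
   (w y m k l - 2^-1 * tor y m k l) * (ex y * cvf 1 y m l a b)).
  have L c d : LCk e y m c d = w y m c d - 2^-1 * tor y m c d.
   by rewrite (wE m c d Uy) mul1r addrK.
  eq_sum l; rewrite (C _ _ _ _ _ Uy) (C _ _ _ _ _ Uy).
  by rewrite (L m l) (L k l).
 have -> : \sum_c (w y m a c * (expR (-2 * phi y) * curv e w y m k c b) +
   w y m b c * (expR (-2 * phi y) * curv e w y m k a c)) =
   \sum_c (w y m a c * (ex y * cvf 1 y m k c b) + w y m b c * (ex y * cvf 1 y m k a c)).
  by eq_sum c; rewrite (C _ _ _ _ _ Uy) (C _ _ _ _ _ Uy).
 exact: gauge_algebra.
rewrite (eq_bigr _ (fun m _=> F m)).
have -> : \sum_i \sum_j T y (tup3 k i j) * curv e w y i j a b = \sum_i \sum_j tor y k i j * cvf 1 y i j a b.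
 eq_sum i; eq_sum j.
 by rewrite (TE k i j Uy) (C _ _ _ _ _ Uy).
exact: (@gauge_pure _ _ (fun m=> t s0 m y) (tor y) (fun i j=> cvf 1 y i j a b)
 k _ _ (tor12 e q y) (t_cvf k a b Uy)).
Qed.

(** On the sphere directions the Einstein equation reads 5 - 1 - 4 = 0 and the dilaton equation 30 -
    4 * 4 - 24 / 12 - 36 / 3 = 0; the latter is where the squared slope 4 of the dilaton enters. *)
Lemma eom_tor y : kap ^+ 2 = 4 -> U y -> eom_at e T phi w (- 3^-1) y.
move=> kap2 Uy.
have TT m k : \sum_a \sum_b T y (idx3 m a b) * T y (idx3 k a b) = 4 * hp y m k.
 rewrite -(tor_tor_trace m k Uy); eq_sum a; eq_sum b.
 by congr (_ * _); exact: TE.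
split.
- move=> m k; rewrite TT (ricci_hp m k Uy) (hess_dilaton m k Uy) (tr_curv_hp m k wE Uy).
 by rewrite mulr0 addr0; field.
- by move=> p k; exact: eom_flux.
- by move=> k a b; exact: eom_gauge.
have -> : scal e y = 30.
 rewrite /scal (eq_bigr (fun m=> 5 * hp y m m))=> [|m _]; last exact: ricci_hp.
 by rewrite -mulr_sumr hp_trace// -natrM.
have -> : \sum_m hess e phi y m m = 0.
 by rewrite big1// => m _; exact: hess_dilaton.
have -> : \sum_m pd e m phi y ^+ 2 = 4.
 rewrite (eq_bigr (fun m=> 4 * (t s0 m y * t s0 m y)))=> [|m _].
  by rewrite -mulr_sumr (tv_tv pf)// eqxx mulr1.
 by rewrite dphi// exprMn kap2 expr2.
have -> : \sum_m \sum_a \sum_b T y (idx3 m a b) ^+ 2 = 24.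
 rewrite (eq_bigr (fun m=> 4 * hp y m m))=> [|m _].
  by rewrite -mulr_sumr hp_trace// -natrM.
 by rewrite -TT; eq_sum a; eq_sum b; rewrite expr2.
have -> : \sum_m \sum_p tr_curv e w y m p m p = 36.
 rewrite (eq_bigr (fun m=> 6 * hp y m m))=> [|m _]; last exact: tr_curv_hp.
 by rewrite -mulr_sumr hp_trace// -natrM.
by field.
Qed.

End Dilaton.

End FieldEquations.

(** * Action of skew matrices on forms and the Lie algebra g2 *)

Definition so2 R n (C f : Bil n R) i j : R :=
 \sum_l (C i l * f l j + C j l * f i l).

Definition so3 R n (C : Bil n R) (f : Tri n R) i j k : R :=
 \sum_l (C i l * f l j k + C j l * f i l k + C k l * f i j l).

Definition so4 R n (C : Bil n R) (f : Quad n R) i j k l : R :=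
 \sum_x (C i x * f x j k l + C j x * f i x k l + C k x * f i j x l
     + C l x * f i j k x).

Section DerivationAction.
Variables (R : realType) (n : nat).
Implicit Types (A C : Bil n R).

Lemma so2E (A : 'M[R]_n) a i j : so_act A a (tup2 i j) = so2 A (fun x y=> a (tup2 x y)) i j.
rewrite /so_act 2!big_ord_recl big_ord0 addr0 -big_split.
eq_sum l=> /=.
by congr (_ * a _ + _ * a _); rewrite [LHS]tup2_eta.
Qed.

Lemma so3E (A : 'M[R]_n) a i j k : so_act A a (tup3 i j k) = so3 A (fun x y z=> a (tup3 x y z)) i j k.
rewrite /so_act 3!big_ord_recl big_ord0 addr0 addrA -!big_split.
eq_sum l=> /=; have [<- <- <-] := upd_tup3 i j k l.
by congr (_ + _ + _); congr (_ * a (upd _ _ _)); exact: val_inj.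
Qed.

Lemma so4E (A : 'M[R]_n) a i j k l : so_act A a (idx4 i j k l) = so4 A (fun x y z w=> a (idx4 x y z w)) i j k l.
rewrite /so_act 4!big_ord_recl big_ord0 addr0 !addrA -!big_split.
eq_sum x=> /=; have [<- <- <- <-] := upd_idx4 i j k l x.
by congr (_ + _ + _ + _); congr (_ * a (upd _ _ _)); exact: val_inj.
Qed.
Lemma eq_so3 A f g : (forall i j k, f i j k = g i j k) -> forall i j k, so3 A f i j k = so3 A g i j k.
by move=> E i j k; eq_sum l; rewrite !E. Qed.
Lemma eq_so4 A f g : (forall i j k l, f i j k l = g i j k l) -> forall i j k l, so4 A f i j k l = so4 A g i j k l.
by move=> E i j k l; eq_sum x; rewrite !E. Qed.

Lemma so3_12 A f : (forall i j k, f j i k = - f i j k) -> forall i j k, so3 A f j i k = - so3 A f i j k.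
move=> F i j k; rewrite -sumrN; eq_sum x.
by rewrite (F i x) (F x j) (F i j); ring.
Qed.

Lemma so3_23 A f : (forall i j k, f i k j = - f i j k) -> forall i j k, so3 A f i k j = - so3 A f i j k.
move=> F i j k; rewrite -sumrN; eq_sum x.
by rewrite (F x j k) (F i x k) (F i j x); ring.
Qed.

Lemma so4_12 A f : (forall i j k l, f j i k l = - f i j k l) -> forall i j k l, so4 A f j i k l = - so4 A f i j k l.
move=> F i j k l; rewrite -sumrN; eq_sum x.
by rewrite (F i x) (F x j) (F i j) (F i j); ring.
Qed.

Lemma so4_23 A f : (forall i j k l, f i k j l = - f i j k l) -> forall i j k l, so4 A f i k j l = - so4 A f i j k l.
move=> F i j k l; rewrite -sumrN; eq_sum x.
by rewrite (F x j k) (F i x k) (F i j x) (F i j k); ring.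
Qed.

Lemma so4_34 A f : (forall i j k l, f i j l k = - f i j k l) -> forall i j k l, so4 A f i j l k = - so4 A f i j k l.
move=> F i j k l; rewrite -sumrN; eq_sum x.
by rewrite (F x j k l) (F i x k l) (F i j x l) (F i j k x); ring.
Qed.

(** Writes a skew matrix as a sum of elementary rotations, so that its action can be compared with
    an integer table for each pair (a, b). Each rotation is counted twice, whence the factor 2. *)
Lemma skew_pair A (F : 'I_n -> R) i : (forall a b, A b a = - A a b) ->
 \sum_a \sum_b A a b * ((a == i)%:R * F b - (b == i)%:R * F a) = 2 * \sum_l A i l * F l.
move=> anti; under eq_bigr do under eq_bigr do rewrite mulrBr.
under eq_bigr do rewrite sumrB.
rewrite sumrB [X in _ - X]exchange_big /=.
have E a : \sum_b A a b * ((a == i)%:R * F b) = (a == i)%:R * \sum_b A a b * F b.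
 by mul_sum b; rewrite mulrCA.
have E' b : \sum_a A a b * ((b == i)%:R * F a) = - ((b == i)%:R * \sum_a A b a * F a).
 by rewrite mulr_sumr -sumrN; eq_sum a; rewrite (anti b a); ring.
under eq_bigr do rewrite E. under [X in _ - X]eq_bigr do rewrite E'.
have D (G : 'I_n -> R) : \sum_a (a == i)%:R * G a = G i by exact: lc_deltal.
rewrite sumrN opprK !D; ring.
Qed.

Lemma so4_wedge C u o p i j k l : so4 C (fun i j k l=> u i * o j k l - u j * o i k l + u k * o i j l
  - u l * o i j k + p i j k l) i j k l =
 (u i * so3 C o j k l - u j * so3 C o i k l + u k * so3 C o i j l
   - u l * so3 C o i j k)
 + (lc (C i) u * o j k l - lc (C j) u * o i k l + lc (C k) u * o i j l
   - lc (C l) u * o i j k) + so4 C p i j k l.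
rewrite /so4 /so3 /lc !mulr_sumr !mulr_suml -!sumrN -!big_split.
by eq_sum x=> /=; ring.
Qed.

End DerivationAction.

Section G2Algebra.
Variable R : realType.
Implicit Types (A K : Bil 7 R).

(* The component of a two-form in the 7-dimensional summand of so(7) *)
Definition Qv A (x : 'I_7) : R := \sum_a \sum_b A a b * omr R a b x.

Definition dz (i j : nat) : int := if i == j then 1 else 0.

Lemma dzE (i j : 'I_7) : (dz i j)%:~R = (i == j)%:R :> R.
by rewrite /dz natb_intr. Qed.

(** The elementary rotation in the plane (a, b) acting on omega; [sps] is the same for *omega. *)
Definition som (a b i j k : nat) : int :=
 (dz a i * om b j k - dz b i * om a j k) + (dz a j * om i b k - dz b j * om i a k)
 + (dz a k * om i j b - dz b k * om i j a).

Definition sps (a b i j k l : nat) : int :=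
 (dz a i * ps b j k l - dz b i * ps a j k l) + (dz a j * ps i b k l - dz b j * ps i a k l)
 + (dz a k * ps i j b l - dz b k * ps i j a l) + (dz a l * ps i j k b - dz b l * ps i j k a).

Lemma om_ps_check : alln 7 (fun a=> alln 7 (fun b=> alln 7 (fun i=> alln 7 (fun j=> alln 7 (fun k =>
  isum 7 (fun x=> om a b x * ps x i j k) == som a b i j k))))).
by vm_compute. Qed.

Lemma sps_check : alln 7 (fun a=> alln 7 (fun b=> alln 7 (fun i =>
 alln 7 (fun j=> alln 7 (fun k=> alln 7 (fun l=> sps a b i j k l == - (om a b i * om j k l - om a b j * om i k l
   + om a b k * om i j l - om a b l * om i j k))))))).
by vm_compute. Qed.

Lemma ps_ps_check : alln 7 (fun x=> alln 7 (fun y =>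
 isum 7 (fun i=> isum 7 (fun j=> isum 7 (fun k=> ps x i j k * ps y i j k))) == 24 * dz x y)).
by vm_compute. Qed.

Lemma ps_om_check : alln 7 (fun x=> alln 7 (fun y=> alln 7 (fun k =>
 isum 7 (fun i=> isum 7 (fun j=> ps x y i j * om i j k)) == 4 * om x y k))).
by vm_compute. Qed.

(** so(7) is g2 plus a copy of R^7, and only the latter moves omega: the vector [Qv A] acts by
    contraction with *omega, up to the factor 1/2. *)
Lemma so3_om A i j k : (forall a b, A b a = - A a b) -> so3 A (omr R) i j k = 2^-1 * \sum_x Qv A x * psr R x i j k.
move=> anti; apply: (@mulfI _ (2 : R))=> //; rewrite mulrA mulfV// mul1r.
transitivity (\sum_a \sum_b A a b * (som a b i j k)%:~R).
 rewrite /so3 !big_split /= !mulrDr.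
 rewrite -(skew_pair (fun l=> omr R l j k) i anti).
 rewrite -(skew_pair (fun l=> omr R i l k) j anti).
 rewrite -(skew_pair (fun l=> omr R i j l) k anti).
 rewrite -!big_split; eq_sum a=> /=.
 rewrite -!big_split; eq_sum b=> /=.
 by rewrite -!dzE /omr /som !(intrD, mulrNz, intrM); ring.
rewrite /Qv; under [RHS]eq_bigr do rewrite mulr_suml.
rewrite [RHS]exchange_big; eq_sum a=> /=.
under [RHS]eq_bigr do rewrite mulr_suml.
rewrite [RHS]exchange_big; eq_sum b=> /=.
have /eqP <- := allnP (allnP (allnP (allnP (allnP om_ps_check a) b) i) j) k.
rewrite isumE rmorph_sum mulr_sumr; eq_sum x.
by rewrite /omr /psr rmorphM /= mulrA.
Qed.

(** The variation of *omega is the wedge of [Qv A] with omega, so an element that fixes omega fixes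
    *omega too. *)
Lemma so4_ps A i j k l : (forall a b, A b a = - A a b) ->
 so4 A (psr R) i j k l = - 2^-1 * (Qv A i * omr R j k l - Qv A j * omr R i k l
   + Qv A k * omr R i j l - Qv A l * omr R i j k).
move=> anti; apply: (@mulfI _ (2 : R))=> //; rewrite mulrA mulrN mulfV// mulN1r.
transitivity (\sum_a \sum_b A a b * (sps a b i j k l)%:~R).
 rewrite /so4 !big_split /= !mulrDr.
 rewrite -(skew_pair (fun x=> psr R x j k l) i anti).
 rewrite -(skew_pair (fun x=> psr R i x k l) j anti).
 rewrite -(skew_pair (fun x=> psr R i j x l) k anti).
 rewrite -(skew_pair (fun x=> psr R i j k x) l anti).
 rewrite -!big_split; eq_sum a=> /=.
 rewrite -!big_split; eq_sum b=> /=.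
 by rewrite -!dzE /psr /sps !(intrD, mulrNz, intrM); ring.
rewrite /Qv !mulr_suml -!sumrB -big_split -sumrB -sumrN; eq_sum a=> /=.
rewrite !mulr_suml -!sumrB -big_split -sumrB -sumrN; eq_sum b=> /=.
have /eqP -> := allnP (allnP (allnP (allnP (allnP (allnP sps_check a) b) i) j) k) l.
by rewrite /omr !(intrD, mulrNz, intrM); ring.
Qed.

(** Contracting *omega with itself over three indices gives 24 times the identity. This recovers a
    vector from its contraction with *omega, hence shows that the action on omega detects [Qv]. *)
Lemma contract_ps (Q : 'I_7 -> R) x :
 \sum_i \sum_j \sum_k psr R x i j k * (2^-1 * \sum_y Q y * psr R y i j k) = 12 * Q x.
transitivity (\sum_y \sum_i \sum_j \sum_k 2^-1 * (Q y * (psr R x i j k * psr R y i j k))).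
 rewrite [RHS]exchange_big; eq_sum i=> /=.
 rewrite [RHS]exchange_big; eq_sum j=> /=.
 rewrite [RHS]exchange_big; eq_sum k=> /=.
 by rewrite !mulr_sumr; eq_sum y; ring.
rewrite -[X in _ = _ * X](lc_delta Q x) mulr_sumr; eq_sum y.
have /eqP E := allnP (allnP ps_ps_check x) y.
transitivity (2^-1 * (Q y * (24 * dz x y)%:~R)).
 rewrite -E isumE rmorph_sum !mulr_sumr; eq_sum i.
 rewrite isumE rmorph_sum !mulr_sumr; eq_sum j.
 rewrite isumE rmorph_sum !mulr_sumr; eq_sum k.
 by rewrite /psr rmorphM.
by rewrite intrM dzE eq_sym; field.
Qed.

Lemma so3_om0P A : (forall a b, A b a = - A a b) ->
 (forall i j k, so3 A (omr R) i j k = 0) <-> (forall x, Qv A x = 0).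
move=> anti; split=> [H x|H i j k]; last first.
 by rewrite so3_om// big1 ?mulr0// => x _; rewrite H mul0r.
have : \sum_i \sum_j \sum_k psr R x i j k * so3 A (omr R) i j k = 0.
 by rewrite big1// => i _; rewrite big1// => j _; rewrite big1// => k _; rewrite H mulr0.
rewrite (_ : (\sum_i _) = 12 * Qv A x).
 by move=> /eqP; rewrite mulf_eq0 pnatr_eq0 /= => /eqP.
rewrite -(contract_ps (Qv A) x).
eq_sum i; eq_sum j; eq_sum k.
by rewrite so3_om.
Qed.

(* For q = 0 this is the projection of x /\ y on g2. *)
Definition Kg2 (u a : 'I_7 -> R) i j : R :=
 2^-1 * lc2 u a (fun x y=> psr R x y i j) - u i * a j + a i * u j.

Lemma Kg2_anti u a i j : Kg2 u a j i = - Kg2 u a i j.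
rewrite /Kg2.
have -> : lc2 u a (fun x y=> psr R x y j i) = - lc2 u a (fun x y=> psr R x y i j).
 by rewrite -lc2N; apply: eq_lc2=> x y; rewrite psr34.
ring.
Qed.

(** The contraction of *omega with omega contributes 1/2 times 4, which cancels the two terms from
    the wedge of u and a. *)
Lemma Qv_Kg2 u a x : Qv (Kg2 u a) x = 0.
have E : \sum_i \sum_j lc2 u a (fun y z=> psr R y z i j) * omr R i j x = 4 * lc2 u a (fun y z=> omr R y z x).
 rewrite -lc2Z.
 transitivity (\sum_i \sum_j lc2 u a (fun y z=> psr R y z i j * omr R i j x)).
  eq_sum i; eq_sum j; rewrite /lc2 -lcZr.
  by apply: eq_lc=> y; rewrite -lcZr.
 under eq_bigr do rewrite lc2_sum.
 rewrite lc2_sum; apply: eq_lc2=> y z.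
 have /eqP E := allnP (allnP (allnP ps_om_check y) z) x.
 transitivity ((4 * om y z x)%:~R : R); last by rewrite intrM.
 rewrite -E; cast_sum i.
 cast_sum j.
 by rewrite /psr /omr rmorphM.
have L (v w : 'I_7 -> R) : \sum_i \sum_j v i * w j * omr R i j x = lc2 v w (fun y z=> omr R y z x).
 eq_sum i; rewrite /lc mulr_sumr.
 by eq_sum j; rewrite mulrA.
have C : lc2 a u (fun y z=> omr R y z x) = - lc2 u a (fun y z=> omr R y z x).
 by rewrite lc2C -lc2N; apply: eq_lc2=> y z; rewrite omr12.
transitivity (2^-1 * (\sum_i \sum_j lc2 u a (fun y z=> psr R y z i j) * omr R i j x)
  - (\sum_i \sum_j u i * a j * omr R i j x) + \sum_i \sum_j a i * u j * omr R i j x).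
 rewrite mulr_sumr -sumrB -big_split; eq_sum i=> /=.
 rewrite mulr_sumr -sumrB -big_split; eq_sum j=> /=.
 by rewrite /Kg2; ring.
by rewrite E !L C; field.
Qed.

Section Derivation.
Variable K : 'I_7 -> 'I_7 -> R.
Hypothesis anti : forall a b, K b a = - K a b.
Hypothesis QK : forall x, Qv K x = 0.

Lemma der_om3 u v w : om3 (comb u K) v w + om3 u (comb v K) w + om3 u v (comb w K) = 0.
have D : forall i j k, so3 K (omr R) i j k = 0 by apply/so3_om0P.
have Z : lc3 u v w (so3 K (omr R)) = 0.
 transitivity (lc3 u v w (fun _ _ _=> 0)); first exact: eq_lc3.
 rewrite /lc3 /lc2 -[RHS](lc0 u); apply: eq_lc=> i.
 by rewrite -[RHS](lc0 v); apply: eq_lc=> j; exact: lc0.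
have E1 x y : om3 (comb u K) x y = lc3 u x y (fun i j k=> \sum_l K i l * omr R l j k).
 rewrite om3_comb1; apply: eq_lc=> i; rewrite /om3 /lc3 lcC; apply: eq_lc=> j.
 by rewrite lcC.
rewrite E1.
have -> : om3 u (comb v K) w = lc3 u v w (fun i j k=> \sum_l K j l * omr R i l k).
 rewrite om3_comb2 /lc3 /lc2 lcC; apply: eq_lc=> i; apply: eq_lc=> j.
 by rewrite lcC.
have -> : om3 u v (comb w K) = lc3 u v w (fun i j k=> \sum_l K k l * omr R i j l).
 rewrite om3_comb3 /om3 /lc3 /lc2 lcC; apply: eq_lc=> i; rewrite lcC.
 by apply: eq_lc=> j.
transitivity (lc3 u v w (so3 K (omr R))); last by [].
by rewrite -!lc3D; apply: eq_lc3=> i j k; rewrite /so3 !big_split.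
Qed.

Lemma der_ps4 u v w x : ps4 (comb u K) v w x + ps4 u (comb v K) w x
 + ps4 u v (comb w K) x + ps4 u v w (comb x K) = 0.
have D i j k l : so4 K (psr R) i j k l = 0 by rewrite so4_ps// !QK !mul0r; ring.
have Z : lc4 u v w x (so4 K (psr R)) = 0.
 transitivity (lc4 u v w x (fun _ _ _ _=> 0)); first exact: eq_lc4.
 rewrite /lc4 /lc3 /lc2 -[RHS](lc0 u); apply: eq_lc=> i.
 rewrite -[RHS](lc0 v); apply: eq_lc=> j.
 by rewrite -[RHS](lc0 w); apply: eq_lc=> k; exact: lc0.
have -> : ps4 (comb u K) v w x = lc4 u v w x (fun i j k l=> \sum_y K i y * psr R y j k l).
 rewrite ps4_comb1; apply: eq_lc=> i; rewrite /ps4 /lc4 /lc3 /lc2 lcC.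
 by apply: eq_lc=> j; rewrite lcC; apply: eq_lc=> k; rewrite lcC.
have -> : ps4 u (comb v K) w x = lc4 u v w x (fun i j k l=> \sum_y K j y * psr R i y k l).
 rewrite ps4_comb2 /lc4 /lc3 lcC; apply: eq_lc=> i; apply: eq_lc=> j.
 by rewrite /lc3 lcC; apply: eq_lc=> k; rewrite /lc2 lcC.
have -> : ps4 u v (comb w K) x = lc4 u v w x (fun i j k l=> \sum_y K k y * psr R i j y l).
 rewrite ps4_comb3 /ps4 /lc4 /lc3 /lc2 lcC; apply: eq_lc=> i; rewrite lcC.
 by apply: eq_lc=> j; apply: eq_lc=> k; rewrite lcC.
have -> : ps4 u v w (comb x K) = lc4 u v w x (fun i j k l=> \sum_y K l y * psr R i j k y).
 rewrite ps4_comb4 /ps4 /lc4 /lc3 /lc2 lcC; apply: eq_lc=> i; rewrite lcC.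
 by apply: eq_lc=> j; rewrite lcC; apply: eq_lc=> k.
transitivity (lc4 u v w x (so4 K (psr R))); last by [].
by rewrite -!lc4D; apply: eq_lc4=> i j k l; rewrite /so4 !big_split.
Qed.

Variables (n : nat) (b : 'I_n -> 'I_7 -> R) (C : Bil n R).
Hypothesis CK : forall i k, comb (C i) b k = comb (b i) K k.

(** If the frame matrix C corresponds under b to a derivation K of the octonions, then C annihilates
    the forms pulled back by b, because K annihilates the forms themselves. *)
Lemma so3_frame i j k : so3 C (fun i j k=> om3 (b i) (b j) (b k)) i j k = 0.
have E x : comb (b x) K = comb (C x) b by ext y; rewrite CK.
rewrite /so3 !big_split -[RHS](der_om3 (b i) (b j) (b k)) !E.
by rewrite om3_comb1 om3_comb2 om3_comb3.
Qed.

Lemma so4_frame i j k l : so4 C (fun i j k l=> ps4 (b i) (b j) (b k) (b l)) i j k l = 0.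
have E x : comb (b x) K = comb (C x) b by ext y; rewrite CK.
rewrite /so4 !big_split -[RHS](der_ps4 (b i) (b j) (b k) (b l)) !E.
by rewrite ps4_comb1 ps4_comb2 ps4_comb3 ps4_comb4.
Qed.

Definition Phi_form (u : 'I_n -> R) i j k l : R :=
 u i * om3 (b j) (b k) (b l) - u j * om3 (b i) (b k) (b l)
 + u k * om3 (b i) (b j) (b l) - u l * om3 (b i) (b j) (b k)
 + ps4 (b i) (b j) (b k) (b l).

Lemma so4_Phi_form (u : 'I_n -> R) : (forall i, lc (C i) u = 0) -> forall i j k l, so4 C (Phi_form u) i j k l = 0.
move=> Cu i j k l.
rewrite /Phi_form so4_wedge so4_frame !(so3_frame, Cu).
by rewrite !mulr0 !mul0r !(subr0, addr0).
Qed.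

End Derivation.

End G2Algebra.

(** * Uniqueness of the torsion: a linear system on the Fano plane *)

Section Uniqueness.
Variable R : realType.

Lemma sum7 (F : 'I_7 -> R) : \sum_i F i = F (od 0) + F (od 1) + F (od 2) + F (od 3) + F (od 4) + F (od 5) + F (od 6).
by rewrite !big_ord_recl big_ord0; od_norm; ring. Qed.
Lemma omrE (a b x : nat) : (a < 7)%N -> (b < 7)%N -> (x < 7)%N -> omr R (od a) (od b) (od x) = (om a b x)%:~R.
by move=> a7 b7 x7; rewrite /omr /= !modn_small. Qed.

Ltac om_norm := repeat match goal with |- context [om ?a ?b ?x] =>
 let v := eval vm_compute in (om a b x) in change (om a b x) with v end.

(** One signed term for each of the three lines of the Fano plane through the point n. *)
Definition Qv_line (A : nat -> nat -> R) (n : nat) : R := nth 0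
 [:: A 1%N 6%N + A 2%N 4%N - A 3%N 5%N; - A 0%N 6%N - A 2%N 5%N - A 3%N 4%N; - A 0%N 4%N + A 1%N 5%N + A 3%N 6%N; A 0%N 5%N + A 1%N 4%N - A 2%N 6%N;
   A 0%N 2%N - A 1%N 3%N + A 5%N 6%N; - A 0%N 3%N - A 1%N 2%N - A 4%N 6%N; A 0%N 1%N + A 2%N 3%N + A 4%N 5%N] n.

Lemma Qv_lines (A : Bil 7 R) n : (forall a b, A b a = - A a b) -> (n < 7)%N ->
 Qv A (od n) = 2 * Qv_line (fun a b=> A (od a) (od b)) n.
move=> anti; have E a : A a a = 0 by have := anti a a; lra.
have Z0 : (0 : int)%:~R = 0 :> R by [].
have Z1 : (1 : int)%:~R = 1 :> R by [].
have N1 : (Negz 0)%:~R = -1 :> R by [].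
case: n=> [|[|[|[|[|[|[|//]]]]]]] _; rewrite /Qv /Qv_line /= !sum7 !omrE//; om_norm;
 rewrite !(Z0, Z1, N1) ?(mulr0, mulr1, mulrN1, add0r, addr0).
all: rewrite ?(anti (od 0) (od 1)) ?(anti (od 0) (od 2)) ?(anti (od 0) (od 3))
 ?(anti (od 0) (od 4)) ?(anti (od 0) (od 5)) ?(anti (od 0) (od 6))
 ?(anti (od 1) (od 2)) ?(anti (od 1) (od 3)) ?(anti (od 1) (od 4))
 ?(anti (od 1) (od 5)) ?(anti (od 1) (od 6)) ?(anti (od 2) (od 3))
 ?(anti (od 2) (od 4)) ?(anti (od 2) (od 5)) ?(anti (od 2) (od 6))
 ?(anti (od 3) (od 4)) ?(anti (od 3) (od 5)) ?(anti (od 3) (od 6))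
 ?(anti (od 4) (od 5)) ?(anti (od 4) (od 6)) ?(anti (od 5) (od 6)); ring.
Qed.

Lemma alternating_lt0 n (S : Tri n R) : (forall i j k, S j i k = - S i j k) -> (forall i j k, S i k j = - S i j k) ->
 (forall i j k : 'I_n, (i < j < k)%N -> S i j k = 0) -> forall i j k, S i j k = 0.
move=> S12 S23 Slt.
have S0 (i j k : 'I_n) : (i < j)%N -> S i j k = 0.
 move=> ij; case: (ltngtP j k)=> [jk|kj|/val_inj <-].
 - by rewrite Slt// ij.
 - case: (ltngtP i k)=> [ik|ki|/val_inj <-].
  + by rewrite S23 Slt ?oppr0// ik.
  + by rewrite S23 S12 Slt ?oppr0// ki.
  + by rewrite S23; have := S12 i i j; lra.
 - by have := S23 i j j; lra.
move=> i j k; case: (ltngtP i j)=> [|ji|/val_inj ->]; first exact: S0.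
 by rewrite S12 S0 ?oppr0.
by have := S12 j j k; lra.
Qed.

(* Solving the linear system that characterizes torsion tensors splits into
eight blocks of seven equations in seven unknowns. *)
Section Blocks.
Variables (S : Tri 7 R) (B : Bil 7 R).
Hypothesis S12 : forall i j k, S j i k = - S i j k.
Hypothesis S23 : forall i j k, S i k j = - S i j k.
Hypothesis B12 : forall i j, B j i = - B i j.
Hypothesis QB : forall x, Qv B x = 0.
Hypothesis QS : forall m x, Qv (S m) x = B m x.

Let S11 i k : S i i k = 0. Proof. by have := S12 i i k; lra. Qed.
Let S13 i k : S i k i = 0. Proof. by rewrite S23 S11 oppr0. Qed.
Let Scyc i j k : S i j k = S j k i. Proof. by rewrite (S23 j i k) (S12 i j k) opprK. Qed.
Let B11 i : B i i = 0. Proof. by have := B12 i i; lra. Qed.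
Let S0 (a b c : nat) := S (od a) (od b) (od c) = 0.
Let B0 (a b : nat) := B (od a) (od b) = 0.

Ltac pair_eqs a b := have := QS (od a) (od b); have := QS (od b) (od a); have := B12 (od a) (od b).
Ltac diag_eqs a := have := QS (od a) (od a).
Ltac triple_eqs a b c := have := S12 (od a) (od b) (od c); have := Scyc (od c) (od a) (od b).
Ltac block_solve := rewrite ?Qv_lines// /Qv_line /= ?S11 ?S13 ?B11; rewrite /S0 /B0; move=> *; do ?split; lra.

(** For a point k the block consists of the equation [QB] at k and of the six equations [QS] at (a,
    b) and (b, a) for the lines through k; its unknowns are the three values of B on these lines and
    four values of S. The next six blocks are the same at the other points. *)
Lemma block0 : [/\ B0 1 6, B0 2 4, B0 3 5 & [/\ S0 1 2 3, S0 1 4 5, S0 2 5 6 & S0 3 4 6]].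
have := QB (od 0); pair_eqs 1%N 6%N; pair_eqs 2%N 4%N; pair_eqs 3%N 5%N.
triple_eqs 1%N 2%N 3%N; triple_eqs 1%N 4%N 5%N; triple_eqs 2%N 5%N 6%N; triple_eqs 3%N 4%N 6%N; block_solve.
Qed.

Lemma block1 : [/\ B0 0 6, B0 2 5, B0 3 4 & [/\ S0 0 2 3, S0 0 4 5, S0 2 4 6 & S0 3 5 6]].
have := QB (od 1); pair_eqs 0%N 6%N; pair_eqs 2%N 5%N; pair_eqs 3%N 4%N.
triple_eqs 0%N 2%N 3%N; triple_eqs 0%N 4%N 5%N; triple_eqs 2%N 4%N 6%N; triple_eqs 3%N 5%N 6%N; block_solve.
Qed.

Lemma block2 : [/\ B0 0 4, B0 1 5, B0 3 6 & [/\ S0 0 1 3, S0 0 5 6, S0 1 4 6 & S0 3 4 5]].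
have := QB (od 2); pair_eqs 0%N 4%N; pair_eqs 1%N 5%N; pair_eqs 3%N 6%N.
triple_eqs 0%N 1%N 3%N; triple_eqs 0%N 5%N 6%N; triple_eqs 1%N 4%N 6%N; triple_eqs 3%N 4%N 5%N; block_solve.
Qed.

Lemma block3 : [/\ B0 0 5, B0 1 4, B0 2 6 & [/\ S0 0 1 2, S0 0 4 6, S0 1 5 6 & S0 2 4 5]].
have := QB (od 3); pair_eqs 0%N 5%N; pair_eqs 1%N 4%N; pair_eqs 2%N 6%N.
triple_eqs 0%N 1%N 2%N; triple_eqs 0%N 4%N 6%N; triple_eqs 1%N 5%N 6%N; triple_eqs 2%N 4%N 5%N; block_solve.
Qed.

Lemma block4 : [/\ B0 0 2, B0 1 3, B0 5 6 & [/\ S0 0 1 5, S0 0 3 6, S0 1 2 6 & S0 2 3 5]].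
have := QB (od 4); pair_eqs 0%N 2%N; pair_eqs 1%N 3%N; pair_eqs 5%N 6%N.
triple_eqs 0%N 1%N 5%N; triple_eqs 0%N 3%N 6%N; triple_eqs 1%N 2%N 6%N; triple_eqs 2%N 3%N 5%N; block_solve.
Qed.

Lemma block5 : [/\ B0 0 3, B0 1 2, B0 4 6 & [/\ S0 0 1 4, S0 0 2 6, S0 1 3 6 & S0 2 3 4]].
have := QB (od 5); pair_eqs 0%N 3%N; pair_eqs 1%N 2%N; pair_eqs 4%N 6%N.
triple_eqs 0%N 1%N 4%N; triple_eqs 0%N 2%N 6%N; triple_eqs 1%N 3%N 6%N; triple_eqs 2%N 3%N 4%N; block_solve.
Qed.

Lemma block6 : [/\ B0 0 1, B0 2 3, B0 4 5 & [/\ S0 0 2 5, S0 0 3 4, S0 1 2 4 & S0 1 3 5]].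
have := QB (od 6); pair_eqs 0%N 1%N; pair_eqs 2%N 3%N; pair_eqs 4%N 5%N.
triple_eqs 0%N 2%N 5%N; triple_eqs 0%N 3%N 4%N; triple_eqs 1%N 2%N 4%N; triple_eqs 1%N 3%N 5%N; block_solve.
Qed.

(** The remaining unknowns are the values of S on the seven lines themselves; they are governed by
    the diagonal equations, where B vanishes. *)
Lemma block7 : [/\ S0 0 1 6, S0 0 2 4, S0 0 3 5 & [/\ S0 1 2 5, S0 1 3 4, S0 2 3 6 & S0 4 5 6]].
diag_eqs 0%N; diag_eqs 1%N; diag_eqs 2%N; diag_eqs 3%N; diag_eqs 4%N; diag_eqs 5%N; diag_eqs 6%N.
triple_eqs 0%N 1%N 6%N; triple_eqs 0%N 2%N 4%N; triple_eqs 0%N 3%N 5%N; triple_eqs 1%N 2%N 5%N; triple_eqs 1%N 3%N 4%N; triple_eqs 2%N 3%N 6%N; triple_eqs 4%N 5%N 6%N; block_solve.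
Qed.

(** With B = 0 this is the statement for G_2; with B twice the component of S along e_0 it is the
    one for Spin(7). One elimination serves both. *)
Lemma alternating_unique : (forall i j k, S i j k = 0) /\ (forall i j, B i j = 0).
case: block0=> ? ? ? [? ? ? ?]; case: block1=> ? ? ? [? ? ? ?].
case: block2=> ? ? ? [? ? ? ?]; case: block3=> ? ? ? [? ? ? ?].
case: block4=> ? ? ? [? ? ? ?]; case: block5=> ? ? ? [? ? ? ?].
case: block6=> ? ? ? [? ? ? ?]; case: block7=> ? ? ? [? ? ? ?].
split.
 apply: alternating_lt0=> // i j k.
 rewrite -(valZpK i) -(valZpK j) -(valZpK k) /= !modn_small ?ltn_ord//.
 case: i j k=> [i i7] [j j7] [k k7] /=.
 do 7 (case: i i7=> [|i] i7 //; first by do 7 (case: j j7=> [|j] j7 //;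
  try by do 7 (case: k k7=> [|k] k7 //; try by []))).
suff Blt (i j : 'I_7) : (i < j)%N -> B i j = 0.
 move=> i j; case: (ltngtP i j)=> [|ji|/val_inj ->]; first exact: Blt.
  by rewrite B12 Blt ?oppr0.
 exact: B11.
rewrite -(valZpK i) -(valZpK j) /= !modn_small ?ltn_ord//.
case: i j=> [i i7] [j j7] /=.
by do 7 (case: i i7=> [|i] i7 //; first by do 7 (case: j j7=> [|j] j7 //; try by [])).
Qed.

End Blocks.

End Uniqueness.

(** * The Lie algebra of Spin(7) *)

Section Spin7Algebra.
Variable R : realType.
Implicit Type A : 'I_8 -> 'I_8 -> R.

Notation l0 := (lift (ord0 : 'I_8)).

Definition phr (a b c d : 'I_8) : R := (ph a b c d)%:~R.

Lemma phr0 (i j k : 'I_7) : phr ord0 (l0 i) (l0 j) (l0 k) = omr R i j k.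
by []. Qed.
Lemma phr1 (i j k l : 'I_7) : phr (l0 i) (l0 j) (l0 k) (l0 l) = psr R i j k l.
by []. Qed.

Lemma ph_anti : alln 8 (fun i=> alln 8 (fun j=> alln 8 (fun k =>
 alln 8 (fun l=> [&& ph j i k l == - ph i j k l, ph i k j l == - ph i j k l & ph i j l k == - ph i j k l])))).
by vm_compute. Qed.

Lemma phr12 i j k l : phr j i k l = - phr i j k l.
rewrite /phr.
have /and3P[/eqP -> _ _] := allnP (allnP (allnP (allnP ph_anti i) j) k) l.
by rewrite mulrNz.
Qed.

Lemma phr23 i j k l : phr i k j l = - phr i j k l.
rewrite /phr.
have /and3P[_ /eqP -> _] := allnP (allnP (allnP (allnP ph_anti i) j) k) l.
by rewrite mulrNz.
Qed.

Lemma phr34 i j k l : phr i j l k = - phr i j k l.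
rewrite /phr.
have /and3P[_ _ /eqP ->] := allnP (allnP (allnP (allnP ph_anti i) j) k) l.
by rewrite mulrNz.
Qed.

(* The component of a two-form in the 7-dimensional summand of so(8) *)
Definition Pv A (x : 'I_7) : R :=
 Qv (fun a b=> A (l0 a) (l0 b)) x + 2 * A ord0 (l0 x).

(** The rotation of e_0 into e_x contributes *omega in the same way as the [Qv] part does, so only
    their combination [Pv] is seen. *)
Lemma so4_phr0 A i j k : (forall a b, A b a = - A a b) ->
 so4 A phr ord0 (l0 i) (l0 j) (l0 k) = 2^-1 * \sum_x Pv A x * psr R x i j k.
move=> anti; have A0 a : A a a = 0 by have := anti a a; lra.
transitivity (\sum_x A ord0 (l0 x) * psr R x i j k + so3 (fun a b=> A (l0 a) (l0 b)) (omr R) i j k).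
 rewrite /so4 big_ord_recl /= A0 !mul0r -big_split /=.
 have -> : phr ord0 ord0 (l0 j) (l0 k) = 0 by [].
 have -> : phr ord0 (l0 i) ord0 (l0 k) = 0 by [].
 have -> : phr ord0 (l0 i) (l0 j) ord0 = 0 by [].
 rewrite !mulr0 !add0r; eq_sum x.
 by rewrite phr1 !phr0 !addrA.
rewrite so3_om=> [|a b]; last exact: anti.
rewrite [in RHS]mulr_sumr mulr_sumr -big_split; eq_sum x=> /=.
by rewrite /Pv; field.
Qed.

Lemma so4_phr1 A i j k l : (forall a b, A b a = - A a b) ->
 so4 A phr (l0 i) (l0 j) (l0 k) (l0 l) = - 2^-1 * (Pv A i * omr R j k l
  - Pv A j * omr R i k l + Pv A k * omr R i j l - Pv A l * omr R i j k).
move=> anti.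
transitivity (A (l0 i) ord0 * omr R j k l - A (l0 j) ord0 * omr R i k l
  + A (l0 k) ord0 * omr R i j l - A (l0 l) ord0 * omr R i j k +
  so4 (fun a b=> A (l0 a) (l0 b)) (psr R) i j k l).
 rewrite {1}/so4 big_ord_recl /=; congr (_ + _).
 rewrite (phr12 ord0) (phr23 (l0 i) ord0) (phr12 ord0).
 rewrite (phr34 (l0 i) (l0 j) ord0) (phr23 (l0 i) ord0) (phr12 ord0) !phr0; ring.
rewrite so4_ps=> [|a b]; last exact: anti.
by rewrite /Pv !(anti ord0); field.
Qed.

Lemma spin7P A : (forall a b, A b a = - A a b) -> (forall i j k l, so4 A phr i j k l = 0) <-> (forall x, Pv A x = 0).
move=> anti; split=> [H|H].
 move=> x.
 have : \sum_i \sum_j \sum_k psr R x i j k * so4 A phr ord0 (l0 i) (l0 j) (l0 k) = 0.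
  by rewrite big1// => i _; rewrite big1// => j _; rewrite big1// => k _; rewrite H mulr0.
 rewrite (_ : (\sum_i _) = 12 * Pv A x).
  by move=> /eqP; rewrite mulf_eq0 pnatr_eq0 /= => /eqP.
 rewrite -(contract_ps (Pv A) x).
 eq_sum i; eq_sum j; eq_sum k.
 by rewrite so4_phr0.
have a12 := so4_12 A phr12; have a23 := so4_23 A phr23; have a34 := so4_34 A phr34.
have Z1 i j k l : so4 A phr (l0 i) (l0 j) (l0 k) (l0 l) = 0.
 by rewrite so4_phr1// !H !mul0r; ring.
have Z0 j k l : so4 A phr ord0 j k l = 0.
 case: (unliftP ord0 j)=> [j'|] ->; last by have := a12 ord0 ord0 k l; lra.
 case: (unliftP ord0 k)=> [k'|] ->; last first.
  by rewrite a23; have := a12 ord0 ord0 (l0 j') l; lra.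
 case: (unliftP ord0 l)=> [l'|] ->; last first.
  by rewrite a34 a23; have := a12 ord0 ord0 (l0 j') (l0 k'); lra.
 by rewrite so4_phr0// big1 ?mulr0// => x _; rewrite H mul0r.
move=> i j k l.
case: (unliftP ord0 i)=> [i'|] ->; last exact: Z0.
case: (unliftP ord0 j)=> [j'|] ->; last by rewrite a12 Z0 oppr0.
case: (unliftP ord0 k)=> [k'|] ->; last by rewrite a23 a12 Z0 !oppr0.
case: (unliftP ord0 l)=> [l'|] ->; last by rewrite a34 a23 a12 Z0 !oppr0.
exact: Z1.
Qed.

(** Splitting off the index 0 turns the condition for m = 0 into the hypothesis on B, and the other
    conditions into the relation between S and B, of the seven-dimensional system. *)
Lemma spin7_unique (S : Tri 8 R) : (forall i j k, S j i k = - S i j k) -> (forall i j k, S i k j = - S i j k) ->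
 (forall m x, Pv (S m) x = 0) -> forall i j k, S i j k = 0.
move=> S12 S23 PS.
pose S7 i j k := S (l0 i) (l0 j) (l0 k).
pose B i j := 2 * S ord0 (l0 i) (l0 j).
have S00 x : S ord0 ord0 x = 0 by have := S12 ord0 ord0 x; lra.
have [S0 B0] : (forall i j k, S7 i j k = 0) /\ (forall i j, B i j = 0).
 apply: alternating_unique.
 - by move=> i j k; exact: S12.
 - by move=> i j k; exact: S23.
 - by move=> i j; rewrite /B S23 mulrN.
 - move=> x; have := PS ord0 x; rewrite /Pv S00 mulr0 addr0=> E.
  rewrite -[RHS](mulr0 2) -E /Qv /B mulr_sumr; eq_sum a.
  by mul_sum b; rewrite mulrA.
 - move=> m x; have := PS (l0 m) x; rewrite /Pv (S12 ord0) /B -/(Qv (S7 m) x).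
  by rewrite mulrN=> /subr0_eq.
have Z j k : S ord0 j k = 0.
 case: (unliftP ord0 j)=> [j'|] ->; last exact: S00.
 case: (unliftP ord0 k)=> [k'|] ->; last by rewrite S23 S00 oppr0.
 by have /eqP := B0 j' k'; rewrite mulf_eq0 pnatr_eq0 /= => /eqP.
move=> i j k.
case: (unliftP ord0 i)=> [i'|] ->; last exact: Z.
case: (unliftP ord0 j)=> [j'|] ->; last by rewrite S12 Z oppr0.
case: (unliftP ord0 k)=> [k'|] ->; last by rewrite S23 S12 Z !oppr0.
exact: S0.
Qed.

Lemma g2_unique (S : Tri 7 R) : (forall i j k, S j i k = - S i j k) -> (forall i j k, S i k j = - S i j k) ->
 (forall m x, Qv (S m) x = 0) -> forall i j k, S i j k = 0.
move=> S12 S23 QS.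
have B12 (i j : 'I_7) : (0 : R) = - 0 by rewrite oppr0.
have QB x : Qv (fun _ _=> 0 : R) x = 0.
 by rewrite /Qv big1// => a _; rewrite big1// => b _; rewrite mul0r.
by have [] := @alternating_unique R S (fun _ _=> 0) S12 S23 B12 QB QS.
Qed.

End Spin7Algebra.

Lemma trmx_anti R n (A : 'M[R]_n) : A^T = - A -> forall a b, A b a = - A a b.
by move=> /matrixP E a b; have := E a b; rewrite !mxE. Qed.

(** * Clifford algebra and the spinor equations *)

Section CliffordAlgebra.
Variables (R : realType) (n K : nat) (gam : 'I_n -> 'M[R]_K) (eta : 'cV[R]_K).

Definition vecg (a : 'I_n -> R) : 'M[R]_K := \sum_i a i *: gam i.

Lemma cliff2_vecg (A : Bil n R) : cliff2 gam A eta = \sum_a gam a *m (vecg (A a) *m eta).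
eq_sum a; rewrite mulmx_suml mulmx_sumr; eq_sum b.
by rewrite -scalemxAl -scalemxAr mulmxA.
Qed.

Lemma cliff2D A B : cliff2 gam (fun a b=> A a b + B a b) eta = cliff2 gam A eta + cliff2 gam B eta.
rewrite -big_split; eq_sum a; rewrite -big_split.
by eq_sum b=> /=; rewrite scalerDl.
Qed.

Lemma cliff2Z c A : cliff2 gam (fun a b=> c * A a b) eta = c *: cliff2 gam A eta.
rewrite scaler_sumr; eq_sum a; rewrite scaler_sumr.
by eq_sum b; rewrite scalerA.
Qed.
Lemma eq_cliff2 A B : (forall a b, A a b = B a b) -> cliff2 gam A eta = cliff2 gam B eta.
by move=> E; eq_sum a; eq_sum b; rewrite E. Qed.

Lemma cliff2_prod a b : cliff2 gam (fun i j=> a i * b j) eta = vecg a *m (vecg b *m eta).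
rewrite cliff2_vecg {2}/vecg mulmx_suml; eq_sum i.
have -> : vecg (fun j=> a i * b j) = a i *: vecg b.
 by rewrite /vecg scaler_sumr; eq_sum j; rewrite scalerA.
by rewrite -!scalemxAl -scalemxAr.
Qed.

Lemma vecg_delta i : vecg (fun k=> (k == i)%:R) = gam i.
rewrite /vecg (bigD1 i)//= eqxx scale1r big1 ?addr0// => k /negPf ->.
by rewrite scale0r.
Qed.

Hypothesis cl : clifford gam.

Lemma vecg_anticomm a b : vecg a *m vecg b = (- 2 * lc a b)%:M - vecg b *m vecg a.
apply/eqP; rewrite eq_sym subr_eq eq_sym; apply/eqP.
rewrite /vecg mulmx_suml [X in _ + X]mulmx_sumr -big_split /=.
transitivity (\sum_i (- 2 * (a i * b i))%:M : 'M[R]_K).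
 eq_sum i; rewrite mulmx_sumr mulmx_suml -big_split /=.
 transitivity (\sum_j (a i * b j) *: ((- 2 * (i == j)%:R)%:M : 'M[R]_K)).
  eq_sum j; rewrite -cl scalerDr -!scalemxAl -!scalemxAr !scalerA.
  by rewrite [b j * a i]mulrC.
 rewrite (bigD1 i)//= eqxx big1 ?addr0; last first.
  by move=> j; rewrite eq_sym=> /negPf ->; rewrite mulr0 raddf0 scaler0.
 by rewrite scale_scalar_mx (_ : true%:R = 1 :> R)//; congr (_%:M); ring.
by rewrite -raddf_sum -mulr_sumr.
Qed.

Variables (T : Tri n R) (t : 'I_n -> R) (h : Bil n R) (s : R).
Hypothesis hsym : forall i j, h j i = h i j.
Hypothesis ht : forall i, lc (h i) t = 0.
Hypothesis trh : \sum_i h i i = 6.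
Hypothesis parT : forall m, cliff2 gam (fun i j=> 2^-1 * T m i j - s * (t i * h m j - t j * h m i)) eta = 0.

(** Because half of T_m differs from s (t /\ h_m) by an element that kills the spinor, T can be
    replaced by Clifford products of t and h_m; only the trace 6 of h survives the summation. *)
Lemma torsion_spinor : 12^-1 *: \sum_m gam m *m cliff2 gam (T m) eta = (2 * s) *: (vecg t *m eta).
have th m : vecg (h m) *m vecg t = - (vecg t *m vecg (h m)).
 by rewrite vecg_anticomm ht mulr0 raddf0 sub0r.
(* T_m acts as 2s (t h_m - h_m t), and t anticommutes with h_m by orthogonality. *)
have E m : cliff2 gam (T m) eta = (4 * s) *: (vecg t *m (vecg (h m) *m eta)).
 have -> : cliff2 gam (T m) eta = 2 *: cliff2 gam (fun i j=> 2^-1 * T m i j - s * (t i * h m j - t j * h m i)) eta +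
   (2 * s) *: (cliff2 gam (fun i j=> t i * h m j) eta - cliff2 gam (fun i j=> h m i * t j) eta).
  rewrite -[X in _ - X]scale1r -scaleNr -!cliff2Z -cliff2D -cliff2Z -cliff2D.
  by apply: eq_cliff2=> i j; field.
 rewrite parT scaler0 add0r !cliff2_prod (mulmxA (vecg (h m))) th mulNmx opprK.
 have -> : vecg t *m vecg (h m) *m eta = vecg t *m (vecg (h m) *m eta).
  by rewrite mulmxA.
 by rewrite scalerDr -scalerDl; congr (_ *: _); ring.
rewrite (eq_bigr (fun m=> (4 * s) *: (gam m *m (vecg t *m (vecg (h m) *m eta)))));
 last by move=> m _; rewrite E -scalemxAr.
rewrite -scaler_sumr.
(* Moving t to the left produces a term with h t = 0 and a sign; the symmetric h then acts as minus
   its trace. *)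
have -> : \sum_m gam m *m (vecg t *m (vecg (h m) *m eta)) = 6 *: (vecg t *m eta).
 have F m : gam m *m (vecg t *m (vecg (h m) *m eta)) =
   (- 2 * t m) *: (vecg (h m) *m eta) - vecg t *m (gam m *m (vecg (h m) *m eta)).
  rewrite -{1}(vecg_delta m) mulmxA vecg_anticomm mulmxBl lc_deltal vecg_delta.
  by rewrite mul_scalar_mx -!mulmxA.
 under eq_bigr do rewrite F.
 rewrite sumrB -mulmx_sumr.
 have -> : \sum_i (- 2 * t i) *: (vecg (h i) *m eta) = 0.
  rewrite (eq_bigr (fun i=> (- 2 * t i) *: vecg (h i) *m eta)); last first.
   by move=> i _; rewrite scalemxAl.
  rewrite -mulmx_suml (_ : \sum_i _ = 0) ?mul0mx//.
  rewrite /vecg; under eq_bigr do rewrite scaler_sumr.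
  rewrite exchange_big big1//= => j _.
  under eq_bigr do rewrite scalerA -mulrA.
  rewrite -scaler_suml -mulr_sumr (_ : \sum_i _ = 0) ?mulr0 ?scale0r//.
  by rewrite -[RHS](ht j); eq_sum i; rewrite mulrC hsym.
 rewrite sub0r -cliff2_vecg.
 have -> : cliff2 gam h eta = - 6 *: eta.
  have -> : cliff2 gam h eta = 2^-1 *: \sum_i \sum_j h i j *: ((gam i *m gam j + gam j *m gam i) *m eta).
   transitivity (2^-1 *: (cliff2 gam h eta + cliff2 gam h eta)).
    by rewrite scalerDr -scalerDl -[LHS]scale1r; congr (_ *: _); field.
   congr (_ *: _); rewrite {2}/cliff2 exchange_big /= -big_split /=.
   eq_sum i; rewrite -big_split /=; eq_sum j.
   by rewrite mulmxDl scalerDr hsym.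
  rewrite (eq_bigr (fun i=> (- 2 * h i i) *: eta)).
   by rewrite -scaler_suml -mulr_sumr trh scalerA; congr (_ *: _); field.
  move=> i _; rewrite (bigD1 i)//= cl eqxx big1 ?addr0.
   rewrite mul_scalar_mx scalerA (_ : true%:R = 1 :> R)//.
   by congr (_ *: _); ring.
  by move=> j; rewrite eq_sym=> /negPf ij; rewrite cl ij mulr0 raddf0 mul0mx scaler0.
 by rewrite -scalemxAr scaleNr opprK.
by rewrite !scalerA; congr (_ *: _); field.
Qed.

End CliffordAlgebra.

Section SpinorEquations.
Variables (R : realType) (n K : nat) (g : 'M[R]_n -> Prop).
Variables (gam : 'I_n -> 'M[R]_K) (eta : 'cV[R]_K).
Hypothesis ds : defining_spinor g gam eta.

Lemma spinor_kill (C : Bil n R) : (forall i j, C j i = - C i j) -> g (\matrix_(i, j) C i j) -> cliff2 gam C eta = 0.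
move=> anti gC; have [_ _ /(_ (\matrix_(i, j) C i j))[|_ /(_ gC) <-]] := ds.
 by apply/matrixP=> i j; rewrite !mxE anti.
by apply: eq_cliff2=> a b; rewrite mxE.
Qed.

Lemma parallel_gravitino (e : frame R n) (H : lform R n 3) y :
 (forall m i j, conn e 2^-1 H y m j i = - conn e 2^-1 H y m i j) ->
 (forall m, g (\matrix_(i, j) conn e 2^-1 H y m i j)) -> gravitino_at gam e H (fun=> eta) y.
move=> anti gw m; rewrite /pd derive_cst add0r.
have := spinor_kill (anti m) (gw m); rewrite /conn cliff2D cliff2Z=> E.
rewrite (_ : 8^-1 = 4^-1 * 2^-1 :> R); last by field.
by rewrite -scalerA -scalerDr E scaler0.
Qed.

Lemma holonomy_gaugino (e : frame R n) (w : coefs R n) y :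
 (forall m q a b, curv e w y q m a b = - curv e w y m q a b) ->
 (forall a b, g (\matrix_(m, q) curv e w y m q a b)) -> gaugino_at gam e w (fun=> eta) y.
by move=> anti gC a b; apply: spinor_kill. Qed.

(** The torsion part equals 2s t on the spinor, which fixes the differential of the dilaton as -2s
    t. *)
Lemma torsion_dilatino (e : frame R n) (H : lform R n 3) (phi : 'rV[R]_n -> R) y (t : 'I_n -> R) (h : Bil n R) (s : R) :
 (forall i j, h j i = h i j) -> (forall i, lc (h i) t = 0) -> \sum_i h i i = 6 ->
 (forall m i j, H y (idx3 m j i) = - H y (idx3 m i j)) -> (forall m, g (\matrix_(i, j)
   (2^-1 * H y (idx3 m i j) - s * (t i * h m j - t j * h m i)))) -> (forall m, pd e m phi y = - 2 * s * t m) ->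
 dilatino_at gam e H phi (fun=> eta) y.
move=> hs ht trh anti gC dphi; have [cl _ _] := ds.
rewrite /dilatino_at (torsion_spinor cl (t := t) (h := h) (s := s))//; last first.
 by move=> m; apply: spinor_kill=> // i j; rewrite anti; ring.
rewrite /vecg mulmx_suml scaler_sumr -big_split big1//= => m _.
by rewrite dphi -scalemxAl scalerA -scalerDl (_ : _ + _ = 0) ?scale0r//; ring.
Qed.

End SpinorEquations.

(** * Real spinor modules built from octonion multiplication *)

Section SpinorModules.
Variable R : realType.

(* Left multiplication by e_(i+1) on the octonions, whose basis is e_0 .. e_7 *)
Definition octl (i x y : nat) : int :=
 match x, y with
 | 0, 0 => 0
 | x.+1, 0 => if x == i then 1 else 0
 | 0, y.+1 => if y == i then -1 else 0
 | x.+1, y.+1 => om i y x end.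

Definition gam7 (i : 'I_7) : 'M[R]_8 := \matrix_(x, y) (octl i x y)%:~R.
Definition eta7 : 'cV[R]_8 := \col_x (x == ord0)%:R.

Lemma octl_check : alln 7 (fun i=> alln 7 (fun j=> alln 8 (fun x=> alln 8 (fun y =>
 isum 8 (fun z=> octl i x z * octl j z y) + isum 8 (fun z=> octl j x z * octl i z y)
 == if (i == j) && (x == y) then -2 else 0)))).
by vm_compute. Qed.

Lemma gam7_clifford : clifford gam7.
move=> i j; apply/matrixP=> x y; rewrite !mxE.
have /eqP E := allnP (allnP (allnP (allnP octl_check i) j) x) y.
transitivity ((isum 8 (fun z=> octl i x z * octl j z y) + isum 8 (fun z=> octl j x z * octl i z y))%:~R : R).
 rewrite intrD !isumE !rmorph_sum; congr (_ + _); eq_sum z; by rewrite !mxE -intrM.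
rewrite E -!val_eqE /=; do 2 case: (_ == _); rewrite /= ?(mulr0, mulr1) //.
Qed.

Lemma gam7_eta i : gam7 i *m eta7 = \col_x (x == lift ord0 i)%:R.
apply/matrixP=> x y; rewrite !mxE (bigD1 ord0)//= !mxE eqxx mulr1 big1 ?addr0.
 case: (unliftP ord0 x)=> [x'|] -> /=; last by [].
 by rewrite (inj_eq (lift_inj (h := ord0))) -val_eqE /=; case: (_ == _).
by move=> z /negPf z0; rewrite !mxE z0 mulr0.
Qed.

Lemma gam7_gam7_eta i j x y : (gam7 i *m (gam7 j *m eta7)) x y = (octl i x (lift ord0 j))%:~R.
rewrite gam7_eta !mxE (bigD1 (lift ord0 j))//= !mxE eqxx mulr1 big1 ?addr0//.
by move=> z /negPf z0; rewrite !mxE z0 mulr0.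
Qed.

(** On the spinor 1 the double product is the octonion sum of A_ab e_a e_b: skewness removes the
    real part, and the imaginary part is [Qv A]. *)
Lemma cliff2_gam7 (A : Bil 7 R) : (forall a b, A b a = - A a b) ->
 cliff2 gam7 A eta7 = \col_x (if unlift ord0 x is Some k then Qv A k else 0).
move=> anti; apply/matrixP=> x y; rewrite /cliff2 summxE.
transitivity (\sum_a \sum_b A a b * (octl a x (lift ord0 b))%:~R).
 eq_sum a; rewrite summxE; eq_sum b.
 by rewrite mxE -mulmxA gam7_gam7_eta.
rewrite mxE; case: unliftP=> [k ->|->].
 eq_sum a; eq_sum b; congr (_ * _); rewrite /omr /=.
rewrite big1// => a _; rewrite (bigD1 a)//= [A a a](_ : _ = 0) ?mul0r ?add0r.
 by rewrite big1// => b /negPf; rewrite -val_eqE /= => ->; rewrite mulr0.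
by have := anti a a; lra.
Qed.

Lemma eta7_neq0 : eta7 != 0.
apply/eqP=> /matrixP/(_ ord0 ord0); rewrite !mxE eqxx=> /eqP.
by rewrite oner_eq0.
Qed.

Lemma cliff2_gam7_eq0 (A : Bil 7 R) : (forall a b, A b a = - A a b) -> cliff2 gam7 A eta7 = 0 <-> forall k, Qv A k = 0.
move=> anti; rewrite cliff2_gam7//; split=> [/matrixP E k|E].
 by have := E (lift ord0 k) ord0; rewrite !mxE liftK.
by apply/matrixP=> x y; rewrite !mxE; case: unliftP=> [k|]; rewrite ?E.
Qed.

Lemma in_g2P (A : 'M[R]_7) : A^T = - A -> in_g2 A <-> forall x, Qv A x = 0.
move=> AT; have anti := trmx_anti AT.
rewrite -so3_om0P//; split=> [H i j k|H I].
 rewrite -(H (tup3 i j k)) so3E; apply: eq_so3=> *; exact/esym/omega_stdE.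
rewrite (tup3_eta I) so3E -(H (I (od 0)) (I (od 1)) (I (od 2))).
by apply: eq_so3=> *; exact: omega_stdE.
Qed.

Lemma has_spinor_g2 : has_spinor 8 (@in_g2 R).
exists gam7, eta7; split; [exact: gam7_clifford|exact: eta7_neq0|]=> A AT.
rewrite in_g2P//; exact: cliff2_gam7_eq0 (trmx_anti AT).
Qed.

(** Extension by zero along e_7, that is, the inclusion of so(6) in so(7); it carries su(3) to the
    part of g2 fixing e_7. *)
Definition ext6 (A : Bil 6 R) (i j : 'I_7) : R :=
 if (insub (val i), insub (val j)) is (Some i', Some j') then A i' j' else 0.

Lemma ext6E A a b : ext6 A (w67 a) (w67 b) = A a b.
by rewrite /ext6 !valK. Qed.
Lemma ext6_r A i : ext6 A i (od 6) = 0.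
by rewrite /ext6; case: insub=> // a; rewrite insubF. Qed.
Lemma ext6_l A i : ext6 A (od 6) i = 0.
by rewrite /ext6 insubF. Qed.

Lemma ext6_anti A : (forall a b, A b a = - A a b) -> forall i j, ext6 A j i = - ext6 A i j.
move=> anti i j; rewrite /ext6; case: insub=> [a|]; case: insub=> [b|] //; by rewrite ?oppr0.
Qed.

Variant ord7_spec : 'I_7 -> Prop :=
| Ord7Last : ord7_spec (od 6)
| Ord7Widen a : ord7_spec (w67 a).

Lemma ord7P i : ord7_spec i.
case: (ltnP i 6)=> [i6|].
 have -> : i = w67 (Ordinal i6) by exact: val_inj.
 exact: Ord7Widen.
rewrite leq_eqVlt ltnNge -ltnS ltn_ord orbF=> /eqP i6.
have -> : i = od 6 by apply: val_inj; rewrite /= -i6.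
exact: Ord7Last.
Qed.

Lemma so3_ext6 A f i j k : so3 (ext6 A) f i j k =
 \sum_(l < 6) (ext6 A i (w67 l) * f (w67 l) j k + ext6 A j (w67 l) * f i (w67 l) k
  + ext6 A k (w67 l) * f i j (w67 l)).
by rewrite /so3 sum_I7 !ext6_r !mul0r !addr0. Qed.

(** F and Psi^+ together are the components of omega with and without the index 7, so fixing both is
    fixing omega. *)
Lemma Qv_ext6 (A : 'M[R]_6) : A^T = - A ->
 (forall I, so_act A (@F_std R) I = 0) -> (forall I, so_act A (@Psip_std R) I = 0) -> forall x, Qv (ext6 A) x = 0.
move=> AT HF HP; have anti6 := trmx_anti AT.
have anti := ext6_anti anti6.
apply/so3_om0P=> //.
have o12 := so3_12 (ext6 A) (@omr12 R); have o23 := so3_23 (ext6 A) (@omr23 R).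
have E6 i j : so3 (ext6 A) (omr R) (od 6) i j = 0.
 have E66 k : so3 (ext6 A) (omr R) (od 6) (od 6) k = 0.
  by have := o12 (od 6) (od 6) k; lra.
 case: (ord7P i)=> [|a]; first exact: E66.
 case: (ord7P j)=> [|b]; first by rewrite o23 E66 oppr0.
 transitivity (- so_act A (@F_std R) (tup2 a b)); last by rewrite HF oppr0.
 rewrite so3_ext6 so2E -sumrN; eq_sum l.
 by rewrite !F_stdE ext6_l !ext6E; ring.
move=> i j k; case: (ord7P i)=> [|a]; first exact: E6.
case: (ord7P j)=> [|b]; first by rewrite o12 E6 oppr0.
case: (ord7P k)=> [|c]; first by rewrite o23 o12 E6 !oppr0.
transitivity (- so_act A (@Psip_std R) (tup3 a b c)); last by rewrite HP oppr0.
rewrite so3_ext6 so3E -sumrN; eq_sum l.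
by rewrite !Psip_stdE !ext6E /omr /=; ring.
Qed.

(** Psi^- is the contraction of *omega with e_7, so it is fixed as soon as omega and e_7 are. *)
Lemma in_su3P (A : 'M[R]_6) : A^T = - A -> in_su3 A <-> forall x, Qv (ext6 A) x = 0.
move=> AT; have anti := ext6_anti (trmx_anti AT).
split=> [[HF HP _]|Qv0]; first exact: Qv_ext6.
have E3 : forall i j k, so3 (ext6 A) (omr R) i j k = 0 by apply/so3_om0P.
split=> I.
- rewrite (tup2_eta I) so2E.
 rewrite -[RHS]oppr0 -(E3 (od 6) (w67 (I (od 0))) (w67 (I (od 1)))) so3_ext6 -sumrN.
 by eq_sum l; rewrite !F_stdE ext6_l !ext6E /omr /=; ring.
- rewrite (tup3_eta I) so3E.
 rewrite -[RHS]oppr0 -(E3 (w67 (I (od 0))) (w67 (I (od 1))) (w67 (I (od 2)))).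
 rewrite so3_ext6 -sumrN; eq_sum l.
 by rewrite !Psip_stdE !ext6E /omr /=; ring.
rewrite (tup3_eta I) so3E.
have := so4_ps (od 6) (w67 (I (od 0))) (w67 (I (od 1))) (w67 (I (od 2))) anti.
rewrite !Qv0 !mul0r subrr addr0 subr0 mulr0=> E4.
rewrite -[RHS]E4 /so4 sum_I7 !ext6_r !mul0r !addr0; eq_sum l.
by rewrite !Psim_stdE ext6_l !ext6E mul0r add0r.
Qed.

Definition gam6 (i : 'I_6) : 'M[R]_8 := gam7 (w67 i).

Lemma cliff2_gam6 (A : Bil 6 R) : cliff2 gam6 A eta7 = cliff2 gam7 (ext6 A) eta7.
rewrite /cliff2 sum_I7 [X in _ + X]big1 ?addr0=> [|b _]; last first.
 by rewrite ext6_l scale0r.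
eq_sum a; rewrite sum_I7 ext6_r scale0r addr0.
by eq_sum b; rewrite ext6E.
Qed.

Lemma has_spinor_su3 : has_spinor 8 (@in_su3 R).
exists gam6, eta7; split; [|exact: eta7_neq0|]=> [i j|A AT].
 rewrite /gam6 gam7_clifford (inj_eq (f := w67))// => a b /(congr1 val) /=.
 exact: val_inj.
rewrite in_su3P// cliff2_gam6; apply: cliff2_gam7_eq0.
exact: ext6_anti (trmx_anti AT).
Qed.

(** Doubling of the seven-dimensional module. Products of two gamma matrices are block diagonal, so
    [eta8], placed in one half-spin summand, stays there under so(8). *)
Definition gam8 (i : 'I_8) : 'M[R]_(8 + 8) :=
 if unlift ord0 i is Some k then block_mx 0 (gam7 k) (gam7 k) 0 else block_mx 0 1%:M (- 1%:M) 0.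
Definition eta8 : 'cV[R]_(8 + 8) := col_mx eta7 0.

Lemma gam8_0 : gam8 ord0 = block_mx 0 1%:M (- 1%:M) 0.
by rewrite /gam8 unlift_none. Qed.
Lemma gam8_lift k : gam8 (lift ord0 k) = block_mx 0 (gam7 k) (gam7 k) 0.
by rewrite /gam8 liftK. Qed.

Lemma gam8_clifford : clifford gam8.
have B (x : R) : x%:M = block_mx x%:M 0 0 x%:M :> 'M[R]_(8 + 8).
 exact: scalar_mx_block.
move=> i j; rewrite B; case: (unliftP ord0 i)=> [i'|] ->; case: (unliftP ord0 j)=> [j'|] ->;
 rewrite ?gam8_0 ?gam8_lift !mulmx_block !mul0mx !mulmx0 !(addr0, add0r) add_block_mx !(addr0, add0r).
- by rewrite gam7_clifford (inj_eq (lift_inj (h := ord0))).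
- by rewrite mulmx1 mulmxN mulmx1 mul1mx mulNmx mul1mx addNr addrN mulr0 raddf0.
- by rewrite mulmx1 mulmxN mulmx1 mul1mx mulNmx mul1mx addNr addrN mulr0 raddf0.
rewrite mul1mx mulmx1 eqxx mulr1 -raddfN -raddfD /=.
by congr (block_mx _%:M _ _ _%:M); ring.
Qed.

Lemma cliff2_gam8 (A : Bil 8 R) : (forall a b, A b a = - A a b) -> cliff2 gam8 A eta8 =
 col_mx (\col_x (if unlift ord0 x is Some k then Pv A k else 0)) 0.
move=> anti; rewrite /cliff2 big_ord_recl [X in X + _]big_ord_recl /=.
have A0 : A ord0 ord0 = 0 by have := anti ord0 ord0; lra.
rewrite A0 scale0r add0r.
under [X in _ + X]eq_bigr do rewrite big_ord_recl /=.
rewrite big_split /= addrA -big_split /=.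
have E0 k : A ord0 (lift ord0 k) *: (gam8 ord0 *m gam8 (lift ord0 k) *m eta8) +
  A (lift ord0 k) ord0 *: (gam8 (lift ord0 k) *m gam8 ord0 *m eta8) =
  (2 * A ord0 (lift ord0 k)) *: col_mx (gam7 k *m eta7) 0.
 rewrite gam8_0 gam8_lift !mulmx_block !mul0mx !mulmx0 !(addr0, add0r).
 rewrite !mul_block_col !mulmx0 !mul0mx !(addr0, add0r) mul1mx mulmxN mulmx1 mulNmx.
 rewrite (anti ord0) -{2}oppr0 -opp_col_mx scaleNr scalerN opprK -scalerDl.
 by congr (_ *: _); ring.
under eq_bigr do rewrite E0.
have E1 a b : gam8 (lift ord0 a) *m gam8 (lift ord0 b) *m eta8 = col_mx (gam7 a *m gam7 b *m eta7) 0.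
 by rewrite !gam8_lift mulmx_block !mul0mx !mulmx0 !(addr0, add0r) mul_block_col !mulmx0 !mul0mx !(addr0, add0r).
under [X in _ + X]eq_bigr do under eq_bigr do rewrite E1.
have S (I : finType) (F : I -> 'cV[R]_8) : \sum_i col_mx (F i) 0 = col_mx (\sum_i F i) (0 : 'cV[R]_8).
 elim/big_rec2: _=> [|i x y _ ->]; first by rewrite col_mx0.
 by rewrite add_col_mx addr0.
under eq_bigr do rewrite scale_col_mx scaler0.
under [X in _ + X]eq_bigr do under eq_bigr do rewrite scale_col_mx scaler0.
under [X in _ + X]eq_bigr do rewrite S.
rewrite !S add_col_mx addr0; congr col_mx.
have := cliff2_gam7 (A := fun a b=> A (lift ord0 a) (lift ord0 b)) (fun a b=> anti _ _).
rewrite /cliff2=> ->.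
apply/matrixP=> x y; rewrite !mxE summxE.
case: unliftP=> [k ->|->].
 rewrite addrC /Pv; congr (_ + _).
 rewrite -[RHS](lc_deltal (fun k=> 2 * A ord0 (lift ord0 k)) k).
 eq_sum l; rewrite gam7_eta !mxE (inj_eq (lift_inj (h := ord0))).
 by rewrite mulrC eq_sym.
by rewrite addr0 big1// => l _; rewrite gam7_eta !mxE mulr0.
Qed.

Lemma in_spin7P (A : 'M[R]_8) : A^T = - A -> in_spin7 A <-> forall x, Pv A x = 0.
move=> AT; have anti := trmx_anti AT.
rewrite -spin7P//; split=> [H i j k l|H I].
 rewrite -(H (idx4 i j k l)) so4E; apply: eq_so4=> *; exact/esym/Phi_stdE.
rewrite (idx4_eta I) so4E -(H (I (od 0)) (I (od 1)) (I (od 2)) (I (od 3))).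
by apply: eq_so4=> *; exact: Phi_stdE.
Qed.

Lemma has_spinor_spin7 : has_spinor 16 (@in_spin7 R).
exists gam8, eta8; split; first exact: gam8_clifford.
 apply/eqP=> E; have /eqP := congr1 (@usubmx R 8 8 1) E.
 by rewrite col_mxKu linear0 (negPf eta7_neq0).
move=> A AT; rewrite in_spin7P// (cliff2_gam8 (trmx_anti AT)).
split=> [E k|E].
 have /matrixP/(_ (lift ord0 k) ord0) := congr1 (@usubmx R 8 8 1) E.
 by rewrite col_mxKu linear0 !mxE liftK.
rewrite (_ : \col_x _ = 0) ?col_mx0//.
by apply/matrixP=> x y; rewrite !mxE; case: unliftP=> [k|]; rewrite ?E.
Qed.

End SpinorModules.

(** * Curvature takes values in the stabilizer algebra *)

Section Holonomy.
Variables (R : realType) (n k : nat).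
Implicit Types (A B : 'M[R]_n) (a : ('I_k -> 'I_n) -> R).

Lemma upd_upd (I : 'I_k -> 'I_n) s x y : upd (upd I s x) s y = upd I s y.
by ext u; rewrite /upd; case: eqP. Qed.

Lemma updC (I : 'I_k -> 'I_n) s t x y : s != t -> upd (upd I s x) t y = upd (upd I t y) s x.
move=> st; ext u; rewrite /upd; case: (u =P t)=> [->|//].
by rewrite eq_sym (negPf st).
Qed.

(** Two derivations hit either the same slot, giving the matrix product, or two different slots; the
    latter part is symmetric in A and B. *)
Lemma so_act_comp A B a I : \sum_(s < k) \sum_c A (I s) c * so_act B a (upd I s c) =
 so_act (A *m B) a I + \sum_(s < k) \sum_(t < k | t != s) \sum_c \sum_l
  A (I s) c * B (I t) l * a (upd (upd I s c) t l).
rewrite /so_act -big_split; eq_sum s=> /=.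
under eq_bigr do rewrite mulr_sumr (bigD1 s)//=.
rewrite big_split /=; congr (_ + _).
 under [RHS]eq_bigr do rewrite mxE mulr_suml.
 rewrite [RHS]exchange_big; eq_sum c=> /=; rewrite mulr_sumr.
 eq_sum l; rewrite upd_upd mulrA; congr (_ * B _ _ * _).
 by rewrite /upd eqxx.
rewrite exchange_big; apply: eq_bigr=> t ts /=; eq_sum c.
mul_sum l; rewrite mulrA; congr (_ * B _ _ * _).
by rewrite /upd (negPf ts).
Qed.

(** When A and B both kill a, each composite vanishes, so both products equal minus the same
    symmetric two-slot term. *)
Lemma so_act_bracket A B a : (forall I, so_act A a I = 0) ->
 (forall I, so_act B a I = 0) -> forall I, so_act (A *m B) a I = so_act (B *m A) a I.
move=> HA HB I.
have Z C D : (forall I, so_act D a I = 0) -> \sum_(s < k) \sum_c C (I s) c * so_act D a (upd I s c) = 0 :> R.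
 by move=> HD; rewrite big1// => s _; rewrite big1// => c _; rewrite HD mulr0.
have := so_act_comp A B a I; have := so_act_comp B A a I.
rewrite !Z// => /esym/eqP; rewrite addr_eq0=> /eqP -> /esym/eqP.
rewrite addr_eq0=> /eqP ->; congr (- _).
rewrite (exchange_big_dep xpredT)//=; eq_sum s.
under [RHS]eq_bigl do rewrite eq_sym.
apply: eq_bigr=> t ts; rewrite exchange_big; eq_sum c=> /=.
by eq_sum l; rewrite updC 1?eq_sym// [A _ _ * _]mulrC.
Qed.

Lemma so_actD A B a I : so_act (A + B) a I = so_act A a I + so_act B a I.
rewrite /so_act -big_split; eq_sum s; rewrite -big_split.
by eq_sum l=> /=; rewrite mxE mulrDl.
Qed.

Lemma so_actZ c A a I : so_act (c *: A) a I = c * so_act A a I.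
rewrite /so_act mulr_sumr; eq_sum s; rewrite mulr_sumr.
by eq_sum l; rewrite mxE mulrA.
Qed.
Lemma so_actN A a I : so_act (- A) a I = - so_act A a I.
by rewrite -scaleN1r so_actZ mulN1r. Qed.

Lemma so_act_sum (J : Type) (r : seq J) (F : J -> 'M[R]_n) a I :
 so_act (\sum_(j <- r) F j) a I = \sum_(j <- r) so_act (F j) a I.
elim: r=> [|j r IH]; last by rewrite !big_cons so_actD IH.
rewrite !big_nil /so_act big1// => s _; rewrite big1// => l _.
by rewrite mxE mul0r.
Qed.

Variables (U : set 'rV[R]_n) (e : frame R n) (w : coefs R n).
Hypothesis oU : open U.

Definition wmx (w : coefs R n) y m : 'M[R]_n := \matrix_(i, j) w y m i j.

Lemma cov_const (a : lform R n k) c y m I : (forall z I, U z -> a z I = c I) ->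
 U y -> cov e w a y m I = - so_act (wmx w y m) c I.
move=> aE Uy; rewrite /cov (@pd_eqon _ _ _ e oU _ (fun=> c I) m y)=> [|z Uz|//]; last exact: aE.
rewrite pd_cst sub0r; congr (- _); eq_sum s; eq_sum l.
by rewrite aE// mxE.
Qed.

Hypothesis dw : forall y m i j, U y -> differentiable (fun z=> w z m i j) y.

(** Curvature is made of derivatives, commutators and combinations of connection matrices.
    Differentiating the condition that these kill the constant tensor c handles the first kind,
    [so_act_bracket] the second. *)
Lemma so_act_curv (c : ('I_k -> 'I_n) -> R) y m p I : U y -> (forall z m I, U z -> so_act (wmx w z m) c I = 0) ->
 so_act (\matrix_(a, b) curv e w y m p a b) c I = 0.
move=> Uy H.
pose D m p := \matrix_(a, b) pd e m (fun z=> w z p a b) y.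
have HD m' p' J : so_act (D m' p') c J = 0.
 rewrite -[RHS](pd_cst e 0 m' y).
 rewrite -(@pd_eqon _ _ _ e oU (fun z=> so_act (wmx w z p') c J) (fun=> 0) m' y)=> [|z Uz|//]; last exact: H.
 have dZ s l : differentiable (fun z=> wmx w z p' (J s) l * c (upd J s l)) y.
  apply: differentiableM; last exact: differentiable_cst.
  rewrite (_ : (fun z=> _) = fun z=> w z p' (J s) l); first exact: dw.
  by ext z; rewrite mxE.
 rewrite /so_act pd_sum=> [|s]; last exact: diff_bigsum.
 eq_sum s; rewrite pd_sum//; eq_sum l.
 rewrite (_ : (fun z=> _) = fun z=> c (upd J s l) * w z p' (J s) l); last first.
  by ext z; rewrite mxE mulrC.
 by rewrite pdZ; [rewrite mxE mulrC|exact: dw].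
have -> : \matrix_(a, b) curv e w y m p a b = D m p - D p m + (wmx w y p *m wmx w y m - wmx w y m *m wmx w y p)
  - \sum_l strc e y m p l *: wmx w y l.
 apply/matrixP=> a b; rewrite !mxE /curv summxE; congr (_ + _ - _).
  rewrite sumrB; congr (_ - _); eq_sum x; by rewrite !mxE.
 by eq_sum l; rewrite !mxE.
rewrite !(so_actD, so_actN) !HD so_act_sum.
rewrite (so_act_bracket (A := wmx w y p) (B := wmx w y m)); [|by move=> J; exact: H..].
rewrite subrr big1=> [|l _]; last by rewrite so_actZ H// mulr0.
by rewrite subrr !(add0r, subr0).
Qed.

End Holonomy.

(** * The moving isometry onto the octonions and its derivative *)

Section Multilinearity.
Variable R : realType.
Implicit Types u v w x : 'I_7 -> R.

Lemma ps4_lin3 u v x z w (c d : R) : ps4 u v (fun k=> c * x k + d * z k) w = c * ps4 u v x w + d * ps4 u v z w.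
rewrite (ps4_23 u _ v) (ps4_12 _ u) opprK (ps4_23 u x v) (ps4_12 x u) opprK.
by rewrite (ps4_23 u z v) (ps4_12 z u) opprK /ps4 /lc4 lcDl !lcZl.
Qed.

Lemma om3_sub1 x z v w : om3 (fun k=> x k - z k) v w = om3 x v w - om3 z v w.
exact: lcBl. Qed.
Lemma om3_sub2 x z v w : om3 v (fun k=> x k - z k) w = om3 v x w - om3 v z w.
by rewrite !(om3_12 _ v) om3_sub1 opprB opprK addrC. Qed.
Lemma om3_sub3 x z v w : om3 v w (fun k=> x k - z k) = om3 v w x - om3 v w z.
by rewrite !(om3_23 v _ w) om3_sub2 opprB opprK addrC. Qed.

Lemma ps4_sub1 x z v w u : ps4 (fun k=> x k - z k) v w u = ps4 x v w u - ps4 z v w u.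
exact: lcBl. Qed.

Lemma comb_bv_algebra n (L T t : 'I_n -> R) (a : 'I_n -> R) (s q : R) :
 lc (fun l=> L l + 2^-1 * T l) (fun l=> s * a l + t l * q) = s * (\sum_l L l * a l) + (\sum_l L l * t l) * q
 + 2^-1 * (s * (\sum_l T l * a l) + (\sum_l T l * t l) * q).
rewrite /lc mulrDr !mulr_sumr !mulr_suml !mulr_sumr -!big_split.
by eq_sum l=> /=; ring.
Qed.

Lemma sub_sum3 (a b c x y z : R) : x + y + z = 0 -> (a - x) + (b - y) + (c - z) = a + b + c.
lra. Qed.

Lemma sub_sum4 (a b c d x y z t : R) : x + y + z + t = 0 -> (a - x) + (b - y) + (c - z) + (d - t) = a + b + c + d.
lra. Qed.
Lemma ps4_sub2' x z v w u : ps4 v (fun k=> x k - z k) w u = ps4 v x w u - ps4 v z w u.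
by rewrite !(ps4_12 _ v) ps4_sub1 opprB opprK addrC. Qed.
Lemma ps4_sub3' x z v w u : ps4 v w (fun k=> x k - z k) u = ps4 v w x u - ps4 v w z u.
by rewrite !(ps4_23 v _ w) ps4_sub2' opprB opprK addrC. Qed.
Lemma ps4_sub4' x z v w u : ps4 v w u (fun k=> x k - z k) = ps4 v w u x - ps4 v w u z.
by rewrite !(ps4_34 v w _ u) ps4_sub3' opprB opprK addrC. Qed.

Lemma comb_cm_algebra n (T H t a : 'I_n -> R) (s q ti hi : R) :
 lc (fun l=> 2^-1 * T l - s * (ti * H l - t l * hi)) (fun l=> s * a l + t l * q) =
 2^-1 * (s * (\sum_l T l * a l) + (\sum_l T l * t l) * q)
 - s * (ti * (s * (\sum_l H l * a l) + (\sum_l H l * t l) * q)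
     - hi * (s * (\sum_l t l * a l) + (\sum_l t l * t l) * q)).
rewrite /lc !mulrDr !mulr_sumr !mulr_suml !mulr_sumr -!big_split.
rewrite mulrN mulr_sumr -sumrN -big_split -sumrN -big_split.
by eq_sum l=> /=; ring.
Qed.

End Multilinearity.

Section ParallelStructure.
Variables (R : realType) (r : nat).
Notation n := (6 + r)%N.
Context (U : set 'rV[R]_n) (e : frame R n) q t (pf : product_frame (r := r) U e q t).
Let oU := pf_open pf.
Variables (s : R) (tau : 'I_n -> 'rV[R]_n -> R).
Hypothesis s2 : s ^+ 2 = 1.
Hypothesis dtau : forall j y, U y -> differentiable (tau j) y.
Hypothesis tau_pd : forall m j y, U y -> pd e m (tau j) y = \sum_l LCk e y m j l * tau l y.
Hypothesis tau_av : forall k y, U y -> \sum_l tau l y * av e q y l k = 0.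

Notation av := (av e q).
Notation hp := (hp e q).
Notation tor := (tor e q).

(* For tau = t_s this is the isometry of the tangent space with R^7 that
identifies the G2-structure with the constant one. *)
Definition bv (y : 'rV[R]_n) (j : 'I_n) (k : 'I_7) : R :=
 s * av y j k + tau j y * q k y.

Lemma comb_Kg2 (v u a : 'I_7 -> R) k : comb v (Kg2 u a) k =
 2^-1 * ps4 u a v (fun i=> (i == k)%:R) - lc v u * a k + lc v a * u k.
have E : ps4 u a v (fun i=> (i == k)%:R) = lc v (fun i=> lc2 u a (fun x y=> psr R x y i k)).
 rewrite /ps4 /lc4 /lc3 /lc2.
 transitivity (lc u (fun x=> lc v (fun i=> lc a (fun y=> psr R x y i k)))).
  apply: eq_lc=> x; rewrite lcC; apply: eq_lc=> i; apply: eq_lc=> y.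
  exact: lc_deltal.
 exact: lcC.
rewrite /comb /Kg2 lcD lcB lcZ E.
by rewrite !lcZr.
Qed.

(** Completeness of the a_l omits only the direction q, which contributes nothing because q already
    occurs in the torsion. *)
Lemma tor_av y m j k : U y -> \sum_l tor y m j l * av y l k = ps4 (q^~ y) (av y m) (av y j) (fun i=> (i == k)%:R).
move=> Uy.
transitivity (ps4 (q^~ y) (av y m) (av y j) (comb (fun l=> av y l k) (av y))).
 by rewrite ps4_comb4; eq_sum l; rewrite mulrC.
rewrite (_ : comb _ _ = fun i=> (i == k)%:R - q k y * q i y).
 by rewrite ps4_sub4 ps4_alt14 mulr0 subr0.
ext i; rewrite /comb /lc (av_complete pf)// eq_sym.
by congr (_ - _).
Qed.

Lemma tor_tau y m j : U y -> \sum_l tor y m j l * tau l y = 0.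
move=> Uy.
transitivity (ps4 (q^~ y) (av y m) (av y j) (comb (fun l=> tau l y) (av y))).
 by rewrite ps4_comb4; eq_sum l; rewrite mulrC.
rewrite (_ : comb _ _ = fun=> 0); last by ext k; rewrite /comb /lc tau_av.
rewrite ps4_34 ps4_23 ps4_12 /ps4 /lc4 /lc big1 ?oppr0// => k _; exact: mul0r.
Qed.

Lemma hp_tau y m : U y -> lc (hp y m) (fun l=> tau l y) = 0.
move=> Uy; transitivity (lc (av y m) (comb (fun l=> tau l y) (av y))).
 by rewrite lc_combr; eq_sum l; rewrite mulrC.
rewrite (_ : comb _ _ = fun=> 0) ?lc0//.
by ext k; rewrite /comb /lc tau_av.
Qed.

Variable w : coefs R n.
Hypothesis wE : tor_conn U e q 1 w.

(** The mechanism behind parallelism: along e_m the vectors b_j change by w and by the derivation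
    [Kg2] of q and a_m, which is the same for all j. G_2-invariant expressions in the b_j feel only
    w. *)
Lemma pd_bv y m j k : U y -> pd e m (fun z=> bv z j k) y =
 comb (w y m j) (bv y) k - comb (bv y j) (Kg2 (q^~ y) (av y m)) k.
move=> Uy.
have D1 : differentiable (fun z=> s * av z j k) y.
 apply: differentiableM; [exact: differentiable_cst|exact: (da pf)].
have D2 : differentiable (fun z=> tau j z * q k z) y.
 by apply: differentiableM; [exact: dtau|exact: (dq pf)].
rewrite /bv (pdD e m D1 D2) (pdZ e s m (da pf j k Uy)) (pd_av pf)//.
rewrite (pdM e m (dtau j Uy) (dq pf k Uy)) tau_pd// -/(av y m k) comb_Kg2.
have -> : lc (bv y j) (q^~ y) = tau j y.
 rewrite /bv lcDl !lcZl lc_sym (qa pf)// mulr0 add0r.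
 by rewrite [lc _ _](pf_q1 pf Uy) mulr1.
have -> : lc (bv y j) (av y m) = s * hp y j m.
 by rewrite /bv lcDl !lcZl (qa pf)// mulr0 addr0.
have -> : ps4 (q^~ y) (av y m) (bv y j) (fun i=> (i == k)%:R) = s * \sum_l tor y m j l * av y l k.
 by rewrite tor_av// /bv ps4_lin3 ps4_alt13 mulr0 addr0.
have -> : comb (w y m j) (bv y) k = s * (\sum_l LCk e y m j l * av y l k) +
  (\sum_l LCk e y m j l * tau l y) * q k y + 2^-1 * (s * \sum_l tor y m j l * av y l k).
 transitivity (s * (\sum_l LCk e y m j l * av y l k) +
  (\sum_l LCk e y m j l * tau l y) * q k y + 2^-1 * (s * (\sum_l tor y m j l * av y l k)
   + (\sum_l tor y m j l * tau l y) * q k y)).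
  rewrite /comb (eq_lcl _ (y := fun l=> LCk e y m j l + 2^-1 * tor y m j l)); last first.
   by move=> l; rewrite (wE m j l Uy) mul1r.
  exact: comb_bv_algebra.
 by rewrite tor_tau// mul0r addr0.
rewrite (hp_sym e q y j m).
move: (\sum_l _ * av y l k) (\sum_l tor y m j l * _)=> X Y; ring.
Qed.

Lemma pd_bv_comb y m j : U y -> (fun k=> pd e m (fun z=> bv z j k) y) =
 (fun k=> comb (w y m j) (bv y) k - comb (bv y j) (Kg2 (q^~ y) (av y m)) k).
by move=> Uy; ext k; exact: pd_bv. Qed.

Lemma diff_bv y j k : U y -> differentiable (fun z=> bv z j k) y.
move=> Uy; apply: differentiableD; apply: differentiableM.
- exact: differentiable_cst.
- exact: (da pf).
- exact: dtau.
- exact: (dq pf).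
Qed.

Lemma pd_om3_bv y m i j k : U y -> pd e m (fun z=> om3 (bv z i) (bv z j) (bv z k)) y =
 so3 (w y m) (fun i j k=> om3 (bv y i) (bv y j) (bv y k)) i j k.
move=> Uy; rewrite (@pd_om3 _ _ e (fun k z=> bv z i k) (fun k z=> bv z j k)
 (fun k' z=> bv z k k')); try by move=> ?; exact: diff_bv.
rewrite !pd_bv_comb// om3_sub1 om3_sub2 om3_sub3.
rewrite (sub_sum3 _ _ _ (der_om3 (Kg2_anti (q^~ y) (av y m)) (Qv_Kg2 (q^~ y) (av y m)) (bv y i) (bv y j) (bv y k))).
by rewrite om3_comb1 om3_comb2 om3_comb3 /so3 !big_split.
Qed.

Lemma pd_ps4_bv y m i j k l : U y -> pd e m (fun z=> ps4 (bv z i) (bv z j) (bv z k) (bv z l)) y =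
 so4 (w y m) (fun i j k l=> ps4 (bv y i) (bv y j) (bv y k) (bv y l)) i j k l.
move=> Uy; rewrite (@pd_ps4 _ _ e (fun k z=> bv z i k) (fun k z=> bv z j k)
 (fun k' z=> bv z k k') (fun k z=> bv z l k)); try by move=> ?; exact: diff_bv.
rewrite !pd_bv_comb// ps4_sub1 ps4_sub2' ps4_sub3' ps4_sub4'.
rewrite (sub_sum4 _ _ _ _ (der_ps4 (Kg2_anti (q^~ y) (av y m)) (Qv_Kg2 (q^~ y) (av y m))
 (bv y i) (bv y j) (bv y k) (bv y l))).
by rewrite ps4_comb1 ps4_comb2 ps4_comb3 ps4_comb4 /so4 !big_split.
Qed.

(** For tau = 0 the point q itself also moves by minus the same derivation, so forms contracted with
    q are covered; this is the case of F on the sphere. *)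
Lemma pd_om3_qbv y m i j : (forall z l, U z -> tau l z = 0) -> U y ->
 pd e m (fun z=> om3 (q^~ z) (bv z i) (bv z j)) y = so2 (w y m) (fun i j=> om3 (q^~ y) (bv y i) (bv y j)) i j.
move=> tau0 Uy; rewrite (@pd_om3 _ _ e q (fun k z=> bv z i k) (fun k z=> bv z j k));
 [|by move=> k; exact: (dq pf)|by move=> k; exact: diff_bv..].
rewrite !pd_bv_comb// om3_sub2 om3_sub3.
have -> : (fun k=> pd e m (q k) y) = fun k=> 0 - comb (q^~ y) (Kg2 (q^~ y) (av y m)) k.
 ext k; rewrite comb_Kg2 ps4_alt13 mulr0 (qa pf)// mul0r addr0.
 by rewrite [lc _ _](pf_q1 pf Uy) mul1r !sub0r opprK.
rewrite om3_sub1 (sub_sum3 _ _ _ (der_om3 (Kg2_anti (q^~ y) (av y m)) (Qv_Kg2 (q^~ y) (av y m))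
 (q^~ y) (bv y i) (bv y j))).
rewrite om3_comb2 om3_comb3 (_ : om3 (fun=> 0) _ _ = 0) ?add0r ?/so2 ?big_split//.
by rewrite /om3 /lc3 /lc big1// => k _; rewrite mul0r.
Qed.

(** The derivation [Kg2] of q and a_m transported to the frame by b. Its difference from the torsion
    matrix T_m / 2 is the rotation s (tau /\ h_m). *)
Definition cm y m i j : R :=
 2^-1 * tor y m i j - s * (tau i y * hp y m j - tau j y * hp y m i).

(** The unit length of tau is needed to bring back the component along q. *)
Lemma cm_comb y m i k : U y -> \sum_l tau l y * tau l y = 1 ->
 comb (cm y m i) (bv y) k = comb (bv y i) (Kg2 (q^~ y) (av y m)) k.
move=> Uy tt; rewrite comb_Kg2.
have -> : lc (bv y i) (q^~ y) = tau i y.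
 rewrite /bv lcDl !lcZl lc_sym (qa pf)// mulr0 add0r.
 by rewrite [lc _ _](pf_q1 pf Uy) mulr1.
have -> : lc (bv y i) (av y m) = s * hp y i m.
 by rewrite /bv lcDl !lcZl (qa pf)// mulr0 addr0.
have -> : ps4 (q^~ y) (av y m) (bv y i) (fun i=> (i == k)%:R) = s * \sum_l tor y m i l * av y l k.
 by rewrite tor_av// /bv ps4_lin3 ps4_alt13 mulr0 addr0.
have H : \sum_l hp y m l * av y l k = av y m k.
 transitivity (lc (av y m) (comb (fun l=> av y l k) (av y))).
  by rewrite lc_combr; eq_sum l; rewrite mulrC.
 rewrite (_ : comb _ _ = fun i=> (i == k)%:R - q k y * q i y).
  by rewrite lcB lcZ lc_delta [lc _ _]lc_sym (qa pf)// mulr0 subr0.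
 ext x; rewrite /comb /lc (av_complete pf)// eq_sym.
 by congr (_ - _).
rewrite (hp_sym e q y i m).
transitivity (2^-1 * (s * (\sum_l tor y m i l * av y l k)
  + (\sum_l tor y m i l * tau l y) * q k y)
 - s * (tau i y * (s * (\sum_l hp y m l * av y l k) + (\sum_l hp y m l * tau l y) * q k y)
     - hp y m i * (s * (\sum_l tau l y * av y l k) + (\sum_l tau l y * tau l y) * q k y))).
 exact: comb_cm_algebra.
rewrite tor_tau// tau_av// tt H [\sum_l hp y m l * _](hp_tau m Uy).
move: (\sum_l _)=> X; rewrite !mul0r mulr0 add0r !addr0 mul1r.
by rewrite mulrBr (mulrCA s (tau i y)) !(mulrA s s) -expr2 s2 mul1r; ring.
Qed.

End ParallelStructure.

(** * Closure and rigidity of the structure algebras *)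

Section StructureAlgebra.
Variables (R : realType) (n : nat).

(** What the spinor arguments require of g: stability under differences and scaling, and that a
    connection with coefficients in g has curvature in g. Every stabilizer of a tensor qualifies. *)
Definition holonomy_closed (g : 'M[R]_n -> Prop) : Prop :=
 [/\ forall A B, g A -> g B -> g (A - B), forall c A, g A -> g (c *: A) &
   forall (U : set 'rV[R]_n) (e : frame R n) (w : coefs R n) y m p, open U ->
    (forall y m i j, U y -> differentiable (fun z=> w z m i j) y) -> U y -> (forall z m, U z -> g (wmx w z m)) ->
    g (\matrix_(a, b) curv e w y m p a b)].

Lemma stabilizer_closed k (c : ('I_k -> 'I_n) -> R) : holonomy_closed (fun A=> forall I, so_act A c I = 0).
split=> [A B HA HB I|a A HA I|U e w y m p oU dw Uy H I].
- by rewrite so_actD so_actN HA HB subrr.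
- by rewrite so_actZ HA mulr0.
- by apply: (so_act_curv e oU dw m p I Uy)=> z m' J Uz; exact: H.
Qed.

Lemma holonomy_closed_and (g g' : 'M[R]_n -> Prop) : holonomy_closed g ->
 holonomy_closed g' -> holonomy_closed (fun A=> g A /\ g' A).
move=> [gB gZ gC] [gB' gZ' gC']; split=> [A B [HA HA'] [HB HB']|a A [HA HA']| U e w y m p oU dw Uy H].
- by split; [exact: gB|exact: gB'].
- by split; [exact: gZ|exact: gZ'].
- by split; [apply: gC oU dw Uy _|apply: gC' oU dw Uy _]=> z m' Uz; case: (H z m' Uz).
Qed.

Lemma eq_holonomy_closed (g g' : 'M[R]_n -> Prop) : (forall A, g A <-> g' A) ->
 holonomy_closed g -> holonomy_closed g'.
by move=> E; have -> : g = g' by ext A; apply/propext. Qed.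

(** A three-form whose contractions all lie in g is zero. Two torsion three-forms of connections
    preserving the same structure differ by such a form. *)
Definition no_prolongation (g : 'M[R]_n -> Prop) : Prop :=
 forall S : 'I_n -> 'I_n -> 'I_n -> R, (forall i j k, S j i k = - S i j k) -> (forall i j k, S i k j = - S i j k) ->
 (forall m, g (\matrix_(i, j) S m i j)) -> forall i j k, S i j k = 0.

End StructureAlgebra.

Lemma anti_trmx R n (C : Bil n R) : (forall i j, C j i = - C i j) -> (\matrix_(i, j) C i j)^T = - \matrix_(i, j) C i j.
by move=> anti; apply/matrixP=> i j; rewrite !mxE anti. Qed.

Section StructureGroups.
Variable R : realType.

Lemma eq_Qv (A B : Bil 7 R) x : (forall a b, A a b = B a b) -> Qv A x = Qv B x.
by move=> E; eq_sum a; eq_sum b; rewrite E. Qed.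
Lemma eq_Pv (A B : Bil 8 R) x : (forall a b, A a b = B a b) -> Pv A x = Pv B x.
by move=> E; rewrite /Pv E; congr (_ + _); apply: eq_Qv. Qed.

Lemma su3_closed : holonomy_closed (@in_su3 R).
apply: eq_holonomy_closed (holonomy_closed_and (stabilizer_closed (@F_std R))
 (holonomy_closed_and (stabilizer_closed (@Psip_std R)) (stabilizer_closed (@Psim_std R)))).
by move=> A; split=> [[? [? ?]]|[? ? ?]].
Qed.

Lemma g2_no_prolongation : no_prolongation (@in_g2 R).
move=> S S12 S23 gS; apply: g2_unique=> // m x.
rewrite -(iffLR (in_g2P (anti_trmx (S23 m))) (gS m) x); apply: eq_Qv=> a b.
by rewrite mxE.
Qed.

Lemma spin7_no_prolongation : no_prolongation (@in_spin7 R).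
move=> S S12 S23 gS; apply: spin7_unique=> // m x.
rewrite -(iffLR (in_spin7P (anti_trmx (S23 m))) (gS m) x); apply: eq_Pv=> a b.
by rewrite mxE.
Qed.

(** Extension by zero along e_7 turns a three-form with values in su(3) into one with values in
    g2. *)
Lemma su3_no_prolongation : no_prolongation (@in_su3 R).
move=> S S12 S23 gS.
pose S7 (i j k : 'I_7) := if insub (val i) is Some a then ext6 (S a) j k else 0.
have S7E a j k : S7 (w67 a) j k = ext6 (S a) j k by rewrite /S7 valK.
have S76 j k : S7 (od 6) j k = 0 by rewrite /S7 insubF.
have anti := fun m=> ext6_anti (S23 m).
have S70 : forall i j k, S7 i j k = 0.
 apply: g2_unique=> [i j k|i j k|m x].
 - case: (ord7P i)=> [|a]; case: (ord7P j)=> [|b]; rewrite ?S76 ?S7E ?ext6_l ?oppr0//.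
  case: (ord7P k)=> [|c]; first by rewrite !ext6_r oppr0.
  by rewrite !ext6E S12.
 - case: (ord7P i)=> [|a]; first by rewrite !S76 oppr0.
  by rewrite !S7E anti.
 - case: (ord7P m)=> [|a].
   by rewrite /Qv big1// => i _; rewrite big1// => j _; rewrite S76 mul0r.
  rewrite -(iffLR (in_su3P (anti_trmx (S23 a))) (gS a) x); apply: eq_Qv=> i j.
  rewrite S7E /ext6; case: insub=> // i'; case: insub=> // j'.
  by rewrite mxE.
by move=> i j k; rewrite -(S70 (w67 i) (w67 j) (w67 k)) S7E ext6E.
Qed.

End StructureGroups.

(** * Spinor equations and uniqueness of torsion in one adapted frame *)

Section AdaptedFrame.
Variables (R : realType) (r : nat).
Notation n := (6 + r)%N.
Context (U : set 'rV[R]_n) (e : frame R n) q t (pf : product_frame (r := r) U e q t).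
Let oU := pf_open pf.

Notation av := (av e q).
Notation hp := (hp e q).
Notation tor := (tor e q).

Definition alt_form (T : lform R n 3) : Prop := forall y i j k, U y ->
 T y (tup3 j i k) = - T y (tup3 i j k) /\ T y (tup3 i k j) = - T y (tup3 i j k).

Lemma tor_form_alt T : tor_form U e q T -> alt_form T.
move=> TE y i j k Uy; rewrite (TE y j i k Uy) (TE y i k j Uy) (TE y i j k Uy).
by split; [exact: tor12|exact: tor23].
Qed.

Lemma conn_anti T y m i j : alt_form T -> U y -> conn e 2^-1 T y m j i = - conn e 2^-1 T y m i j.
move=> alt Uy; rewrite /conn -LCk_eq -[idx3 m j i]/(tup3 m j i) -[idx3 m i j]/(tup3 m i j).
have [_ ->] := alt y m i j Uy; have := LCk_metric e y m i j.
move: (LCk e y m i j) (LCk e y m j i) (T y _)=> x z u; lra.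
Qed.

Lemma differentiable_tor_conn w y m i j : tor_conn U e q 1 w -> U y -> differentiable (fun z=> w z m i j) y.
move=> wE Uy.
have E z : U z -> LCk e z m i j + 1 / 2 * tor z m i j = w z m i j by move=> Uz; rewrite wE.
apply: (diff_eqon oU E Uy).
apply: differentiableD; first exact: (dLC pf).
by apply: differentiableM; [exact: differentiable_cst|exact: (dtor pf)].
Qed.

Variable g : 'M[R]_n -> Prop.
Hypotheses (gcl : holonomy_closed g) (gnp : no_prolongation g).
Hypothesis tor_g : forall w y m, tor_conn U e q 1 w -> U y -> g (wmx w y m).

(** Twice the difference of the two connections is the difference of their torsions: a three-form
    with values in g, hence zero. *)
Lemma torsion_unique T : alt_form T -> (forall y m, U y -> g (wmx (conn e 2^-1 T) y m)) -> tor_form U e q T.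
move=> alt gT y i j k Uy; apply/subr0_eq.
have [gB gZ _] := gcl.
apply: (gnp (S := fun i j k=> T y (tup3 i j k) - tor y i j k))=> {i j k} [i j k|i j k|m].
- by have [-> _] := alt y i j k Uy; rewrite tor12; ring.
- by have [_ ->] := alt y i j k Uy; rewrite tor23; ring.
pose w : coefs R n := fun y i j k=> LCk e y i j k + 1 / 2 * tor y i j k.
have wE : tor_conn U e q 1 w by [].
have := gZ 2 _ (gB _ _ (gT y m Uy) (tor_g m wE Uy)); congr g.
apply/matrixP=> i j; rewrite !mxE /conn /w -LCk_eq -[idx3 m i j]/(tup3 m i j).
by move: (LCk e y m i j) (T y _) (tor y m i j)=> x z u; field.
Qed.

Variable T : lform R n 3.
Hypothesis TE : tor_form U e q T.
Variables (K : nat) (gam : 'I_n -> 'M[R]_K) (eta : 'cV[R]_K).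
Hypothesis ds : defining_spinor g gam eta.

Let wE : tor_conn U e q 1 (conn e 2^-1 T).
by apply: conn_tor_conn TE _; rewrite mul1r. Qed.

Lemma adapted_gravitino y : U y -> gravitino_at gam e T (fun=> eta) y.
move=> Uy; apply: (parallel_gravitino ds)=> [m i j|m].
 exact: conn_anti (tor_form_alt TE) Uy.
exact: tor_g.
Qed.

(** Holonomy puts the endomorphism part of the curvature in g, whereas the equation concerns the
    two-form part; pair symmetry exchanges the two. *)
Lemma adapted_gaugino y : U y -> gaugino_at gam e (conn e 2^-1 T) (fun=> eta) y.
move=> Uy; apply: (holonomy_gaugino ds)=> [m p a b|a b].
 rewrite !(curv_tor_conn pf _ _ _ _ wE Uy).
 by have [-> _] := cvf_anti pf Uy.
have [_ _ gC] := gcl.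
have -> : \matrix_(m, p) curv e (conn e 2^-1 T) y m p a b = \matrix_(m, p) curv e (conn e 2^-1 T) y a b m p.
 by apply/matrixP=> m p; rewrite !mxE (curv_pair pf m p a b wE Uy).
apply: (gC U)=> // [z m i j Uz|z m Uz]; first exact: differentiable_tor_conn.
exact: tor_g.
Qed.

Lemma adapted_dilatino y (s : R) tau (phi : 'rV[R]_n -> R) : U y -> (forall k, \sum_l tau l y * av y l k = 0) ->
 (forall m, g (\matrix_(i, j) cm e q s tau y m i j)) -> (forall m, pd e m phi y = - 2 * s * tau m y) ->
 dilatino_at gam e T phi (fun=> eta) y.
move=> Uy tau_av gC dphi.
apply: (@torsion_dilatino _ _ _ _ _ _ ds e T phi y (fun i=> tau i y) (hp y) s).
- by move=> i j; rewrite hp_sym.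
- move=> m; transitivity (lc (av y m) (comb (fun l=> tau l y) (av y))).
  by rewrite lc_combr; eq_sum l; rewrite mulrC.
 rewrite (_ : comb _ _ = fun=> 0) ?lc0//.
 by ext k; rewrite /comb /lc tau_av.
- exact: (hp_trace pf Uy).
- by move=> m i j; have [_ ->] := tor_form_alt TE m i j Uy.
- move=> m; have := gC m; congr g; apply/matrixP=> i j; rewrite !mxE /cm.
 by rewrite -(TE m i j Uy).
- exact: dphi.
Qed.

End AdaptedFrame.

Lemma so2_mx R n (C f : Bil n R) i j : so2 (\matrix_(i, j) C i j) f i j = so2 C f i j.
by eq_sum l; rewrite !mxE. Qed.
Lemma so3_mx R n (C : Bil n R) f i j k : so3 (\matrix_(i, j) C i j) f i j k = so3 C f i j k.
by eq_sum l; rewrite !mxE. Qed.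
Lemma so4_mx R n (C : Bil n R) f i j k l : so4 (\matrix_(i, j) C i j) f i j k l = so4 C f i j k l.
by eq_sum x; rewrite !mxE. Qed.

Lemma lc_cm_algebra R n (T H t u : 'I_n -> R) (s ti hi : R) : lc (fun l=> 2^-1 * T l - s * (ti * H l - t l * hi)) u =
 2^-1 * (\sum_l T l * u l) - s * (ti * lc H u - (\sum_l t l * u l) * hi).
rewrite /lc mulr_sumr mulr_suml mulr_sumr -sumrN -big_split mulr_sumr -sumrN -big_split.
by eq_sum l=> /=; ring.
Qed.

Lemma Phi_pd_algebra R (p a1 b1 c1 d1 a2 b2 c2 d2 a3 b3 c3 d3 a4 b4 c4 d4 : R) :
 a1 * b1 + c1 * d1 - (a2 * b2 + c2 * d2) + (a3 * b3 + c3 * d3) - (a4 * b4 + c4 * d4) + p =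
 c1 * d1 - c2 * d2 + c3 * d3 - c4 * d4 + (a1 * b1 - a2 * b2 + a3 * b3 - a4 * b4) + p.
ring. Qed.

Lemma differentiable_om3 R n (u v w : 'I_7 -> 'rV[R]_n -> R) y :
 (forall i, differentiable (u i) y) -> (forall i, differentiable (v i) y) -> (forall i, differentiable (w i) y) ->
 differentiable (fun z=> om3 (u^~ z) (v^~ z) (w^~ z)) y.
move=> du dv dw; have cst (c : R) : differentiable (fun=> c : R) y.
 exact: differentiable_cst.
apply: (diff_lc (x := fun i z=> lc (v^~ z) (fun j=> lc (w^~ z) (omr R i j))))=> // i.
apply: (diff_lc (x := fun j z=> lc (w^~ z) (omr R i j)))=> // j.
exact: (diff_lc (x := fun k z=> omr R i j k)).
Qed.

Lemma differentiable_ps4 R n (u v w x : 'I_7 -> 'rV[R]_n -> R) y :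
 (forall i, differentiable (u i) y) -> (forall i, differentiable (v i) y) ->
 (forall i, differentiable (w i) y) -> (forall i, differentiable (x i) y) ->
 differentiable (fun z=> ps4 (u^~ z) (v^~ z) (w^~ z) (x^~ z)) y.
move=> du dv dw dx; have cst (c : R) : differentiable (fun=> c : R) y.
 exact: differentiable_cst.
apply: (diff_lc (x := fun i z=> lc (v^~ z) (fun j=> lc (w^~ z) (fun k=> lc (x^~ z) (psr R i j k)))))=> // i.
apply: (diff_lc (x := fun j z=> lc (w^~ z) (fun k=> lc (x^~ z) (psr R i j k))))=> // j.
apply: (diff_lc (x := fun k z=> lc (x^~ z) (psr R i j k)))=> // k.
exact: (diff_lc (x := fun l z=> psr R i j k l)).
Qed.

(** * The torsion connection preserves the G_2, SU(3) and Spin(7) structures *)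

Section G2Frames.
Variable R : realType.
Notation n := (6 + 1)%N.
Context (U : set 'rV[R]_n) (e : frame R n) q t (pf : product_frame (r := 1) U e q t).
Variable s : R.
Hypothesis s2 : s ^+ 2 = 1.
Notation bv := (bv e q s (t 0)).
Hypothesis adapted : forall y (i j k : 'I_7), U y -> om3 (bv y i) (bv y j) (bv y k) = omr R i j k.

Let dtau s0 : forall (j : 'I_n) y, U y -> differentiable (t s0 j) y.
by move=> j y; exact: (dt pf). Qed.
Let tau_pd s0 : forall m j y, U y -> pd e m (t s0 j) y = \sum_l LCk e y m j l * t s0 l y.
by move=> m j y; exact: (pd_t pf). Qed.
Let tau_av s0 : forall k y, U y -> \sum_l t s0 l y * av e q y l k = 0.
by move=> k y; exact: (tv_av pf). Qed.

Lemma g2_omega_act y (C : Bil 7 R) : U y ->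
 (forall i j k, so3 C (fun i j k=> om3 (bv y i) (bv y j) (bv y k)) i j k = 0) -> in_g2 (\matrix_(i, j) C i j).
move=> Uy H I; rewrite (tup3_eta I) so3E so3_mx -[RHS](H (I (od 0)) (I (od 1)) (I (od 2))).
by apply: eq_so3=> i j k; rewrite omega_stdE adapted.
Qed.

(** In an adapted frame the components of omega are constant, and by [pd_om3_bv] their derivative is
    the action of w. *)
Lemma g2_tor_conn w y (m : 'I_7) : tor_conn U e q 1 w -> U y -> in_g2 (wmx w y m).
move=> wE Uy; apply: (@g2_omega_act y (w y m) Uy)=> i j k.
rewrite -(pd_om3_bv pf s (dtau 0) (tau_pd 0) (tau_av 0) wE _ _ _ _ Uy).
rewrite (@pd_eqon _ _ _ e (pf_open pf) _ (fun=> omr R i j k)) ?pd_cst// => z Uz.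
exact: adapted.
Qed.

Lemma g2_cm y (m : 'I_7) : U y -> in_g2 (\matrix_(i, j) cm e q s (t 0) y m i j).
move=> Uy; apply: (g2_omega_act Uy)=> i j k.
apply: (so3_frame (Kg2_anti (q^~ y) (av e q y m)) (Qv_Kg2 (q^~ y) (av e q y m)))=> {}i {}k.
apply: (cm_comb pf s2 (tau_av 0) _ _ _ Uy).
by rewrite (tv_tv pf).
Qed.

End G2Frames.

Section SU3Frames.
Variable R : realType.
Notation n := (6 + 0)%N.
Context (U : set 'rV[R]_n) (e : frame R n) q t (pf : product_frame (r := 0) U e q t).
Variable s : R.
Hypothesis s2 : s ^+ 2 = 1.
Notation bv := (bv e q s (fun _ _ => 0)).
Hypothesis adaptedF : forall y (i j : 'I_6), U y -> om3 (q^~ y) (bv y i) (bv y j) = omr R (od 6) (w67 i) (w67 j).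
Hypothesis adaptedP : forall y (i j k : 'I_6), U y -> om3 (bv y i) (bv y j) (bv y k) = omr R (w67 i) (w67 j) (w67 k).

(** Here tau = 0 and the isometry is s times the inclusion of the tangent space. F and Psi^+ are
    handled by differentiation, and Psi^- follows from them through [Qv_ext6]. *)
Lemma su3_tor_conn w y (m : 'I_6) : tor_conn U e q 1 w -> U y -> in_su3 (wmx w y m).
move=> wE Uy.
have AT : (wmx w y m)^T = - wmx w y m.
 by apply: anti_trmx=> i j; exact: (w_anti wE).
have tau_pd m' (j : 'I_n) y' : U y' -> pd e m' (fun=> 0 : R) y' = \sum_l LCk e y' m' j l * 0.
 by move=> _; rewrite pd_cst big1// => l _; rewrite mulr0.
have tau_av k y' : U y' -> \sum_(l < n) 0 * av e q y' l k = 0.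
 by move=> _; rewrite big1// => l _; rewrite mul0r.
have dtau (j : 'I_n) y' : U y' -> differentiable (fun=> 0 : R) y'.
 by move=> _; exact: differentiable_cst.
apply/in_su3P=> //; apply: Qv_ext6=> // I.
 rewrite (tup2_eta I) so2E so2_mx.
 transitivity (- so2 (w y m) (fun i j=> om3 (q^~ y) (bv y i) (bv y j)) (I (od 0)) (I (od 1))).
  rewrite -sumrN; eq_sum l; rewrite !F_stdE !(adaptedF _ _ Uy) /omr /=.
  ring.
 rewrite -(pd_om3_qbv pf s dtau tau_pd tau_av wE m (I (od 0)) (I (od 1)) _ Uy)//.
 rewrite (@pd_eqon _ _ _ e (pf_open pf) _ (fun=> omr R (od 6) (w67 (I (od 0))) (w67 (I (od 1))))) ?pd_cst ?oppr0// => z Uz.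
 exact: adaptedF.
rewrite (tup3_eta I) so3E so3_mx.
transitivity (- so3 (w y m) (fun i j k=> om3 (bv y i) (bv y j) (bv y k)) (I (od 0)) (I (od 1)) (I (od 2))).
 rewrite -sumrN; eq_sum l; rewrite !Psip_stdE !(adaptedP _ _ _ Uy) /omr /=.
 ring.
rewrite -(pd_om3_bv pf s dtau tau_pd tau_av wE _ _ _ _ Uy).
rewrite (@pd_eqon _ _ _ e (pf_open pf) _ (fun=> omr R (w67 (I (od 0))) (w67 (I (od 1))) (w67 (I (od 2))))) ?pd_cst ?oppr0// => z Uz.
exact: adaptedP.
Qed.

End SU3Frames.

Section Spin7Frames.
Variable R : realType.
Notation n := (6 + 2)%N.
Context (U : set 'rV[R]_n) (e : frame R n) q t (pf : product_frame (r := 2) U e q t).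
Variable s : R.
Hypothesis s2 : s ^+ 2 = 1.
Notation bv := (bv e q s (t 0)).
Hypothesis adapted : forall y (i j k l : 'I_8), U y -> Phi_form (bv y) (fun i=> t 1 i y) i j k l = phr R i j k l.

Let dtau s0 : forall (j : 'I_n) y, U y -> differentiable (t s0 j) y.
by move=> j y; exact: (dt pf). Qed.
Let tau_pd s0 : forall m j y, U y -> pd e m (t s0 j) y = \sum_l LCk e y m j l * t s0 l y.
by move=> m j y; exact: (pd_t pf). Qed.
Let tau_av s0 : forall k y, U y -> \sum_l t s0 l y * av e q y l k = 0.
by move=> k y; exact: (tv_av pf). Qed.

Lemma spin7_Phi_act y (C : Bil 8 R) : U y -> (forall i j k l, so4 C (Phi_form (bv y) (fun i=> t 1 i y)) i j k l = 0) ->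
 in_spin7 (\matrix_(i, j) C i j).
move=> Uy H I; rewrite (idx4_eta I) so4E so4_mx.
rewrite -[RHS](H (I (od 0)) (I (od 1)) (I (od 2)) (I (od 3))).
by apply: eq_so4=> i j k l; rewrite Phi_stdE adapted.
Qed.

Lemma pd_Phi_form w y m i j k l : tor_conn U e q 1 w -> U y ->
 pd e m (fun z=> Phi_form (bv z) (fun i=> t 1 i z) i j k l) y =
 so4 (w y m) (Phi_form (bv y) (fun i=> t 1 i y)) i j k l.
move=> wE Uy.
have du i' : differentiable (t 1 i') y by exact: dtau.
have db i' k' : differentiable (fun z=> bv z i' k') y.
 exact: (diff_bv pf s (dtau 0)).
have do3 a b c : differentiable (fun z=> om3 (bv z a) (bv z b) (bv z c)) y.
 exact: (@differentiable_om3 _ _ (fun k z=> bv z a k) (fun k z=> bv z b k) (fun k z=> bv z c k)).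
have dp4 a b c d : differentiable (fun z=> ps4 (bv z a) (bv z b) (bv z c) (bv z d)) y.
 exact: (@differentiable_ps4 _ _ (fun k z=> bv z a k) (fun k z=> bv z b k)
  (fun k z=> bv z c k) (fun k z=> bv z d k)).
have po a b c := pd_om3_bv pf s (dtau 0) (tau_pd 0) (tau_av 0) wE m a b c Uy.
have pp a b c d := pd_ps4_bv pf s (dtau 0) (tau_pd 0) (tau_av 0) wE m a b c d Uy.
have pu j' : pd e m (t 1 j') y = lc (w y m j') (fun l=> t 1 l y).
 rewrite (pd_t pf)//; transitivity (\sum_l LCk e y m j' l * t 1 l y + 2^-1 * \sum_l tor e q y m j' l * t 1 l y).
  by rewrite (tor_tau (tau_av 1) m j' Uy) mulr0 addr0.
 rewrite mulr_sumr -big_split; apply: eq_bigr=> l' _ /=.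
 by rewrite (wE y m j' l' Uy) mul1r mulrDl mulrA.
have dM a b c d : differentiable (fun z=> t 1 a z * om3 (bv z b) (bv z c) (bv z d)) y.
 exact: differentiableM.
have pM a b c d : pd e m (fun z=> t 1 a z * om3 (bv z b) (bv z c) (bv z d)) y =
  lc (w y m a) (fun l=> t 1 l y) * om3 (bv y b) (bv y c) (bv y d) +
  t 1 a y * so3 (w y m) (fun i j k=> om3 (bv y i) (bv y j) (bv y k)) b c d.
 by rewrite (pdM e m (du a) (do3 b c d)) pu po.
have D1 := differentiableB (dM i j k l) (dM j i k l).
have D2 := differentiableD D1 (dM k i j l).
have D3 := differentiableB D2 (dM l i j k).
rewrite /Phi_form (pdD e m D3 (dp4 i j k l)) (pdB e m D2 (dM l i j k)).
rewrite (pdD e m D1 (dM k i j l)) (pdB e m (dM i j k l) (dM j i k l)).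
rewrite !pM pp so4_wedge; exact: Phi_pd_algebra.
Qed.

Lemma spin7_tor_conn w y (m : 'I_8) : tor_conn U e q 1 w -> U y -> in_spin7 (wmx w y m).
move=> wE Uy; apply: (@spin7_Phi_act y (w y m) Uy)=> i j k l.
rewrite -(pd_Phi_form _ _ _ _ _ wE Uy).
rewrite (@pd_eqon _ _ _ e (pf_open pf) _ (fun=> phr R i j k l)) ?pd_cst// => z Uz.
exact: adapted.
Qed.

(** Besides acting as a derivation of R^7, [cm] must annihilate the one-form of the second line; it
    does, since torsion and [hp] vanish there and the two line forms are orthogonal. *)
Lemma spin7_cm y (m : 'I_8) : U y -> in_spin7 (\matrix_(i, j) cm e q s (t 0) y m i j).
move=> Uy; apply: (spin7_Phi_act Uy).
apply: (so4_Phi_form (Kg2_anti (q^~ y) (av e q y m)) (Qv_Kg2 (q^~ y) (av e q y m)))=> [i k|i].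
 apply: (cm_comb pf s2 (tau_av 0) _ _ _ Uy).
 by rewrite (tv_tv pf).
transitivity (2^-1 * (\sum_l tor e q y m i l * t 1 l y) - s * (t 0 i y * lc (hp e q y m) (fun l=> t 1 l y)
  - (\sum_l t 0 l y * t 1 l y) * hp e q y m i)).
 rewrite /lc /cm; exact: lc_cm_algebra.
rewrite (tor_tau (tau_av 1) _ _ Uy) (hp_tau (tau_av 1) _ Uy) (tv_tv pf)//.
by rewrite !(mulr0, mul0r) subrr mulr0 subrr.
Qed.

End Spin7Frames.

(** * Levi-Civita symbol and iterated Hodge stars *)

Section LeviCivitaSymbol.
Variable R : realType.

(** The determinant from the definition of [hodge] as a sign: zero unless K is a permutation. It is
    multiplicative under composition, which makes signs of reordered indices computable. *)
Definition lcs n (K : 'I_n -> 'I_n) : R := \det (\matrix_(i, j) (K i == j)%:R : 'M[R]_n).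

Lemma lcs_comp n (K f : 'I_n -> 'I_n) : lcs (K \o f) = lcs f * lcs K.
rewrite /lcs -det_mulmx; congr (\det _); apply/matrixP=> i j; rewrite !mxE.
rewrite (bigD1 (f i))//= !mxE eqxx mul1r big1 ?addr0// => x /negPf xf.
by rewrite !mxE eq_sym xf mul0r.
Qed.
Lemma lcs_perm n (s : 'S_n) : lcs s = (-1) ^+ s.
by rewrite -det_perm; congr (\det _); apply/matrixP=> i j; rewrite !mxE. Qed.

Lemma lcs_inj n (K : 'I_n -> 'I_n) : lcs K != 0 -> injective K.
move=> K0 i j Kij; apply/eqP; apply: contraNT K0=> ij.
by rewrite /lcs (determinant_alternate ij)// => x; rewrite !mxE Kij.
Qed.

Lemma lcs_sqr n (K : 'I_n -> 'I_n) : injective K -> lcs K ^+ 2 = 1.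
move=> Ki; rewrite (_ : lcs K = lcs (perm Ki)); first by rewrite lcs_perm sqrr_sign.
by congr (\det _); apply/matrixP=> i j; rewrite !mxE permE.
Qed.

Definition alt_comps n k (a : ('I_k -> 'I_n) -> R) : Prop :=
 forall (s : 'S_k) I, a (I \o s) = (-1) ^+ s * a I.

Lemma catidx_l (X : Type) k l (I : 'I_k -> X) (J : 'I_l -> X) i : catidx I J (lshift l i) = I i.
by rewrite /catidx (unsplitK (inl i)). Qed.
Lemma catidx_r (X : Type) k l (I : 'I_k -> X) (J : 'I_l -> X) j : catidx I J (rshift k j) = J j.
by rewrite /catidx (unsplitK (inr j)). Qed.

Definition catfun k l (f : 'I_k -> 'I_k) (g : 'I_l -> 'I_l) : 'I_(k + l) -> 'I_(k + l) :=
 catidx (fun i=> lshift l (f i)) (fun j=> rshift k (g j)).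

Lemma catidx_comp (X : Type) k l (I : 'I_k -> X) (J : 'I_l -> X) f g :
 catidx (I \o f) (J \o g) = catidx I J \o catfun f g.
ext x; rewrite /catfun /=; case: (split_ordP x)=> i ->.
 by rewrite !catidx_l.
by rewrite !catidx_r.
Qed.

Lemma lcs_catfun k l (f : 'I_k -> 'I_k) (g : 'I_l -> 'I_l) : lcs (catfun f g) = lcs f * lcs g.
rewrite /lcs -(det_ublock _ 0); congr (\det _); apply/matrixP=> i j.
rewrite mxE /catfun; case: (split_ordP i)=> x ->; case: (split_ordP j)=> y ->;
 rewrite ?catidx_l ?catidx_r ?block_mxEul ?block_mxEur ?block_mxEdl ?block_mxEdr !mxE.
- by rewrite (inj_eq (@lshift_inj _ _)).
- by rewrite eq_lrshift.
- by rewrite eq_rlshift.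
- by rewrite (inj_eq (@rshift_inj _ _)).
Qed.

Lemma lcs_cat_perm k l (I : 'I_k -> 'I_(k + l)) J (s : 'S_k) : lcs (catidx (I \o s) J) = (-1) ^+ s * lcs (catidx I J).
rewrite -[J]/(J \o id) catidx_comp lcs_comp lcs_catfun lcs_perm.
have -> : lcs (id : 'I_l -> 'I_l) = 1.
 by rewrite -(det1 R l); congr (\det _); apply/matrixP=> i j; rewrite !mxE.
by rewrite mulr1.
Qed.

Lemma lcs_cat_permr k l (I : 'I_k -> 'I_(k + l)) J (s : 'S_l) :
 lcs (catidx I (J \o s)) = (-1) ^+ s * lcs (catidx I J).
rewrite -[I]/(I \o id) catidx_comp lcs_comp lcs_catfun lcs_perm.
have -> : lcs (id : 'I_k -> 'I_k) = 1.
 by rewrite -(det1 R k); congr (\det _); apply/matrixP=> i j; rewrite !mxE.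
by rewrite mul1r.
Qed.

Lemma cat_onto n k l (K : 'I_(k + l) -> 'I_n) y : n = (k + l)%N -> injective K -> exists x, K x = y.
move=> nE Ki; subst n; have [g _ gK] := injF_bij Ki.
by exists (g y).
Qed.

Lemma reorder_perm n k (I I' : 'I_k -> 'I_n) : injective I ->
 (forall i, exists i', I i = I' i') -> exists s : 'S_k, I = I' \o s.
move=> Ii /choice[f fE].
have f_inj : injective f by move=> i j ij; apply: Ii; rewrite !fE ij.
by exists (perm f_inj); apply/funext=> i /=; rewrite permE fE.
Qed.

Lemma cat_inj_perm k l (I I' : 'I_k -> 'I_(k + l)) (J : 'I_l -> 'I_(k + l)) :
 injective (catidx I J) -> injective (catidx I' J) -> exists s : 'S_k, I = I' \o s.
move=> Ki K'i; apply: reorder_perm=> [i j ij|i].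
 by apply: (@lshift_inj k l); apply: Ki; rewrite !catidx_l.
have [x] := cat_onto (I i) erefl K'i; case: (split_ordP x)=> y ->.
 by rewrite catidx_l=> <-; exists y.
rewrite catidx_r=> E; have /Ki/eqP : catidx I J (lshift l i) = catidx I J (rshift k y).
 by rewrite catidx_l catidx_r.
by rewrite eq_lrshift.
Qed.

Lemma cat_inj_permr k l (I : 'I_k -> 'I_(k + l)) (J J' : 'I_l -> 'I_(k + l)) :
 injective (catidx I J) -> injective (catidx I J') -> exists s : 'S_l, J = J' \o s.
move=> Ki K'i; apply: reorder_perm=> [i j ij|i].
 by apply: (@rshift_inj k l); apply: Ki; rewrite !catidx_r.
have [x] := cat_onto (J i) erefl K'i; case: (split_ordP x)=> y ->.
 rewrite catidx_l=> E; have /Ki/eqP : catidx I J (lshift l y) = catidx I J (rshift k i).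
  by rewrite catidx_l catidx_r.
 by rewrite eq_lrshift.
by rewrite catidx_r=> <-; exists y.
Qed.

(** F is supported on the reorderings of one injective index tuple, on which it is constant, and
    there are k! of them. *)
Lemma sum_perm_orbit n k (F : ('I_k -> 'I_n) -> R) (I' : 'I_k -> 'I_n) :
 injective I' -> (forall I, F I <> 0 -> exists s : 'S_k, I = I' \o s) -> (forall (s : 'S_k), F (I' \o s) = F I') ->
 \sum_(I : {ffun 'I_k -> 'I_n}) F I = (k`!)%:R * F I'.
move=> I'i F0 Fs.
pose h (s : 'S_k) : {ffun 'I_k -> 'I_n} := [ffun i=> I' (s i)].
have hE s : h s = I' \o s :> ('I_k -> _) by ext i; rewrite ffunE.
have hi : injective h.
 move=> s u /ffunP E; apply/permP=> i; apply: I'i.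
 by have := E i; rewrite !ffunE.
rewrite (bigID (fun I=> I \in [set h s | s in [set: 'S_k]]%SET)) /=.
rewrite [X in _ + X]big1 ?addr0=> [|I nI]; last first.
 have [//|/eqP/F0[s E]] := eqVneq (F I) 0; move/negP: nI; case.
 apply/imsetP; exists s; rewrite ?inE//; apply/ffunP=> i.
 by rewrite ffunE E.
rewrite big_imset /=; last by move=> s u _ _; exact: hi.
under eq_bigr do rewrite hE Fs.
by rewrite sumr_const cardsT card_Sn mulr_natl.
Qed.

(** For fixed distinct indices J only the reorderings of the complementary indices contribute, all
    equally, and the factorial in [hodge] cancels their number. *)
Lemma hodge_inj k l (a : ('I_k -> 'I_(k + l)) -> R) I' (J : 'I_l -> 'I_(k + l)) :
 alt_comps a -> injective (catidx I' J) -> hodge a J = a I' * lcs (catidx I' J).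
move=> alt Ki.
rewrite /hodge (sum_perm_orbit (F := fun I=> a I * lcs (catidx I J)) (I' := I')).
- by rewrite mulKf// pnatr_eq0 -lt0n fact_gt0.
- by move=> i j ij; apply: (@lshift_inj k l); apply: Ki; rewrite !catidx_l.
- move=> I nI; apply: (cat_inj_perm (J := J))=> //; apply: lcs_inj.
 by apply/eqP=> E; apply: nI; rewrite E mulr0.
- by move=> s; rewrite alt lcs_cat_perm mulrACA -expr2 sqrr_sign mul1r.
Qed.

Lemma exists_complement k l (I : 'I_k -> 'I_(k + l)) : injective I ->
 exists J : 'I_l -> 'I_(k + l), injective (catidx I J).
move=> Ii; pose A := ~: [set I i | i in [set: 'I_k]]%SET.
have cA : #|A| = l.
 by rewrite cardsCs finset.setCK card_imset// cardsT !card_ord addKn.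
exists (fun j=> enum_val (cast_ord (esym cA) j))=> x y.
have nA i j : I i <> enum_val (cast_ord (esym cA) j).
 move=> E; have := enum_valP (cast_ord (esym cA) j); rewrite -E inE=> /negP; apply.
 by apply: imset_f; rewrite inE.
case: (split_ordP x)=> i ->; case: (split_ordP y)=> j ->; rewrite ?catidx_l ?catidx_r.
- by move=> /Ii ->.
- by move=> /nA.
- by move=> /esym/nA.
- by move=> /enum_val_inj/cast_ord_inj ->.
Qed.

Lemma sum_lcs_sqr k l (I : 'I_k -> 'I_(k + l)) : injective I ->
 \sum_(J : {ffun 'I_l -> 'I_(k + l)}) lcs (catidx I J) ^+ 2 = (l`!)%:R.
move=> Ii; have [J Ji] := exists_complement Ii.
rewrite (sum_perm_orbit (F := fun J=> lcs (catidx I J) ^+ 2) (I' := J)).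
- by rewrite lcs_sqr// mulr1.
- by move=> i j ij; apply: (@rshift_inj k l); apply: Ji; rewrite !catidx_r.
- move=> J' nJ; apply: (cat_inj_permr (I := I))=> //; apply: lcs_inj.
 by apply/eqP=> E; apply: nJ; rewrite E expr0n.
- by move=> s; rewrite lcs_cat_permr exprMn sqrr_sign mul1r.
Qed.

Lemma sum_catidx n k l (F : ('I_(k + l) -> 'I_n) -> R) : \sum_(K : {ffun 'I_(k + l) -> 'I_n}) F K =
 \sum_(J : {ffun 'I_l -> 'I_n}) \sum_(I : {ffun 'I_k -> 'I_n}) F (catidx I J).
rewrite pair_bigA /=.
rewrite (reindex (fun p : {ffun 'I_l -> 'I_n} * {ffun 'I_k -> 'I_n}=> [ffun x=> catidx p.2 p.1 x])) /=.
 by eq_sum p; congr F; ext x; rewrite ffunE.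
exists (fun K : {ffun 'I_(k + l) -> 'I_n} =>
 ([ffun j=> K (rshift k j)], [ffun i=> K (lshift l i)]))=> [[J I] _|K _] /=.
 by congr (_, _); apply/ffunP=> x; rewrite !ffunE ?catidx_l ?catidx_r.
apply/ffunP=> x; rewrite ffunE; case: (split_ordP x)=> i ->; by rewrite ?catidx_l ?catidx_r !ffunE.
Qed.

(** Each permutation in the wedge is absorbed by reindexing K, its sign being compensated by that of
    [lcs]; the (l + p)! equal copies cancel the factorial of the star. *)
Lemma hodge_wedge l p m (a : ('I_l -> 'I_(l + p + m)) -> R)
  (b : ('I_p -> 'I_(l + p + m)) -> R) (J : 'I_m -> 'I_(l + p + m)) :
 hodge (wedge a b) J = (l`!)%:R^-1 * (p`!)%:R^-1 * \sum_(K : {ffun 'I_(l + p) -> 'I_(l + p + m)})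
   a (fun i=> K (lshift p i)) * b (fun i=> K (rshift l i)) * lcs (catidx K J).
rewrite /hodge /wedge.
set c := _ * (p`!)%:R^-1; set S := RHS.
transitivity (((l + p)`!)%:R^-1 * (c * \sum_(s : 'S_(l + p)) \sum_(K : {ffun 'I_(l + p) -> 'I_(l + p + m)})
  (-1) ^+ s * a (fun i=> K (s (lshift p i))) * b (fun i=> K (s (rshift l i))) * lcs (catidx K J))).
 congr (_ * _); rewrite exchange_big /= [RHS]mulr_sumr; eq_sum K.
 by rewrite -mulrA mulr_suml.
rewrite (eq_bigr (fun=> \sum_(K : {ffun 'I_(l + p) -> 'I_(l + p + m)})
  a (fun i=> K (lshift p i)) * b (fun i=> K (rshift l i)) * lcs (catidx K J))).
 set X := \sum_(K : {ffun _}) _; rewrite sumr_const card_Sn -[X *+ _]mulr_natl (mulrCA c) mulKf//.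
move=> s _.
pose h (K : {ffun 'I_(l + p) -> 'I_(l + p + m)}) := [ffun x=> K (s x)].
rewrite [RHS](reindex h) /=; last first.
 exists (fun K : {ffun 'I_(l + p) -> 'I_(l + p + m)}=> [ffun x=> K (s^-1%g x)])=> K _;
  by apply/ffunP=> x; rewrite !ffunE ?permKV ?permK.
eq_sum K.
have -> : h K = K \o s :> ('I_(l + p) -> _) by ext x; rewrite ffunE.
rewrite (lcs_cat_perm K J s) -!mulrA mulrCA; congr (_ * _).
by rewrite mulrCA.
Qed.

Lemma alternating_noninj n k (a : ('I_k -> 'I_n) -> R) I : alt_comps a -> ~ injective I -> a I = 0.
move=> alt nI.
have [i [j [Iij ij]]] : exists i j, I i = I j /\ i != j.
 apply: contrapT=> H; apply: nI=> i j Iij; apply/eqP; apply: contrapT=> ij.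
 by apply: H; exists i, j; split=> //; apply/negP.
have := alt (tperm i j) I; rewrite odd_tperm ij expr1 mulN1r.
have -> : I \o tperm i j = I.
 by apply/funext=> x /=; case: tpermP=> [->|->|//].
lra.
Qed.

(* Compares the two orders of the blocks of sizes l, p and 1. *)
Definition block_rot l p : 'I_(l + p + 1) -> 'I_(p + 1 + l) :=
 catidx (catidx (fun i : 'I_l=> rshift (p + 1) i) (fun i : 'I_p=> lshift l (lshift 1 i)))
     (fun i : 'I_1=> lshift l (rshift p i)).

Lemma catidx_rot (X : Type) l p (L : 'I_l -> X) (B : 'I_p -> X) (J : 'I_1 -> X) :
 catidx (catidx L B) J = catidx (catidx B J) L \o @block_rot l p.
ext x; rewrite /block_rot /=; case: (split_ordP x)=> i ->.
 by case: (split_ordP i)=> y ->; rewrite !(catidx_l, catidx_r).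
by rewrite !(catidx_l, catidx_r).
Qed.

Lemma val_block_rot l p (x : 'I_(l + p + 1)) : val (block_rot x) = ((x + (p + 1)) %% (l + p + 1))%N.
rewrite /block_rot; case: (split_ordP x)=> i ->.
 case: (split_ordP i)=> y ->; rewrite !(catidx_l, catidx_r) /=.
  by have := ltn_ord y=> yl; rewrite modn_small; lia.
 have := ltn_ord y=> yp; rewrite (_ : l + y + (p + 1) = y + (l + p + 1))%N; last by lia.
 by rewrite modnDr modn_small; lia.
rewrite catidx_r /= ord1 /= (_ : l + p + 0 + (p + 1) = p + (l + p + 1))%N; last by lia.
by rewrite modnDr modn_small; lia.
Qed.

Lemma lcs_block_rot7 : lcs (@block_rot 3 3 : 'I_7 -> 'I_7) = 1.
rewrite /lcs det_eps (eq_map (g := (fun i=> (i + 4) %% 7)%N \o val)); last first.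
 by move=> i; exact: (@val_block_rot 3 3).
by rewrite map_comp val_enum_ord.
Qed.

Lemma lcs_block_rot8 : lcs (@block_rot 3 4 : 'I_8 -> 'I_8) = -1.
rewrite /lcs det_eps (eq_map (g := (fun i=> (i + 5) %% 8)%N \o val)); last first.
 by move=> i; exact: (@val_block_rot 3 4).
by rewrite map_comp val_enum_ord.
Qed.

(** Star, wedge and star again amount to contracting a with b. The inner star is evaluated where the
    outer sign is nonzero, so that only squares of signs remain; summing them over the 3! orders of
    L gives 6 / (3! 3!). *)
Lemma hodge_wedge_hodge7 (a : ('I_4 -> 'I_7) -> R) (b : ('I_3 -> 'I_7) -> R) (J : 'I_1 -> 'I_7) : alt_comps a ->
 hodge (k := 6) (l := 1) (wedge (hodge (k := 4) (l := 3) a) b) J =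
 6^-1 * \sum_(B : {ffun 'I_3 -> 'I_7}) a (catidx (k := 3) (l := 1) B J) * b B.
move=> alt; pose C B : 'I_4 -> 'I_7 := catidx (k := 3) (l := 1) B J.
rewrite (@hodge_wedge 3 3 1 (hodge (k := 4) (l := 3) a) b J).
rewrite (_ : \sum_K _ = \sum_(B : {ffun 'I_3 -> 'I_7}) \sum_(L : {ffun 'I_3 -> 'I_7})
  a (C B) * b B * lcs (catidx (k := 4) (l := 3) (C B) L) ^+ 2); last first.
 rewrite (@sum_catidx 7 3 3 (fun K=> hodge (k := 4) (l := 3) a (fun i=> K (lshift 3 i)) *
  b (fun i=> K (rshift 3 i)) * lcs (catidx (k := 6) (l := 1) K J))).
 eq_sum B; eq_sum L.
 have -> : (fun i : 'I_3=> catidx (k := 3) (l := 3) L B (lshift 3 i)) = L.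
  by ext i; exact: catidx_l.
 have -> : (fun i : 'I_3=> catidx (k := 3) (l := 3) L B (rshift 3 i)) = B.
  by ext i; exact: catidx_r.
 rewrite (@catidx_rot _ 3 3 L B J) (lcs_comp (catidx (k := 4) (l := 3) (C B) L)).
 rewrite lcs_block_rot7 mul1r.
 have [->|E] := eqVneq (lcs (catidx (k := 4) (l := 3) (C B) L)) 0.
  by rewrite expr0n !mulr0.
 rewrite (hodge_inj alt (lcs_inj E)); ring.
have E B : \sum_(L : {ffun 'I_3 -> 'I_7}) a (C B) * b B *
  lcs (catidx (k := 4) (l := 3) (C B) L) ^+ 2 = 6 * (a (C B) * b B).
 rewrite -mulr_sumr; case: (pselect (injective (C B)))=> [Ci|nC].
  by rewrite (sum_lcs_sqr Ci) mulrC.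
 by rewrite (alternating_noninj alt nC) !mul0r mulr0.
under eq_bigr do rewrite E.
by rewrite -mulr_sumr mulrA (_ : (3`!)%:R = 6 :> R)//; congr (_ * _); field.
Qed.

Lemma hodge_wedge_hodge8 (a : ('I_5 -> 'I_8) -> R) (b : ('I_4 -> 'I_8) -> R) (J : 'I_1 -> 'I_8) : alt_comps a ->
 hodge (k := 7) (l := 1) (wedge (hodge (k := 5) (l := 3) a) b) J =
 - 24^-1 * \sum_(B : {ffun 'I_4 -> 'I_8}) a (catidx (k := 4) (l := 1) B J) * b B.
move=> alt; pose C B : 'I_5 -> 'I_8 := catidx (k := 4) (l := 1) B J.
rewrite (@hodge_wedge 3 4 1 (hodge (k := 5) (l := 3) a) b J).
rewrite (_ : \sum_K _ = \sum_(B : {ffun 'I_4 -> 'I_8}) \sum_(L : {ffun 'I_3 -> 'I_8})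
  - (a (C B) * b B) * lcs (catidx (k := 5) (l := 3) (C B) L) ^+ 2); last first.
 rewrite (@sum_catidx 8 3 4 (fun K=> hodge (k := 5) (l := 3) a (fun i=> K (lshift 4 i)) *
  b (fun i=> K (rshift 3 i)) * lcs (catidx (k := 7) (l := 1) K J))).
 eq_sum B; eq_sum L.
 have -> : (fun i : 'I_3=> catidx (k := 3) (l := 4) L B (lshift 4 i)) = L.
  by ext i; exact: catidx_l.
 have -> : (fun i : 'I_4=> catidx (k := 3) (l := 4) L B (rshift 3 i)) = B.
  by ext i; exact: catidx_r.
 rewrite (@catidx_rot _ 3 4 L B J) (lcs_comp (catidx (k := 5) (l := 3) (C B) L)).
 rewrite lcs_block_rot8.
 have [->|E] := eqVneq (lcs (catidx (k := 5) (l := 3) (C B) L)) 0.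
  by rewrite expr0n !mulr0.
 rewrite (hodge_inj alt (lcs_inj E)); ring.
have E B : \sum_(L : {ffun 'I_3 -> 'I_8}) - (a (C B) * b B) *
  lcs (catidx (k := 5) (l := 3) (C B) L) ^+ 2 = - 6 * (a (C B) * b B).
 rewrite -mulr_sumr; case: (pselect (injective (C B)))=> [Ci|nC].
  by rewrite (sum_lcs_sqr Ci) (_ : (3`!)%:R = 6 :> R)//; ring.
 by rewrite (alternating_noninj alt nC) mul0r oppr0 mul0r mulr0.
under eq_bigr do rewrite E.
rewrite -mulr_sumr mulrA (_ : (3`!)%:R = 6 :> R)// (_ : (4`!)%:R = 24 :> R)//.
by congr (_ * _); field.
Qed.

End LeviCivitaSymbol.

(** * Exterior derivatives of forms with constant components, alternation and contraction *)

Lemma ext_d4_algebra R n (G : Tri n R) (T : Quad n R) (pi pj pk pl pm : R) i j k l m :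
 (forall a b c d, T b a c d = - T a b c d) -> (forall a b c d, T a c b d = - T a b c d) ->
 (forall a b c d, T a b d c = - T a b c d) ->
 (pi + \sum_p (G i j p * T p k l m + G i k p * T j p l m + G i l p * T j k p m + G i m p * T j k l p)
  - (\sum_p (G i j p - G j i p) * T p k l m + \sum_p (G i k p - G k i p) * T j p l m
   + \sum_p (G i l p - G l i p) * T j k p m + \sum_p (G i m p - G m i p) * T j k l p))
 - (pj + \sum_p (G j i p * T p k l m + G j k p * T i p l m + G j l p * T i k p m + G j m p * T i k l p)
   - (\sum_p (G j k p - G k j p) * T i p l m + \sum_p (G j l p - G l j p) * T i k p m
    + \sum_p (G j m p - G m j p) * T i k l p))
 + (pk + \sum_p (G k i p * T p j l m + G k j p * T i p l m + G k l p * T i j p m + G k m p * T i j l p)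
   - (\sum_p (G k l p - G l k p) * T i j p m + \sum_p (G k m p - G m k p) * T i j l p))
 - (pl + \sum_p (G l i p * T p j k m + G l j p * T i p k m + G l k p * T i j p m + G l m p * T i j k p)
   - (\sum_p (G l m p - G m l p) * T i j k p))
 + (pm + \sum_p (G m i p * T p j k l + G m j p * T i p k l + G m k p * T i j p l + G m l p * T i j k p)) =
 pi - pj + pk - pl + pm.
move=> T12 T23 T34.
set S1 := \sum_p (G i j p * _ + _ + _ + _); set S2 := \sum_p (G i j p - _) * _.
set S3 := \sum_p (G i k p - _) * _; set S4 := \sum_p (G i l p - _) * _.
set S5 := \sum_p (G i m p - _) * _.
set S6 := \sum_p (G j i p * _ + _ + _ + _); set S7 := \sum_p (G j k p - _) * _.
set S8 := \sum_p (G j l p - _) * _; set S9 := \sum_p (G j m p - _) * _.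
set P1 := \sum_p (G k i p * _ + _ + _ + _); set P2 := \sum_p (G k l p - _) * _.
set P3 := \sum_p (G k m p - _) * _; set P4 := \sum_p (G l i p * _ + _ + _ + _).
set P5 := \sum_p (G l m p - _) * _; set P6 := \sum_p (G m i p * _ + _ + _ + _).
suff : S1 - (S2 + S3 + S4 + S5) - (S6 - (S7 + S8 + S9)) + (P1 - (P2 + P3)) - (P4 - P5) + P6 = 0 by lra.
rewrite /S1 /S2 /S3 /S4 /S5 /S6 /S7 /S8 /S9 /P1 /P2 /P3 /P4 /P5 /P6.
rewrite !opprB !opprD -!sumrN -!big_split /=.
rewrite big1// => p _.
have R1 a b c : T a b c p = - T p a b c.
 by rewrite (T34 a b p c) (T23 a p b c) (T12 p a b c) opprK.
have R2 a b c : T a b p c = T p a b c by rewrite (T23 a p b c) (T12 p a b c) opprK.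
have R3 a b c : T a p b c = - T p a b c by exact: T12.
rewrite !R1 !R2 !R3; ring.
Qed.

Section ConstantForms.
Variables (R : realType) (n : nat) (U : set 'rV[R]_n) (e : frame R n).
Hypothesis oU : open U.
Variable y : 'rV[R]_n.
Hypothesis Uy : U y.

(** Although the components are constant, the frame rotates. Writing the zero derivative as D plus
    the Levi-Civita action leaves the alternation of D. *)
Lemma ext_d_const3 (a : lform R n 3) c D i j k l :
 (forall i j k, c j i k = - c i j k) -> (forall i j k, c i k j = - c i j k) ->
 (forall z i j k, U z -> a z (tup3 i j k) = c i j k) -> (forall m i j k, D m i j k + so3 (LCk e y m) c i j k = 0) ->
 ext_d e a y (idx4 i j k l) = D i j k l - D j i k l + D k i j l - D l i j k.
move=> c12 c23 aE DE; rewrite ext_d3E.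
have dE m a' b' d' : pd e m (fun z=> a z (tup3 a' b' d')) y = D m a' b' d' +
  \sum_p (LCk e y m a' p * c p b' d' + LCk e y m b' p * c a' p d' + LCk e y m d' p * c a' b' p).
 rewrite (@pd_eqon _ _ _ e oU _ (fun=> c a' b' d') m y)=> [|z Uz|//]; last exact: aE.
 by rewrite pd_cst -[LHS](DE m a' b' d').
rewrite !dE.
have S x z (f : 'I_n -> 'I_3 -> 'I_n) (g : 'I_n -> R) : (forall p, a y (f p) = g p) ->
  \sum_p strck e y x z p * a y (f p) = \sum_p (LCk e y x z p - LCk e y z x p) * g p.
 by move=> E; eq_sum p; rewrite LCk_torsion_free E.
rewrite (S _ _ _ (fun p=> c p k l)); last by move=> p; exact: aE.
rewrite (S _ _ _ (fun p=> c j p l)); last by move=> p; exact: aE.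
rewrite (S _ _ _ (fun p=> c j k p)); last by move=> p; exact: aE.
rewrite (S _ _ _ (fun p=> c i p l)); last by move=> p; exact: aE.
rewrite (S _ _ _ (fun p=> c i k p)); last by move=> p; exact: aE.
rewrite (S _ _ _ (fun p=> c i j p)); last by move=> p; exact: aE.
exact: ext_d3_algebra.
Qed.

Lemma ext_d_const4 (a : lform R n 4) c D i j k l m :
 (forall i j k l, c j i k l = - c i j k l) -> (forall i j k l, c i k j l = - c i j k l) ->
 (forall i j k l, c i j l k = - c i j k l) -> (forall z i j k l, U z -> a z (idx4 i j k l) = c i j k l) ->
 (forall m i j k l, D m i j k l + so4 (LCk e y m) c i j k l = 0) ->
 ext_d e a y (idx5 i j k l m) = D i j k l m - D j i k l m + D k i j l m - D l i j k m + D m i j k l.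
move=> c12 c23 c34 aE DE; rewrite ext_d4E.
have dE x a' b' d' f' : pd e x (fun z=> a z (idx4 a' b' d' f')) y = D x a' b' d' f' +
  \sum_p (LCk e y x a' p * c p b' d' f' + LCk e y x b' p * c a' p d' f' + LCk e y x d' p * c a' b' p f'
   + LCk e y x f' p * c a' b' d' p).
 rewrite (@pd_eqon _ _ _ e oU _ (fun=> c a' b' d' f') x y)=> [|z Uz|//]; last exact: aE.
 by rewrite pd_cst -[LHS](DE x a' b' d' f').
rewrite !dE.
have S x z (f : 'I_n -> 'I_4 -> 'I_n) (g : 'I_n -> R) : (forall p, a y (f p) = g p) ->
  \sum_p strck e y x z p * a y (f p) = \sum_p (LCk e y x z p - LCk e y z x p) * g p.
 by move=> E; eq_sum p; rewrite LCk_torsion_free E.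
rewrite (S _ _ _ (fun p=> c p k l m)); last by move=> p; exact: aE.
rewrite (S _ _ _ (fun p=> c j p l m)); last by move=> p; exact: aE.
rewrite (S _ _ _ (fun p=> c j k p m)); last by move=> p; exact: aE.
rewrite (S _ _ _ (fun p=> c j k l p)); last by move=> p; exact: aE.
rewrite (S _ _ _ (fun p=> c i p l m)); last by move=> p; exact: aE.
rewrite (S _ _ _ (fun p=> c i k p m)); last by move=> p; exact: aE.
rewrite (S _ _ _ (fun p=> c i k l p)); last by move=> p; exact: aE.
rewrite (S _ _ _ (fun p=> c i j p m)); last by move=> p; exact: aE.
rewrite (S _ _ _ (fun p=> c i j l p)); last by move=> p; exact: aE.
rewrite (S _ _ _ (fun p=> c i j k p)); last by move=> p; exact: aE.
exact: ext_d4_algebra.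
Qed.

End ConstantForms.

Section FormContraction.
Variables (R : realType) (n : nat).
Implicit Types (F : Tri n R) (G : Quad n R).

Lemma sum3_12 F : \sum_a \sum_b \sum_d F a b d = \sum_a \sum_b \sum_d F b a d.
exact: exchange_big. Qed.
Lemma sum3_23 F : \sum_a \sum_b \sum_d F a b d = \sum_a \sum_b \sum_d F a d b.
by eq_sum a; exact: exchange_big. Qed.

Lemma sum4_12 G : \sum_a \sum_b \sum_d \sum_f G a b d f = \sum_a \sum_b \sum_d \sum_f G b a d f.
exact: exchange_big. Qed.
Lemma sum4_23 G : \sum_a \sum_b \sum_d \sum_f G a b d f = \sum_a \sum_b \sum_d \sum_f G a d b f.
by eq_sum a; exact: exchange_big. Qed.
Lemma sum4_34 G : \sum_a \sum_b \sum_d \sum_f G a b d f = \sum_a \sum_b \sum_d \sum_f G a b f d.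
by eq_sum a; eq_sum b; exact: exchange_big. Qed.

Lemma eq_sum3 F F' : (forall a b d, F a b d = F' a b d) ->
 \sum_a \sum_b \sum_d F a b d = \sum_a \sum_b \sum_d F' a b d.
by move=> E; eq_sum a; eq_sum b; eq_sum d. Qed.

Lemma eq_sum4 G G' : (forall a b d f, G a b d f = G' a b d f) ->
 \sum_a \sum_b \sum_d \sum_f G a b d f = \sum_a \sum_b \sum_d \sum_f G' a b d f.
by move=> E; eq_sum a; exact: eq_sum3. Qed.

Lemma sum3D F F' : \sum_a \sum_b \sum_d (F a b d + F' a b d) =
 \sum_a \sum_b \sum_d F a b d + \sum_a \sum_b \sum_d F' a b d.
by rewrite -big_split; eq_sum a; rewrite -big_split; eq_sum b; rewrite -big_split. Qed.

Lemma sum4D G G' : \sum_a \sum_b \sum_d \sum_f (G a b d f + G' a b d f) =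
 \sum_a \sum_b \sum_d \sum_f G a b d f + \sum_a \sum_b \sum_d \sum_f G' a b d f.
by rewrite -big_split; eq_sum a; exact: sum3D. Qed.
Lemma sum3Z c F : \sum_a \sum_b \sum_d c * F a b d = c * \sum_a \sum_b \sum_d F a b d.
by mul_sum a; mul_sum b; rewrite mulr_sumr. Qed.
Lemma sum4Z c G : \sum_a \sum_b \sum_d \sum_f c * G a b d f = c * \sum_a \sum_b \sum_d \sum_f G a b d f.
by mul_sum a; exact: sum3Z. Qed.

Lemma sum_antisym (A S : Bil n R) : (forall i j, A j i = - A i j) ->
 (forall i j, S j i = S i j) -> \sum_i \sum_j A i j * S i j = 0.
move=> aA sS; set X := \sum_i _; have : X = - X; last by lra.
rewrite {1}/X exchange_big -sumrN; eq_sum i; rewrite -sumrN.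
by eq_sum j; rewrite aA sS mulNr.
Qed.

Variable t : 'I_n -> R.

(** By skewness of c the three terms with t in different slots contribute equally. *)
Lemma contract_wedge3 (Y : Bil n R) Z z c :
 (forall i j k, c j i k = - c i j k) -> (forall i j k, c i k j = - c i j k) ->
 \sum_a \sum_b \sum_d (t a * Y b d - t b * Y a d + t d * Y a b - z * Z a b d) * c a b d =
 3 * \sum_a t a * (\sum_b \sum_d Y b d * c a b d) - z * \sum_a \sum_b \sum_d Z a b d * c a b d.
move=> c12 c23.
pose S := \sum_a \sum_b \sum_d t a * Y b d * c a b d.
pose S2 := \sum_a \sum_b \sum_d t b * Y a d * c b a d.
pose S3 := \sum_a \sum_b \sum_d t d * Y a b * c d a b.
have E2 : S = S2 by rewrite /S sum3_12.
have E3 : S = S3 by rewrite /S sum3_12 sum3_23.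
transitivity (S + S2 + S3 + (- z) * \sum_a \sum_b \sum_d Z a b d * c a b d).
 rewrite /S /S2 /S3 -sum3Z -!sum3D; apply: eq_sum3=> a b d.
 by rewrite (c12 a b d) (_ : c d a b = c a b d); [ring|rewrite c12 c23 opprK].
rewrite -E2 -E3 (_ : \sum_a t a * _ = S); first by ring.
eq_sum a; mul_sum b; rewrite mulr_sumr.
by eq_sum d; rewrite mulrA.
Qed.

Lemma contract_wedge4 Y Z z c :
 (forall i j k l, c j i k l = - c i j k l) -> (forall i j k l, c i k j l = - c i j k l) ->
 (forall i j k l, c i j l k = - c i j k l) -> \sum_a \sum_b \sum_d \sum_f
  (t a * Y b d f - t b * Y a d f + t d * Y a b f - t f * Y a b d + z * Z a b d f) * c a b d f =
 4 * \sum_a t a * (\sum_b \sum_d \sum_f Y b d f * c a b d f)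
 + z * \sum_a \sum_b \sum_d \sum_f Z a b d f * c a b d f.
move=> c12 c23 c34.
pose S := \sum_a \sum_b \sum_d \sum_f t a * Y b d f * c a b d f.
pose S2 := \sum_a \sum_b \sum_d \sum_f t b * Y a d f * c b a d f.
pose S3 := \sum_a \sum_b \sum_d \sum_f t d * Y a b f * c d a b f.
pose S4 := \sum_a \sum_b \sum_d \sum_f t f * Y a b d * c f a b d.
have E2 : S = S2 by rewrite /S sum4_12.
have E3 : S = S3 by rewrite /S sum4_12 sum4_23.
have E4 : S = S4 by rewrite /S sum4_12 sum4_23 sum4_34.
transitivity (S + S2 + S3 + S4 + z * \sum_a \sum_b \sum_d \sum_f Z a b d f * c a b d f).
 rewrite /S /S2 /S3 /S4 -sum4Z -!sum4D; apply: eq_sum4=> a b d f.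
 rewrite (c12 a b d f) (_ : c d a b f = c a b d f); last by rewrite c12 c23 opprK.
 by rewrite (_ : c f a b d = - c a b d f); [ring|rewrite c12 c23 c34 opprK].
rewrite -E2 -E3 -E4 (_ : \sum_a t a * _ = S); first by ring.
by eq_sum a; rewrite -sum3Z; apply: eq_sum3=> b d f; rewrite mulrA.
Qed.

Definition owedge3 (x : 'I_n -> R) Q i j k := x i * Q j k - x j * Q i k + x k * Q i j.

Definition owedge4 (x : 'I_n -> R) Q i j k l :=
 x i * Q j k l - x j * Q i k l + x k * Q i j l - x l * Q i j k.

(** The part with the symmetric g drops out under alternation, and the other part gives three equal
    copies of t /\ c. *)
Lemma alternate_shift3 c (g Q : Bil n R) i j k l :
 (forall i j k, c j i k = - c i j k) -> (forall i j k, c i k j = - c i j k) -> (forall i j, g j i = g i j) ->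
 let D m i j k := owedge3 t (c m) i j k - owedge3 (g m) Q i j k in D i j k l - D j i k l + D k i j l - D l i j k =
 - 3 * (t i * c j k l - t j * c i k l + t k * c i j l - t l * c i j k).
move=> c12 c23 gs; rewrite /owedge3; have cyc a b d : c d a b = c a b d by rewrite c12 c23 opprK.
rewrite (c12 i j k) (c12 i j l) (c12 i k l) (c12 j k l) !(cyc i j, cyc i k, cyc j k).
by rewrite (gs i j) (gs i k) (gs i l) (gs j k) (gs j l) (gs k l); ring.
Qed.

Lemma alternate_shift4 c (g : Bil n R) Q (u : 'I_n -> R) O i j k l m :
 (forall i j k l, c j i k l = - c i j k l) -> (forall i j k l, c i k j l = - c i j k l) ->
 (forall i j k l, c i j l k = - c i j k l) -> (forall i j, g j i = g i j) ->
 let D m i j k l := owedge4 t (c m) i j k l - u m * (owedge4 t O i j k l - owedge4 u Q i j k l)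
  - owedge4 (g m) Q i j k l in
 let Y i j k l := 4 * c i j k l - owedge4 u O i j k l in
 D i j k l m - D j i k l m + D k i j l m - D l i j k m + D m i j k l =
 - (t i * Y j k l m - t j * Y i k l m + t k * Y i j l m - t l * Y i j k m + t m * Y i j k l).
move=> c12 c23 c34 gs; rewrite /owedge4.
have r3 a b d f : c d a b f = c a b d f by rewrite c12 c23 opprK.
have r4 a b d f : c f a b d = - c a b d f by rewrite r3 c34.
rewrite (c12 i j k l) (c12 i j k m) (c12 i j l m) (c12 i k l m) (c12 j k l m).
rewrite (r3 i j k l) (r3 i j k m) (r3 i j l m) (r3 i k l m) (r3 j k l m).
rewrite (r4 i j k l) (r4 i j k m) (r4 i j l m) (r4 i k l m) (r4 j k l m).
rewrite (gs i j) (gs i k) (gs i l) (gs i m) (gs j k) (gs j l) (gs j m) (gs k l) (gs k m) (gs l m).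
by ring.
Qed.

Lemma so3_tensor c (x z : 'I_n -> R) i j k :
 (forall i j k, c j i k = - c i j k) -> (forall i j k, c i k j = - c i j k) ->
 so3 (fun i l=> x i * z l) c i j k = owedge3 x (fun j k=> \sum_l z l * c l j k) i j k.
move=> c12 c23; rewrite /so3 /owedge3 !mulr_sumr -sumrB -big_split; eq_sum l=> /=.
by rewrite (c12 l i k) (c23 i l j) (c12 l i j); ring.
Qed.

Lemma so4_tensor c (x z : 'I_n -> R) i j k l :
 (forall i j k l, c j i k l = - c i j k l) -> (forall i j k l, c i k j l = - c i j k l) ->
 (forall i j k l, c i j l k = - c i j k l) ->
 so4 (fun i l=> x i * z l) c i j k l = owedge4 x (fun j k l=> \sum_p z p * c p j k l) i j k l.
move=> c12 c23 c34; rewrite /so4 /owedge4 !mulr_sumr -sumrB -big_split -sumrB; eq_sum p=> /=.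
rewrite (c12 p i k l) (c23 i p j l) (c12 p i j l) (c34 i j p k) (c23 i p j k) (c12 p i j k); ring.
Qed.

End FormContraction.

Section Alternation.
Variables (R : realType) (n : nat).

Lemma alternating_tperm k (a : ('I_k -> 'I_n) -> R) :
 (forall i j I, i != j -> a (I \o tperm i j) = - a I) -> alt_comps a.
move=> aT s; have [ts ->] := prod_tpermP s.
elim: ts=> [_ I|[i j] ts IH /= /andP[ij Hts] I].
 rewrite big_nil odd_perm1 expr0 mul1r; congr a.
 by apply/funext=> x /=; rewrite perm1.
rewrite big_cons odd_permM odd_tperm ij addTb signrN mulNr -IH//.
rewrite -(aT i j (I \o _) ij); congr a.
by apply/funext=> x /=; rewrite permM.
Qed.
Lemma od_eq m x y : (x <= m)%N -> (y <= m)%N -> (od x == od y :> 'I_m.+1) = (x == y).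
by move=> xm ym; rewrite -val_eqE /= !modn_small. Qed.

Lemma odP m (i : 'I_m.+1) : exists2 x, (x <= m)%N & i = od x.
exists (val i); [by case: i | by rewrite (valZpK i)]. Qed.
Lemma tperm_if (T : finType) (x y z : T) : tperm x y z = if z == x then y else if z == y then x else z.
by case: tpermP=> [->|->|/eqP/negPf -> /eqP/negPf ->]; rewrite ?eqxx//; case: eqP. Qed.

Lemma alternating_idx4 (a : ('I_4 -> 'I_n) -> R) : (forall i j k l, a (idx4 j i k l) = - a (idx4 i j k l)) ->
 (forall i j k l, a (idx4 i k j l) = - a (idx4 i j k l)) ->
 (forall i j k l, a (idx4 i j l k) = - a (idx4 i j k l)) -> alt_comps a.
move=> a12 a23 a34.
have a13 i j k l : a (idx4 k j i l) = - a (idx4 i j k l) by rewrite a12 a23 a12 !opprK.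
have a24 i j k l : a (idx4 i l k j) = - a (idx4 i j k l) by rewrite a23 a34 a23 !opprK.
have a14 i j k l : a (idx4 l j k i) = - a (idx4 i j k l) by rewrite a12 a24 a12 !opprK.
apply: alternating_tperm=> i j I; rewrite (idx4_eta (I \o _)) (idx4_eta I) /=.
have [x xm ->] := odP i; have [y ym ->] := odP j; rewrite od_eq// !tperm_if.
move: x y xm ym=> [|[|[|[|//]]]] [|[|[|[|//]]]] _ _; rewrite ?eqxx// => _;
 rewrite ?eqxx !od_eq//=; first [exact: a12|exact: a23|exact: a34|exact: a13|exact: a24|exact: a14].
Qed.

Lemma alternating_idx5 (a : ('I_5 -> 'I_n) -> R) : (forall i j k l m, a (idx5 j i k l m) = - a (idx5 i j k l m)) ->
 (forall i j k l m, a (idx5 i k j l m) = - a (idx5 i j k l m)) ->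
 (forall i j k l m, a (idx5 i j l k m) = - a (idx5 i j k l m)) ->
 (forall i j k l m, a (idx5 i j k m l) = - a (idx5 i j k l m)) -> alt_comps a.
move=> a12 a23 a34 a45.
have a13 i j k l m : a (idx5 k j i l m) = - a (idx5 i j k l m) by rewrite a12 a23 a12 !opprK.
have a24 i j k l m : a (idx5 i l k j m) = - a (idx5 i j k l m) by rewrite a23 a34 a23 !opprK.
have a35 i j k l m : a (idx5 i j m l k) = - a (idx5 i j k l m) by rewrite a34 a45 a34 !opprK.
have a14 i j k l m : a (idx5 l j k i m) = - a (idx5 i j k l m) by rewrite a12 a24 a12 !opprK.
have a25 i j k l m : a (idx5 i m k l j) = - a (idx5 i j k l m) by rewrite a23 a35 a23 !opprK.
have a15 i j k l m : a (idx5 m j k l i) = - a (idx5 i j k l m) by rewrite a12 a25 a12 !opprK.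
apply: alternating_tperm=> i j I; rewrite (idx5_eta (I \o _)) (idx5_eta I) /=.
have [x xm ->] := odP i; have [y ym ->] := odP j; rewrite od_eq// !tperm_if.
move: x y xm ym=> [|[|[|[|[|//]]]]] [|[|[|[|[|//]]]]] _ _; rewrite ?eqxx// => _;
 rewrite ?eqxx !od_eq//=; first [exact: a12|exact: a23|exact: a34|exact: a45|exact: a13|exact: a24|exact: a35
  |exact: a14|exact: a25|exact: a15].
Qed.

Lemma alternating_alternation4 (a : ('I_4 -> 'I_n) -> R) (D : Quad n R) :
 (forall m i j k, D m j i k = - D m i j k) -> (forall m i j k, D m i k j = - D m i j k) ->
 (forall i j k l, a (idx4 i j k l) = D i j k l - D j i k l + D k i j l - D l i j k) -> alt_comps a.
move=> D12 D23 aE; apply: alternating_idx4=> i j k l; rewrite !aE.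
- by rewrite (D12 k i j) (D12 l i j); ring.
- by rewrite (D12 i j k) (D23 l i j); ring.
- by rewrite (D23 i j k) (D23 j i k); ring.
Qed.

Lemma alternating_alternation5 (a : ('I_5 -> 'I_n) -> R) (D : 'I_n -> 'I_n -> 'I_n -> 'I_n -> 'I_n -> R) :
 (forall m i j k l, D m j i k l = - D m i j k l) -> (forall m i j k l, D m i k j l = - D m i j k l) ->
 (forall m i j k l, D m i j l k = - D m i j k l) -> (forall i j k l m, a (idx5 i j k l m) =
   D i j k l m - D j i k l m + D k i j l m - D l i j k m + D m i j k l) -> alt_comps a.
move=> D12 D23 D34 aE; apply: alternating_idx5=> i j k l m; rewrite !aE.
- by rewrite (D12 k i j) (D12 l i j) (D12 m i j); ring.
- by rewrite (D12 i j k) (D23 l i j) (D23 m i j); ring.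
- by rewrite (D23 i j k) (D23 j i k) (D34 m i j); ring.
- by rewrite (D34 i j k) (D34 j i k) (D34 k i j); ring.
Qed.

End Alternation.

Lemma sum_ffun4 (V : nmodType) (T : finType) (F : ('I_4 -> T) -> V) :
 \sum_(I : {ffun 'I_4 -> T}) F I = \sum_i \sum_j \sum_k \sum_l F (idx4 i j k l).
under [RHS]eq_bigr do under eq_bigr do rewrite pair_bigA /=.
under [RHS]eq_bigr do rewrite pair_bigA /=.
rewrite pair_bigA /=.
rewrite (reindex (fun p : T * (T * (T * T))=> [ffun x=> idx4 p.1 p.2.1 p.2.2.1 p.2.2.2 x])) /=.
 by eq_sum p; congr F; ext x; rewrite ffunE.
exists (fun I : {ffun 'I_4 -> T}=> (I (od 0), (I (od 1), (I (od 2), I (od 3))))).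
 by case=> i [j [k l]] _; rewrite !ffunE.
by move=> I _; apply/ffunP=> x; rewrite ffunE -idx4_eta.
Qed.

Lemma catidx_tup3 (X : Type) (a b c x : X) (J : 'I_1 -> X) : J = (fun=> x) ->
 catidx (k := 3) (l := 1) (tup3 a b c) J = idx4 a b c x.
move=> ->; ext y; rewrite /catidx; case: split_ordP=> -[m pm] ->.
 by case: m pm=> [|[|[|//]]] pm; rewrite /tup3 /idx4 !(tnth_nth a).
by case: m pm=> [|//] pm; rewrite /idx4 (tnth_nth a).
Qed.

Lemma catidx_idx4 (X : Type) (a b c d x : X) (J : 'I_1 -> X) : J = (fun=> x) ->
 catidx (k := 4) (l := 1) (idx4 a b c d) J = idx5 a b c d x.
move=> ->; ext y; rewrite /catidx; case: split_ordP=> -[m pm] ->.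
 by case: m pm=> [|[|[|[|//]]]] pm; rewrite /idx4 /idx5 !(tnth_nth a).
by case: m pm=> [|//] pm; rewrite /idx5 (tnth_nth a).
Qed.

Section PhiContractions.
Variable R : realType.

Lemma ph_ph_check : alln 8 (fun a=> alln 8 (fun b=> alln 8 (fun p=> alln 8 (fun x =>
 isum 8 (fun d=> isum 8 (fun f=> ph a b d f * ph p d f x)) ==
 6 * (dz a p * dz b x - dz a x * dz b p) + 4 * ph a b p x)))).
by vm_compute. Qed.

Lemma ph_ph_trace : alln 8 (fun p=> alln 8 (fun a =>
 isum 8 (fun b=> isum 8 (fun d=> isum 8 (fun f=> ph p b d f * ph a b d f))) == 42 * dz p a)).
by vm_compute. Qed.

End PhiContractions.

Section ShiftedAction.
Variables (R : realType) (n : nat).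
Implicit Types (w v LC : Bil n R) (t u : 'I_n -> R).

(** Modulo two matrices that annihilate c, the Levi-Civita matrix is an infinitesimal rotation in
    the plane of t and e_m, whose action on c is explicit. *)
Lemma so3_shift w v LC c t s m i j k : (forall i j k, c j i k = - c i j k) -> (forall i j k, c i k j = - c i j k) ->
 so3 w c i j k = 0 -> so3 v c i j k = 0 ->
 (forall i l, LC i l = w i l - v i l - s * (t i * (l == m)%:R - (i == m)%:R * t l)) ->
 s * (owedge3 t (c m) i j k - owedge3 (fun i=> (i == m)%:R) (fun j k=> \sum_l t l * c l j k) i j k)
 + so3 LC c i j k = 0.
move=> c12 c23 w0 v0 LE.
rewrite (_ : so3 LC c i j k = so3 w c i j k - so3 v c i j k -
  s * (so3 (fun i l=> t i * (l == m)%:R) c i j k - so3 (fun i l=> (i == m)%:R * t l) c i j k)).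
 rewrite w0 v0 (so3_tensor t (fun l=> (l == m)%:R))// (so3_tensor (fun i=> (i == m)%:R) t)// /owedge3.
 have dl a b : \sum_l (l == m)%:R * c l a b = c m a b by exact: (lc_deltal (fun l=> c l a b)).
 by cbv beta; rewrite !dl; ring.
by rewrite /so3 -!sumrB mulr_sumr -sumrB; eq_sum l; rewrite !LE; ring.
Qed.

Lemma so4_shift w v LC c t u s m i j k l :
 (forall i j k l, c j i k l = - c i j k l) -> (forall i j k l, c i k j l = - c i j k l) ->
 (forall i j k l, c i j l k = - c i j k l) -> so4 w c i j k l = 0 -> so4 v c i j k l = 0 ->
 (forall i l, LC i l = w i l - v i l -
  s * (t i * (l == m)%:R - (i == m)%:R * t l - u m * (t i * u l - u i * t l))) ->
 let Q j k l := \sum_p t p * c p j k l in s * (owedge4 t (c m) i j k l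
  - u m * (owedge4 t (fun j k l=> \sum_p u p * c p j k l) i j k l - owedge4 u Q i j k l)
  - owedge4 (fun i=> (i == m)%:R) Q i j k l)
 + so4 LC c i j k l = 0.
move=> c12 c23 c34 w0 v0 LE Q.
rewrite (_ : so4 LC c i j k l = so4 w c i j k l - so4 v c i j k l -
  s * (so4 (fun i l=> t i * (l == m)%:R) c i j k l - so4 (fun i l=> (i == m)%:R * t l) c i j k l
   - u m * (so4 (fun i l=> t i * u l) c i j k l - so4 (fun i l=> u i * t l) c i j k l))).
 rewrite w0 v0 !so4_tensor// /owedge4 {}/Q.
 have dl a b d : \sum_l (l == m)%:R * c l a b d = c m a b d.
  exact: (lc_deltal (fun l=> c l a b d)).
 by cbv beta; rewrite !dl; ring.
rewrite /so4 -!sumrB !mulr_sumr -!sumrB mulr_sumr -sumrB; eq_sum p; rewrite !LE; ring.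
Qed.

End ShiftedAction.

(** * Lee forms in dimensions seven and eight *)

Section LeeForms.
Variable R : realType.

Lemma om_om_trace : alln 7 (fun p=> alln 7 (fun a =>
 isum 7 (fun b=> isum 7 (fun d=> om p b d * om a b d)) == 6 * dz p a)).
by vm_compute. Qed.

Lemma sum_omr_trace p a : \sum_b \sum_d omr R p b d * omr R a b d = 6 * (p == a)%:R.
have /eqP E := allnP (allnP om_om_trace p) a.
rewrite -dzE -[6]/(6%:~R) -intrM -E; cast_sum i.
by cast_sum j; rewrite /omr -intrM.
Qed.

Lemma sum_phr_trace p a : \sum_b \sum_d \sum_f phr R p b d f * phr R a b d f = 42 * (p == a)%:R.
have /eqP E := allnP (allnP ph_ph_trace p) a.
have -> : (p == a)%:R = (dz p a)%:~R :> R by rewrite /dz natb_intr.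
rewrite -[42]/(42%:~R) -intrM -E; cast_sum i.
cast_sum j.
by cast_sum k; rewrite /phr -intrM.
Qed.

Lemma sum_phr_phr a b p x : \sum_d \sum_f phr R a b d f * phr R p d f x =
 6 * ((a == p)%:R * (b == x)%:R - (a == x)%:R * (b == p)%:R) + 4 * phr R a b p x.
have /eqP E := allnP (allnP (allnP (allnP ph_ph_check a) b) p) x.
have D (i j : 'I_8) : (i == j)%:R = (dz i j)%:~R :> R by rewrite /dz natb_intr.
rewrite !D -[6]/(6%:~R) -[4]/(4%:~R) /phr -!(intrM, intrB, intrD) -E; cast_sum i; cast_sum j.
by rewrite -intrM.
Qed.

End LeeForms.

Lemma in_g2_so3 R (A : 'M[R]_7) : in_g2 A -> forall i j k, so3 A (omr R) i j k = 0.
move=> gA i j k; rewrite -[RHS](gA (tup3 i j k)) so3E.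
by apply: eq_so3=> i' j' k'; rewrite omega_stdE.
Qed.

Lemma in_spin7_so4 R (A : 'M[R]_8) : in_spin7 A -> forall i j k l, so4 A (phr R) i j k l = 0.
move=> gA i j k l; rewrite -[RHS](gA (idx4 i j k l)) so4E.
by apply: eq_so4=> i' j' k' l'; rewrite Phi_stdE.
Qed.

Section LeeForm7.
Variable R : realType.
Notation n := (6 + 1)%N.
Context (U : set 'rV[R]_n) (e : frame R n) q t (pf : product_frame (r := 1) U e q t).
Variable s : R.
Hypothesis s2 : s ^+ 2 = 1.
Notation bv := (bv e q s (t 0)).
Hypothesis adapted : forall y (i j k : 'I_7), U y -> om3 (bv y i) (bv y j) (bv y k) = omr R i j k.
Notation tor := (tor e q).

Let w : coefs R n := fun y i j k=> LCk e y i j k + 2^-1 * tor y i j k.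

Let wE : tor_conn U e q 1 w.
by move=> y i j k _; rewrite mul1r. Qed.

Let w_om y m i j k : U y -> so3 (w y m) (omr R) i j k = 0.
move=> Uy; rewrite -[RHS](g2_tor_conn pf adapted m wE Uy (tup3 i j k)) so3E so3_mx.
by apply: eq_so3=> i' j' k'; rewrite omega_stdE.
Qed.

(** Levi-Civita is w minus [cm] minus a rotation, and the first two fix omega, so d omega = -3s t /\
    omega. Contracting with omega gives 3 * 6 - 42 = -24 times t, and (-1/3)(1/6)(-3s)(-24) =
    -4s. *)
Lemma lee7E (a : lform R 7 3) y J : U y -> (forall z i j k, U z -> a z (tup3 i j k) = omr R i j k) ->
 lee7 e a y J = - 4 * s * t 0 (J 0) y.
move=> Uy aE; pose tt i := t 0 i y; pose Q j k := \sum_l tt l * omr R l j k.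
pose D m i j k := s * (owedge3 tt (omr R m) i j k - owedge3 (fun i=> (i == m)%:R) Q i j k).
have dE i j k l : ext_d e a y (idx4 i j k l) = D i j k l - D j i k l + D k i j l - D l i j k.
 apply: (ext_d_const3 (pf_open pf) Uy _ _ _ _ (@omr12 R) (@omr23 R) aE)=> m i' j' k'.
 apply: (so3_shift (@omr12 R) (@omr23 R) (w_om m i' j' k' Uy) (v := cm e q s (t 0) y m)).
  rewrite -[RHS](in_g2_so3 (g2_cm pf s2 adapted m Uy) i' j' k').
  by eq_sum p; rewrite !mxE.
 move=> i0 l0; have hE b : hp e q y m b = (b == m)%:R - tt m * tt b.
  by have := pf_on pf m b Uy; rewrite big_ord1 eq_sym=> <-; rewrite addrK.
 by rewrite /w /cm !hE /tt; ring.
have dE' i j k l : ext_d e a y (idx4 i j k l) = s * - 3 *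
  (tt i * omr R j k l - tt j * omr R i k l + tt k * omr R i j l - tt l * omr R i j k).
 rewrite dE -mulrA -(alternate_shift3 tt (g := fun m i=> (i == m)%:R) Q i j k l (@omr12 R) (@omr23 R)).
  by rewrite /D; ring.
 by move=> ? ?; rewrite eq_sym.
have JE : J = (fun=> J 0) by ext x; rewrite ord1.
rewrite /lee7 hodge_wedge_hodge7; last first.
 have Q12 i j : Q j i = - Q i j.
  by rewrite /Q -sumrN; eq_sum l; rewrite omr23 mulrN.
 apply: alternating_alternation4 dE=> m i j k; rewrite /D /owedge3.
  by rewrite (@omr23 R m i j) (Q12 i j); ring.
 by rewrite (@omr23 R m j k) (Q12 j k); ring.
rewrite (sum_ffun3 (fun B=> ext_d e a y (catidx (k := 3) (l := 1) B J) * a y B)).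
rewrite (_ : \sum_i _ = s * - 3 * \sum_a \sum_b \sum_d (tt a * omr R b d (J 0) - tt b * omr R a d (J 0)
  + tt d * omr R a b (J 0) - tt (J 0) * omr R a b d) * omr R a b d); last first.
 by rewrite -sum3Z; apply: eq_sum3=> i j k; rewrite (catidx_tup3 i j k JE) dE' aE// mulrA.
rewrite (@contract_wedge3 R 7 tt (fun b d=> omr R b d (J 0)) (omr R) (tt (J 0)) (omr R) (@omr12 R) (@omr23 R)).
rewrite (eq_bigr (fun a=> 6 * (tt a * (a == J 0)%:R))); last first.
 move=> i _; rewrite [RHS]mulrCA; congr (_ * _); rewrite eq_sym -sum_omr_trace.
 by eq_sum b; eq_sum d; rewrite omr23 omr12 opprK.
rewrite -mulr_sumr (_ : \sum_i _ = tt (J 0)); last exact: lc_delta.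
rewrite (_ : \sum_a _ = 42); last first.
 rewrite (eq_bigr (fun=> 6))=> [|i _]; last by rewrite sum_omr_trace eqxx mulr1.
 by rewrite sumr_const card_ord -[LHS]mulr_natr -natrM.
by rewrite /tt; field.
Qed.

End LeeForm7.

Section LeeForm8.
Variable R : realType.
Notation n := (6 + 2)%N.
Context (U : set 'rV[R]_n) (e : frame R n) q t (pf : product_frame (r := 2) U e q t).
Variable s : R.
Hypothesis s2 : s ^+ 2 = 1.
Notation bv := (bv e q s (t 0)).
Hypothesis adapted : forall y (i j k l : 'I_8), U y -> Phi_form (bv y) (fun i=> t 1 i y) i j k l = phr R i j k l.
Notation tor := (tor e q).

Let w : coefs R n := fun y i j k=> LCk e y i j k + 2^-1 * tor y i j k.

Let wE : tor_conn U e q 1 w.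
by move=> y i j k _; rewrite mul1r. Qed.

Let w_ph y m i j k l : U y -> so4 (w y m) (phr R) i j k l = 0.
move=> Uy; rewrite -[RHS](spin7_tor_conn pf adapted m wE Uy (idx4 i j k l)) so4E so4_mx.
by apply: eq_so4=> i' j' k' l'; rewrite Phi_stdE.
Qed.

(** As in dimension seven, but [hp] also misses the direction u of the second line. This corrects 4
    Phi to Y = 4 Phi - u /\ (u contracted with Phi), so d Phi = -s t /\ Y. *)
Lemma lee8E (a : lform R 8 4) y J : U y -> (forall z i j k l, U z -> a z (idx4 i j k l) = phr R i j k l) ->
 lee8 e a y J = - (24 / 7) * s * t 0 (J 0) y.
move=> Uy aE; pose tt i := t 0 i y; pose u i := t 1 i y; pose x := J 0.
have uu : \sum_i u i * u i = 1 by rewrite (tv_tv pf).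
have tu : \sum_i tt i * u i = 0 by rewrite (tv_tv pf).
have [p12 [p23 p34]] := (@phr12 R, (@phr23 R, @phr34 R)).
pose Q j k l := \sum_p tt p * phr R p j k l; pose O j k l := \sum_p u p * phr R p j k l.
pose D m i j k l := s * (owedge4 tt (phr R m) i j k l - u m * (owedge4 tt O i j k l - owedge4 u Q i j k l)
  - owedge4 (fun i=> (i == m)%:R) Q i j k l).
pose Y i j k l := 4 * phr R i j k l - owedge4 u O i j k l.
have dE i j k l m : ext_d e a y (idx5 i j k l m) =
  D i j k l m - D j i k l m + D k i j l m - D l i j k m + D m i j k l.
 apply: (ext_d_const4 (pf_open pf) Uy _ _ _ _ _ p12 p23 p34 aE)=> {}m i' j' k' l'.
 apply: (so4_shift p12 p23 p34 (w_ph m i' j' k' l' Uy) (v := cm e q s (t 0) y m)).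
  rewrite -[RHS](in_spin7_so4 (spin7_cm pf s2 adapted m Uy) i' j' k' l').
  by eq_sum p; rewrite !mxE.
 move=> i0 l0; have hE b : hp e q y m b = (b == m)%:R - tt m * tt b - u m * u b.
  have := pf_on pf m b Uy; rewrite big_ord_recl big_ord1 eq_sym=> <-.
  by rewrite (_ : lift _ _ = 1); [rewrite /tt /u /hp; ring|exact: val_inj].
 by rewrite /w /cm !hE /tt; ring.
have dE' i j k l m : ext_d e a y (idx5 i j k l m) = - s *
  (tt i * Y j k l m - tt j * Y i k l m + tt k * Y i j l m - tt l * Y i j k m + tt m * Y i j k l).
 rewrite dE mulNr -mulrN.
 rewrite -(alternate_shift4 tt (g := fun m i=> (i == m)%:R) Q u O i j k l m p12 p23 p34).
  by rewrite /D; ring.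
 by move=> ? ?; rewrite eq_sym.
have O12 i j k : O j i k = - O i j k.
 by rewrite /O -sumrN; eq_sum p; rewrite p23 mulrN.
have O23 i j k : O i k j = - O i j k.
 by rewrite /O -sumrN; eq_sum p; rewrite p34 mulrN.
have Q12 i j k : Q j i k = - Q i j k.
 by rewrite /Q -sumrN; eq_sum p; rewrite p23 mulrN.
have Q23 i j k : Q i k j = - Q i j k.
 by rewrite /Q -sumrN; eq_sum p; rewrite p34 mulrN.
have JE : J = (fun=> x) by ext z; rewrite ord1.
rewrite /lee8 hodge_wedge_hodge8; last first.
 apply: alternating_alternation5 dE=> m i j k l; rewrite /D /owedge4.
 - by rewrite (p23 m i j k) (p23 m i j l) (O12 i j) (Q12 i j) (O12 i j) (Q12 i j); ring.
 - by rewrite (p23 m j k l) (p34 m i j k) (O12 j k) (Q12 j k) (O23 i j k) (Q23 i j k); ring.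
 - by rewrite (p34 m i k l) (p34 m j k l) !(O23 i k l, Q23 i k l, O23 j k l, Q23 j k l); ring.
rewrite (sum_ffun4 (fun B=> ext_d e a y (catidx (k := 4) (l := 1) B J) * a y B)).
rewrite (_ : \sum_i _ = - s * \sum_a \sum_b \sum_d \sum_f (tt a * Y b d f x - tt b * Y a d f x
  + tt d * Y a b f x - tt f * Y a b d x + tt x * Y a b d f) * phr R a b d f); last first.
 by rewrite -sum4Z; apply: eq_sum4=> i j k l; rewrite (catidx_idx4 i j k l JE) dE' aE// mulrA.
rewrite (@contract_wedge4 R 8 tt (fun b d f=> Y b d f x) Y (tt x) (phr R) p12 p23 p34).
have OP b : \sum_i \sum_j \sum_k O i j k * phr R b i j k = 42 * u b.
 transitivity (\sum_p u p * \sum_i \sum_j \sum_k phr R p i j k * phr R b i j k).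
  rewrite [RHS](eq_bigr (fun p=> \sum_i \sum_j \sum_k u p * (phr R p i j k * phr R b i j k)))=> [|p _].
   rewrite [RHS]exchange_big; eq_sum i; rewrite [RHS]exchange_big; eq_sum j.
   rewrite [RHS]exchange_big; eq_sum k; rewrite mulr_suml.
   by eq_sum p; rewrite mulrA.
  by rewrite -sum3Z.
 rewrite (eq_bigr (fun p=> 42 * (u p * (p == b)%:R)))=> [|p _]; last by rewrite sum_phr_trace mulrCA.
 by rewrite -mulr_sumr; congr (_ * _); exact: lc_delta.
have OPx b i : \sum_j \sum_k O j k x * phr R b i j k =
  6 * (u b * (i == x)%:R - (b == x)%:R * u i) + 4 * \sum_p u p * phr R b i p x.
 transitivity (\sum_p u p * \sum_j \sum_k phr R b i j k * phr R p j k x).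
  rewrite [RHS](eq_bigr (fun p=> \sum_j \sum_k u p * (phr R b i j k * phr R p j k x)))=> [|p _].
   rewrite [RHS]exchange_big; eq_sum j; rewrite [RHS]exchange_big; eq_sum k.
   by rewrite mulr_suml; eq_sum p; ring.
  by mul_sum j; rewrite mulr_sumr.
 rewrite (eq_bigr (fun p=> 6 * ((i == x)%:R * (u p * (p == b)%:R)) - 6 * ((b == x)%:R * (u p * (p == i)%:R))
  + 4 * (u p * phr R b i p x)))=> [|p _]; last first.
  by rewrite sum_phr_phr (eq_sym b p) (eq_sym i p); ring.
 rewrite big_split sumrB /= -!mulr_sumr.
 rewrite (_ : \sum_i _ = u b); last exact: lc_delta.
 by rewrite (_ : \sum_i _ = u i); [ring|exact: lc_delta].
(* -150 = -4 * 42 + 3 * 6 and 24 = 42 - 3 * 6, from the two contractions of Phi with itself and u of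
   length one. *)
have YP b : \sum_i \sum_j \sum_k Y i j k x * phr R b i j k = - 150 * (b == x)%:R + 24 * u b * u x.
 transitivity (- 4 * (\sum_i \sum_j \sum_k phr R x i j k * phr R b i j k)
  - \sum_i \sum_j \sum_k (u i * O j k x - u j * O i k x + u k * O i j x - u x * O i j k) * phr R b i j k).
  rewrite -sum3Z -[X in _ = _ - X]mul1r -mulNr -sum3Z -sum3D; apply: eq_sum3=> i j k.
  by rewrite /Y /owedge4 (p34 i j x k) (p23 i x j k) (p12 x i j k); ring.
 rewrite (@contract_wedge3 R 8 u (fun j k=> O j k x) O (u x) (phr R b))=> [|i j k|i j k]; [|exact: p23|exact: p34].
 rewrite OP sum_phr_trace (eq_bigr (fun i=> 6 * u b * (u i * (i == x)%:R) - 6 * (b == x)%:R * (u i * u i)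
  + 4 * (u i * \sum_p u p * phr R b i p x)))=> [|i _]; last by rewrite OPx; ring.
 rewrite big_split sumrB /= -!mulr_sumr uu (_ : \sum_i u i * (i == x)%:R = u x); last exact: lc_delta.
 rewrite (_ : \sum_i u i * _ = 0); first by rewrite (eq_sym x b); ring.
 rewrite -[RHS](@sum_antisym R 8 (fun i p=> phr R b i p x) (fun i p=> u i * u p))=> [|i p|i p].
 - by eq_sum i; mul_sum p; ring.
 - exact: p23.
 - by rewrite mulrC.
(* 1176 = 4 * 8 * 42 - 4 * 42, again with u of length one. *)
have YY : \sum_i \sum_j \sum_k \sum_l Y i j k l * phr R i j k l = 1176.
 transitivity (4 * (\sum_i \sum_j \sum_k \sum_l phr R i j k l * phr R i j k l) - \sum_i \sum_j \sum_k \sum_l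
  (u i * O j k l - u j * O i k l + u k * O i j l - u l * O i j k + 0 * O i i i) * phr R i j k l).
  rewrite -sum4Z -[X in _ = _ - X]mul1r -mulNr -sum4Z -sum4D; apply: eq_sum4=> i j k l.
  by rewrite /Y /owedge4; ring.
 rewrite (@contract_wedge4 R 8 u O (fun i _ _ _=> O i i i) 0 (phr R) p12 p23 p34) mul0r addr0.
 rewrite (eq_bigr (fun=> 42))=> [|i _]; last by rewrite sum_phr_trace eqxx mulr1.
 rewrite [X in _ - 4 * X](eq_bigr (fun i=> 42 * (u i * u i)))=> [|i _]; last by rewrite OP mulrCA.
 by rewrite -mulr_sumr uu sumr_const card_ord -mulr_natr; ring.
rewrite YY (eq_bigr (fun b=> - 150 * (tt b * (b == x)%:R) + 24 * u x * (tt b * u b)))=> [|b _]; last first.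
 by rewrite YP; ring.
rewrite big_split /= -!mulr_sumr tu (_ : \sum_i _ = tt x); last exact: lc_delta.
by rewrite /tt; field.
Qed.

End LeeForm8.

(** * Tangent vectors of spheres, lines and products *)

Section Tangents.
Variable R : realType.

Lemma is_derive_rV N (c : R -> 'rV[R]_N) (t : R) (v : 'rV[R]_N) :
 (forall k, is_derive t (1 : R) (fun x=> c x 0 k) (v 0 k)) -> is_derive t (1 : R) c v.
move=> H; have dc : derivable c t 1.
 by apply/derivable_mxP=> i j; rewrite ord1; exact: (ex_derive (is_derive := H j)).
apply: DeriveDef=> //; rewrite derive_mx//; apply/rowP=> k; rewrite mxE.
exact: (derive_val (is_derive := H k)).
Qed.

Lemma is_derive_rVE N (c : R -> 'rV[R]_N) (t : R) v k :
 is_derive t (1 : R) c v -> is_derive t (1 : R) (fun x=> c x 0 k) (v 0 k).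
move=> H; have dc := ex_derive (is_derive := H).
apply: DeriveDef; first by have /derivable_mxP := dc; apply.
by have := derive_val (is_derive := H); rewrite derive_mx// => /rowP/(_ k); rewrite mxE.
Qed.

(** Tangency asks for a curve that stays in M for all real times, whereas p maps only U into M;
    running back and forth along a short segment by a sine keeps the curve inside U and has velocity
    v at 0. *)
Lemma push_tangent n N (M : set 'rV[R]_N) (U : set 'rV[R]_n) (p : 'rV[R]_n -> 'rV[R]_N) y v :
 open U -> U y -> smooth_on U p -> (forall z, U z -> M (p z)) -> tangent M (p y) ('D_v p y).
move=> oU Uy sp Mp.
have /nbhs_ballP[d /= d0 dU] : nbhs y U by exact: open_nbhs_nbhs.
(* The amplitude times |v| stays below the radius d, also when v = 0. *)
pose r : R := d / (2 * (`|v| + 1)).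
have r0 : 0 < r by rewrite divr_gt0// mulr_gt0// ltr_wpDl.
have UU t : U (y + (r * sin (t / r)) *: v).
 apply: dU; rewrite -ball_normE /= opprD addrA subrr sub0r normrN normrZ normrM (gtr0_norm r0).
 apply: (@le_lt_trans _ _ (r * `|v|)).
  rewrite ler_wpM2r// ler_piMr//; first exact: ltW.
  by rewrite ler_norml sin_le1 sin_geN1.
 rewrite /r mulrAC ltr_pdivrMr ?mulr_gt0 ?ltr_wpDl// ltr_pM2l//.
 by have := normr_ge0 v; lra.
exists (fun t=> p (y + (r * sin (t / r)) *: v)); split.
- by rewrite mul0r sin0 mulr0 scale0r addr0.
- by move=> t; exact: Mp.
apply: is_derive_rV=> k.
have dp : differentiable (fun z=> p z 0 k) y.
 by apply: smooth_diff Uy; exact: smooth_comp_coord.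
have H1 : is_derive (0 : R) 1 (fun t : R=> p (y + t *: v) 0 k) ('D_v (fun z=> p z 0 k) y).
 have := @is_derive_line R n (fun z=> p z 0 k) y v 0; rewrite scale0r addr0; exact.
have H2 : is_derive (0 : R) (1 : R) (fun t : R=> r * sin (t / r)) (1 : R).
 have H3 : is_derive (0 : R) (1 : R) (fun t : R=> t / r) r^-1.
  have -> : (fun t : R=> t / r) = r^-1 *: (id : R -> R).
   by ext t; rewrite mulrC.
  by apply: is_derive_eq; rewrite /GRing.scale /= mulr1.
 have H4 := @is_derive1_comp _ sin (fun t : R=> t / r) 0 _ _ (is_derive_sin (0 / r)) H3.
 rewrite (_ : (fun _=> _) = r *: (sin \o (fun t : R=> t / r)))//.
 apply: is_derive_eq.
 by rewrite mul0r cos0 mul1r /GRing.scale /= mulfV// gt_eqF.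
have H5 : is_derive (r * sin (0 / r)) (1 : R) (fun t : R=> p (y + t *: v) 0 k) ('D_v (fun z=> p z 0 k) y).
 by rewrite mul0r sin0 mulr0.
have := @is_derive1_comp _ (fun t : R=> p (y + t *: v) 0 k) (fun t : R=> r * sin (t / r)) 0 _ _ H5 H2; rewrite mulr1 derive_mxE//.
exact: smooth_diff Uy.
Qed.
Lemma dotvC N (u v : 'rV[R]_N) : dotv u v = dotv v u.
by eq_sum i; rewrite mulrC. Qed.

Lemma tangent_dot0 n (x v : 'rV[R]_n.+1) : tangent (@sphere R n) x v -> dotv x v = 0.
move=> [c [c0 Mc dc]].
have H i : is_derive (0 : R) (1 : R) (fun t=> c t 0 i * c t 0 i) (2 * (x 0 i * v 0 i)).
 have Hi := is_derive_rVE i dc; apply: is_derive_eq (is_deriveM Hi Hi) _.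
 by rewrite c0 /GRing.scale /=; ring.
have : is_derive (0 : R) (1 : R) (\sum_i (fun t=> c t 0 i * c t 0 i)) (\sum_i 2 * (x 0 i * v 0 i)).
 exact: is_derive_sum.
rewrite (_ : \sum_i (fun t=> _) = cst 1); last first.
 by ext t; rewrite fct_sumE; exact: Mc.
move=> H'; have := derive_val (is_derive := H'); rewrite derive_cst -mulr_sumr.
rewrite -/(dotv x v); lra.
Qed.

Lemma is_derive_affine (a b : R) : is_derive (0 : R) (1 : R) (fun t : R=> a + t * b) b.
rewrite (_ : (fun t=> _) = cst a + b *: (id : R -> R)); last first.
 by ext t; rewrite mulrC.
apply: (is_derive_eq (is_deriveD (is_derive_cst a (0 : R) (1 : R)) (is_deriveZ b (is_derive_id (0 : R) (1 : R))))).
by rewrite add0r /GRing.scale /= mulr1.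
Qed.

(** The line x + t v is pushed back to the sphere by normalization; as v is orthogonal to x, its
    squared length is 1 + t^2 |v|^2 and the velocity at 0 is unchanged. *)
Lemma dot0_tangent n (x v : 'rV[R]_n.+1) : @sphere R n x -> dotv x v = 0 -> tangent (@sphere R n) x v.
move=> Mx xv; pose b := dotv v v.
have b0 : 0 <= b by apply: sumr_ge0=> i _; rewrite -expr2 sqr_ge0.
have g0 t : 0 < 1 + b * t ^+ 2 by rewrite ltr_wpDr// mulr_ge0// sqr_ge0.
exists (fun t=> (Num.sqrt (1 + b * t ^+ 2))^-1 *: (x + t *: v)); split.
- by rewrite expr0n mulr0 addr0 sqrtr1 invr1 !scale1r scale0r addr0.
- move=> t; rewrite /sphere /= /dotv.
 transitivity ((Num.sqrt (1 + b * t ^+ 2))^-1 ^+ 2 * \sum_i (x 0 i * x 0 i + 2 * t * (x 0 i * v 0 i) + t ^+ 2 * (v 0 i * v 0 i))).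
  by mul_sum i; rewrite !mxE; ring.
 rewrite !big_split /= -!mulr_sumr -!/(dotv _ _) xv Mx mulr0 addr0 -/b.
 by rewrite exprVn sqr_sqrtr ?ltW// (mulrC _ b) mulVf// gt_eqF.
apply: is_derive_rV=> k.
have H1 : is_derive (0 : R) (1 : R) (fun t : R=> 1 + b * t ^+ 2) (0 : R).
 apply: (is_derive_eq (is_deriveD (is_derive_cst (1 : R) (0 : R) (1 : R))
  (is_deriveZ b (is_deriveM (is_derive_id (0 : R) (1 : R)) (is_derive_id (0 : R) (1 : R)))))).
 rewrite -[LHS]/(0 + b * (0 * 1 + 0 * 1)); ring.
have H2 := is_derive_affine (x 0 k) (v 0 k).
have H3 : is_derive (1 + b * 0 ^+ 2) (1 : R) (fun z : R=> (Num.sqrt z)^-1) (- 2^-1 * (Num.sqrt (1 + b * 0 ^+ 2))^-1 ^+ 3).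
 exact: is_derive_isqrt.
have H4 := @is_derive1_comp _ (fun z : R=> (Num.sqrt z)^-1) (fun t : R=> 1 + b * t ^+ 2) 0 _ _ H3 H1.
have := is_deriveM H4 H2; rewrite /= expr0n mulr0 addr0 sqrtr1 invr1 mulr0 scaler0 addr0 scale1r.
rewrite (_ : _ * _ = (fun t=> ((Num.sqrt (1 + b * t ^+ 2))^-1 *: (x + t *: v)) 0 k))//.
by ext t; rewrite !mxE.
Qed.

Lemma tangent_prod N N' (M : set 'rV[R]_N) (L : set 'rV[R]_N') x v :
 tangent (prodM M L) x v <-> tangent M (lsubmx x) (lsubmx v) /\ tangent L (rsubmx x) (rsubmx v).
split=> [[c [c0 Mc dc]]|[[c [c0 Mc dc]] [c' [c0' Mc' dc']]]].
 split.
  exists (fun t=> lsubmx (c t)); split; [by rewrite c0|by move=> t; case: (Mc t)|].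
  apply: is_derive_rV=> k; rewrite mxE; have := is_derive_rVE (lshift N' k) dc.
  by congr is_derive; ext t; rewrite mxE.
 exists (fun t=> rsubmx (c t)); split; [by rewrite c0|by move=> t; case: (Mc t)|].
 apply: is_derive_rV=> k; rewrite mxE; have := is_derive_rVE (rshift N k) dc.
 by congr is_derive; ext t; rewrite mxE.
exists (fun t=> row_mx (c t) (c' t)); split.
- by rewrite c0 c0' hsubmxK.
- by move=> t; rewrite /prodM /= row_mxKl row_mxKr.
apply: is_derive_rV=> k; case: (split_ordP k)=> j ->.
 have := is_derive_rVE j dc; rewrite mxE.
 by congr is_derive; ext t; rewrite row_mxEl.
have := is_derive_rVE j dc'; rewrite mxE.
by congr is_derive; ext t; rewrite row_mxEr.
Qed.

Lemma tangent_line (x v : 'rV[R]_1) : tangent (@line R) x v.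
exists (fun t=> x + t *: v); split=> //; first by rewrite scale0r addr0.
apply: is_derive_rV=> k; have := is_derive_affine (x 0 k) (v 0 k).
by congr is_derive; ext t; rewrite !mxE.
Qed.

End Tangents.

(** Common interface of the line and the circle, so that one argument serves the complete and the
    compact products. The last field is a parametrization by arc length. *)
Record unit_factor R N' (L : set 'rV[R]_N') (form : dform R N' 1) : Prop := Factor {
 fa_lin : forall x c u u', form x (fun=> c *: u + u') = c * form x (fun=> u) + form x (fun=> u');
 fa_tan : forall x c u u', L x -> tangent L x u -> tangent L x u' -> tangent L x (c *: u + u');
 fa_dot : forall x u u', L x -> tangent L x u -> tangent L x u' -> dotv u u' = form x (fun=> u) * form x (fun=> u');
 fa_smooth : forall n (U : set 'rV[R]_n) p e m, open U -> (forall i, smooth_on U (e i)) ->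
  smooth_on U p -> smooth_on U (fun y=> form (p y) (fun=> push p e m y));
 fa_closed : forall n (U : set 'rV[R]_n) p e i j y, open U -> (forall i, smooth_on U (e i)) ->
  smooth_on U p -> (forall z, U z -> L (p z)) -> U y -> \matrix_l e l y \in unitmx ->
  pd e i (fun z=> form (p z) (fun=> push p e j z)) y
  - pd e j (fun z=> form (p z) (fun=> push p e i z)) y =
  \sum_l strck e y i j l * form (p y) (fun=> push p e l y);
 fa_chart : forall x, L x -> exists c c' t0, [/\ c t0 = x, forall t, L (c t), forall t, form (c t) (fun=> c' t) = 1 &
  forall n (U : set 'rV[R]_n) k, open U -> smooth_on U (fun y=> c (y 0 k)) /\
   forall y v, 'D_v (fun y : 'rV[R]_n=> c (y 0 k)) y = v 0 k *: c' (y 0 k)] }.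

Section Factors.
Variable R : realType.

Lemma push_coord n N (U : set 'rV[R]_n) (p : 'rV[R]_n -> 'rV[R]_N) (e : frame R n) i y k :
 smooth_on U p -> U y -> push p e i y 0 k = pd e i (fun z=> p z 0 k) y.
by move=> sp Uy; rewrite /push derive_mxE//; exact: smooth_diff sp Uy. Qed.

Lemma line_factor : unit_factor (@line R) (@line_form R).
split.
- by move=> x c u u'; rewrite /line_form !mxE.
- by move=> *; exact: tangent_line.
- by move=> x u u' _ _ _; rewrite /dotv big_ord1.
- move=> n U p e m oU se sp; apply: (smooth_eqon oU (f := pd e m (fun z=> p z 0 0))).
  by move=> z Uz; rewrite /line_form (push_coord _ _ _ sp Uz).
 by apply: smooth_pd=> //; exact: smooth_comp_coord.
- move=> n U p e i j y oU se sp _ Uy eu.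
 have E m z : U z -> line_form (p z) (fun=> push p e m z) = pd e m (fun z=> p z 0 0) z.
  by move=> Uz; rewrite /line_form (push_coord _ _ _ sp Uz).
 rewrite (pd_eqon e oU i (E j) Uy) (pd_eqon e oU j (E i) Uy).
 rewrite (pd_commutatork i j oU se Uy (smooth_comp_coord oU 0 sp) eu).
 by eq_sum l; rewrite (E l).
- move=> x _; exists (fun t=> const_mx t), (fun=> const_mx 1), (x 0 0); split=> //.
 + by apply/rowP=> k; rewrite mxE ord1.
 + by move=> t; rewrite /line_form mxE.
 move=> n U k oU.
 have sc V : open V -> smooth_on V (fun y : 'rV[R]_n=> const_mx (y 0 k) : 'rV[R]_1).
  move=> oV; apply: smooth_mx=> // j.
  by apply: (smooth_eqon oV _ (smooth_coord oV k))=> y _; rewrite mxE.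
 split=> [|y v]; first exact: sc.
 apply/rowP=> j; rewrite derive_mxE ?mxE; last first.
  exact: smooth_diff (sc _ openT) _.
 rewrite (_ : (fun z : 'rV[R]_n=> _) = fun z=> z 0 k); last by ext z; rewrite mxE.
 by rewrite derive_coord mulr1.
Qed.
Lemma dotv2 (u v : 'rV[R]_2) : dotv u v = u 0 0 * v 0 0 + u 0 1 * v 0 1.
by rewrite /dotv big_ord_recl big_ord1 (_ : lift ord0 ord0 = 1 :> 'I_2)//; exact: val_inj. Qed.

Lemma circle_angle (x y : R) : x ^+ 2 + y ^+ 2 = 1 -> exists t : R, cos t = x /\ sin t = y.
move=> xy; have x1 : -1 <= x <= 1.
 by rewrite -ler_norml -(@ler_pXn2r _ 2) ?nnegrE// expr1n real_normK ?num_real//; have := sqr_ge0 y; lra.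
have sE : sin (acos x) = `|y|.
 by rewrite sin_acos// -xy (addrC (x ^+ 2)) addrK sqrtr_sqr.
have cE : cos (acos x) = x by apply: acosK; rewrite in_itv.
have [y0|y0] := leP 0 y; first by exists (acos x); rewrite cE sE ger0_norm.
by exists (- acos x); rewrite cosN sinN cE sE ltr0_norm// opprK.
Qed.

(** A vector orthogonal to the unit vector x is a multiple of x turned by a right angle, and the
    unit form is that multiple. *)
Lemma circle_tangent_algebra (x0 x1 u0 u1 v0 v1 : R) : x0 * x0 + x1 * x1 = 1 ->
 x0 * u0 + x1 * u1 = 0 -> x0 * v0 + x1 * v1 = 0 ->
 u0 * v0 + u1 * v1 = (x0 * u1 - x1 * u0) * (x0 * v1 - x1 * v0) /\ u0 * v1 - u1 * v0 = 0.
move=> xx xu xv.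
have E0 : u0 = - x1 * (x0 * u1 - x1 * u0).
 by rewrite -[LHS]mul1r -xx -[X in _ = X]addr0 -(mulr0 x0) -xu; ring.
have E1 : u1 = x0 * (x0 * u1 - x1 * u0).
 by rewrite -[LHS]mul1r -xx -[X in _ = X]addr0 -(mulr0 x1) -xu; ring.
move: E0 E1; set w := x0 * u1 - x1 * u0=> E0 E1; split; first by rewrite E0 E1; ring.
rewrite E0 E1; transitivity (- w * (x0 * v0 + x1 * v1)); first by ring.
by rewrite xv mulr0.
Qed.

Lemma circle_closed_algebra (a0 a1 b0 b1 f0 f1 m01 m00 m11 m10 : R) : a0 * b1 - a1 * b0 = 0 ->
 a0 * b1 + f0 * m01 - (a1 * b0 + f1 * m00) - (b0 * a1 + f0 * m11 - (b1 * a0 + f1 * m10)) =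
 f0 * (m01 - m11) - f1 * (m00 - m10).
by move=> det0; transitivity (2 * (a0 * b1 - a1 * b0) + (f0 * (m01 - m11) - f1 * (m00 - m10)));
 [ring|rewrite det0; ring]. Qed.

Lemma circle_factor : unit_factor (@circle R) (@circle_form R).
have cE (x v : 'rV[R]_2) : circle_form x (fun=> v) = x 0 0 * v 0 1 - x 0 1 * v 0 0 by [].
have cx (x : 'rV[R]_2) : circle x -> x 0 0 * x 0 0 + x 0 1 * x 0 1 = 1 by move=> Cx; rewrite -dotv2.
have tx (x v : 'rV[R]_2) : tangent (@circle R) x v -> x 0 0 * v 0 0 + x 0 1 * v 0 1 = 0.
 by move=> /tangent_dot0; rewrite dotv2.
split.
- by move=> x c u u'; rewrite !cE !mxE; ring.
- move=> x c u u' Lx /tx tu /tx tu'; apply: dot0_tangent=> //; rewrite dotv2 !mxE.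
 by transitivity (c * (x 0 0 * u 0 0 + x 0 1 * u 0 1) + (x 0 0 * u' 0 0 + x 0 1 * u' 0 1));
  [ring|rewrite tu tu'; ring].
- move=> x u u' /cx Lx /tx tu /tx tu'; rewrite dotv2 !cE.
 by have [] := circle_tangent_algebra Lx tu tu'.
- move=> n U p e m oU se sp.
 apply: (smooth_eqon oU (f := fun z=> p z 0 0 * pd e m (fun z=> p z 0 1) z
   + - (p z 0 1 * pd e m (fun z=> p z 0 0) z))).
  by move=> z Uz; rewrite cE !(push_coord _ _ _ sp Uz).
 apply: smoothD=> //; [|apply: smoothN=> //]; apply: smoothM=> //; try exact: smooth_comp_coord;
  by apply: smooth_pd=> //; exact: smooth_comp_coord.
- move=> n U p e i j y oU se sp Lp Uy eu.
 pose f k := fun z=> p z 0 k : R.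
 have sf k : smooth_on U (f k) by exact: smooth_comp_coord.
 have spd m k : smooth_on U (pd e m (f k)) by exact: smooth_pd.
 have df k : differentiable (f k) y by exact: smooth_diff (sf k) Uy.
 have dpd m k : differentiable (pd e m (f k)) y by exact: smooth_diff (spd m k) Uy.
 have E m z : U z -> circle_form (p z) (fun=> push p e m z) = f 0 z * pd e m (f 1) z - f 1 z * pd e m (f 0) z.
  by move=> Uz; rewrite cE !(push_coord _ _ _ sp Uz).
 have D m m' : pd e m (fun z=> f 0 z * pd e m' (f 1) z - f 1 z * pd e m' (f 0) z) y =
   pd e m (f 0) y * pd e m' (f 1) y + f 0 y * pd e m (pd e m' (f 1)) y
   - (pd e m (f 1) y * pd e m' (f 0) y + f 1 y * pd e m (pd e m' (f 0)) y).
  have dN : differentiable (fun z=> - (f 1 z * pd e m' (f 0) z)) y.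
   by apply: differentiableN; apply: differentiableM.
  rewrite (pdD e m (differentiableM (df 0) (dpd m' 1)) dN).
  rewrite (pdN e m (differentiableM (df 1) (dpd m' 0))).
  by rewrite (pdM e m (df 0) (dpd m' 1)) (pdM e m (df 1) (dpd m' 0)).
 rewrite (pd_eqon e oU i (E j) Uy) (pd_eqon e oU j (E i) Uy) !D.
 have T m : p y 0 0 * pd e m (f 0) y + p y 0 1 * pd e m (f 1) y = 0.
  by rewrite -!(push_coord _ _ _ sp Uy); apply: tx; exact: push_tangent oU Uy sp Lp.
 (* The extra term in the derivative of x dy - y dx is the area of two parallel vectors, hence zero
    on the circle. *)
 have [_ det0] := circle_tangent_algebra (cx _ (Lp _ Uy)) (T i) (T j).
 have C k := pd_commutatork i j oU se Uy (sf k) eu.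
 transitivity (f 0 y * (\sum_l strck e y i j l * pd e l (f 1) y) - f 1 y * (\sum_l strck e y i j l * pd e l (f 0) y)).
  by rewrite -!C; apply: circle_closed_algebra det0.
 rewrite !mulr_sumr -sumrB; eq_sum l; rewrite (E l y Uy); ring.
- move=> x Lx; have [t [ct st]] : exists t : R, cos t = x 0 0 /\ sin t = x 0 1.
  by apply: circle_angle; have := cx x Lx; rewrite !expr2.
 exists (fun t=> \row_k (if k == 0 then cos t else sin t)), (fun t=> \row_k (if k == 0 then - sin t else cos t)), t.
 split.
 + by apply/rowP=> -[[|[|//]] pk]; rewrite mxE /= ?ct ?st; congr (x 0 _); exact: val_inj.
 + by move=> z; rewrite /circle /sphere /= dotv2 !mxE /= -!expr2 cos2Dsin2.
 + by move=> z; rewrite cE !mxE /= mulrN opprK -!expr2 cos2Dsin2.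
 move=> n U k oU.
 have sc V : open V -> smooth_on V (fun y : 'rV[R]_n=> \row_j (if j == 0 then cos (y 0 k) else sin (y 0 k)) : 'rV[R]_2).
  move=> oV; apply: smooth_mx=> // j; have [->|j0] := eqVneq j 0.
   by apply: (smooth_eqon oV _ (smooth_cos oV (smooth_coord oV k)))=> y _; rewrite mxE.
  by apply: (smooth_eqon oV _ (smooth_sin oV (smooth_coord oV k)))=> y _; rewrite mxE (negPf j0).
 split=> [|y v]; first exact: sc.
 have dk : differentiable (fun y : 'rV[R]_n=> y 0 k) y.
  exact: smooth_diff (smooth_coord openT k) _.
 apply/rowP=> j; rewrite derive_mxE ?mxE; last first.
  exact: smooth_diff (sc _ openT) _.
 have [->|j0] := eqVneq j 0.
  rewrite (_ : (fun z : 'rV[R]_n=> _) = cos \o (fun z=> z 0 k)); last by ext z; rewrite mxE.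
  by have [_ ->] := is_derive_comp1 dk (is_derive_cos (y 0 k)) (derive_coord k v y); rewrite mulrC.
 rewrite (_ : (fun z : 'rV[R]_n=> _) = sin \o (fun z=> z 0 k)); last first.
  by ext z; rewrite mxE (negPf j0).
 by have [_ ->] := is_derive_comp1 dk (is_derive_sin (y 0 k)) (derive_coord k v y); rewrite mulrC.
Qed.

End Factors.

(* S^6 times r lines or circles, embedded in R^N so that the coordinates emb k
are those of the point of the sphere; eta s is the unit form of factor s. *)
Record sphere_product R r N (M : set 'rV[R]_N) (emb : 'I_7 -> 'I_N)
  (eta : 'I_r -> 'rV[R]_N -> 'rV[R]_N -> R) : Prop := SphereProduct {
 sp_unit : forall x, M x -> lc (fun k=> x 0 (emb k)) (fun k=> x 0 (emb k)) = 1;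
 sp_orth : forall x v, M x -> tangent M x v -> lc (fun k=> x 0 (emb k)) (fun k=> v 0 (emb k)) = 0;
 sp_lin : forall s x c u u', eta s x (c *: u + u') = c * eta s x u + eta s x u';
 sp_tan : forall x c u u', M x -> tangent M x u -> tangent M x u' -> tangent M x (c *: u + u');
 sp_dot : forall x u u', M x -> tangent M x u -> tangent M x u' ->
  dotv u u' = lc (fun k=> u 0 (emb k)) (fun k=> u' 0 (emb k)) + \sum_s eta s x u * eta s x u';
 sp_smooth : forall n (U : set 'rV[R]_n) p e m s, open U -> (forall i, smooth_on U (e i)) ->
  smooth_on U p -> smooth_on U (fun y=> eta s (p y) (push p e m y));
 sp_closed : forall n (U : set 'rV[R]_n) p e i j s y, open U -> (forall i, smooth_on U (e i)) ->
  smooth_on U p -> (forall z, U z -> M (p z)) -> U y -> \matrix_l e l y \in unitmx ->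
  pd e i (fun z=> eta s (p z) (push p e j z)) y
  - pd e j (fun z=> eta s (p z) (push p e i z)) y =
  \sum_l strck e y i j l * eta s (p y) (push p e l y) }.

(** * Products of the sphere with lines or circles *)

Section SphereProducts.
Variable R : realType.

Lemma S6_product (eta : 'I_0 -> 'rV[R]_7 -> 'rV[R]_7 -> R) : sphere_product (@sphere R 6) id eta.
split=> //; try by case.
- by move=> x v Mx /tangent_dot0.
- move=> x c u u' Mx /tangent_dot0 tu /tangent_dot0 tu'; apply: dot0_tangent=> //.
 transitivity (c * dotv x u + dotv x u'); last by rewrite tu tu' mulr0 addr0.
 by rewrite /dotv mulr_sumr -big_split; eq_sum i=> /=; rewrite !mxE; ring.
- by move=> x u u' _ _ _; rewrite big_ord0 addr0.
- by move=> n U p e m [].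
- by move=> n U p e i j [].
Qed.

Definition eta_times r N N' (eta : 'I_r -> 'rV[R]_N -> 'rV[R]_N -> R) (form : dform R N' 1)
  (s : 'I_(r + 1)) (x v : 'rV[R]_(N + N')) : R :=
 match fintype.split s with
 | inl s' => eta s' (lsubmx x) (lsubmx v)
 | inr _ => form (rsubmx x) (fun=> rsubmx v) end.

Lemma eta_times_l r N N' eta form s (x v : 'rV[R]_(N + N')) :
 eta_times (r := r) eta form (lshift 1 s) x v = eta s (lsubmx x) (lsubmx v).
by rewrite /eta_times split_lshift. Qed.

Lemma eta_times_r r N N' (eta : 'I_r -> 'rV[R]_N -> 'rV[R]_N -> R) form s (x v : 'rV[R]_(N + N')) :
 eta_times eta form (rshift r s) x v = form (rsubmx x) (fun=> rsubmx v).
by rewrite /eta_times split_rshift. Qed.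

Lemma dotv_sub N N' (u v : 'rV[R]_(N + N')) : dotv u v = dotv (lsubmx u) (lsubmx v) + dotv (rsubmx u) (rsubmx v).
by rewrite /dotv big_split_ord; congr (_ + _); eq_sum i; rewrite !mxE.
Qed.

Lemma smooth_lsubmx n N N' (U : set 'rV[R]_n) (p : 'rV[R]_n -> 'rV[R]_(N + N')) :
 open U -> smooth_on U p -> smooth_on U (fun y=> lsubmx (p y)).
move=> oU sp; apply: smooth_mx=> // k.
by apply: (smooth_eqon oU _ (smooth_comp_coord oU (lshift N' k) sp))=> y _; rewrite mxE.
Qed.

Lemma smooth_rsubmx n N N' (U : set 'rV[R]_n) (p : 'rV[R]_n -> 'rV[R]_(N + N')) :
 open U -> smooth_on U p -> smooth_on U (fun y=> rsubmx (p y)).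
move=> oU sp; apply: smooth_mx=> // k.
by apply: (smooth_eqon oU _ (smooth_comp_coord oU (rshift N k) sp))=> y _; rewrite mxE.
Qed.

Lemma push_lsubmx n N N' (U : set 'rV[R]_n) (p : 'rV[R]_n -> 'rV[R]_(N + N')) e i y :
 open U -> smooth_on U p -> U y -> lsubmx (push p e i y) = push (fun z=> lsubmx (p z)) e i y.
move=> oU sp Uy; apply/rowP=> k; rewrite (push_coord _ _ _ (smooth_lsubmx oU sp) Uy) mxE.
by rewrite (push_coord _ _ _ sp Uy); congr pd; ext z; rewrite mxE.
Qed.

Lemma push_rsubmx n N N' (U : set 'rV[R]_n) (p : 'rV[R]_n -> 'rV[R]_(N + N')) e i y :
 open U -> smooth_on U p -> U y -> rsubmx (push p e i y) = push (fun z=> rsubmx (p z)) e i y.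
move=> oU sp Uy; apply/rowP=> k; rewrite (push_coord _ _ _ (smooth_rsubmx oU sp) Uy) mxE.
by rewrite (push_coord _ _ _ sp Uy); congr pd; ext z; rewrite mxE.
Qed.

Lemma times_product r N N' (M : set 'rV[R]_N) (L : set 'rV[R]_N') emb (eta : 'I_r -> _) form :
 sphere_product M emb eta -> unit_factor L form ->
 sphere_product (r := r + 1) (prodM M L) (fun k=> lshift N' (emb k)) (eta_times eta form).
move=> sM fL.
have lE (x : 'rV[R]_(N + N')) : (fun k=> x 0 (lshift N' (emb k))) = (fun k=> lsubmx x 0 (emb k)).
 by ext k; rewrite mxE.
split.
- by move=> x [Mx _]; rewrite lE; exact: sp_unit sM _ Mx.
- by move=> x v [Mx _] /tangent_prod[tv _]; rewrite !lE; exact: sp_orth sM _ _ Mx tv.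
- move=> s x c u u'; rewrite /eta_times; case: fintype.split=> s'.
  by rewrite linearP /= (sp_lin sM).
 by rewrite linearP /= (fa_lin fL).
- move=> x c u u' [Mx Lx] /tangent_prod[tu ru] /tangent_prod[tu' ru']; apply/tangent_prod.
 by rewrite !linearP; split; [exact: sp_tan sM _ _ _ _ Mx tu tu'|exact: fa_tan fL _ _ _ _ Lx ru ru'].
- move=> x u u' [Mx Lx] /tangent_prod[tu ru] /tangent_prod[tu' ru'].
 rewrite dotv_sub (sp_dot sM Mx tu tu') (fa_dot fL Lx ru ru') !lE -addrA; congr (_ + _).
 rewrite big_split_ord big_ord1 !eta_times_r; congr (_ + _).
 by eq_sum s; rewrite !eta_times_l.
- move=> n U p e m s oU se sp; case: (split_ordP s)=> s' ->.
  apply: (smooth_eqon oU _ (sp_smooth sM m s' oU se (smooth_lsubmx oU sp)))=> y Uy.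
  by rewrite eta_times_l (push_lsubmx _ _ oU sp Uy).
 apply: (smooth_eqon oU _ (fa_smooth fL m oU se (smooth_rsubmx oU sp)))=> y Uy.
 by rewrite eta_times_r (push_rsubmx _ _ oU sp Uy).
- move=> n U p e i j s y oU se sp Mp Uy eu; case: (split_ordP s)=> s' ->.
  have E m z : U z -> eta_times eta form (lshift 1 s') (p z) (push p e m z) =
    eta s' (lsubmx (p z)) (push (fun z=> lsubmx (p z)) e m z).
   by move=> Uz; rewrite eta_times_l (push_lsubmx _ _ oU sp Uz).
  rewrite (pd_eqon e oU i (E j) Uy) (pd_eqon e oU j (E i) Uy).
  rewrite (sp_closed sM i j s' oU se (smooth_lsubmx oU sp) _ Uy eu)=> [|z /Mp[]//].
  by eq_sum l; rewrite (E l y Uy).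
 have E m z : U z -> eta_times eta form (rshift r s') (p z) (push p e m z) =
   form (rsubmx (p z)) (fun=> push (fun z=> rsubmx (p z)) e m z).
  by move=> Uz; rewrite eta_times_r (push_rsubmx _ _ oU sp Uz).
 rewrite (pd_eqon e oU i (E j) Uy) (pd_eqon e oU j (E i) Uy).
 rewrite (fa_closed fL i j oU se (smooth_rsubmx oU sp) _ Uy eu)=> [|z /Mp[]//].
 by eq_sum l; rewrite (E l y Uy).
Qed.

(** The Gram matrix of the pushed frame is the identity and factors through the matrix of frame
    coefficients. *)
Lemma onframe_unit n N (M : set 'rV[R]_N) U p (e : frame R n) y :
 onframe M U p e -> U y -> \matrix_l e l y \in unitmx.
move=> [oU sp se _ on] Uy.
pose J := lin1_mx ('d p y).
have pE i : push p e i y = e i y *m J.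
 by rewrite mul_rV_lin1 /push deriveE//; exact: smooth_diff sp Uy.
have : (\matrix_l e l y) *m (J *m ((\matrix_l e l y) *m J)^T) = 1%:M.
 rewrite mulmxA; apply/matrixP=> i j; rewrite !mxE -(on y i j Uy) /dotv !pE.
 eq_sum k; rewrite [X in _ * X]mxE; congr (_ * _); rewrite !mxE; by eq_sum l; rewrite !mxE.
by case/mulmx1_unit.
Qed.

Lemma onframe_pf r N (M : set 'rV[R]_N) emb eta U p (e : frame R (6 + r)) :
 sphere_product M emb eta -> onframe M U p e ->
 product_frame U e (fun k y=> p y 0 (emb k)) (fun s i y=> eta s (p y) (push p e i y)).
move=> sM ofr; have [oU sp se Mp on] := ofr.
have tp i y : U y -> tangent M (p y) (push p e i y) by move=> Uy; exact: push_tangent oU Uy sp Mp.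
split=> //.
- by move=> y Uy; exact: onframe_unit ofr Uy.
- by move=> k; exact: smooth_comp_coord.
- by move=> s i; exact: (sp_smooth sM i s oU se sp).
- by move=> y Uy; exact: sp_unit sM _ (Mp _ Uy).
- move=> y i j Uy; rewrite -(on y i j Uy) (sp_dot sM (Mp _ Uy) (tp i y Uy) (tp j y Uy)).
 by congr (lc _ _ + _); ext k; rewrite (push_coord _ _ _ sp Uy).
- move=> y s i j Uy; apply: (sp_closed sM i j s oU se sp Mp Uy).
 exact: onframe_unit ofr Uy.
Qed.

End SphereProducts.

(** * The nearly Kahler relation determines Psi^+ *)

Section Multilinear.
Variables (R : realType) (N k : nat).
Variable P : 'rV[R]_N -> Prop.

Definition multilinear_on (f : ('I_k -> 'rV[R]_N) -> R) : Prop :=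
 forall v s c u u', (forall t, P (v t)) -> P u -> P u' ->
  f (upd v s (c *: u + u')) = c * f (upd v s u) + f (upd v s u').

Hypothesis P0 : P 0.
Hypothesis PD : forall c u u', P u -> P u' -> P (c *: u + u').
Variables (n : nat) (E : 'I_n -> 'rV[R]_N).
Hypothesis PE : forall j, P (E j).
Hypothesis span : forall v, P v -> exists c : 'I_n -> R, v = \sum_j c j *: E j.

(** Forms are linear only as long as every slot holds a tangent vector, so the slots are expanded
    one at a time, and all intermediate vectors are shown to stay in P. *)
Lemma multilinear_eq (f g : ('I_k -> 'rV[R]_N) -> R) : multilinear_on f -> multilinear_on g ->
 (forall I : 'I_k -> 'I_n, f (fun s=> E (I s)) = g (fun s=> E (I s))) ->
 forall v, (forall s, P (v s)) -> f v = g v.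
move=> ml mg fg v Pv; apply/subr0_eq; pose h v := f v - g v; rewrite -/(h v).
have mh : multilinear_on h.
 by move=> w s c u u' Pw Pu Pu'; rewrite /h ml// mg//; ring.
have h0 w s : (forall t, P (w t)) -> h (upd w s 0) = 0.
 by move=> Pw; have := mh w s 1 0 0 Pw P0 P0; rewrite scaler0 addr0 mul1r; lra.
(* The slots from m on already hold frame vectors; at m = k nothing is assumed and at m = 0 the
   hypothesis on frames applies. *)
suff H m w : (m <= k)%N -> (forall s, P (w s)) -> (forall s : 'I_k, (m <= s)%N -> exists j, w s = E j) -> h w = 0.
 by apply: (H k)=> // s; rewrite leqNgt ltn_ord.
elim: m w=> [|m IH] w mk Pw wE.
 have [I IE] := choice (fun s=> wE s isT).
 by rewrite /h (_ : w = fun s=> E (I s)) ?fg ?subrr//; apply/funext.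
pose s := Ordinal mk; have [c wsE] := span (Pw s).
have -> : w = upd w s (\sum_j c j *: E j).
 by ext t; rewrite /upd; case: eqP=> [->|].
have PS (r : seq 'I_n) : P (\sum_(j <- r) c j *: E j).
 by elim: r=> [|j r IHr]; rewrite ?big_nil ?big_cons//; exact: PD.
elim: (index_enum _)=> [|j r IHr]; first by rewrite big_nil h0.
rewrite big_cons mh// IHr addr0 (IH (upd w s (E j))) ?mulr0 ?(ltnW mk)//.
 by move=> t; rewrite /upd; case: eqP.
move=> t mt; rewrite /upd; case: eqP=> [_|/eqP ts]; first by exists j.
by apply: wE; rewrite ltn_neqAle mt andbT; apply: contra_neq ts=> mE; exact: val_inj.
Qed.

End Multilinear.

Lemma ext_d2_algebra R n (G : Tri n R) (S : Bil n R) (pi pj pk : R) i j k : (forall a b, S b a = - S a b) ->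
 (pi + \sum_p (G i j p * S p k + G i k p * S j p)
  - (\sum_p (G i j p - G j i p) * S p k + \sum_p (G i k p - G k i p) * S j p))
 - (pj + \sum_p (G j i p * S p k + G j k p * S i p)
   - \sum_p (G j k p - G k j p) * S i p)
 + (pk + \sum_p (G k i p * S p j + G k j p * S i p)) = pi - pj + pk.
move=> Sa.
set S1 := \sum_p (G i j p * _ + _); set S2 := \sum_p (G i j p - _) * _.
set S3 := \sum_p (G i k p - _) * _; set S4 := \sum_p (G j i p * _ + _).
set S5 := \sum_p (G j k p - _) * _; set S6 := \sum_p (G k i p * _ + _).
suff : S1 - (S2 + S3) - (S4 - S5) + S6 = 0 by lra.
rewrite /S1 /S2 /S3 /S4 /S5 /S6 !opprB !opprD -!sumrN -!big_split /=.
by rewrite big1// => p _; rewrite (Sa j p); ring.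
Qed.

Lemma ext_d2_LC R n (e : frame R n) (a : lform R n 2) y (P : Tri n R) (S : Bil n R) i j k :
 (forall a b, S b a = - S a b) -> (forall b c, a y (tup2 b c) = S b c) ->
 (forall m b c, pd e m (fun z=> a z (tup2 b c)) y =
   P m b c + \sum_l (LCk e y m b l * S l c + LCk e y m c l * S b l)) ->
 ext_d e a y (tup3 i j k) = P i j k - P j i k + P k i j.
move=> Sa aS D; rewrite ext_d2E !D.
have SK x z (f : 'I_n -> 'I_2 -> 'I_n) (g : 'I_n -> R) : (forall l, a y (f l) = g l) ->
  \sum_l strck e y x z l * a y (f l) = \sum_l (LCk e y x z l - LCk e y z x l) * g l.
 by move=> E; eq_sum l; rewrite LCk_torsion_free E.
rewrite (SK i j _ (fun l=> S l k)); last by move=> l; exact: aS.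
rewrite (SK i k _ (fun l=> S j l)); last by move=> l; exact: aS.
rewrite (SK j k _ (fun l=> S i l)); last by move=> l; exact: aS.
exact: ext_d2_algebra.
Qed.

Definition co R N (x : 'rV[R]_N) (k : 'I_N) : R := x 0 k.

Section KahlerDerivative.
Variables (R : realType) (r : nat) (U : set 'rV[R]_(6 + r)) (e : frame R (6 + r)).
Variables (q : 'I_7 -> 'rV[R]_(6 + r) -> R) (t : 'I_r -> 'I_(6 + r) -> 'rV[R]_(6 + r) -> R).
Hypothesis pf : product_frame U e q t.

Lemma om3_scale2 c (u w : 'I_7 -> R) : om3 u (fun l=> c * u l) w = 0.
rewrite om3_12 (_ : om3 _ u w = c * om3 u u w); last exact: lcZl.
by rewrite om3_alt12 mulr0 oppr0.
Qed.

Lemma kahler_derivative_algebra n (A : 'I_n -> 'I_7 -> R) (x am aa ab u v : 'I_7 -> R) (La Lb : 'I_n -> R) ha hb :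
 om3 x u ab = om3 x (fun k=> comb La A k - ha * x k) ab ->
 om3 x aa v = om3 x aa (fun k=> comb Lb A k - hb * x k) ->
 - (om3 am aa ab + om3 x u ab + om3 x aa v) =
 - om3 am aa ab + \sum_l (La l * - om3 x (A l) ab + Lb l * - om3 x aa (A l)).
move=> -> ->; rewrite om3_sub2 om3_sub3 om3_comb2 om3_comb3 om3_scale2.
rewrite (om3_23 x _ aa) om3_scale2 oppr0 !subr0 !opprD -addrA; congr (_ + _).
by rewrite subr0 big_split /= -!lcN.
Qed.

Lemma pd_kahler y m a b : U y -> pd e m (fun z=> - om3 (q^~ z) (av e q z a) (av e q z b)) y =
 - om3 (av e q y m) (av e q y a) (av e q y b) +
 \sum_l (LCk e y m a l * - om3 (q^~ y) (av e q y l) (av e q y b)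
  + LCk e y m b l * - om3 (q^~ y) (av e q y a) (av e q y l)).
move=> Uy.
have dav x i : differentiable (fun z=> av e q z x i) y by exact: (da pf).
have dqy i : differentiable (q i) y by exact: (dq pf i Uy).
rewrite (pdN e m (differentiable_om3 dqy (dav a) (dav b))) (pd_om3 e m dqy (dav a) (dav b)).
transitivity (- (om3 (av e q y m) (av e q y a) (av e q y b)
 + om3 (q^~ y) (fun k=> pd e m (fun z=> av e q z a k) y) (av e q y b)
 + om3 (q^~ y) (av e q y a) (fun k=> pd e m (fun z=> av e q z b k) y))); first by [].
have E2 := congr1 (fun v=> om3 (q^~ y) v (av e q y b)) (pd_av_comb pf m a Uy).
have E3 := congr1 (fun v=> om3 (q^~ y) (av e q y a) v) (pd_av_comb pf m b Uy).
exact: (kahler_derivative_algebra (av e q y m) E2 E3).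
Qed.

End KahlerDerivative.

Section NearlyKahler.
Variable R : realType.

Lemma F_S6E (x : 'rV[R]_7) v : @F_S6 R x v = - om3 (co x) (co (v 0)) (co (v 1)).
rewrite -om3_23 -om3_cr lc_sym; eq_sum k; congr (_ * _).
rewrite mxE /cr /lc2 /lc; eq_sum i; mul_sum j.
by rewrite -[idx3 i j k]/(tup3 i j k) omega_stdE /co /omr; ring.
Qed.

Section SphereFrame.
Variables (U : set 'rV[R]_(6 + 0)) (p : 'rV[R]_(6 + 0) -> 'rV[R]_7) (e : frame R (6 + 0)).
Hypothesis ofr : onframe (@sphere R 6) U p e.

Definition sphere_eta (s : 'I_0) (x v : 'rV[R]_7) : R := 0.

Let q (k : 'I_7) y := p y 0 k : R.
Let oU : open U. Proof. by case: ofr. Qed.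
Let sp : smooth_on U p. Proof. by case: ofr. Qed.
Let Mp y : U y -> sphere (p y). Proof. by move=> Uy; case: ofr=> _ _ _ + _; apply. Qed.
Let pf := onframe_pf (S6_product sphere_eta) ofr.

Lemma co_push y i : U y -> co (push p e i y) = av e q y i.
by move=> Uy; ext k; rewrite /co (push_coord _ _ _ sp Uy). Qed.

Lemma sphere_tangent_span y v : U y -> tangent (@sphere R 6) (p y) v ->
 v = \sum_i lc (co v) (av e q y i) *: push p e i y.
move=> Uy tv; apply/rowP=> k; rewrite summxE.
transitivity (lc (co v) (fun l=> \sum_i av e q y i l * av e q y i k)).
 rewrite (eq_lc _ (y := fun l=> (l == k)%:R - q k y * q l y))=> [|l].
  rewrite lcB lc_delta lcZ (_ : lc _ (q^~ y) = 0) ?mulr0 ?subr0// lc_sym.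
  exact: (tangent_dot0 tv).
 by rewrite (av_complete pf l k Uy) mulrC.
rewrite lc_sum; eq_sum i; rewrite lcZr mxE; congr (_ * _).
by rewrite -[RHS]/(co (push p e i y) k) co_push.
Qed.

(** Differentiating the base point in F = -omega(q, ., .) gives -omega on the frame, and alternation
    yields three equal terms. *)
Lemma ext_d_F y i j k : U y ->
 ext_d e (comps p e (@F_S6 R)) y (tup3 i j k) = - 3 * om3 (av e q y i) (av e q y j) (av e q y k).
move=> Uy.
have FE z a b : U z -> comps p e (@F_S6 R) z (tup2 a b) = - om3 (q^~ z) (av e q z a) (av e q z b).
 by move=> Uz; rewrite /comps F_S6E !(co_push _ Uz).
transitivity (- om3 (av e q y i) (av e q y j) (av e q y k)
 - - om3 (av e q y j) (av e q y i) (av e q y k) + - om3 (av e q y k) (av e q y i) (av e q y j)).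
 apply: (ext_d2_LC (P := fun m a b=> - om3 (av e q y m) (av e q y a) (av e q y b))
  (S := fun a b=> - om3 (q^~ y) (av e q y a) (av e q y b)))=> [a b|a b|m a b].
 - by rewrite om3_23.
 - exact: FE.
 - rewrite (pd_eqon e oU m (fun z=> FE z a b) Uy); exact: (pd_kahler pf m a b Uy).
rewrite (om3_12 (av e q y i)) (om3_12 (av e q y i) (av e q y k)) (om3_23 (av e q y i) (av e q y j)); ring.
Qed.

End SphereFrame.

End NearlyKahler.

Section MultilinearForms.
Variables (R : realType) (N : nat) (P : 'rV[R]_N -> Prop).
Implicit Types (l : 'rV[R]_N -> 'I_7 -> R).

Definition slotwise l : Prop := forall c u u', l (c *: u + u') = (fun k=> c * l u k + l u' k).

Lemma om3_lin1 (c : R) (x z u v : 'I_7 -> R) : om3 (fun k=> c * x k + z k) u v = c * om3 x u v + om3 z u v.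
by rewrite /om3 /lc3 lcDl lcZl. Qed.
Lemma om3_lin2 (c : R) (x z u v : 'I_7 -> R) : om3 u (fun k=> c * x k + z k) v = c * om3 u x v + om3 u z v.
by rewrite !(om3_12 _ u) om3_lin1; ring. Qed.
Lemma om3_lin3 (c : R) (x z u v : 'I_7 -> R) : om3 u v (fun k=> c * x k + z k) = c * om3 u v x + om3 u v z.
by rewrite !(om3_23 u _ v) om3_lin2; ring. Qed.
Lemma ps4_lin1 (c : R) (x z u v w : 'I_7 -> R) : ps4 (fun k=> c * x k + z k) u v w = c * ps4 x u v w + ps4 z u v w.
by rewrite /ps4 /lc4 lcDl lcZl. Qed.
Lemma ps4_lin2 (c : R) (x z u v w : 'I_7 -> R) : ps4 u (fun k=> c * x k + z k) v w = c * ps4 u x v w + ps4 u z v w.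
by rewrite !(ps4_12 _ u) ps4_lin1; ring. Qed.
Lemma ps4_lin3' (c : R) (x z u v w : 'I_7 -> R) : ps4 u v (fun k=> c * x k + z k) w = c * ps4 u v x w + ps4 u v z w.
by rewrite !(ps4_23 u _ v) ps4_lin2; ring. Qed.
Lemma ps4_lin4 (c : R) (x z u v w : 'I_7 -> R) : ps4 u v w (fun k=> c * x k + z k) = c * ps4 u v w x + ps4 u v w z.
by rewrite !(ps4_34 u v _ w) ps4_lin3'; ring. Qed.

Lemma om3_multilinear l : slotwise l ->
 multilinear_on P (fun v : 'I_3 -> 'rV[R]_N=> om3 (l (v (od 0))) (l (v (od 1))) (l (v (od 2)))).
move=> ll v s c u u' _ _ _; have [x xm ->] := odP s; rewrite /upd !od_eq//.
by move: x xm=> [|[|[|//]]] _ /=; rewrite ll ?om3_lin1 ?om3_lin2 ?om3_lin3.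
Qed.

Lemma ps4_multilinear (q : 'I_7 -> R) l : slotwise l ->
 multilinear_on P (fun v : 'I_3 -> 'rV[R]_N=> ps4 q (l (v (od 0))) (l (v (od 1))) (l (v (od 2)))).
move=> ll v s c u u' _ _ _; have [x xm ->] := odP s; rewrite /upd !od_eq//.
by move: x xm=> [|[|[|//]]] _ /=; rewrite ll ?ps4_lin2 ?ps4_lin3' ?ps4_lin4.
Qed.

Lemma multilinear_onZ k (f : ('I_k -> 'rV[R]_N) -> R) (a : R) : multilinear_on P f ->
 multilinear_on P (fun v=> a * f v).
by move=> mf v s c u u' Pv Pu Pu'; rewrite mf//; ring. Qed.

End MultilinearForms.

Section NearlyKahlerForm.
Variable R : realType.

Lemma co_slotwise : slotwise (@co R 7).
by move=> c u u'; ext k; rewrite /co !mxE. Qed.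

Lemma onframe_tangent n N (M : set 'rV[R]_N) U p (e : frame R n) y i :
 onframe M U p e -> U y -> tangent M (p y) (push p e i y).
by case=> oU sp se Mp _ Uy; exact: push_tangent oU Uy sp Mp. Qed.

(** dF is -3 omega, so Psi^+ is -3c omega on frames; comparing norms at one point gives (3c)^2 = 1.
    The formula then spreads to all tangent vectors by multilinearity. *)
Lemma nearly_kahler_Psip (Psip Psim : dform R 7 3) : nearly_kahler_S6 Psip Psim ->
 exists2 s : R, s ^+ 2 = 1 & forall x v, sphere x -> (forall i, tangent (@sphere R 6) x (v i)) ->
  Psip x v = - s * om3 (co (v (od 0))) (co (v (od 1))) (co (v (od 2))).
move=> [[_ _ fP _ frP] [c cP]].
have compsE U p e y i j k : onframe (n := 6) (@sphere R 6) U p e -> U y ->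
  comps p e Psip y (tup3 i j k) = - (3 * c) * om3 (co (push p e i y)) (co (push p e j y)) (co (push p e k y)).
 by move=> ofr Uy; rewrite (cP _ _ _ _ ofr Uy) (ext_d_F ofr) // !(co_push ofr _ Uy); ring.
have tan0 x : sphere x -> tangent (@sphere R 6) x 0.
 by move=> Sx; apply: dot0_tangent=> //; rewrite /dotv big1// => i _; rewrite mxE mulr0.
exists (3 * c).
 pose x0 : 'rV[R]_7 := delta_mx 0 0.
 have Sx0 : sphere x0.
  by rewrite /sphere /= /dotv (bigD1 0)//= !mxE eqxx big1 ?mulr1 ?addr0// => i /negPf i0; rewrite !mxE i0 mulr0.
 have [U [p [e [y [[ofr HA] Uy _]]]]] := frP x0 Sx0.
 have [HF HP _] := HA y Uy.
 pose q (k : 'I_7) y := p y 0 k : R.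
 pose pf := onframe_pf (S6_product (@sphere_eta R)) ofr.
 pose a := av e q y.
 have FE i j : om3 (q^~ y) (a i) (a j) = omr R (od 6) (w67 i) (w67 j).
  have := HF (tup2 i j); rewrite /comps -/(@F_S6 R) F_S6E !(co_push ofr _ Uy) F_stdE=> /oppr_inj.
  exact.
 have PE i j k : 3 * c * om3 (a i) (a j) (a k) = omr R (w67 i) (w67 j) (w67 k).
  have := HP (tup3 i j k); rewrite (compsE _ _ _ _ i j k ofr Uy) !(co_push ofr _ Uy) Psip_stdE.
  by rewrite mulNr=> /oppr_inj.
 have aa i j : lc (a i) (a j) = (i == j)%:R.
  by rewrite -(pf_on pf i j Uy) big_ord0 addr0.
 (* The unit vector a_1 x a_3 is orthogonal to q because F vanishes on this pair, so its tangential
    components have square sum 1. The standard Psi^+ has one unit component there. *)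
 have nrm : \sum_k om3 (a (od 0)) (a (od 2)) (a k) ^+ 2 = 1.
  pose u := cr (a (od 0)) (a (od 2)).
  transitivity (lc u (fun i=> lc u (fun j=> \sum_k a k i * a k j))).
   rewrite (eq_lc u (y := fun i=> \sum_k a k i * lc u (a k)))=> [|i].
    rewrite lc_sum; eq_sum k; rewrite lcZr -om3_cr -expr2.
    by rewrite expr2; congr (_ * _); exact: eq_lc.
   by rewrite lc_sum; eq_sum k; rewrite lcZ.
  rewrite (eq_lc u (y := fun i=> u i - q i y * lc u (q^~ y)))=> [|i].
   rewrite lcB lcZr (_ : lc u (q^~ y) = 0) ?mulr0 ?subr0.
    by rewrite /u dot_cr !aa mulr1 mulr0 subr0.
   by rewrite om3_cr (om3_cycle (q^~ y)) FE.
  rewrite (eq_lc u (y := fun j=> (i == j)%:R - q i y * q j y))=> [|j].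
   by rewrite lcB lcZ; congr (_ - _); rewrite -[RHS](lc_delta u i); apply: eq_lc=> j; rewrite eq_sym.
  exact: (av_complete pf i j Uy).
 transitivity ((3 * c) ^+ 2 * \sum_k om3 (a (od 0)) (a (od 2)) (a k) ^+ 2); first by rewrite nrm mulr1.
 rewrite mulr_sumr (eq_bigr (fun k=> omr R (w67 (od 0)) (w67 (od 2)) (w67 k) ^+ 2)).
  have /eqP E : isum 6 (fun k=> om 0 2 k * om 0 2 k) == 1 by vm_compute.
  rewrite -[RHS]/(1%:~R) -E; cast_sum k.
  by rewrite expr2 /omr -intrM.
 by move=> k _; rewrite -PE [RHS]exprMn.
move=> x v Sx tv.
have [U [p [e [y [[ofr _] Uy yx]]]]] := frP x Sx.
have tpush i : tangent (@sphere R 6) x (push p e i y) by rewrite -yx; exact: (onframe_tangent i ofr Uy).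
apply: (@multilinear_eq R 7 3 (tangent (@sphere R 6) x) _ _ 6 (fun i=> push p e i y) _ _ (Psip x)
 (fun v=> - (3 * c) * om3 (co (v (od 0))) (co (v (od 1))) (co (v (od 2)))))=> //.
- exact: tan0.
- by move=> c' u u'; exact: (fun tu tu1=> sp_tan (S6_product (@sphere_eta R)) c' Sx tu tu1).
- move=> w; rewrite -yx=> tw; exists (fun i=> lc (co w) (av e (fun k y=> p y 0 k) y i)).
 exact: (sphere_tangent_span ofr Uy tw).
- by case: fP=> m _ _ w s d u u' tw tu tu'; exact: m.
- by apply: multilinear_onZ; apply: om3_multilinear; exact: co_slotwise.
- move=> I; rewrite -(compsE U p e y (I (od 0)) (I (od 1)) (I (od 2)) ofr Uy) -tup3_eta.
 by rewrite /comps yx.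
Qed.

End NearlyKahlerForm.

(** * Structure forms of the products as pullbacks of octonionic forms *)

Section AlternatingMaps.
Variables (R : realType) (N : nat) (P : 'rV[R]_N -> Prop).
Notation V := 'rV[R]_N.

Lemma antisym3_alt (X : Type) (G : X -> X -> X -> R) :
 (forall a b c, G b a c = - G a b c) -> (forall a b c, G a c b = - G a b c) ->
 forall (v : 'I_3 -> X) s t, s != t -> v s = v t -> G (v (od 0)) (v (od 1)) (v (od 2)) = 0.
move=> G12 G23 v s t; have [x xm ->] := odP s; have [y ym ->] := odP t; rewrite od_eq//.
have Z1 a c : G a a c = 0 by have := G12 a a c; lra.
have Z2 a c : G c a a = 0 by have := G23 c a a; lra.
have Z3 a c : G a c a = 0 by rewrite G23 Z1 oppr0.
by move: x y xm ym=> [|[|[|//]]] [|[|[|//]]] _ _ //= _ ->; rewrite ?(Z1, Z2, Z3).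
Qed.

Lemma antisym4_alt (X : Type) (G : X -> X -> X -> X -> R) :
 (forall a b c d, G b a c d = - G a b c d) -> (forall a b c d, G a c b d = - G a b c d) ->
 (forall a b c d, G a b d c = - G a b c d) -> forall (v : 'I_4 -> X) s t, s != t -> v s = v t ->
 G (v (od 0)) (v (od 1)) (v (od 2)) (v (od 3)) = 0.
move=> G12 G23 G34 v s t; have [x xm ->] := odP s; have [y ym ->] := odP t; rewrite od_eq//.
have Z1 a c d : G a a c d = 0 by have := G12 a a c d; lra.
have Z2 a c d : G c a a d = 0 by have := G23 c a a d; lra.
have Z3 a c d : G c d a a = 0 by have := G34 c d a a; lra.
have Z4 a c d : G a c a d = 0 by rewrite G23 Z1 oppr0.
have Z5 a c d : G a c d a = 0 by rewrite G34 Z4 oppr0.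
have Z6 a c d : G d a c a = 0 by rewrite G34 Z2 oppr0.
by move: x y xm ym=> [|[|[|[|//]]]] [|[|[|[|//]]]] _ _ //= _ ->; rewrite ?(Z1, Z2, Z3, Z4, Z5, Z6).
Qed.

Lemma antisym4_multilinear (G : V -> V -> V -> V -> R) :
 (forall a b c d, G b a c d = - G a b c d) -> (forall a b c d, G a c b d = - G a b c d) ->
 (forall a b c d, G a b d c = - G a b c d) ->
 (forall k u u' a b c, G (k *: u + u') a b c = k * G u a b c + G u' a b c) ->
 multilinear_on P (fun v : 'I_4 -> V=> G (v (od 0)) (v (od 1)) (v (od 2)) (v (od 3))).
move=> G12 G23 G34 G1 v s c u u' _ _ _; have [x xm ->] := odP s; rewrite /upd !od_eq//.
have G2 k w w' a b d : G a (k *: w + w') b d = k * G a w b d + G a w' b d by rewrite !(G12 _ a) G1; ring.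
have G3 k w w' a b d : G a b (k *: w + w') d = k * G a b w d + G a b w' d by rewrite !(G23 a _ b) G2; ring.
have G4 k w w' a b d : G a b d (k *: w + w') = k * G a b d w + G a b d w' by rewrite !(G34 a b _ d) G3; ring.
by move: x xm=> [|[|[|[|//]]]] _ /=.
Qed.

End AlternatingMaps.

Section FlatMap.
Variables (R : realType) (r N : nat) (M : set 'rV[R]_N) (emb : 'I_7 -> 'I_N).
Variables (eta : 'I_r -> 'rV[R]_N -> 'rV[R]_N -> R).
Hypothesis sM : sphere_product M emb eta.
Variables (s : R) (s0 : 'I_r).

(* Isometry of T_x (S^6 x L) onto R^7, x = (q, z) *)
Definition flat (x v : 'rV[R]_N) (k : 'I_7) : R := s * v 0 (emb k) + eta s0 x v * x 0 (emb k).

Lemma flat_linear x c u u' : flat x (c *: u + u') = (fun k=> c * flat x u k + flat x u' k).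
by ext k; rewrite /flat (sp_lin sM) !mxE; ring. Qed.

Lemma flat_push U p (e : frame R (6 + r)) i y : onframe M U p e -> U y ->
 flat (p y) (push p e i y) = bv e (fun k z=> p z 0 (emb k)) s (fun i z=> eta s0 (p z) (push p e i z)) y i.
by move=> [oU sp _ _ _] Uy; ext k; rewrite /flat /bv (push_coord _ _ _ sp Uy).
Qed.

Lemma smooth_flat n U p (e : frame R n) i k : onframe M U p e -> smooth_on U (fun y=> flat (p y) (push p e i y) k).
move=> [oU sp se Mp _].
apply: smoothD=> //; apply: smoothM=> //; first exact: smooth_cst.
- apply: (smooth_eqon oU _ (smooth_pd oU se i (smooth_comp_coord oU (emb k) sp)))=> y Uy.
 by rewrite (push_coord _ _ _ sp Uy).
- exact: (sp_smooth sM i s0 oU se sp).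
- exact: smooth_comp_coord.
Qed.

End FlatMap.

Section ProductForms.
Variables (R : realType) (N' : nat) (L : set 'rV[R]_N') (form : dform R N' 1).
Hypothesis fL : unit_factor L form.
Variables (Psip : dform R 7 3) (s : R).
Hypothesis s2 : s ^+ 2 = 1.
Hypothesis PsipE : forall x v, sphere x -> (forall i, tangent (@sphere R 6) x (v i)) ->
 Psip x v = - s * om3 (co (v (od 0))) (co (v (od 1))) (co (v (od 2))).

Notation S6 := (@sphere R 6).
Notation ML := (prodM S6 L).
Notation MLL := (prodM ML L).
Notation omega := (g2_product (@F_S6 R) Psip form).
Notation Phi := (spin7_product ML omega form).

Definition eta1 : 'I_1 -> 'rV[R]_(7 + N') -> 'rV[R]_(7 + N') -> R := eta_times (@sphere_eta R) form.
Definition eta2 : 'I_2 -> 'rV[R]_(7 + N' + N') -> 'rV[R]_(7 + N' + N') -> R := eta_times eta1 form.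
Definition emb1 (k : 'I_7) : 'I_(7 + N') := lshift N' k.
Definition emb2 (k : 'I_7) : 'I_(7 + N' + N') := lshift N' (emb1 k).

Lemma sphere_product1 : sphere_product (r := 1) ML emb1 eta1.
exact: times_product (S6_product _) fL. Qed.

Lemma sphere_product2 : sphere_product (r := 2) MLL emb2 eta2.
exact: times_product sphere_product1 fL. Qed.
Lemma eta1E x v : eta1 0 x v = form (rsubmx x) (fun=> rsubmx v).
by rewrite (_ : 0 = rshift 0 0 :> 'I_(0 + 1)) ?[LHS]eta_times_r// [RHS]ord1. Qed.
Lemma eta2_0 x v : eta2 0 x v = eta1 0 (lsubmx x) (lsubmx v).
by rewrite (_ : 0 = lshift 1 0 :> 'I_(1 + 1)) ?[LHS]eta_times_l//; exact: val_inj. Qed.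
Lemma eta2_1 x v : eta2 1 x v = form (rsubmx x) (fun=> rsubmx v).
by rewrite (_ : 1 = rshift 1 0 :> 'I_(1 + 1)) ?[LHS]eta_times_r//; exact: val_inj. Qed.

Notation flat1 := (flat emb1 eta1 s 0).
Notation flat2 := (flat emb2 eta2 s 0).

Lemma flat2E x v : flat2 x v = flat1 (lsubmx x) (lsubmx v).
by ext k; rewrite /flat eta2_0 !mxE. Qed.

(** Expanding, terms with q repeated vanish, and the powers of s reduce by s^2 = 1: s^3 = s in front
    of omega, and s^2 = 1 in front of the terms with q. *)
Lemma om3_flat (q a b c : 'I_7 -> R) (ta tb tc : R) :
 om3 (fun k=> s * a k + ta * q k) (fun k=> s * b k + tb * q k) (fun k=> s * c k + tc * q k) =
 s * om3 a b c + ta * om3 q b c - tb * om3 q a c + tc * om3 q a b.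
have Z (u v : 'I_7 -> R) k : om3 (fun i=> k * u i) u v = 0.
 by rewrite /om3 /lc3 lcZl -/(lc3 _ _ _ _) -/(om3 _ _ _) om3_alt12 mulr0.
have S1 (u v w : 'I_7 -> R) k : om3 (fun i=> k * u i) v w = k * om3 u v w by exact: lcZl.
have S2 (u v w : 'I_7 -> R) k : om3 v (fun i=> k * u i) w = k * om3 v u w.
 by rewrite !(om3_12 _ v) S1 mulrN.
have S3 (u v w : 'I_7 -> R) k : om3 v w (fun i=> k * u i) = k * om3 v w u.
 by rewrite !(om3_23 v _ w) S2 mulrN.
rewrite !om3_lin1 !om3_lin2 !om3_lin3 !S1 !S2 !S3.
rewrite !(om3_alt12, om3_alt23, om3_alt13) (om3_12 q a c) (om3_cycle q a b) !(mulr0, addr0, add0r).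
have s3 : s * (s * (s * om3 a b c)) = s * om3 a b c by rewrite !mulrA -expr2 s2 mul1r.
transitivity (s * (s * (s * om3 a b c)) + s ^+ 2 * (ta * om3 q b c - tb * om3 q a c + tc * om3 q a b)).
 ring.
by rewrite s3 s2 mul1r !addrA.
Qed.

(** The sign s in [flat] is chosen for this: it turns the possibly negative Psi^+ into part of
    omega, without affecting F, which is even in s. *)
Lemma omega_flat x v : ML x -> (forall i, tangent ML x (v i)) ->
 omega x v = om3 (flat1 x (v (od 0))) (flat1 x (v (od 1))) (flat1 x (v (od 2))).
move=> [Sx Lx] tv.
pose t (u : 'rV[R]_(7 + N')) := form (rsubmx x) (fun=> rsubmx u).
pose q := co (lsubmx x); pose a (u : 'rV[R]_(7 + N')) := co (lsubmx u).
have fE u : flat1 x u = fun k=> s * a u k + t u * q k.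
 by ext k; rewrite /flat eta1E /a /q /co !mxE.
rewrite !fE om3_flat.
have -> : omega x v = - wedge (pull1 (N' := N') (@F_S6 R) x) (pull2 (N := 7) form x) v
  + s * om3 (a (v (od 0))) (a (v (od 1))) (a (v (od 2))).
 by rewrite /omega /g2_product /pull1 PsipE ?mulNr ?opprK// => i; have /tangent_prod[] := tv i.
rewrite wedge_altsum.
rewrite (@eq_altsum R _ 3 _ (fun u=> - om3 q (a (u (od 0))) (a (u (od 1))) * t (u (od 2)))); last first.
 move=> u; congr (_ * _); first rewrite /pull1 F_S6E /a /q.
  by congr (- om3 _ (co (lsubmx (u _))) (co (lsubmx (u _)))); exact: val_inj.
 by rewrite /pull2 /t; congr form; ext i; congr (rsubmx (u _)); rewrite ord1; exact: val_inj.
rewrite (altsum3 (fun b c d=> - om3 q (a b) (a c) * t d)) /=.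
rewrite (om3_23 q (a (v (od 1))) (a (v (od 0)))) (om3_23 q (a (v (od 2))) (a (v (od 0)))).
rewrite (om3_23 q (a (v (od 2))) (a (v (od 1)))) (_ : (2`!)%:R = 2 :> R)// (_ : (1`!)%:R = 1 :> R)//.
by field.
Qed.

Lemma flat_dot x u v : ML x -> tangent ML x u -> tangent ML x v -> lc (flat1 x u) (flat1 x v) = dotv u v.
move=> Mx tu tv; rewrite (sp_dot sphere_product1 Mx tu tv) big_ord1 -[ord0]/(0 : 'I_1).
rewrite /flat lcDl !lcD !lcZl !lcZ (sp_unit sphere_product1 Mx) (sp_orth sphere_product1 Mx tv).
rewrite [lc _ (fun k=> x 0 (emb1 k))]lc_sym (sp_orth sphere_product1 Mx tu) mulrA -expr2 s2.
by move: (lc _ _)=> X; ring.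
Qed.

Lemma prod_od4 (F : 'I_4 -> R) : \prod_(i < 4) F i = F (od 0) * F (od 1) * F (od 2) * F (od 3).
rewrite 4!big_ord_recl big_ord0 mulr1 !mulrA; congr (F _ * F _ * F _ * F _); exact: val_inj.
Qed.

(** Whichever basis [hodge7] selects, its image under [flat] is an octonionic basis, in which *omega
    has its standard components; thus the result does not depend on the selection. *)
Lemma hodge7_flat x v : ML x -> (exists E, g2_basis ML omega x E) -> (forall i, tangent ML x (v i)) ->
 hodge7 ML omega x v = ps4 (flat1 x (v (od 0))) (flat1 x (v (od 1))) (flat1 x (v (od 2))) (flat1 x (v (od 3))).
move=> Mx exE tv; rewrite /hodge7; have := xgetPex 0 exE.
move: (xget _ _)=> E [tE EE oE] {exE}.
pose B i := flat1 x (row i E).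
have gB : g2b B.
 split=> [i j|i j k]; first by rewrite flat_dot.
 by rewrite /omr -omega_stdE -oE omega_flat//.
have dec i : flat1 x (v i) = comb (fun j=> dotv (row j E) (v i)) B.
 ext k; rewrite (orthonormal_decomp (proj1 gB) (flat1 x (v i)) k).
 by eq_sum j; rewrite flat_dot.
rewrite !dec ps4_comb (_ : (fun I=> _) = @omega_std R); last by apply/funext.
rewrite (sum_ffun4 (fun J=> hodge (k := 3) (l := 4) (@omega_std R) J *
 \prod_(i < 4) dotv (row (J i) E) (v i))) /lc4 /lc3 /lc2 /lc.
eq_sum a; mul_sum b; rewrite !mulr_sumr.
eq_sum c; rewrite !mulr_sumr; eq_sum d.
rewrite hodge_omegaE -/(psr R a b c d) (g2b_ps a b c d gB) prod_od4.
by move: (psr R a b c d)=> X; rewrite /=; ring.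
Qed.

Lemma wedge13_algebra (b0 b1 b2 b3 : 'I_7 -> R) (u0 u1 u2 u3 : R) : let g a b c d : R := a * om3 b c d in
 (1`!)%:R^-1 * (3`!)%:R^-1 *
 (g u0 b1 b2 b3 - g u0 b1 b3 b2 - g u0 b2 b1 b3 + g u0 b2 b3 b1 + g u0 b3 b1 b2 - g u0 b3 b2 b1
 - (g u1 b0 b2 b3 - g u1 b0 b3 b2 - g u1 b2 b0 b3 + g u1 b2 b3 b0 + g u1 b3 b0 b2 - g u1 b3 b2 b0)
 + (g u2 b0 b1 b3 - g u2 b0 b3 b1 - g u2 b1 b0 b3 + g u2 b1 b3 b0 + g u2 b3 b0 b1 - g u2 b3 b1 b0)
 - (g u3 b0 b1 b2 - g u3 b0 b2 b1 - g u3 b1 b0 b2 + g u3 b1 b2 b0 + g u3 b2 b0 b1 - g u3 b2 b1 b0)) =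
 u0 * om3 b1 b2 b3 - u1 * om3 b0 b2 b3 + u2 * om3 b0 b1 b3 - u3 * om3 b0 b1 b2.
move=> g; rewrite /g.
have E (a b c : 'I_7 -> R) u : u * om3 a b c - u * om3 a c b - u * om3 b a c + u * om3 b c a
  + u * om3 c a b - u * om3 c b a = 6 * (u * om3 a b c).
 have e3 : om3 b c a = om3 a b c by rewrite om3_cycle.
 have e4 : om3 c a b = om3 a b c by rewrite -e3 om3_cycle.
 have e5 : om3 c b a = - om3 a b c by rewrite om3_12 e3.
 by rewrite (om3_23 a b c) (om3_12 a b c) e3 e4 e5; ring.
rewrite !E (_ : (3`!)%:R = 6 :> R)// (_ : (1`!)%:R = 1 :> R)//; by field.
Qed.

Lemma spin7_flat x v : MLL x -> (exists E, g2_basis ML omega (lsubmx x) E) -> (forall i, tangent MLL x (v i)) ->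
 Phi x v = eta2 1 x (v (od 0)) * om3 (flat2 x (v (od 1))) (flat2 x (v (od 2))) (flat2 x (v (od 3)))
  - eta2 1 x (v (od 1)) * om3 (flat2 x (v (od 0))) (flat2 x (v (od 2))) (flat2 x (v (od 3)))
  + eta2 1 x (v (od 2)) * om3 (flat2 x (v (od 0))) (flat2 x (v (od 1))) (flat2 x (v (od 3)))
  - eta2 1 x (v (od 3)) * om3 (flat2 x (v (od 0))) (flat2 x (v (od 1))) (flat2 x (v (od 2)))
  + ps4 (flat2 x (v (od 0))) (flat2 x (v (od 1))) (flat2 x (v (od 2))) (flat2 x (v (od 3))).
move=> [Mx Lx] exE tv; have tl i : tangent ML (lsubmx x) (lsubmx (v i)) by have /tangent_prod[] := tv i.
rewrite /spin7_product /pull1 (hodge7_flat Mx exE tl) !flat2E; congr (_ + _).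
rewrite wedge_altsum.
transitivity ((1`!)%:R^-1 * (3`!)%:R^-1 * altsum (fun u : 'I_4 -> 'rV[R]_(7 + N' + N') =>
 eta2 1 x (u (od 0)) * om3 (flat2 x (u (od 1))) (flat2 x (u (od 2))) (flat2 x (u (od 3)))) v).
 congr (_ * _); eq_sum g; congr (_ * (_ * _)).
  rewrite /pull2 eta2_1; congr form; ext i; congr (rsubmx (v (g _))).
  by rewrite ord1; exact: val_inj.
 rewrite omega_flat// !flat2E.
 by congr (om3 (flat1 _ (lsubmx (v (g _)))) (flat1 _ (lsubmx (v (g _)))) (flat1 _ (lsubmx (v (g _)))));
  exact: val_inj.
rewrite (altsum4 (fun a b c d=> eta2 1 x a * om3 (flat2 x b) (flat2 x c) (flat2 x d))) /= !flat2E.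
move: (flat1 _ (lsubmx (v (od 0)))) (flat1 _ (lsubmx (v (od 1)))) (flat1 _ (lsubmx (v (od 2))))
 (flat1 _ (lsubmx (v (od 3))))=> b0 b1 b2 b3.
move: (eta2 1 x (v (od 0))) (eta2 1 x (v (od 1))) (eta2 1 x (v (od 2))) (eta2 1 x (v (od 3)))=> u0 u1 u2 u3.
exact: wedge13_algebra.
Qed.

End ProductForms.

(** * Charts and orthonormal frames of a product with a one-dimensional factor *)

Section ProductCharts.
Variable R : realType.

Lemma derive_lsubmx n m (W : normedModType R) (f : 'rV[R]_n -> W) v (y : 'rV[R]_(n + m)) :
 'D_v (fun z : 'rV[R]_(n + m)=> f (lsubmx z)) y = 'D_(lsubmx v) f (lsubmx y).
have E : (fun h : R=> h^-1 *: (((fun z : 'rV[R]_(n + m)=> f (lsubmx z)) \o shift y) (h *: v) - f (lsubmx y))) =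
  (fun h : R=> h^-1 *: ((f \o shift (lsubmx y)) (h *: lsubmx v) - f (lsubmx y))).
 by apply/funext=> h /=; rewrite linearP.
by rewrite /derive E.
Qed.

Lemma differentiable_lsubmx n m (y : 'rV[R]_(n + m)) :
 differentiable (fun z : 'rV[R]_(n + m)=> lsubmx z : 'rV[R]_n) y.
apply: (@smooth_diff R _ setT _ _ _ _ I); apply: smooth_mx; first exact: openT.
move=> k; apply: (smooth_eqon openT _ (smooth_coord openT (lshift m k)))=> z _.
by rewrite mxE.
Qed.

Lemma smooth_comp_lsubmx n m (W : normedModType R) (U : set 'rV[R]_n) (f : 'rV[R]_n -> W) :
 smooth_on U f -> smooth_on [set y : 'rV[R]_(n + m) | U (lsubmx y)] (fun y=> f (lsubmx y)).
move=> sf vs y Uy.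
have E : iterder vs (fun z : 'rV[R]_(n + m)=> f (lsubmx z)) = (fun z=> iterder (map lsubmx vs) f (lsubmx z)).
 elim: vs=> [//|v vs IH] /=; ext z; rewrite IH.
 exact: (derive_lsubmx (iterder [seq lsubmx i | i <- vs] f) v z).
rewrite E; apply: (differentiable_comp (g := iterder (map lsubmx vs) f)).
 exact: differentiable_lsubmx.
exact: sf.
Qed.

Lemma open_lsubmx n m (U : set 'rV[R]_n) : open U -> open [set y : 'rV[R]_(n + m) | U (lsubmx y)].
move=> oU; apply: (@open_comp _ _ (fun z : 'rV[R]_(n + m)=> lsubmx z : 'rV[R]_n) U)=> // y _.
by apply: differentiable_continuous; exact: differentiable_lsubmx.
Qed.

Lemma onframe_inj n N (M : set 'rV[R]_N) U p (e : frame R n) (f : 'I_n -> 'I_n) : injective f ->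
 onframe M U p e -> onframe M U p (fun i=> e (f i)).
move=> fi [oU sp se Mp on]; split; [exact: oU|exact: sp|by move=> i; exact: se|exact: Mp|move=> y i j Uy].
by rewrite -[RHS](congr1 (fun b : bool=> b%:R) (inj_eq fi i j)); exact: on.
Qed.

Section Chart.
Variables (n N N' : nat) (M : set 'rV[R]_N) (L : set 'rV[R]_N') (form : dform R N' 1).
Hypothesis fL : unit_factor L form.
Variables (U : set 'rV[R]_n) (p : 'rV[R]_n -> 'rV[R]_N) (e : frame R n).
Hypothesis ofr : onframe M U p e.
Variables (c c' : R -> 'rV[R]_N').
Hypotheses (Lc : forall t, L (c t)) (c1 : forall t, form (c t) (fun=> c' t) = 1).
Hypothesis dc : forall n (U : set 'rV[R]_n) k, open U -> smooth_on U (fun y=> c (y 0 k)) /\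
 forall y v, 'D_v (fun y : 'rV[R]_n=> c (y 0 k)) y = v 0 k *: c' (y 0 k).

Definition prod_dom : set 'rV[R]_(n + 1) := [set y | U (lsubmx y)].
Definition last_ord : 'I_(n + 1) := rshift n ord0.
Definition prod_map (y : 'rV[R]_(n + 1)) : 'rV[R]_(N + N') := row_mx (p (lsubmx y)) (c (y 0 last_ord)).
Definition prod_frm : frame R (n + 1) := fun i y=> match fintype.split i with
 | inl j => row_mx (e j (lsubmx y)) 0 | inr _ => row_mx 0 (const_mx 1) end.

Let oU : open U. Proof. by case: ofr. Qed.
Let sp : smooth_on U p. Proof. by case: ofr. Qed.

Lemma open_prod_dom : open prod_dom. Proof. exact: open_lsubmx. Qed.

Lemma smooth_prod_map : smooth_on prod_dom prod_map.
apply: smooth_mx=> [|k]; first exact: open_prod_dom.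
case: (split_ordP k)=> j ->.
 apply: (smooth_eqon open_prod_dom _ (smooth_comp_lsubmx (m := 1) (smooth_comp_coord oU j sp)))=> y Uy.
 by rewrite row_mxEl.
have [sc _] := dc last_ord open_prod_dom.
apply: (smooth_eqon open_prod_dom _ (smooth_comp_coord open_prod_dom j sc))=> y Uy.
by rewrite row_mxEr.
Qed.

Lemma derive_prod_map v y : prod_dom y ->
 'D_v prod_map y = row_mx ('D_(lsubmx v) p (lsubmx y)) (v 0 last_ord *: c' (y 0 last_ord)).
move=> Uy; have dp := smooth_diff smooth_prod_map Uy.
have [sc dcv] := dc last_ord open_prod_dom.
apply/rowP=> k; rewrite derive_mxE//; case: (split_ordP k)=> j ->.
 rewrite row_mxEl derive_mxE; last exact: smooth_diff sp Uy.
 rewrite -(derive_lsubmx (m := 1) (fun z=> p z 0 j) v y).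
 by congr ('D_v _ y); ext z; rewrite row_mxEl.
rewrite row_mxEr -dcv derive_mxE; last exact: smooth_diff sc Uy.
by congr ('D_v _ y); ext z; rewrite row_mxEr.
Qed.

Lemma chart_tangent t : tangent L (c t) (c' t).
have [sc dcv] := dc (ord0 : 'I_1) (@openT 'rV[R]_1).
have := @push_tangent R 1 N' L setT (fun z=> c (z 0 ord0)) (const_mx t) (const_mx 1) openT I sc (fun z _=> Lc _).
by rewrite dcv !mxE scale1r.
Qed.
Lemma chart_norm t : dotv (c' t) (c' t) = 1.
by rewrite (fa_dot fL (Lc t) (chart_tangent t) (chart_tangent t)) c1 mulr1. Qed.

Lemma chart_form t a : form (c t) (fun=> a *: c' t) = a.
have f0 x : form x (fun=> 0) = 0.
 by have := fa_lin fL x 1 0 0; rewrite scaler0 addr0; lra.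
by have := fa_lin fL (c t) a (c' t) 0; rewrite addr0 c1 f0 mulr1 addr0.
Qed.

Lemma prod_push_l i y : prod_dom y -> push prod_map prod_frm (lshift 1 i) y = row_mx (push p e i (lsubmx y)) 0.
move=> Uy; rewrite /push derive_prod_map// /prod_frm split_lshift row_mxKl row_mxEr mxE scale0r.
by [].
Qed.

Lemma prod_push_r y : prod_dom y -> push prod_map prod_frm last_ord y = row_mx 0 (c' (y 0 last_ord)).
move=> Uy; rewrite /push derive_prod_map// /prod_frm split_rshift row_mxKl row_mxEr mxE scale1r.
congr row_mx; rewrite deriveE ?linear0//; exact: smooth_diff sp Uy.
Qed.

Lemma prod_onframe : onframe (prodM M L) prod_dom prod_map prod_frm.
have [_ _ se Mp on] := ofr.
split.
- exact: open_prod_dom.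
- exact: smooth_prod_map.
- move=> i; apply: smooth_mx=> [|k]; first exact: open_prod_dom.
 case: (split_ordP i)=> i' ->; case: (split_ordP k)=> j ->.
 + apply: (smooth_eqon open_prod_dom _ (smooth_comp_lsubmx (m := 1) (smooth_comp_coord oU j (se i'))))=> y Uy.
  by rewrite /prod_frm split_lshift row_mxEl.
 + apply: (smooth_eqon open_prod_dom (f := cst (0 : R)))=> [y Uy|]; last by apply: smooth_cst; exact: open_prod_dom.
  by rewrite /prod_frm split_lshift row_mxEr mxE.
 + apply: (smooth_eqon open_prod_dom (f := cst (0 : R)))=> [y Uy|]; last by apply: smooth_cst; exact: open_prod_dom.
  by rewrite /prod_frm split_rshift row_mxEl mxE.
 + apply: (smooth_eqon open_prod_dom (f := cst (1 : R)))=> [y Uy|]; last by apply: smooth_cst; exact: open_prod_dom.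
  by rewrite /prod_frm split_rshift row_mxEr mxE.
- by move=> y Uy; split; rewrite /prod_map ?row_mxKl ?row_mxKr//; exact: Mp.
- move=> y i j Uy; have d0 m (v : 'rV[R]_m) : dotv v 0 = 0.
  by rewrite /dotv big1// => k _; rewrite mxE mulr0.
 have dr (a a' : 'rV[R]_N) (b b' : 'rV[R]_N') : dotv (row_mx a b) (row_mx a' b') = dotv a a' + dotv b b'.
  by rewrite dotv_sub !row_mxKl !row_mxKr.
 have lE (k : 'I_1) : rshift n k = last_ord by rewrite (ord1 k).
 case: (split_ordP i)=> i' ->; case: (split_ordP j)=> j' ->.
 + rewrite (prod_push_l i' Uy) (prod_push_l j' Uy) dr d0 addr0 (on _ i' j' Uy).
  by rewrite (inj_eq (@lshift_inj _ _)).
 + by rewrite lE (prod_push_l i' Uy) (prod_push_r Uy) dr d0 dotvC d0 addr0 -(lE 0) eq_lrshift.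
 + by rewrite lE (prod_push_l j' Uy) (prod_push_r Uy) dr d0 dotvC d0 addr0 -(lE 0) eq_rlshift.
 + by rewrite !lE (prod_push_r Uy) dr d0 chart_norm add0r eqxx.
Qed.
Lemma smooth_last : smooth_on prod_dom (fun y : 'rV[R]_(n + 1)=> y 0 last_ord).
by apply: smooth_coord; exact: open_prod_dom. Qed.

Lemma derive_last v y : prod_dom y -> 'D_v (fun y : 'rV[R]_(n + 1)=> y 0 last_ord) y =
 form (rsubmx (prod_map y)) (fun=> rsubmx ('D_v prod_map y)).
by move=> Uy; rewrite derive_coord derive_prod_map// /prod_map !row_mxKr chart_form.
Qed.

End Chart.
End ProductCharts.

(** * Standard components from those in the adapted directions; smoothness of the structure forms *)

Section ExtendedBases.
Variable R : realType.
Notation l0 := (lift (ord0 : 'I_8)).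

Lemma ord7_cases (i : 'I_7) : (exists a, i = w67 a) \/ i = od 6.
have [i6|i6] := ltnP i 6; first by left; exists (Ordinal i6); exact: val_inj.
by right; apply: val_inj=> /=; have := ltn_ord i; case: i i6=> /= m _; lia.
Qed.

Lemma om3_extend (b : Bil 7 R) : (forall a c, om3 (b (od 6)) (b (w67 a)) (b (w67 c)) = omr R (od 6) (w67 a) (w67 c)) ->
 (forall a c d, om3 (b (w67 a)) (b (w67 c)) (b (w67 d)) = omr R (w67 a) (w67 c) (w67 d)) ->
 forall i j k, om3 (b i) (b j) (b k) = omr R i j k.
move=> H6 H i j k.
have Z1 x y : omr R x x y = 0 by have := @omr12 R x x y; lra.
have Z2 x y : omr R y x x = 0 by have := @omr23 R y x x; lra.
have Z3 x y : omr R x y x = 0 by rewrite omr23 Z1 oppr0.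
case: (ord7_cases i)=> [[a ->]|->]; case: (ord7_cases j)=> [[c ->]|->]; case: (ord7_cases k)=> [[d ->]|->].
- exact: H.
- by rewrite om3_23 om3_12 H6 omr12 omr23 !opprK.
- by rewrite om3_12 H6 [RHS]omr12.
- by rewrite om3_alt23 Z2.
- exact: H6.
- by rewrite om3_alt13 Z3.
- by rewrite om3_alt12 Z1.
- by rewrite om3_alt12 Z1.
Qed.
Lemma om3_0 (u v : 'I_7 -> R) : om3 (fun=> 0) u v = 0.
by rewrite /om3 /lc3 /lc big1// => i _; rewrite mul0r. Qed.
Lemma ps4_0 (u v w : 'I_7 -> R) : ps4 (fun=> 0) u v w = 0.
by rewrite /ps4 /lc4 /lc big1// => i _; rewrite mul0r. Qed.

(** Both sides are alternating, so it is enough to compare them with index 0 in front, where only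
    omega remains, and without index 0, where only *omega remains. *)
Lemma Phi_extend (b : 'I_8 -> 'I_7 -> R) (u : 'I_8 -> R) :
 b ord0 = (fun=> 0) -> u ord0 = 1 -> (forall j, u (l0 j) = 0) -> g2b (fun j=> b (l0 j)) ->
 forall i j k l, Phi_form b u i j k l = phr R i j k l.
move=> b0 u0 uS gB.
have o0 : forall v w, om3 (b ord0) v w = 0 by move=> v w; rewrite b0 om3_0.
have o1 v w : om3 v (b ord0) w = 0 by rewrite om3_12 o0 oppr0.
have o2 v w : om3 v w (b ord0) = 0 by rewrite om3_23 o1 oppr0.
have p0 v w x : ps4 (b ord0) v w x = 0 by rewrite b0 ps4_0.
have p1 v w x : ps4 v (b ord0) w x = 0 by rewrite ps4_12 p0 oppr0.
have p2 v w x : ps4 v w (b ord0) x = 0 by rewrite ps4_23 p1 oppr0.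
have p3 v w x : ps4 v w x (b ord0) = 0 by rewrite ps4_34 p2 oppr0.
have oB i j k : om3 (b (l0 i)) (b (l0 j)) (b (l0 k)) = omr R i j k by exact: (proj2 gB).
have pB i j k l : ps4 (b (l0 i)) (b (l0 j)) (b (l0 k)) (b (l0 l)) = psr R i j k l.
 exact: (g2b_ps i j k l gB).
have f12 i j k l : Phi_form b u j i k l = - Phi_form b u i j k l.
 rewrite /Phi_form (om3_12 (b i) (b j)) (om3_12 (b i) (b j) (b k)) (ps4_12 (b i)); ring.
have f23 i j k l : Phi_form b u i k j l = - Phi_form b u i j k l.
 rewrite /Phi_form (om3_12 (b j) (b k)) (om3_23 (b i) (b j) (b k)) (ps4_23 (b i)); ring.
have f34 i j k l : Phi_form b u i j l k = - Phi_form b u i j k l.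
 rewrite /Phi_form (om3_23 (b j) (b k) (b l)) (om3_23 (b i) (b k) (b l)) (ps4_34 (b i)); ring.
have f0 j k l : Phi_form b u ord0 j k l = phr R ord0 j k l.
 case: (unliftP ord0 j)=> [j' ->|->]; case: (unliftP ord0 k)=> [k' ->|->];
  case: (unliftP ord0 l)=> [l' ->|->]; rewrite /Phi_form u0 ?uS ?o0 ?o1 ?o2 ?p0 ?p1 ?p2 ?p3 ?oB;
  rewrite ?(mul1r, mul0r, subrr, subr0, addr0) //.
have fS i j k l : Phi_form b u (l0 i) (l0 j) (l0 k) (l0 l) = phr R (l0 i) (l0 j) (l0 k) (l0 l).
 by rewrite /Phi_form !uS !mul0r !(subrr, subr0, addr0, add0r) pB phr1.
move=> i j k l.
case: (unliftP ord0 i)=> [i' ->|->]; last exact: f0.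
case: (unliftP ord0 j)=> [j' ->|->]; last by rewrite f12 f0 [RHS]phr12.
case: (unliftP ord0 k)=> [k' ->|->]; last by rewrite f23 f12 f0 (@phr23 R (l0 i') ord0 (l0 j')) (@phr12 R ord0 (l0 i')).
case: (unliftP ord0 l)=> [l' ->|->]; first exact: fS.
by rewrite f34 f23 f12 f0 (@phr34 R (l0 i') (l0 j') ord0 (l0 k')) (@phr23 R (l0 i') ord0 (l0 j'))
 (@phr12 R ord0 (l0 i')).
Qed.

End ExtendedBases.

Section TangentForms.
Variables (R : realType) (r n N : nat) (M : set 'rV[R]_N) (emb : 'I_7 -> 'I_N).
Variables (eta : 'I_r -> 'rV[R]_N -> 'rV[R]_N -> R).
Hypothesis sM : sphere_product M emb eta.

(** The conditions on a form only test tangent vectors at points of M, so they may be checked on an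
    expression G that is multilinear and alternating by its formula. *)
Lemma is_form_ext k (a G : dform R N k) : (forall x v, M x -> (forall i, tangent M x (v i)) -> a x v = G x v) ->
 (forall x, M x -> multilinear_on (tangent M x) (G x)) ->
 (forall x v s t, M x -> s != t -> v s = v t -> G x v = 0) ->
 (forall U p e, onframe (n := n) M U p e -> forall I, smooth_on U (fun y=> comps p e G y I)) -> is_form n M a.
move=> aG mG altG sG; split.
- move=> x v s c u u' Mx tv tu tu'.
 have tup w : tangent M x w -> forall i, tangent M x (upd v s w i).
  by move=> tw i; rewrite /upd; case: eqP.
 rewrite !aG//; [exact: mG|exact: tup|exact: tup|].
 by apply: tup; exact: (sp_tan sM).
- by move=> x v s t Mx tv st vst; rewrite aG//; exact: altG st vst.
- move=> U p e ofr I; have [oU _ _ Mp _] := ofr.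
 apply: (smooth_eqon oU _ (sG U p e ofr I))=> y Uy.
 by rewrite /comps aG// => [|i]; [exact: Mp|exact: onframe_tangent ofr Uy].
Qed.

(** The torsion without reference to a frame: *omega contracted with the point of the sphere. *)
Definition torsion_form : dform R N 3 := fun x v=> ps4 (fun k=> x 0 (emb k))
 (fun k=> v (od 0) 0 (emb k)) (fun k=> v (od 1) 0 (emb k)) (fun k=> v (od 2) 0 (emb k)).

Lemma smooth_push_coord U p (e : frame R n) i k : onframe M U p e -> smooth_on U (fun y=> push p e i y 0 k).
move=> [oU sp se _ _].
apply: (smooth_eqon oU _ (smooth_pd oU se i (smooth_comp_coord oU k sp)))=> y Uy.
by rewrite (push_coord _ _ _ sp Uy).
Qed.

Lemma torsion_is_form : is_form n M torsion_form.
apply: (is_form_ext (G := torsion_form))=> //.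
- move=> x _.
 apply: (@ps4_multilinear R N _ (fun k=> x 0 (emb k)) (fun w k=> w 0 (emb k)))=> c u u'.
 by ext k; rewrite !mxE.
- move=> x v s t _ st vst.
 pose G (a b c : 'rV[R]_N) := ps4 (fun k=> x 0 (emb k)) (fun k=> a 0 (emb k))
  (fun k=> b 0 (emb k)) (fun k=> c 0 (emb k)).
 by apply: (@antisym3_alt R _ G _ _ v s t st vst)=> a b c; [exact: ps4_23|exact: ps4_34].
- move=> U p e ofr I; have [oU sp _ _ _] := ofr.
 apply: (smooth_ps4 oU (u := fun k y=> p y 0 (emb k)) (v := fun k y=> push p e (I (od 0)) y 0 (emb k))
  (w := fun k y=> push p e (I (od 1)) y 0 (emb k)) (x := fun k y=> push p e (I (od 2)) y 0 (emb k)));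
  try by move=> k; exact: smooth_push_coord ofr.
 by move=> k; exact: smooth_comp_coord.
Qed.

End TangentForms.

Section AdaptedFrames.
Variables (R : realType) (N' : nat) (L : set 'rV[R]_N') (form : dform R N' 1).
Hypothesis fL : unit_factor L form.
Variables (Psip Psim : dform R 7 3) (s : R).
Hypothesis s2 : s ^+ 2 = 1.
Hypothesis PsipE : forall x v, sphere x -> (forall i, tangent (@sphere R 6) x (v i)) ->
 Psip x v = - s * om3 (co (v (od 0))) (co (v (od 1))) (co (v (od 2))).

Notation S6 := (@sphere R 6).
Notation ML := (prodM S6 L).
Notation MLL := (prodM ML L).
Notation omega := (g2_product (@F_S6 R) Psip form).
Notation Phi := (spin7_product ML omega form).
Notation A6 := (su3_frame S6 (@F_S6 R) Psip Psim).
Notation flat1 := (flat (@emb1 N') (eta1 form) s 0).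
Notation flat2 := (flat (@emb2 N') (eta2 form) s 0).

Lemma su3_adapted U p e y : A6 U p e -> U y ->
 (forall i j, om3 (co (p y)) (fun k=> s * co (push p e i y) k) (fun k=> s * co (push p e j y) k) =
   omr R (od 6) (w67 i) (w67 j)) /\
 (forall i j l, om3 (fun k=> s * co (push p e i y) k) (fun k=> s * co (push p e j y) k)
   (fun k=> s * co (push p e l y) k) = omr R (w67 i) (w67 j) (w67 l)).
move=> [ofr HA] Uy; have [HF HP _] := HA y Uy.
have S1 (u v w : 'I_7 -> R) k : om3 (fun i=> k * u i) v w = k * om3 u v w by exact: lcZl.
have S2 (u v w : 'I_7 -> R) k : om3 v (fun i=> k * u i) w = k * om3 v u w.
 by rewrite !(om3_12 _ v) S1 mulrN.
have S3 (u v w : 'I_7 -> R) k : om3 v w (fun i=> k * u i) = k * om3 v w u.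
 by rewrite !(om3_23 v _ w) S2 mulrN.
have [_ _ _ Mp _] := ofr.
split=> [i j|i j l].
 rewrite S2 S3 mulrA -expr2 s2 mul1r; have := HF (tup2 i j).
 by rewrite /comps F_S6E F_stdE=> /oppr_inj.
rewrite S1 S2 S3 (mulrA s s) -expr2 s2 mul1r; have := HP (tup3 i j l).
rewrite /comps PsipE=> [|//|a]; [|exact: Mp|exact: onframe_tangent ofr Uy].
by rewrite Psip_stdE mulNr=> /oppr_inj.
Qed.

Lemma g2_adapted U p e y i j k : g2_frame ML omega U p e -> U y ->
 let b := bv e (fun k z=> p z 0 (emb1 N' k)) s (fun i z=> eta1 form 0 (p z) (push p e i z)) y in
 om3 (b i) (b j) (b k) = omr R i j k.
move=> [ofr HA] Uy; have [_ _ _ Mp _] := ofr; have := HA y (tup3 i j k) Uy.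
rewrite /comps (omega_flat form s2 PsipE (Mp y Uy))=> [|a]; last exact: onframe_tangent ofr Uy.
have FP a := @flat_push R 1 (7 + N') ML (emb1 N') (eta1 form) s 0 U p e a y ofr Uy.
rewrite omega_stdE=> H.
by rewrite /= -[bv _ _ _ _ _](funext FP).
Qed.

Lemma framed_g2_basis : framed_around ML (g2_frame ML omega) -> forall x, ML x -> exists E, g2_basis ML omega x E.
move=> fr x Mx; have [U [p [e [y [[ofr HA] Uy yx]]]]] := fr x Mx; subst x.
have [_ _ _ _ on] := ofr.
exists (\matrix_i push p e i y); split=> [i|i j|I]; rewrite ?rowK.
- exact: onframe_tangent ofr Uy.
- exact: on.
- by rewrite -(HA y I Uy) /comps; congr omega; ext a; rewrite rowK.
Qed.

Hypothesis g2E : forall x, ML x -> exists E, g2_basis ML omega x E.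

Lemma spin7_adapted U p e y i j k l : spin7_frame MLL Phi U p e -> U y ->
 let b := bv e (fun k z=> p z 0 (emb2 N' k)) s (fun i z=> eta2 form 0 (p z) (push p e i z)) y in
 Phi_form b (fun i=> eta2 form 1 (p y) (push p e i y)) i j k l = phr R i j k l.
move=> [ofr HA] Uy; have [_ _ _ Mp _] := ofr; have := HA y (idx4 i j k l) Uy.
rewrite /comps (spin7_flat fL s2 PsipE (Mp y Uy))=> [||a]; last first.
- exact: onframe_tangent ofr Uy.
- by apply: g2E; case: (Mp y Uy).
have FP a := @flat_push R 2 (7 + N' + N') MLL (emb2 N') (eta2 form) s 0 U p e a y ofr Uy.
rewrite Phi_stdE=> H.
by rewrite /= -[bv _ _ _ _ _](funext FP).
Qed.

Lemma omega_is_form : is_form 7 ML omega.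
apply: (is_form_ext (sphere_product1 fL) (G := fun x v =>
 om3 (flat1 x (v (od 0))) (flat1 x (v (od 1))) (flat1 x (v (od 2))))).
- by move=> x v Mx tv; exact: (omega_flat form s2 PsipE Mx tv).
- by move=> x Mx; apply: om3_multilinear=> c u u'; exact: (flat_linear (sphere_product1 fL)).
- move=> x v a b _ ab vab.
 pose G (u v w : 'rV[R]_(7 + N')) := om3 (flat1 x u) (flat1 x v) (flat1 x w).
 by apply: (@antisym3_alt R _ G _ _ v a b ab vab)=> u u' w; [exact: om3_12|exact: om3_23].
- move=> U p e ofr I; have [oU _ _ _ _] := ofr.
 apply: (smooth_om3 oU (u := fun k y=> flat1 (p y) (push p e (I (od 0)) y) k)
  (v := fun k y=> flat1 (p y) (push p e (I (od 1)) y) k)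
  (w := fun k y=> flat1 (p y) (push p e (I (od 2)) y) k))=> k;
  exact: (smooth_flat (sphere_product1 fL) _ _ _ _ ofr).
Qed.

Lemma Phi_is_form : is_form 8 MLL Phi.
pose G x (a b c d : 'rV[R]_(7 + N' + N')) := eta2 form 1 x a * om3 (flat2 x b) (flat2 x c) (flat2 x d)
  - eta2 form 1 x b * om3 (flat2 x a) (flat2 x c) (flat2 x d)
  + eta2 form 1 x c * om3 (flat2 x a) (flat2 x b) (flat2 x d)
  - eta2 form 1 x d * om3 (flat2 x a) (flat2 x b) (flat2 x c)
  + ps4 (flat2 x a) (flat2 x b) (flat2 x c) (flat2 x d).
have G12 x a b c d : G x b a c d = - G x a b c d.
 by rewrite /G (om3_12 (flat2 x a) (flat2 x b)) (om3_12 (flat2 x a) (flat2 x b) (flat2 x c)) (ps4_12 (flat2 x a)); ring.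
have G23 x a b c d : G x a c b d = - G x a b c d.
 by rewrite /G (om3_12 (flat2 x b) (flat2 x c)) (om3_23 (flat2 x a) (flat2 x b) (flat2 x c)) (ps4_23 (flat2 x a)); ring.
have G34 x a b c d : G x a b d c = - G x a b c d.
 by rewrite /G (om3_23 (flat2 x b) (flat2 x c) (flat2 x d)) (om3_23 (flat2 x a) (flat2 x c) (flat2 x d)) (ps4_34 (flat2 x a)); ring.
apply: (is_form_ext (sphere_product2 fL) (G := fun x v=> G x (v (od 0)) (v (od 1)) (v (od 2)) (v (od 3)))).
- by move=> x v Mx tv; apply: spin7_flat=> //; apply: g2E; case: Mx.
- move=> x Mx; apply: antisym4_multilinear=> [a b c d|a b c d|a b c d|k u u' b c d].
 + exact: G12.
 + exact: G23.
 + exact: G34.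
 + rewrite /G (flat_linear (sphere_product2 fL)) (sp_lin (sphere_product2 fL)) !om3_lin1 ps4_lin1; ring.
- by move=> x v a b _ ab vab; apply: (@antisym4_alt R _ (G x) _ _ _ v a b ab vab)=> *; [exact: G12|exact: G23|exact: G34].
- move=> U p e ofr I; have [oU sp se _ _] := ofr.
 have sf i k : smooth_on U (fun y=> flat2 (p y) (push p e i y) k).
  exact: (smooth_flat (sphere_product2 fL) _ _ _ _ ofr).
 have se1 i : smooth_on U (fun y=> eta2 form 1 (p y) (push p e i y)).
  exact: (sp_smooth (sphere_product2 fL) i 1 oU se sp).
 have so i j l : smooth_on U (fun y=> om3 (flat2 (p y) (push p e i y)) (flat2 (p y) (push p e j y)) (flat2 (p y) (push p e l y))).
  exact: (smooth_om3 oU (sf i) (sf j) (sf l)).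
 apply: smoothD=> //; last exact: (smooth_ps4 oU (sf _) (sf _) (sf _) (sf _)).
 apply: smoothD=> //; last by apply: smoothN=> //; exact: smoothM.
 apply: smoothD=> //; last exact: smoothM.
 by apply: smoothD=> //; [exact: smoothM|apply: smoothN=> //; exact: smoothM].
Qed.

End AdaptedFrames.

(** * Existence of adapted frames on the products *)

Section ProductFrames.
Variables (R : realType) (N' : nat) (L : set 'rV[R]_N') (form : dform R N' 1).
Hypothesis fL : unit_factor L form.
Variables (Psip Psim : dform R 7 3) (s : R).
Hypothesis s2 : s ^+ 2 = 1.
Hypothesis PsipE : forall x v, sphere x -> (forall i, tangent (@sphere R 6) x (v i)) ->
 Psip x v = - s * om3 (co (v (od 0))) (co (v (od 1))) (co (v (od 2))).

Notation S6 := (@sphere R 6).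
Notation ML := (prodM S6 L).
Notation MLL := (prodM ML L).
Notation omega := (g2_product (@F_S6 R) Psip form).
Notation Phi := (spin7_product ML omega form).
Notation A6 := (su3_frame S6 (@F_S6 R) Psip Psim).
Notation flat1 := (flat (@emb1 N') (eta1 form) s 0).
Notation flat2 := (flat (@emb2 N') (eta2 form) s 0).

Lemma form0 x : form x (fun=> 0) = 0.
by have := fa_lin fL x 1 0 0; rewrite scaler0 addr0; lra. Qed.
Lemma flat1E x v : flat1 x v = fun k=> s * co (lsubmx v) k + form (rsubmx x) (fun=> rsubmx v) * co (lsubmx x) k.
by ext k; rewrite /flat eta1E /co !mxE. Qed.

Lemma flat10 x : flat1 x 0 = fun=> 0.
have r0 : rsubmx (0 : 'rV[R]_(7 + N')) = 0 by apply/rowP=> d; rewrite !mxE.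
by rewrite flat1E r0 form0; ext a; rewrite mul0r addr0 /co !mxE mulr0.
Qed.

(* phi is an arc length along the line or circle, so every dilaton is a multiple of it *)
Definition arc_length N n (eta : 'rV[R]_N -> 'rV[R]_N -> R) (U : set 'rV[R]_n) (p : 'rV[R]_n -> 'rV[R]_N) : Prop :=
 exists phi : 'rV[R]_n -> R, smooth_on U phi /\ forall v y, U y -> 'D_v phi y = eta (p y) ('D_v p y).

(** An SU(3)-frame of the sphere followed by the unit vector of the factor: under [flat] it becomes
    s e_i and q, which is octonionic by [su3_adapted]. *)
Lemma g2_framed : framed_around S6 A6 ->
 framed_around ML (fun U p e=> g2_frame ML omega U p e /\ arc_length (eta1 form 0) U p).
move=> fr x [Sx Lx]; have [U [p [e [y [[ofr HA] Uy yx]]]]] := fr _ Sx.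
have [c [c' [t0 [ct Lc c1 dc]]]] := fa_chart fL Lx.
have ofr' := prod_onframe fL ofr Lc c1 dc.
exists (prod_dom U), (prod_map p c), (prod_frm e), (row_mx y (const_mx t0)); split; last first.
- by rewrite /prod_map row_mxKl row_mxEr mxE yx ct hsubmxK.
- by rewrite /prod_dom /= row_mxKl.
split; last first.
 exists (fun y=> y 0 (last_ord 6)); split; first exact: smooth_last ofr.
 by move=> v z Uz; rewrite (derive_last fL ofr c1 dc)// eta1E.
split=> [//|z I Uz]; rewrite (tup3_eta I) omega_stdE.
move: (I (od 0)) (I (od 1)) (I (od 2))=> i j k {I}.
have [_ _ _ Mp _] := ofr'.
rewrite /comps (omega_flat form s2 PsipE (Mp z Uz))=> [|a]; last exact: onframe_tangent ofr' Uz.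
pose z0 : 'rV[R]_6 := lsubmx (z : 'rV[R]_(6 + 1)).
pose b (a : 'I_7) := flat1 (prod_map p c z) (push (prod_map p c) (prod_frm e) a z).
suff : om3 (b i) (b j) (b k) = omr R i j k by [].
have [HF HP] := su3_adapted s2 PsipE (conj ofr HA : A6 U p e) Uz.
have bl a : b (w67 a) = fun k=> s * co (push p e a z0) k.
 rewrite /b (_ : w67 a = lshift 1 a); last exact: val_inj.
 rewrite (prod_push_l ofr dc a Uz) flat1E !row_mxKl !row_mxKr form0.
 by ext l; rewrite mul0r addr0.
have br : b (od 6) = co (p z0).
 rewrite /b (_ : od 6 = last_ord 6); last exact: val_inj.
 rewrite (prod_push_r ofr dc Uz) flat1E /prod_map !row_mxKl !row_mxKr c1.
 by ext l; rewrite /co !mxE mulr0 add0r mul1r.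
apply: om3_extend=> [a d|a d f]; rewrite ?br !bl; first exact: HF.
exact: HP.
Qed.

(** The product chart puts the new direction last, while the Spin(7) convention wants it as e_0. *)
Definition spin7_order (i : 'I_8) : 'I_(7 + 1) :=
 if unlift ord0 i is Some j then lshift 1 j else last_ord 7.

Lemma spin7_order_inj : injective spin7_order.
move=> i j; rewrite /spin7_order.
case: (unliftP ord0 i)=> [i' ->|->]; case: (unliftP ord0 j)=> [j' ->|->] //.
- by move=> /lshift_inj ->.
- by move=> /eqP; rewrite eq_lrshift.
- by move=> /eqP; rewrite eq_rlshift.
Qed.

Lemma spin7_framed : framed_around ML (fun U p e=> g2_frame ML omega U p e /\ arc_length (eta1 form 0) U p) ->
 framed_around MLL (fun U p e=> spin7_frame MLL Phi U p e /\ arc_length (eta2 form 0) U p).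
move=> fr x [Mx Lx]; have [U [p [e [y [[[ofr HA] [phi [sphi dphi]]] Uy yx]]]]] := fr _ Mx.
have g2E : forall x, ML x -> exists E, g2_basis ML omega x E.
 apply: (framed_g2_basis (form := form))=> z Mz.
 by have [U' [p' [e' [y' [[H _] Uy' y'z]]]]] := fr z Mz; exists U', p', e', y'.
have [c [c' [t0 [ct Lc c1 dc]]]] := fa_chart fL Lx.
have ofr0 := prod_onframe fL ofr Lc c1 dc.
have ofr' := onframe_inj spin7_order_inj ofr0.
exists (prod_dom U), (prod_map p c), (fun i=> prod_frm e (spin7_order i)), (row_mx y (const_mx t0)).
split; last first.
- by rewrite /prod_map row_mxKl row_mxEr mxE yx ct hsubmxK.
- by rewrite /prod_dom /= row_mxKl.
split; last first.
 (* The Lee direction remains that of the first factor, so its arc length is inherited from the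
    seven-dimensional chart. *)
 exists (fun y : 'rV[R]_(7 + 1)=> phi (lsubmx y)); split; first exact: (smooth_comp_lsubmx (m := 1) sphi).
 move=> v z Uz; rewrite (derive_lsubmx (m := 1) phi v z) dphi// eta2_0.
 by rewrite (derive_prod_map ofr dc v Uz) /prod_map !row_mxKl.
split=> [//|z I Uz]; rewrite (idx4_eta I) Phi_stdE.
move: (I (od 0)) (I (od 1)) (I (od 2)) (I (od 3))=> i j k l {I}.
have [_ _ _ Mp _] := ofr'.
rewrite /comps (spin7_flat fL s2 PsipE (Mp z Uz))=> [||a]; last first.
- exact: (onframe_tangent _ ofr' Uz).
- by apply: g2E; case: (Mp z Uz).
pose z0 : 'rV[R]_7 := lsubmx (z : 'rV[R]_(7 + 1)).
pose b a := flat2 (prod_map p c z) (push (prod_map p c) (fun i=> prod_frm e (spin7_order i)) a z).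
pose u a := eta2 form 1 (prod_map p c z) (push (prod_map p c) (fun i=> prod_frm e (spin7_order i)) a z).
suff : Phi_form b u i j k l = phr R i j k l by [].
have pE a : push (prod_map p c) (fun i=> prod_frm e (spin7_order i)) a z =
  push (prod_map p c) (prod_frm e) (spin7_order a) z by [].
have uE a : u a = form (rsubmx (prod_map p c z)) (fun=> rsubmx (push (prod_map p c) (fun i=> prod_frm e (spin7_order i)) a z)).
 by rewrite -eta2_1.
have [_ _ _ Mp1 on1] := ofr.
have bS (a : 'I_7) : b (lift ord0 a) = flat1 (p z0) (push p e a z0).
 rewrite /b flat2E pE /spin7_order liftK (prod_push_l ofr dc a Uz) /prod_map.
 by rewrite !row_mxKl.
apply: (@Phi_extend R b u).
- by rewrite /b flat2E pE /spin7_order unlift_none (prod_push_r ofr dc Uz) !row_mxKl flat10.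
- by rewrite uE pE /spin7_order unlift_none (prod_push_r ofr dc Uz) /prod_map !row_mxKr c1.
- by move=> a; rewrite uE pE /spin7_order liftK (prod_push_l ofr dc a Uz) row_mxKr form0.
split=> [a a'|a a' a'']; rewrite !bS.
 by rewrite (flat_dot fL s2 (Mp1 _ Uz)) ?on1//; exact: onframe_tangent ofr Uz.
have := HA z0 (tup3 a a' a'') Uz; rewrite /comps (omega_flat form s2 PsipE (Mp1 _ Uz))=> [|d].
 by rewrite omega_stdE.
exact: onframe_tangent ofr Uz.
Qed.

End ProductFrames.

(** * From structure forms to torsion: families of adapted frames *)

Lemma alternating_swap R N k (P : 'rV[R]_N -> Prop) (f : ('I_k -> 'rV[R]_N) -> R) :
 (forall c u v, P u -> P v -> P (c *: u + v)) -> (forall v s c u u', (forall t, P (v t)) -> P u -> P u' ->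
  f (upd v s (c *: u + u')) = c * f (upd v s u) + f (upd v s u')) ->
 (forall v s t, (forall r, P (v r)) -> s != t -> v s = v t -> f v = 0) ->
 forall v s t x y, (forall r, P (v r)) -> s != t -> P x -> P y ->
 f (upd (upd v s y) t x) = - f (upd (upd v s x) t y).
move=> PD lin alt v s t x y Pv st Px Py.
have Pu w a i : (forall r, P (w r)) -> P a -> forall r, P (upd w i a r).
 by move=> Pw Pa r; rewrite /upd; case: eqP.
have swC a b : upd (upd v t b) s a = upd (upd v s a) t b.
 by ext i; rewrite /upd; case: eqP=> // ->; rewrite (negbTE st).
have W0 a : P a -> f (upd (upd v s a) t a) = 0.
 move=> Pa; apply: (alt _ s t _ st); last by rewrite /upd (negbTE st) !eqxx.
 by apply: (Pu _ _ _ _ _ Pa); exact: (Pu _ _ _ _ Pv Pa).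
have linL a b c : P a -> P b -> P c ->
  f (upd (upd v s (a + b)) t c) = f (upd (upd v s a) t c) + f (upd (upd v s b) t c).
 move=> Pa Pb Pc; have := lin (upd v t c) s 1 a b (Pu _ _ _ _ Pv Pc) Pa Pb.
 by rewrite scale1r mul1r !swC.
have linR a b c : P a -> P b -> P c ->
  f (upd (upd v s c) t (a + b)) = f (upd (upd v s c) t a) + f (upd (upd v s c) t b).
 by move=> Pa Pb Pc; have := lin (upd v s c) t 1 a b (Pu _ _ _ _ Pv Pc) Pa Pb; rewrite scale1r mul1r.
have Pxy : P (x + y) by rewrite -[x]scale1r; exact: PD.
(* Polarization: the value with x + y in both slots vanishes, and so do the two diagonal terms. *)
have := W0 _ Pxy; rewrite linL// !linR// !W0// add0r addr0 addrC=> /eqP.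
by rewrite addr_eq0=> /eqP.
Qed.

Lemma tup3_swap R (X : Type) (P : X -> Prop) (f : ('I_3 -> X) -> R) :
 (forall v s t x y, (forall r, P (v r)) -> s != t -> P x -> P y ->
  f (upd (upd v s y) t x) = - f (upd (upd v s x) t y)) -> forall a b c, P a -> P b -> P c ->
 f (tup3 b a c) = - f (tup3 a b c) /\ f (tup3 a c b) = - f (tup3 a b c).
move=> sw a b c Pa Pb Pc.
have Pt t : P (tup3 a b c t) by case: t=> [[|[|[|//]]]] ?.
have [e1 _ _] := upd_tup3 a b c b; have [_ e2 _] := upd_tup3 b b c a.
have [e3 _ _] := upd_tup3 a b c a; have [_ e4 _] := upd_tup3 a b c b.
have [_ e5 _] := upd_tup3 a b c c; have [_ _ e6] := upd_tup3 a c c b.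
have [_ _ e7] := upd_tup3 a b c c.
have := sw _ (od 0) (od 1) a b Pt isT Pa Pb; rewrite e1 e2 e3 e4.
by have := sw _ (od 1) (od 2) b c Pt isT Pb Pc; rewrite e5 e6 e4 e7.
Qed.

Lemma form_comps_alt R r N (M : set 'rV[R]_N) U p (e : frame R (6 + r)) (T : dform R N 3) :
 (forall x c u v, M x -> tangent M x u -> tangent M x v -> tangent M x (c *: u + v)) ->
 is_form (6 + r) M T -> onframe M U p e -> alt_form U (comps p e T).
move=> tan [lin alt _] ofr y i j k Uy.
have [_ _ _ Mp _] := ofr; have My := Mp y Uy.
have sw := alternating_swap (fun c u v=> tan _ c u v My) (fun v s c u u' Pv=> lin _ v s c u u' My Pv)
 (fun v s t Pv=> alt _ v s t My Pv).
pose w a := push p e a y.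
have Pw a : tangent M (p y) (w a) := onframe_tangent a ofr Uy.
have cE a b c : comps p e T y (tup3 a b c) = T (p y) (tup3 (w a) (w b) (w c)).
 by rewrite /comps; congr T; rewrite [LHS]tup3_eta.
rewrite !cE; exact: (tup3_swap sw (Pw i) (Pw j) (Pw k)).
Qed.

Lemma closed_algebra R n (c x y : R) (S X : 'I_n -> R) : x - y = \sum_l S l * X l ->
 c * x - \sum_l S l * (c * X l) - c * y = 0.
move=> H; rewrite (_ : \sum_l _ = c * (x - y)); first by ring.
by rewrite H mulr_sumr; eq_sum l; rewrite mulrCA.
Qed.

Lemma so_act_delta R n (C : 'M[R]_n) (I : 'I_2 -> 'I_n) :
 (forall i j, C i j = - C j i) -> so_act C (fun J=> (J 0 == J 1)%:R) I = 0.
move=> anti; rewrite /so_act 2!big_ord_recl big_ord0 addr0.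
have -> : lift ord0 ord0 = 1 :> 'I_2 by exact: val_inj.
under eq_bigr=> l _ do rewrite /upd eqxx [1 == ord0]/=.
under [X in _ + X]eq_bigr=> l _ do rewrite /upd eqxx [0 == 1 :> 'I_2]/=.
rewrite (bigD1 (I 1))//= big1=> [|l /negbTE ->]; last by rewrite mulr0.
rewrite (bigD1 (I 0))//= big1=> [|l lI]; last by rewrite eq_sym (negbTE lI) mulr0.
by rewrite !eqxx !mulr1 !addr0 anti addNr.
Qed.

Section AdaptedFamilies.
Variables (R : realType) (r N K : nat) (M : set 'rV[R]_N) (emb : 'I_7 -> 'I_N).
Notation n := (6 + r)%N.
Variables (eta : 'I_r -> 'rV[R]_N -> 'rV[R]_N -> R) (A : frames R N n) (g : 'M[R]_n -> Prop).
Hypothesis sM : sphere_product M emb eta.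
Hypothesis A_on : forall U p e, A U p e -> onframe M U p e.
Hypotheses (gcl : holonomy_closed g) (gnp : no_prolongation g) (gK : has_spinor K g).

Notation q p := (fun k y => p y 0 (emb k)).
Notation t p e := (fun s i y => eta s (p y) (push p e i y)).

Hypothesis tor_g : forall U p e w y m, A U p e -> tor_conn U e (q p) 1 w -> U y -> g (wmx w y m).

Let pf U p e (AU : A U p e) : product_frame U e (q p) (t p e) :=
 onframe_pf sM (A_on AU).

Definition torsion_comps (T : dform R N 3) : Prop :=
 forall U p e, A U p e -> tor_form U e (q p) (comps p e T).

Lemma torsion_form_comps : torsion_comps (torsion_form emb).
move=> U p e AU z i j k Uz; rewrite /tor /av /comps /torsion_form.
have [_ sp _ _ _] := A_on AU.
by congr ps4; ext a; rewrite (push_coord _ _ _ sp Uz).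
Qed.

Lemma torsion_comps_unique T : is_form n M T ->
 (forall U p e y m, A U p e -> U y -> g (wmx (tconn p e T) y m)) -> torsion_comps T.
move=> fT hT U p e AU.
apply: (torsion_unique gcl gnp)=> [w y m wE Uy||y m Uy].
- exact: (tor_g _ AU wE Uy).
- by apply: form_comps_alt fT (A_on AU)=> x c u v; exact: (sp_tan sM).
- exact: hT AU Uy.
Qed.
Lemma torsion_comps_g T U p e y m : torsion_comps T -> A U p e -> U y -> g (wmx (tconn p e T) y m).
by move=> TE AU Uy; apply: (tor_g _ AU _ Uy); apply: conn_tor_conn (TE _ _ _ AU) _; rewrite div1r. Qed.

Lemma torsion_comps_metric T : torsion_comps T -> metric_connection A T.
move=> TE U p e y AU Uy m I.
rewrite (cov_const e (tconn p e T) (pf_open (pf AU)) m I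
 (fun z I _=> erefl : metric_comps z I = (I 0 == I 1)%:R) Uy).
rewrite so_act_delta ?oppr0// => a b; rewrite !mxE.
exact: (conn_anti e m b a (tor_form_alt (TE _ _ _ AU)) Uy).
Qed.

Variable T : dform R N 3.
Hypothesis TE : torsion_comps T.

Lemma family_gravitino : solves_gravitino K A g T.
split=> [//|gam eta' ds U p e y AU Uy].
exact: (adapted_gravitino (fun w y m wE Uy=> tor_g _ AU wE Uy) (TE AU) ds Uy).
Qed.

Lemma family_gaugino : solves_gaugino K A g T.
split=> [//|gam eta' ds U p e y AU Uy].
exact: (adapted_gaugino (pf AU) gcl (fun w y m wE Uy=> tor_g _ AU wE Uy) (TE AU) ds Uy).
Qed.
Lemma family_bianchi1 : bianchi1 A T (- 3^-1).
by move=> U p e y AU Uy; exact: (bianchi1_tor (pf AU) (TE AU) Uy). Qed.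
Lemma family_bianchi2 : bianchi2 A T (- 12^-1).
by move=> U p e y AU Uy; exact: (bianchi2_tor (pf AU) (TE AU) Uy). Qed.

Variables (s : R) (s0 : 'I_r).
Hypothesis s2 : s ^+ 2 = 1.
Hypothesis cm_g : forall U p e y m, A U p e -> U y -> g (\matrix_(i, j) cm e (q p) s (t p e s0) y m i j).

Lemma family_dilatino (gam : 'I_n -> 'M[R]_K) eta' U p e (phi : 'rV[R]_n -> R) y :
 defining_spinor g gam eta' -> A U p e -> U y -> (forall m, pd e m phi y = - 2 * s * t p e s0 m y) ->
 dilatino_at gam e (comps p e T) phi (fun=> eta') y.
move=> ds AU Uy dphi.
apply: (adapted_dilatino (pf AU) (TE AU) ds Uy _ _ dphi)=> [k|m].
 exact: (tv_av (pf AU) s0 k Uy).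
exact: cm_g AU Uy.
Qed.

Lemma family_eom (phi : 'rV[R]_N -> R) : smooth_fun n M phi ->
 (forall U p e y m, A U p e -> U y -> pd e m (phi \o p) y = - 2 * s * t p e s0 m y) -> solves_eom A T phi (- 3^-1).
move=> sphi dphi U p e y AU Uy.
apply: (eom_tor (pf AU) (s0 := s0) (kap := - 2 * s) _ _ (TE AU))=> //.
- exact: sphi (A_on AU).
- by move=> z m Uz; exact: dphi AU Uz.
- by apply: conn_tor_conn (TE AU) _; rewrite div1r.
- by rewrite exprMn s2 sqrrN mulr1; lra.
Qed.

Lemma closed_1form (a : lform R n 1) U p e c y I : A U p e -> U y ->
 (forall z J, U z -> a z J = c * t p e s0 (J 0) z) -> ext_d e a y I = 0.
move=> AU Uy aE; have oU := pf_open (pf AU).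
have dt' i := dt (pf AU) s0 i Uy.
rewrite (tup2_eta I) ext_d1E.
rewrite (pd_eqon e oU (I (od 0)) (fun z Uz=> aE z (fun=> I (od 1)) Uz) Uy).
rewrite (pd_eqon e oU (I (od 1)) (fun z Uz=> aE z (fun=> I (od 0)) Uz) Uy) !pdZ//.
under eq_bigr=> l _ do rewrite aE//.
have := pf_closed (pf AU) s0 (I (od 0)) (I (od 1)) Uy.
exact: closed_algebra.
Qed.

End AdaptedFamilies.

Lemma parallel_act R N n k (A : frames R N n) M T (a : dform R N k) c U p e y m I :
 A U p e -> onframe M U p e -> parallel A T a ->
 (forall z J, U z -> comps p e a z J = c J) -> U y -> so_act (wmx (tconn p e T) y m) c I = 0.
move=> AU ofr par aE Uy; have [oU _ _ _ _] := ofr.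
have /eqP := par _ _ _ _ AU Uy m I.
by rewrite (cov_const e (tconn p e T) oU m I aE Uy) oppr_eq0=> /eqP.
Qed.

Lemma act_parallel R N n k (A : frames R N n) M T (a : dform R N k) c : (forall U p e, A U p e -> onframe M U p e) ->
 (forall U p e, A U p e -> forall z J, U z -> comps p e a z J = c J) ->
 (forall U p e y m I, A U p e -> U y -> so_act (wmx (tconn p e T) y m) c I = 0) -> parallel A T a.
move=> on aE act U p e y AU Uy m I; have [oU _ _ _ _] := on _ _ _ AU.
by rewrite (cov_const e (tconn p e T) oU m I (aE _ _ _ AU) Uy) (act _ _ _ _ m I AU Uy) oppr0.
Qed.

Section NonzeroTorsion.
Variables (R : realType) (r N : nat) (M : set 'rV[R]_N) (emb : 'I_7 -> 'I_N).
Notation n := (6 + r)%N.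
Variables (eta : 'I_r -> 'rV[R]_N -> 'rV[R]_N -> R) (A : frames R N n) (T : dform R N 3).
Hypothesis sM : sphere_product M emb eta.
Hypothesis A_on : forall U p e, A U p e -> onframe M U p e.
Hypothesis TE : torsion_comps emb A T.

(** If the torsion vanished in a frame, its square contraction, four times the projection on the
    sphere, would vanish as well, although the projection has trace 6. *)
Lemma torsion_nonzero U p e y : A U p e -> U y -> nonzero_form M T.
move=> AU Uy; have ofr := A_on AU; have pf := onframe_pf sM ofr.
have [_ _ _ Mp _] := ofr.
case: (pselect (exists i j k, T (p y) (tup3 (push p e i y) (push p e j y) (push p e k y)) != 0)).
 move=> [i [j [k Tn]]]; exists (p y), (tup3 (push p e i y) (push p e j y) (push p e k y)).
 by split=> [||//]; [exact: Mp|case=> [[|[|[|//]]]] ?; exact: onframe_tangent ofr Uy].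
move=> T0; exfalso.
have tor0 i j k : tor e (fun k y=> p y 0 (emb k)) y i j k = 0.
 rewrite -(TE AU i j k Uy); apply: contrapT=> /eqP Tn; apply: T0; exists i, j, k.
 by move: Tn; rewrite /comps [X in T _ X]tup3_eta.
have h0 m : hp e (fun k y=> p y 0 (emb k)) y m m = 0.
 have := tor_tor_trace pf m m Uy; rewrite big1=> [h|a _]; first by lra.
 by rewrite big1// => b _; rewrite tor0 mul0r.
have := hp_trace pf Uy; rewrite big1=> [h|m _]; last exact: h0.
lra.
Qed.

End NonzeroTorsion.

(** * The six-sphere itself, and consequences of an abstract torsion structure *)

Section SU3.
Variables (R : realType) (Psip Psim : dform R 7 3) (s : R).
Hypothesis s2 : s ^+ 2 = 1.
Hypothesis PsipE : forall x v, sphere x -> (forall i, tangent (@sphere R 6) x (v i)) ->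
 Psip x v = - s * om3 (co (v (od 0))) (co (v (od 1))) (co (v (od 2))).
Notation S6 := (@sphere R 6).
Notation A6 := (su3_frame S6 (@F_S6 R) Psip Psim).

Let eta0 (i : 'I_0) (x v : 'rV[R]_7) : R := 0.
Let sM : sphere_product S6 id eta0 := S6_product eta0.
Let A_on U p e : A6 U p e -> onframe (n := 6 + 0) S6 U p e. Proof. by case. Qed.

Lemma su3_tor_g U p (e : frame R (6 + 0)) w y m : A6 U p e ->
 tor_conn U e (fun k y=> p y 0 k) 1 w -> U y -> in_su3 (wmx w y m).
move=> AU wE Uy; have pf := onframe_pf sM (A_on AU).
have [_ sp _ _ _] := A_on AU.
have bE z i : U z -> bv e (fun k y=> p y 0 k) s (fun _ _=> 0) z i = fun k=> s * co (push p e i z) k.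
 move=> Uz; ext k.
 by rewrite /bv mul0r addr0 /av /co (push_coord _ _ _ sp Uz).
apply: (su3_tor_conn pf (s := s) _ _ m wE Uy)=> z i j.
- by move=> Uz; rewrite !bE//; exact: (proj1 (su3_adapted s2 PsipE AU Uz)).
- by move=> k Uz; rewrite !bE//; exact: (proj2 (su3_adapted s2 PsipE AU Uz)).
Qed.

Lemma su3_part : is_form 6 S6 (torsion_form id : dform R 7 3) ->
 (exists T : dform R 7 3, su3_torsion S6 (@cross R) Psip Psim T) /\
 (forall T : dform R 7 3, su3_torsion S6 (@cross R) Psip Psim T ->
  [/\ solves_gravitino 8 A6 (@in_su3 R) T, solves_gaugino 8 A6 (@in_su3 R) T,
    exists2 al : R, al < 0 & bianchi1 A6 T al & exists2 al : R, al < 0 & bianchi2 A6 T al]).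
move=> fT; split.
- have TE := torsion_form_comps (r := 0) id A_on.
 have Tg U p e y m : A6 U p e -> U y -> in_su3 (wmx (tconn p e (torsion_form id)) y m) :=
  @torsion_comps_g R 0 7 id A6 (@in_su3 R) su3_tor_g _ U p e y m TE.
 exists (torsion_form id); split=> //.
 + exact: (torsion_comps_metric (r := 0) sM A_on TE).
 + apply: (act_parallel A_on (c := @F_std R))=> [U p e [_ H] z J Uz|U p e y m I AU Uy].
   by have [-> _ _] := H z Uz.
  by have [H _ _] := Tg U p e y m AU Uy.
 + apply: (act_parallel A_on (c := @Psip_std R))=> [U p e [_ H] z J Uz|U p e y m I AU Uy].
   by have [_ -> _] := H z Uz.
  by have [_ H _] := Tg U p e y m AU Uy.
 + apply: (act_parallel A_on (c := @Psim_std R))=> [U p e [_ H] z J Uz|U p e y m I AU Uy].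
   by have [_ _ ->] := H z Uz.
  by have [_ _ H] := Tg U p e y m AU Uy.
- move=> T [fT' _ parF parP parM].
 have TE : torsion_comps (r := 0) id A6 T.
  apply: (torsion_comps_unique (r := 0) sM A_on (@su3_closed R) (@su3_no_prolongation R) su3_tor_g fT').
  move=> U p e y m AU Uy; have [ofr H] := AU; split=> I.
  + by apply: (parallel_act m I AU ofr parF)=> // z J Uz; have [-> _ _] := H z Uz.
  + by apply: (parallel_act m I AU ofr parP)=> // z J Uz; have [_ -> _] := H z Uz.
  + by apply: (parallel_act m I AU ofr parM)=> // z J Uz; have [_ _ ->] := H z Uz.
 split.
 + exact: (family_gravitino (r := 0) (has_spinor_su3 R) su3_tor_g TE).
 + exact: (family_gaugino (r := 0) sM A_on (@su3_closed R) (has_spinor_su3 R) su3_tor_g TE).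
 + by exists (- 3^-1); [lra|exact: (family_bianchi1 (r := 0) sM A_on TE)].
 + by exists (- 12^-1); [lra|exact: (family_bianchi2 (r := 0) sM A_on TE)].
Qed.

End SU3.

(* M = S^6 x (r lines or circles) with a structure form S, constant in the frames of A; g is its stabilizer *)
Record torsion_structure R (r N k : nat) (M : set 'rV[R]_N) (emb : 'I_7 -> 'I_N)
  (eta : 'I_r -> 'rV[R]_N -> 'rV[R]_N -> R) (A : frames R N (6 + r)) (std : ('I_k -> 'I_(6 + r)) -> R)
  (S : dform R N k) (lee : frame R (6 + r) -> lform R (6 + r) k -> lform R (6 + r) 1)
  (K : nat) (kap s : R) (s0 : 'I_r) : Prop := TorsionStructure { ts_product : sphere_product M emb eta;
 ts_on : forall U p e, A U p e -> onframe M U p e;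
 ts_std : forall U p e, A U p e -> forall z J, U z -> comps p e S z J = std J;
 ts_np : no_prolongation (fun C : 'M[R]_(6 + r)=> forall I, so_act C std I = 0);
 ts_spinor : has_spinor K (fun C : 'M[R]_(6 + r)=> forall I, so_act C std I = 0);
 ts_tor : forall U p e w y m, A U p e -> tor_conn U e (fun i z=> p z 0 (emb i)) 1 w -> U y ->
  forall I, so_act (wmx w y m) std I = 0;
 ts_cm : forall U p e y m, A U p e -> U y -> forall I, so_act (\matrix_(i, j)
  cm e (fun i z=> p z 0 (emb i)) s (fun i z=> eta s0 (p z) (push p e i z)) y m i j) std I = 0;
 ts_lee : forall U p e y J, A U p e -> U y ->
  lee e (comps p e S) y J = - 2 * kap * s * eta s0 (p y) (push p e (J 0) y); ts_sqr : s ^+ 2 = 1;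
 ts_kap : kap != 0 }.

Section TorsionStructure.
Variables (R : realType) (r N k : nat) (M : set 'rV[R]_N) (emb : 'I_7 -> 'I_N).
Notation n := (6 + r)%N.
Variables (eta : 'I_r -> 'rV[R]_N -> 'rV[R]_N -> R) (A : frames R N n) (std : ('I_k -> 'I_n) -> R).
Variables (S : dform R N k) (lee : frame R n -> lform R n k -> lform R n 1).
Variables (K : nat) (kap s : R) (s0 : 'I_r).
Hypothesis ts : torsion_structure M emb eta A std S lee K kap s s0.
Notation g := (fun C : 'M[R]_n => forall I, so_act C std I = 0).

Let sM := ts_product ts.
Let A_on := ts_on ts.
Let tor_g := ts_tor ts.
Let gcl : holonomy_closed g := stabilizer_closed std.

(** After cancelling the convention-dependent factor, the dilaton equation is the same in dimensions
    seven and eight: d phi = -2s times the unit form. *)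
Lemma lee_dilaton U p e y phi : A U p e -> U y -> dilaton_at e (lee e (comps p e S)) kap phi y <->
 forall m, pd e m phi y = - 2 * s * eta s0 (p y) (push p e m y).
move=> AU Uy; split=> H m; have := H m; rewrite (ts_lee ts _ AU Uy).
 by rewrite (mulrC (- 2)) -!mulrA=> /(mulfI (ts_kap ts)) <-; rewrite !mulrA.
by move=> ->; ring.
Qed.

Lemma closed_lee U p e y I : A U p e -> U y -> ext_d e (lee e (comps p e S)) y I = 0.
move=> AU Uy; apply: (closed_1form sM A_on (s0 := s0) (c := - 2 * kap * s) I AU Uy)=> z J Uz.
exact: (ts_lee ts J AU Uz).
Qed.

Definition is_torsion T := [/\ is_form n M T, metric_connection A T & parallel A T S].

Lemma torsion_exists : exists T, is_torsion T.
have TE := torsion_form_comps emb A_on.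
exists (torsion_form emb); split.
- exact: (torsion_is_form n sM).
- exact: (torsion_comps_metric sM A_on TE).
- apply: (act_parallel A_on (ts_std ts))=> U p e y m I AU Uy.
 by have H := torsion_comps_g (g := g) tor_g m TE AU Uy; exact: H.
Qed.

Section Torsion.
Variable T : dform R N 3.
Hypothesis gT : is_torsion T.

Let TE : torsion_comps emb A T.
have [fT _ par] := gT.
apply: (torsion_comps_unique sM A_on gcl (ts_np ts) tor_g fT).
by move=> U p e y m AU Uy I; apply: (parallel_act m I AU (A_on AU) par (ts_std ts AU) Uy).
Qed.

Lemma structure_nonzero : framed_around M A -> (exists x, M x) -> nonzero_form M T.
move=> fr [x /fr[U [p [e [y [AU Uy _]]]]]]; exact: (torsion_nonzero sM A_on TE AU Uy).
Qed.

Lemma structure_bianchi1 : bianchi1 A T (- 3^-1).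
exact: (family_bianchi1 sM A_on TE). Qed.

Lemma structure_bianchi2 : bianchi2 A T (- 12^-1).
exact: (family_bianchi2 sM A_on TE). Qed.

Let gravitino := family_gravitino (ts_spinor ts) tor_g TE.
Let gaugino := family_gaugino sM A_on gcl (ts_spinor ts) tor_g TE.

Let dilatino (gam : 'I_n -> 'M[R]_K) eta' U p e (phi : 'rV[R]_n -> R) y :
 defining_spinor g gam eta' -> A U p e -> U y ->
 dilaton_at e (lee e (comps p e S)) kap phi y -> dilatino_at gam e (comps p e T) phi (fun=> eta') y.
move=> ds AU Uy /(lee_dilaton _ AU Uy) dphi.
exact: (family_dilatino sM A_on TE (s := s) (s0 := s0) (ts_cm ts) ds AU Uy dphi).
Qed.

Lemma structure_local : framed_around M (fun U p e=> A U p e /\ arc_length (eta s0) U p) ->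
 solves_susy_locally K M A g lee S kap T.
move=> fr; split=> [U p e y AU Uy I|x Mx|//|//|gam eta' ds U p e phi AU sphi dphi y Uy].
- exact: closed_lee AU Uy.
- have [U [p [e [y [[AU [phi [sphi dphi]]] Uy yx]]]]] := fr _ Mx.
 have oU := pf_open (onframe_pf sM (A_on AU)).
 exists U, p, e, y; split=> //; split=> //.
 exists (fun y=> - 2 * s * phi y); split.
  by apply: smoothM=> //; exact: (smooth_cst (- 2 * s : R)).
 move=> z Uz; apply/(lee_dilaton _ AU Uz)=> m.
 rewrite pdZ; last exact: smooth_diff sphi Uz.
 by rewrite [pd e m phi z]dphi.
- exact: (dilatino ds AU Uy (dphi y Uy)).
Qed.

Lemma structure_global (phi : 'rV[R]_N -> R) : smooth_fun n M phi ->
 (forall U p e y m, A U p e -> U y -> pd e m (phi \o p) y = - 2 * s * eta s0 (p y) (push p e m y)) ->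
 [/\ is_dilaton A lee S kap phi, solves_susy K A g T phi & solves_eom A T phi (- 3^-1)].
move=> sphi dphi.
have dil U p e y : A U p e -> U y -> dilaton_at e (lee e (comps p e S)) kap (phi \o p) y.
 by move=> AU Uy; apply/(lee_dilaton _ AU Uy)=> m; exact: dphi AU Uy.
split=> //; last exact: (family_eom sM A_on TE (s := s) (s0 := s0) (ts_sqr ts) sphi dphi).
split=> //; split=> [|gam eta' ds U p e y AU Uy]; first exact: ts_spinor ts.
exact: (dilatino ds AU Uy (dil _ _ _ _ AU Uy)).
Qed.

End Torsion.
End TorsionStructure.

(** * The G_2 and Spin(7) products as torsion structures *)

Section ProductStructures.
Variables (R : realType) (N' : nat) (L : set 'rV[R]_N') (form : dform R N' 1).
Hypothesis fL : unit_factor L form.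
Variables (Psip Psim : dform R 7 3) (s : R).
Hypothesis s2 : s ^+ 2 = 1.
Hypothesis PsipE : forall x v, sphere x -> (forall i, tangent (@sphere R 6) x (v i)) ->
 Psip x v = - s * om3 (co (v (od 0))) (co (v (od 1))) (co (v (od 2))).
Notation S6 := (@sphere R 6).
Notation ML := (prodM S6 L).
Notation MLL := (prodM ML L).
Notation omega := (g2_product (@F_S6 R) Psip form).
Notation Phi := (spin7_product ML omega form).
Hypothesis fr6 : framed_around S6 (su3_frame S6 (@F_S6 R) Psip Psim).

(** The normalization 2 d phi = theta and the Lee form -4s t agree with -2 * 2 * s. *)
Lemma g2_torsion_structure : torsion_structure (r := 1) ML (@emb1 N') (eta1 form) (g2_frame ML omega)
 (@omega_std R) omega (@lee7 R) 8 2 s 0.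
have sM : sphere_product (r := 1) ML (@emb1 N') (eta1 form) := sphere_product1 fL.
have A_on U p e : g2_frame ML omega U p e -> onframe (n := 6 + 1) ML U p e by case.
split=> //.
- by move=> U p e [].
- exact: g2_no_prolongation.
- exact: has_spinor_g2.
- move=> U p e w y m AU wE Uy; have pf := onframe_pf sM (A_on _ _ _ AU).
 by apply: (g2_tor_conn pf (s := s) _ m wE Uy)=> z i j k Uz; exact: (g2_adapted s2 PsipE i j k AU Uz).
- move=> U p e y m AU Uy; have pf := onframe_pf sM (A_on _ _ _ AU).
 by apply: (g2_cm pf s2 _ m Uy)=> z i j k Uz; exact: (g2_adapted s2 PsipE i j k AU Uz).
- move=> U p e y J AU Uy; have pf := onframe_pf sM (A_on _ _ _ AU).
 rewrite (lee7E pf s2 _ J Uy)=> [|z i j k Uz|z i j k Uz].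
 + ring.
 + exact: (g2_adapted s2 PsipE i j k AU Uz).
 + by rewrite (proj2 AU)// omega_stdE.
Qed.

Lemma g2_arc_framed : framed_around ML (fun U p e=> g2_frame ML omega U p e /\ arc_length (eta1 form 0) U p).
exact: (g2_framed fL s2 PsipE fr6). Qed.

Lemma g2_product_structure : g2_structure ML omega.
split; first exact: (omega_is_form fL s2 PsipE).
move=> x Mx; have [U [p [e [y [[AU _] Uy yx]]]]] := g2_arc_framed Mx.
by exists U, p, e, y.
Qed.

(** Here theta = (12/7) d phi and the Lee form is -(24/7) s t, giving the same slope -2s. *)
Lemma spin7_torsion_structure : torsion_structure (r := 2) MLL (@emb2 N') (eta2 form) (spin7_frame MLL Phi)
 (@Phi_std R) Phi (@lee8 R) 16 (12 / 7) s 0.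
have sM : sphere_product (r := 2) MLL (@emb2 N') (eta2 form) := sphere_product2 fL.
have A_on U p e : spin7_frame MLL Phi U p e -> onframe (n := 6 + 2) MLL U p e by case.
have g2E := framed_g2_basis (proj2 g2_product_structure).
split=> //.
- by move=> U p e [].
- exact: spin7_no_prolongation.
- exact: has_spinor_spin7.
- move=> U p e w y m AU wE Uy; have pf := onframe_pf sM (A_on _ _ _ AU).
 by apply: (spin7_tor_conn pf (s := s) _ m wE Uy)=> z i j k l Uz; exact: (spin7_adapted fL s2 PsipE g2E i j k l AU Uz).
- move=> U p e y m AU Uy; have pf := onframe_pf sM (A_on _ _ _ AU).
 by apply: (spin7_cm pf s2 _ m Uy)=> z i j k l Uz; exact: (spin7_adapted fL s2 PsipE g2E i j k l AU Uz).
- move=> U p e y J AU Uy; have pf := onframe_pf sM (A_on _ _ _ AU).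
 rewrite (lee8E pf s2 _ J Uy)=> [|z i j k l Uz|z i j k l Uz].
 + by field.
 + exact: (spin7_adapted fL s2 PsipE g2E i j k l AU Uz).
 + by rewrite (proj2 AU)// Phi_stdE.
Qed.

Lemma spin7_arc_framed : framed_around MLL (fun U p e=> spin7_frame MLL Phi U p e /\ arc_length (eta2 form 0) U p).
exact: (spin7_framed fL s2 PsipE g2_arc_framed). Qed.

Lemma spin7_product_structure : spin7_structure MLL Phi.
split; first exact: (Phi_is_form fL s2 PsipE (framed_g2_basis (proj2 g2_product_structure))).
move=> x Mx; have [U [p [e [y [[AU _] Uy yx]]]]] := spin7_arc_framed Mx.
by exists U, p, e, y.
Qed.

End ProductStructures.

(** * Octonionic frames varying smoothly with a point of the sphere *)

Section GramSchmidt.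
Variable R : realType.

(** Squared length of the projection of the i-th coordinate vector to the complement of the
    orthonormal u_j; [gs] is that projection normalized. *)
Definition gs_norm m (u : 'I_m -> 'I_7 -> R) (i : 'I_7) : R := 1 - \sum_j u j i ^+ 2.

Definition gs m (u : 'I_m -> 'I_7 -> R) (i k : 'I_7) : R :=
 (Num.sqrt (gs_norm u i))^-1 * ((k == i)%:R - \sum_j u j i * u j k).

Section Orthonormal.
Variables (m : nat) (u : 'I_m -> 'I_7 -> R).
Hypothesis on : forall i j, lc (u i) (u j) = (i == j)%:R.

Lemma gs_orth i j : lc (u j) (gs u i) = 0.
rewrite /gs (lcZ _ (u j)) lcB lc_delta lc_sum (bigD1 j)//= big1=> [|l lj].
 by rewrite lcZ on eqxx mulr1 addr0 subrr mulr0.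
by rewrite lcZ on eq_sym (negbTE lj) mulr0.
Qed.

Lemma gs_unit i : 0 < gs_norm u i -> lc (gs u i) (gs u i) = 1.
move=> n0; rewrite {2}/gs (lcZ _ (gs u i)) lcB lc_delta lc_sum big1=> [|l _]; last first.
 by rewrite lcZ lc_sym gs_orth mulr0.
rewrite subr0 /gs eqxx (_ : true%:R = 1 :> R)// mulrA -expr2 exprVn sqr_sqrtr; last exact: ltW.
under eq_bigr=> j _ do rewrite -expr2.
by rewrite -/(gs_norm u i) mulVf ?gt_eqF.
Qed.

(* the norms add up to 7 - m > 0 *)
Lemma gs_axis : (m < 7)%N -> exists i, 0 < gs_norm u i.
move=> m7; apply: contrapT=> H.
have : \sum_i gs_norm u i <= 0.
 by apply: sumr_le0=> i _; rewrite leNgt; apply/negP=> n0; apply: H; exists i.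
rewrite /gs_norm sumrB exchange_big /= [X in _ - X](eq_bigr (fun=> 1))=> [|j _]; last first.
 by transitivity (lc (u j) (u j)); [eq_sum i; rewrite expr2|rewrite on eqxx].
by rewrite !sumr_const !card_ord subr_le0 ler_nat leqNgt m7.
Qed.

End Orthonormal.

Definition fst_dir (q : 'I_7 -> R) (i : 'I_7) : 'I_7 -> R := gs (fun _ : 'I_1=> q) i.
(** The cross product is included because the third generator of an octonionic basis must be
    orthogonal to it as well. *)
Definition two_dir (q : 'I_7 -> R) (i : 'I_7) : 'I_3 -> 'I_7 -> R :=
 tup3 q (fst_dir q i) (cr q (fst_dir q i)).
Definition snd_dir (q : 'I_7 -> R) (i j : 'I_7) : 'I_7 -> R := gs (two_dir q i) j.

Definition g2frame (i j : 'I_7) (q : 'I_7 -> R) : 'I_7 -> 'I_7 -> R :=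
 g2gen q (fst_dir q i) (snd_dir q i j).

Section Pointwise.
Variable q : 'I_7 -> R.
Hypothesis q1 : lc q q = 1.

Let on1 (i j : 'I_1) : lc ((fun _ : 'I_1=> q) i) ((fun _ : 'I_1=> q) j) = (i == j)%:R.
by rewrite !ord1 eqxx. Qed.

Lemma two_dir_on i : 0 < gs_norm (fun _ : 'I_1=> q) i ->
 forall a b, lc (two_dir q i a) (two_dir q i b) = (a == b)%:R.
move=> n0; have e1 : lc (fst_dir q i) (fst_dir q i) = 1 := gs_unit on1 n0.
have qe : lc q (fst_dir q i) = 0 := gs_orth on1 i 0.
have cc : lc (cr q (fst_dir q i)) (cr q (fst_dir q i)) = 1.
 by rewrite dot_cr q1 e1 qe mul0r subr0 mulr1.
have eq0 : lc (fst_dir q i) q = 0 by rewrite lc_sym.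
case=> [[|[|[|//]]] pa]; case=> [[|[|[|//]]] pb]; rewrite /two_dir /tup3 !(tnth_nth q) /=.
all: by rewrite ?q1 ?e1 ?qe ?cc ?eq0 ?lc_cr_l ?lc_cr_r ?lc_crl ?lc_crr.
Qed.

Lemma g2frameP i j : 0 < gs_norm (fun _ : 'I_1=> q) i -> 0 < gs_norm (two_dir q i) j -> g2b (g2frame i j q).
move=> n1 n3; have on3 := two_dir_on n1.
apply: g2genP=> //.
- exact: (gs_unit on1 n1).
- exact: (gs_unit on3 n3).
- exact: (gs_orth on1 i 0).
- exact: (gs_orth on3 j (od 0)).
- exact: (gs_orth on3 j (od 1)).
- by rewrite -om3_cr; exact: (gs_orth on3 j (od 2)).
Qed.

Lemma g2frame_axes : exists i j, 0 < gs_norm (fun _ : 'I_1=> q) i /\ 0 < gs_norm (two_dir q i) j.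
have [i n1] := gs_axis on1 isT; have [j n3] := gs_axis (two_dir_on n1) isT.
by exists i, j.
Qed.

End Pointwise.

Section Smoothness.
Variables (n : nat) (U : set 'rV[R]_n).
Hypothesis oU : open U.

Lemma smooth_gs_norm m (u : 'I_m -> 'I_7 -> 'rV[R]_n -> R) i :
 (forall j k, smooth_on U (u j k)) -> smooth_on U (fun y=> gs_norm (fun j k=> u j k y) i).
move=> su; apply: smoothD=> //; first exact: (smooth_cst (1 : R)).
by apply: smoothN=> //; apply: smooth_sum=> // j _; apply: smoothM.
Qed.

Lemma smooth_gs m (u : 'I_m -> 'I_7 -> 'rV[R]_n -> R) i k :
 (forall j k, smooth_on U (u j k)) -> (forall y, U y -> 0 < gs_norm (fun j k=> u j k y) i) ->
 smooth_on U (fun y=> gs (fun j k=> u j k y) i k).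
move=> su n0; apply: smoothM=> //; first by apply: smooth_isqrt=> //; exact: smooth_gs_norm.
apply: smoothD=> //; first exact: (smooth_cst ((k == i)%:R : R)).
by apply: smoothN=> //; apply: smooth_sum=> // j _; apply: smoothM.
Qed.

Lemma smooth_cr (u v : 'I_7 -> 'rV[R]_n -> R) k : (forall i, smooth_on U (u i)) -> (forall i, smooth_on U (v i)) ->
 smooth_on U (fun y=> cr (u^~ y) (v^~ y) k).
move=> su sv; rewrite /cr /lc2; apply: smooth_sum=> // i _; apply: smoothM=> //.
by apply: smooth_sum=> // j _; apply: smoothM=> //; exact: (smooth_cst (omr R i j k : R)).
Qed.

Variables (q : 'I_7 -> 'rV[R]_n -> R) (i j : 'I_7).
Hypothesis sq : forall k, smooth_on U (q k).
Hypothesis n1 : forall y, U y -> 0 < gs_norm (fun _ : 'I_1=> q^~ y) i.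

Lemma smooth_fst_dir k : smooth_on U (fun y=> fst_dir (q^~ y) i k).
exact: (smooth_gs (u := fun _=> q)). Qed.

Lemma smooth_two_dir a k : smooth_on U (fun y=> two_dir (q^~ y) i a k).
case: a=> [[|[|[|//]]] pa].
- exact: sq.
- exact: smooth_fst_dir.
- by apply: (smooth_cr (u := q) (v := fun k y=> fst_dir (q^~ y) i k))=> // l; exact: smooth_fst_dir.
Qed.
Lemma smooth_two_norm : smooth_on U (fun y=> gs_norm (two_dir (q^~ y) i) j).
by apply: (smooth_gs_norm (u := fun a k y=> two_dir (q^~ y) i a k))=> a k; exact: smooth_two_dir. Qed.

Hypothesis n3 : forall y, U y -> 0 < gs_norm (two_dir (q^~ y) i) j.

Lemma smooth_g2frame a k : smooth_on U (fun y=> g2frame i j (q^~ y) a k).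
have s1 l := smooth_fst_dir l.
have s3 l : smooth_on U (fun y=> snd_dir (q^~ y) i j l).
 by apply: (smooth_gs (u := fun a k y=> two_dir (q^~ y) i a k))=> // a' k'; exact: smooth_two_dir.
have sc (u v : 'I_7 -> 'rV[R]_n -> R) := @smooth_cr u v.
have s13 l := sc _ _ l s1 s3.
case: a=> [[|[|[|[|[|[|[|//]]]]]]] pa].
- exact: s1.
- exact: (sc _ _ k sq s1).
- exact: s3.
- exact: (sc _ _ k sq s3).
- exact: s13.
- exact: (sc _ _ k sq s13).
- exact: sq.
Qed.

End Smoothness.

Lemma open_positive n (U : set 'rV[R]_n) (f : 'rV[R]_n -> R) :
 open U -> smooth_on U f -> open (U `&` [set y | 0 < f y]).
move=> oU sf; rewrite openE=> y [Uy fy]; apply: filterI; first exact: open_nbhs_nbhs.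
have cf := differentiable_continuous (smooth_diff sf Uy).
exact: (cf _ (open_nbhs_nbhs (conj (@open_gt R 0) fy))).
Qed.

End GramSchmidt.

Lemma g2b_split R (f : Bil 7 R) (z : 'I_7 -> R) k : (forall i j, lc (f i) (f j) = (i == j)%:R) ->
 z k = \sum_(j < 6) lc (f (w67 j)) z * f (w67 j) k + lc (f (od 6)) z * f (od 6) k.
move=> on; rewrite [LHS](orthonormal_decomp on) {1}/lc big_ord_recr /= (_ : ord_max = od 6); last exact: val_inj.
congr (_ + _); eq_sum i.
by rewrite (_ : widen_ord _ i = w67 i)//; exact: val_inj.
Qed.

(* Central projection from the tangent plane at f_7: q = v / |v| with v = f_7 + sum_k y_k f_k.
  Along w_k = |v| (<E, f_k> - <E, f_7> y_k) the derivative of q is E, for E orthogonal to q. *)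
Section CentralProjection.
Variables (R : realType) (f : Bil 7 R).
Hypothesis on : forall i j, lc (f i) (f j) = (i == j)%:R.

Definition plane (k : 'I_7) (y : 'rV[R]_6) : R := f (od 6) k + \sum_(j < 6) y 0 j * f (w67 j) k.
Definition plane_norm (y : 'rV[R]_6) : R := 1 + \sum_(j < 6) y 0 j ^+ 2.
Definition inv_norm (y : 'rV[R]_6) : R := (Num.sqrt (plane_norm y))^-1.
Definition cproj (k : 'I_7) (y : 'rV[R]_6) : R := plane k y * inv_norm y.
(** The length |v| is written as |v|^2 / |v|, so that the only root whose smoothness is needed is
    the inverse square root. *)
Definition lift_vec (E : 'I_7 -> R) (y : 'rV[R]_6) : 'rV[R]_6 :=
 \row_j (plane_norm y * inv_norm y * (lc (f (w67 j)) E - lc (f (od 6)) E * y 0 j)).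

Let sT : open [set: 'rV[R]_6] := openT.

Lemma smooth_plane k : smooth_on [set: 'rV[R]_6] (plane k).
apply: smoothD=> //; first exact: (smooth_cst (f (od 6) k : R)).
apply: smooth_sum=> // j _; apply: smoothM=> //; first exact: smooth_coord.
exact: (smooth_cst (f (w67 j) k : R)).
Qed.

Lemma smooth_plane_norm : smooth_on [set: 'rV[R]_6] plane_norm.
apply: smoothD=> //; first exact: (smooth_cst (1 : R)).
by apply: smooth_sum=> // j _; apply: smoothM=> //; exact: smooth_coord.
Qed.
Lemma plane_norm_gt0 y : 0 < plane_norm y.
by rewrite ltr_wpDr// sumr_ge0// => j _; rewrite sqr_ge0. Qed.
Lemma smooth_inv_norm : smooth_on [set: 'rV[R]_6] inv_norm.
by apply: smooth_isqrt=> //; [exact: smooth_plane_norm|move=> y _; exact: plane_norm_gt0]. Qed.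
Lemma smooth_proj k : smooth_on [set: 'rV[R]_6] (cproj k).
by apply: smoothM=> //; [exact: smooth_plane|exact: smooth_inv_norm]. Qed.

Lemma inv_norm2 y : plane_norm y * inv_norm y * inv_norm y = 1.
by rewrite -mulrA -expr2 exprVn sqr_sqrtr ?mulfV ?gt_eqF ?plane_norm_gt0//; exact/ltW/plane_norm_gt0.
Qed.

Lemma lc_plane y : lc (plane^~ y) (plane^~ y) = plane_norm y.
have fp (i : 'I_7) : lc (f i) (plane^~ y) = (od 6 == i)%:R + \sum_(j < 6) y 0 j * (w67 j == i)%:R.
 rewrite /plane lcD lc_sum on eq_sym; congr (_ + _); eq_sum j.
 by rewrite lcZ on eq_sym.
have w6 (j : 'I_6) : (w67 j == od 6) = false.
 by apply/negbTE/eqP=> /(congr1 val) /= H; have := ltn_ord j; rewrite H.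
rewrite [in LHS]/plane lcDl lc_suml fp eqxx big1=> [|j _]; last by rewrite w6 mulr0.
rewrite addr0; congr (_ + _); eq_sum j.
rewrite lcZl fp eq_sym w6 add0r (bigD1 j)//= eqxx mulr1 big1=> [|i ij]; last first.
 by have -> : (w67 i == w67 j) = false; [apply/negbTE; apply: contra ij=> /eqP /(congr1 val) H; exact/eqP/val_inj|rewrite mulr0].
by rewrite addr0 expr2.
Qed.
Lemma proj_unit y : lc (cproj^~ y) (cproj^~ y) = 1.
by rewrite /cproj lcZr lc_sym lcZr lc_plane inv_norm2. Qed.

Lemma proj0 k : cproj k 0 = f (od 6) k.
rewrite /cproj /inv_norm /plane /plane_norm !big1 ?addr0 ?sqrtr1 ?invr1 ?mulr1// => j _; rewrite mxE ?mul0r//.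
by rewrite expr0n.
Qed.

Lemma pd_proj_algebra (v N h dv dh E b : R) : dv = N * h * (E - b * v) -> N * h * h = 1 ->
 dv * h + v * dh = E + (dh - b) * N * h * (v * h).
move=> -> H.
rewrite (_ : N * h * (E - b * v) * h = N * h * h * (E - b * v)); last by ring.
rewrite (_ : (dh - b) * N * h * (v * h) = (N * h * h) * ((dh - b) * v)); last by ring.
by rewrite H; ring.
Qed.

Lemma pd_proj n0 (e : 'I_n0 -> 'rV[R]_6 -> 'rV[R]_6) i y (E : 'I_7 -> R) k :
 e i y = lift_vec E y -> lc (cproj^~ y) E = 0 -> 'D_(e i y) (cproj k) y = E k.
move=> eE qE; pose e' : frame R 6 := fun _=> e i.
have dp l : differentiable (cproj l) y by exact: smooth_diff (smooth_proj l) I.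
have dpl l : differentiable (plane l) y by exact: smooth_diff (smooth_plane l) I.
have dh : differentiable inv_norm y by exact: smooth_diff smooth_inv_norm I.
pose b := lc (f (od 6)) E; pose dinv := pd e' 0 inv_norm y.
have dplane l : pd e' 0 (plane l) y = plane_norm y * inv_norm y * (E l - b * plane l y).
 have dc j : differentiable (fun z : 'rV[R]_6=> z 0 j) y by exact: differentiable_coord.
 rewrite /plane pdD; [|exact: differentiable_cst|]; last first.
  apply: (smooth_diff (U := [set: 'rV[R]_6]))=> //; apply: smooth_sum=> // j _.
  by apply: smoothM=> //; [exact: smooth_coord|exact: (smooth_cst (f (w67 j) l : R))].
 rewrite pd_cst add0r pd_sum=> [|j]; last exact: differentiableM.
 transitivity (\sum_(j < 6) (e i y) 0 j * f (w67 j) l).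
  eq_sum j; rewrite pdM; [|exact: dc|exact: differentiable_cst].
  by rewrite pd_cst mulr0 addr0 /pd derive_coord.
 rewrite (g2b_split E l on) eE.
 rewrite (_ : _ - b * _ = \sum_(j < 6) (lc (f (w67 j)) E - b * y 0 j) * f (w67 j) l); last first.
  rewrite mulrDr mulr_sumr -/b opprD addrA addrK -sumrB.
  by eq_sum j; rewrite mulrBl mulrA.
 by mul_sum j; rewrite mxE mulrA.
pose g := (dinv - b) * plane_norm y * inv_norm y.
have dproj l : pd e' 0 (cproj l) y = E l + g * cproj l y.
 rewrite /cproj pdM//; exact: pd_proj_algebra (dplane l) (inv_norm2 y).
(* The derivative of q is E up to a multiple of q; as q has constant length and E is orthogonal to
   q, the multiple is zero. *)
have g0 : g = 0.
 have : pd e' 0 (fun z=> lc (cproj^~ z) (cproj^~ z)) y = 0.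
  by rewrite (pd_eqon e' sT 0 (fun z _=> proj_unit z) I) pd_cst.
 rewrite pd_lc// (lc_sym (fun l=> pd e' 0 (cproj l) y)) (eq_lc _ dproj) lcD qE add0r lcZ proj_unit mulr1.
 lra.
by have := dproj k; rewrite g0 mul0r addr0.
Qed.

End CentralProjection.

(** * The standard nearly Kahler structure exists *)

Section NearlyKahlerSphere.
Variable R : realType.
Notation S6 := (@sphere R 6).

Definition std_Psip : dform R 7 3 :=
 fun _ v=> - om3 (co (v (od 0))) (co (v (od 1))) (co (v (od 2))).
Definition std_Psim : dform R 7 3 := torsion_form id.

Lemma smooth_sub n (W : normedModType R) (U V : set 'rV[R]_n) (h : 'rV[R]_n -> W) :
 U `<=` V -> smooth_on V h -> smooth_on U h.
by move=> UV sh vs y Uy; apply: sh; exact: UV. Qed.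

Lemma su3_frame_g2b U p (e : frame R 6) (B : 'rV[R]_6 -> 'I_7 -> 'I_7 -> R) :
 open U -> smooth_on U p -> (forall a, smooth_on U (e a)) -> (forall y, U y -> g2b (B y)) ->
 (forall y, U y -> co (p y) = B y (od 6)) -> (forall a y, U y -> co (push p e a y) = B y (w67 a)) ->
 su3_frame S6 (@F_S6 R) std_Psip std_Psim U p e.
move=> oU sp se gB cp pushE.
have dotE u v : dotv u v = lc (co u) (co v) by [].
split; first split=> //.
- by move=> y Uy; rewrite /sphere /= dotE cp// (proj1 (gB y Uy)) eqxx.
- move=> y a b Uy; rewrite dotE (pushE a y Uy) (pushE b y Uy) (proj1 (gB y Uy)).
 by have -> : (w67 a == w67 b) = (a == b) by [].
move=> y Uy; have [_ gp] := gB y Uy; split=> J.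
- by rewrite (tup2_eta J) F_stdE /comps F_S6E cp// !pushE// gp.
- rewrite (tup3_eta J) Psip_stdE; move: (J (od 0)) (J (od 1)) (J (od 2))=> a b c {J}.
 rewrite -[LHS]/(- om3 (co (push p e a y)) (co (push p e b y)) (co (push p e c y))).
 by rewrite (pushE a y Uy) (pushE b y Uy) (pushE c y Uy) gp.
- rewrite (tup3_eta J) Psim_stdE; move: (J (od 0)) (J (od 1)) (J (od 2))=> a b c {J}.
 rewrite -[LHS]/(ps4 (co (p y)) (co (push p e a y)) (co (push p e b y)) (co (push p e c y))).
 by rewrite cp// (pushE a y Uy) (pushE b y Uy) (pushE c y Uy) (g2b_ps _ _ _ _ (gB y Uy)).
Qed.

(** A moving octonionic basis by Gram-Schmidt is lifted through central projection, giving a frame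
    whose push-forward is that basis without its seventh vector q. *)
Lemma S6_framed : framed_around S6 (su3_frame S6 (@F_S6 R) std_Psip std_Psim).
move=> x Sx; have q1 : lc (co x) (co x) = 1 := Sx.
have [i [j [n1 n3]]] := g2frame_axes q1.
pose f := g2frame i j (co x); have [on _] := g2frameP q1 n1 n3.
have f6 : f (od 6) = co x by [].
pose q (k : 'I_7) (y : 'rV[R]_6) : R := cproj f k y.
(* The axes i and j work at x; positivity of the two Gram-Schmidt norms is open, so the same axes
   work nearby. The second norm is smooth only where the first is positive, hence the two steps. *)
pose U1 := [set: 'rV[R]_6] `&` [set y : 'rV[R]_6 | 0 < gs_norm (fun _ : 'I_1=> q^~ y) i].
have oT : open [set: 'rV[R]_6] by exact: openT.
have oU1 : open U1.
 by apply: (open_positive oT); apply: (smooth_gs_norm oT (u := fun _ : 'I_1=> q))=> // _ k; exact: smooth_proj.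
have sq1 k : smooth_on U1 (q k) by apply: smooth_sub (smooth_proj f k).
have n1y y : U1 y -> 0 < gs_norm (fun _ : 'I_1=> q^~ y) i by case.
pose U := U1 `&` [set y : 'rV[R]_6 | 0 < gs_norm (two_dir (q^~ y) i) j].
have oU : open U by apply: open_positive=> //; exact: smooth_two_norm.
have UU1 : U `<=` U1 by move=> y [].
have sqU k : smooth_on U (q k) := smooth_sub UU1 (sq1 k).
pose B y := g2frame i j (q^~ y).
have gB y : U y -> g2b (B y) by move=> [[_ a1] a3]; exact: (g2frameP (proj_unit on y) a1 a3).
have B6 y : B y (od 6) = q^~ y by [].
have sB a k : smooth_on U (fun y=> B y a k).
 by apply: smooth_g2frame=> // y [[]].
pose p y : 'rV[R]_7 := \row_k q k y.
pose e a y : 'rV[R]_6 := lift_vec f (B y (w67 a)) y.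
have pk k y : p y 0 k = q k y by rewrite mxE.
have sp : smooth_on U p by apply: smooth_mx=> // k; apply: smooth_eqon (sqU k)=> // y _; rewrite pk.
have cp y : co (p y) = B y (od 6) by ext k; rewrite /co pk.
have pushE a y : U y -> co (push p e a y) = B y (w67 a).
 move=> Uy; ext k; rewrite /co /push derive_mxE; last exact: smooth_diff sp Uy.
 rewrite (_ : (fun z=> p z 0 k) = q k); last by ext z; rewrite pk.
 apply: (pd_proj on (E := B y (w67 a)))=> //.
 rewrite -[cproj f ^~ y](B6 y) (proj1 (gB y Uy)).
 by rewrite (_ : (od 6 == w67 a) = false)//; apply/negbTE/eqP=> /(congr1 val) /= H; have := ltn_ord a; rewrite -H.
exists U, p, e, 0; split; last first.
- by apply/rowP=> k; rewrite pk /q proj0 f6.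
- have q0 : q^~ 0 = co x by ext k; rewrite /q proj0 f6.
 have a1 : 0 < gs_norm (fun _ : 'I_1=> q^~ 0) i by rewrite q0.
 have a3 : 0 < gs_norm (two_dir (q^~ 0) i) j by rewrite q0.
 exact: (conj (conj I a1) a3).
apply: (su3_frame_g2b (B := B))=> //.
move=> a; apply: smooth_mx=> // l.
apply: (smooth_eqon oU (f := fun y=> plane_norm y * inv_norm y *
 (lc (f (w67 l)) (B y (w67 a)) - lc (f (od 6)) (B y (w67 a)) * y 0 l)))=> [y _|]; first by rewrite mxE.
have sl (c : 'I_7 -> R) : smooth_on U (fun y=> lc c (B y (w67 a))).
 by apply: (smooth_lc oU (c := fun k _=> c k) (x := fun k y=> B y (w67 a) k))=> // k; exact: (smooth_cst (c k : R)).
apply: smoothM=> //.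
 by apply: smoothM=> //; [apply: smooth_sub (@smooth_plane_norm R)|apply: smooth_sub (@smooth_inv_norm R)].
by apply: smoothD=> //; apply: smoothN=> //; apply: smoothM=> //; exact: smooth_coord.
Qed.

Lemma co_cross (x v : 'rV[R]_7) : co (cross x v) = cr (co x) (co v).
ext k; rewrite /co mxE /cr /lc2 /lc; eq_sum i; mul_sum j.
by rewrite -[idx3 i j k]/(tup3 i j k) omega_stdE /co /omr; ring.
Qed.
Lemma co_inj : injective (@co R 7).
by move=> u v uv; apply/rowP=> k; exact: (congr1 (fun h=> h k) uv). Qed.

Lemma cross_almost_hermitian : almost_hermitian S6 (@cross R).
move=> x u v Sx tu tv.
have q1 : lc (co x) (co x) = 1 := Sx.
have xu : lc (co x) (co u) = 0 := tangent_dot0 tu.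
have xv : lc (co x) (co v) = 0 := tangent_dot0 tv.
have dotE (a b : 'rV[R]_7) : dotv a b = lc (co a) (co b) by [].
split.
- by apply: dot0_tangent=> //; rewrite dotE co_cross lc_crl.
- move=> c; apply: co_inj; ext k.
 have -> : co (c *: cross x u + cross x v) k = c * co (cross x u) k + co (cross x v) k by rewrite /co !mxE.
 rewrite !co_cross /cr /lc2 -lcZ -lcD; apply: eq_lc=> i; rewrite -lcZl -lcDl.
 by apply: eq_lcl=> l; rewrite /co !mxE.
- apply: co_inj; rewrite !co_cross cr_double//.
 by ext k; rewrite /co !mxE.
- by rewrite !dotE !co_cross dot_cr q1 xv mul0r subr0 mul1r.
Qed.

Let eta0 (i : 'I_0) (x v : 'rV[R]_7) : R := 0.
Let sM : sphere_product S6 id eta0 := S6_product eta0.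

Lemma F_S6_is_form : is_form 6 S6 (kahler_form (@cross R)).
rewrite -/(@F_S6 R); split.
- move=> x v s c u u' _ _ _ _; rewrite !F_S6E.
 have lin a b : co (c *: a + b) = fun k=> c * co a k + co b k by ext k; rewrite /co !mxE.
 by case: s=> [[|[|//]]] ?; rewrite /upd /= lin ?om3_lin2 ?om3_lin3; ring.
- move=> x v s t _ _ st vst; rewrite F_S6E (_ : v 0 = v 1) ?om3_alt23 ?oppr0//.
 by move: s t st vst; do 2 case=> [[|[|//]]] ?; rewrite ?eqxx// => _ H;
   [|symmetry]; move: H; congr (v _ = v _); exact: val_inj.
- move=> U p e ofr I; have [oU sp _ _ _] := ofr.
 apply: (smooth_eqon oU (f := fun y=> - om3 (co (p y)) (co (push p e (I 0) y)) (co (push p e (I 1) y))))=> [y _|].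
  by rewrite /comps F_S6E.
 apply: smoothN=> //.
 apply: (smooth_om3 oU (u := fun k y=> p y 0 k) (v := fun k y=> push p e (I 0) y 0 k)
  (w := fun k y=> push p e (I 1) y 0 k))=> k.
 + exact: smooth_comp_coord.
 + exact: smooth_push_coord ofr.
 + exact: smooth_push_coord ofr.
Qed.

Lemma std_Psip_is_form : is_form 6 S6 std_Psip.
apply: (is_form_ext sM (G := std_Psip))=> //.
- move=> x _ v s c u u' tv tu tu'; rewrite /std_Psip.
 have lin a b : co (c *: a + b) = fun k=> c * co a k + co b k by ext k; rewrite /co !mxE.
 by case: s=> [[|[|[|//]]]] ?; rewrite /upd /= lin ?om3_lin1 ?om3_lin2 ?om3_lin3; ring.
- move=> x v s t _ st vst.
 pose G (a b c : 'rV[R]_7) := - om3 (co a) (co b) (co c).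
 by apply: (@antisym3_alt R _ G _ _ v s t st vst)=> a b c; rewrite /G; [rewrite om3_12|rewrite om3_23].
- move=> U p e ofr I; have [oU sp _ _ _] := ofr.
 apply: smoothN=> //.
 by apply: (smooth_om3 oU (u := fun k y=> push p e (I (od 0)) y 0 k) (v := fun k y=> push p e (I (od 1)) y 0 k)
  (w := fun k y=> push p e (I (od 2)) y 0 k))=> k; exact: smooth_push_coord ofr.
Qed.

Lemma nearly_kahler_exists : nearly_kahler_S6 std_Psip std_Psim.
split; first split.
- exact: cross_almost_hermitian.
- exact: F_S6_is_form.
- exact: std_Psip_is_form.
- exact: (torsion_is_form 6 sM).
- exact: S6_framed.
(* dF is -3 omega and the chosen Psi^+ is -omega, so this is the choice s = 1. *)
exists 3^-1=> U p e y ofr Uy J.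
rewrite (tup3_eta J) (ext_d_F ofr _ _ _ Uy).
move: (J (od 0)) (J (od 1)) (J (od 2))=> a b d {J}.
rewrite -[LHS]/(- om3 (co (push p e a y)) (co (push p e b y)) (co (push p e d y))).
by rewrite (co_push ofr a Uy) (co_push ofr b Uy) (co_push ofr d Uy) mulrA mulrN mulVf// mulN1r.
Qed.

End NearlyKahlerSphere.

(** * Compactness of the products with circles *)

Section CompactProducts.
Variable R : realType.

Lemma smooth_continuous n (W : normedModType R) (h : 'rV[R]_n -> W) : smooth_on [set: 'rV[R]_n] h -> continuous h.
by move=> sh x; apply: differentiable_continuous; exact: (smooth_diff sh I). Qed.

Let oT n : open [set: 'rV[R]_n]. Proof. exact: openT. Qed.

Lemma closed_sphere n : closed (@sphere R n).
apply: (@preimage_closed _ _ (fun x : 'rV[R]_n.+1=> dotv x x) [set (1 : R)]); last exact: closed_eq.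
move=> x _; apply: smooth_continuous; apply: smooth_sum=> [|k _]; first exact: openT.
by apply: smoothM=> //; exact: smooth_coord.
Qed.

Lemma closed_prodM N N' (M : set 'rV[R]_N) (L : set 'rV[R]_N') : closed M -> closed L -> closed (prodM M L).
move=> cM cL; apply: (@closedI _ (lsubmx @^-1` M) (rsubmx @^-1` L)).
- apply: preimage_closed cM=> x _; apply: smooth_continuous; apply: smooth_mx=> [|k]; first exact: openT.
 rewrite [X in smooth_on _ X](_ : _ = fun y : 'rV[R]_(N + N')=> y 0 (lshift N' k)); first exact: smooth_coord.
 by ext y; rewrite mxE.
- apply: preimage_closed cL=> x _; apply: smooth_continuous; apply: smooth_mx=> [|k]; first exact: openT.
 rewrite [X in smooth_on _ X](_ : _ = fun y : 'rV[R]_(N + N')=> y 0 (rshift N k)); first exact: smooth_coord.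
 by ext y; rewrite mxE.
Qed.

(** Boundedness in the form that passes to products coordinate by coordinate. *)
Definition unit_coords N (M : set 'rV[R]_N) : Prop := forall x i, M x -> `|x 0 i| <= 1.

Lemma unit_coords_sphere n : unit_coords (@sphere R n).
move=> x i Sx; rewrite -(@ler_pXn2r _ 2)// ?nnegrE// expr1n real_normK ?num_real//.
by rewrite -[leRHS]Sx expr2 /dotv (bigD1 i)//= lerDl sumr_ge0// => j _; rewrite -expr2 sqr_ge0.
Qed.

Lemma unit_coords_prodM N N' (M : set 'rV[R]_N) (L : set 'rV[R]_N') :
 unit_coords M -> unit_coords L -> unit_coords (prodM M L).
move=> bM bL x i [Mx Lx]; rewrite -[i]splitK; case: (fintype.split i)=> j /=.
- by have := bM _ j Mx; rewrite mxE.
- by have := bL _ j Lx; rewrite mxE.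
Qed.

Lemma compact_unit_coords N (M : set 'rV[R]_N) : unit_coords M -> closed M -> compact M.
move=> bM; apply: bounded_closed_compact; exists 1; split=> [|r r1 x /= Mx]; first exact: num_real.
rewrite (le_trans _ (ltW r1))// [leLHS]mx_normrE; apply: bigmax_le=> // -[i j] _ /=.
by rewrite ord1; exact: bM.
Qed.

Lemma compact_sphere_circle : compact (prodM (@sphere R 6) (@circle R)).
apply: compact_unit_coords; first by apply: unit_coords_prodM; exact: unit_coords_sphere.
by apply: closed_prodM; exact: closed_sphere.
Qed.

Lemma compact_sphere_circle2 : compact (prodM (prodM (@sphere R 6) (@circle R)) (@circle R)).
apply: compact_unit_coords.
 by apply: unit_coords_prodM; [apply: unit_coords_prodM|]; exact: unit_coords_sphere.
by apply: closed_prodM; [apply: closed_prodM|]; exact: closed_sphere.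
Qed.

End CompactProducts.

(** * Global dilatons on the products with lines *)

Lemma coord_dilaton R N n U (p : 'rV[R]_n -> 'rV[R]_N) (e : frame R n) (c : R) k y m :
 open U -> smooth_on U p -> U y -> pd e m ((fun x=> c * x 0 k) \o p) y = c * push p e m y 0 k.
move=> oU sp Uy; rewrite (push_coord _ _ _ sp Uy) [LHS]pdZ//.
exact: smooth_diff (smooth_comp_coord oU k sp) Uy.
Qed.

Lemma smooth_fun_coord R N n (M : set 'rV[R]_N) (c : R) k : smooth_fun n M (fun x=> c * x 0 k).
move=> U p e [oU sp _ _ _]; apply: smoothM=> //; first exact: (smooth_cst c).
exact: smooth_comp_coord.
Qed.

Lemma sphere_point R n : exists x : 'rV[R]_n.+1, sphere x.
exists (delta_mx 0 0); rewrite /sphere /= /dotv (bigD1 0)//= big1=> [|i /negbTE i0].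
 by rewrite !mxE !eqxx mulr1 addr0.
by rewrite !mxE eqxx i0 mul0r.
Qed.

Lemma prodM_point R N N' (M : set 'rV[R]_N) (L : set 'rV[R]_N') :
 (exists x, M x) -> (exists x, L x) -> exists x, prodM M L x.
by move=> [x Mx] [z Lz]; exists (row_mx x z); split; rewrite ?row_mxKl ?row_mxKr. Qed.

Lemma line_nonconstant R N (M : set 'rV[R]_N) (c : R) : c != 0 -> (exists x, M x) ->
 nonconstant (prodM M (@line R)) (fun x=> c * x 0 (rshift N 0)).
move=> c0 [x Mx]; exists (row_mx x 0), (row_mx x 1); split; try by split; rewrite ?row_mxKl.
by rewrite !row_mxEr !mxE mulr0 eqxx mulr1 eq_sym.
Qed.

Lemma line_nonconstant2 R N (M : set 'rV[R]_N) (c : R) : c != 0 -> (exists x, M x) ->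
 nonconstant (prodM (prodM M (@line R)) (@line R)) (fun x=> c * x 0 (lshift 1 (rshift N 0))).
move=> c0 Mx; have [x [x' [Lx Lx' xx']]] := line_nonconstant c0 Mx.
exists (row_mx x 0), (row_mx x' 0); split; try by split; rewrite ?row_mxKl.
by rewrite !row_mxEl.
Qed.

Theorem theorem6p2 (R : realType) :
  (exists Psip Psim : dform R 7 3, nearly_kahler_S6 Psip Psim) /\
  forall Psip Psim : dform R 7 3, nearly_kahler_S6 Psip Psim ->
  let S6 := @sphere R 6 in
  let A6 := su3_frame S6 (@F_S6 R) Psip Psim in
  (* S^6 x R, S^6 x S^1 *)
  let ML := prodM S6 (@line R) in
  let omegaL := g2_product (@F_S6 R) Psip (@line_form R) in
  let MC := prodM S6 (@circle R) in
  let omegaC := g2_product (@F_S6 R) Psip (@circle_form R) in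
  (* S^6 x R x R, S^6 x S^1 x S^1 *)
  let MLL := prodM ML (@line R) in
  let PhiLL := spin7_product ML omegaL (@line_form R) in
  let MCC := prodM MC (@circle R) in
  let PhiCC := spin7_product MC omegaC (@circle_form R) in
  [/\ (exists T : dform R 7 3, su3_torsion S6 (@cross R) Psip Psim T) /\
      (forall T : dform R 7 3, su3_torsion S6 (@cross R) Psip Psim T ->
        [/\ solves_gravitino 8 A6 (@in_su3 R) T,
            solves_gaugino 8 A6 (@in_su3 R) T,
            exists2 al : R, al < 0 & bianchi1 A6 T al &
            exists2 al : R, al < 0 & bianchi2 A6 T al]),

      [/\ g2_structure ML omegaL,
          exists T, g2_torsion ML omegaL T &
          forall T, g2_torsion ML omegaL T ->
            nonzero_form ML T /\
            exists phi : 'rV[R]_(7 + 1) -> R,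
              [/\ smooth_fun 7 ML phi /\ nonconstant ML phi,
                  is_dilaton (g2_frame ML omegaL) (@lee7 R) omegaL 2 phi,
                  solves_susy 8 (g2_frame ML omegaL) (@in_g2 R) T phi,
                  exists al : R,
                    [/\ al < 0, bianchi1 (g2_frame ML omegaL) T al &
                        solves_eom (g2_frame ML omegaL) T phi al] &
                  exists2 al : R, al < 0 &
                    bianchi2 (g2_frame ML omegaL) T al]],

      [/\ compact MC, g2_structure MC omegaC,
          exists T, g2_torsion MC omegaC T &
          forall T, g2_torsion MC omegaC T ->
            [/\ solves_susy_locally 8 MC (g2_frame MC omegaC) (@in_g2 R)
                  (@lee7 R) omegaC 2 T,
                exists2 al : R, al < 0 & bianchi1 (g2_frame MC omegaC) T al &
                exists2 al : R, al < 0 &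
                  bianchi2 (g2_frame MC omegaC) T al]],

      [/\ spin7_structure MLL PhiLL,
          exists T, spin7_torsion MLL PhiLL T &
          forall T, spin7_torsion MLL PhiLL T ->
            nonzero_form MLL T /\
            exists phi : 'rV[R]_(7 + 1 + 1) -> R,
              [/\ smooth_fun 8 MLL phi /\ nonconstant MLL phi,
                  is_dilaton (spin7_frame MLL PhiLL) (@lee8 R) PhiLL
                    (12 / 7) phi,
                  solves_susy 16 (spin7_frame MLL PhiLL) (@in_spin7 R) T phi,
                  exists al : R,
                    [/\ al < 0, bianchi1 (spin7_frame MLL PhiLL) T al &
                        solves_eom (spin7_frame MLL PhiLL) T phi al] &
                  exists2 al : R, al < 0 &
                    bianchi2 (spin7_frame MLL PhiLL) T al]] &

      [/\ compact MCC, spin7_structure MCC PhiCC,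
          exists T, spin7_torsion MCC PhiCC T &
          forall T, spin7_torsion MCC PhiCC T ->
            [/\ solves_susy_locally 16 MCC (spin7_frame MCC PhiCC)
                  (@in_spin7 R) (@lee8 R) PhiCC (12 / 7) T,
                exists2 al : R, al < 0 &
                  bianchi1 (spin7_frame MCC PhiCC) T al &
                exists2 al : R, al < 0 &
                  bianchi2 (spin7_frame MCC PhiCC) T al]]].
Proof.
have S0 : exists x, @sphere R 6 x := sphere_point R 6.
have L0 : exists x, @line R x by exists 0.
split; first by exists (@std_Psip R), (@std_Psim R); exact: nearly_kahler_exists.
move=> Psip Psim nk; have [s s2 PsipE] := nearly_kahler_Psip nk.
have [[_ _ _ _ fr6] _] := nk.
(* The slope of the dilaton is nonzero because s^2 = 1; this makes the dilaton non-constant. *)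
have c0 : - 2 * s != 0.
  by rewrite mulf_neq0 ?oppr_eq0 ?pnatr_eq0// -sqrf_eq0 s2 oner_eq0.
have lF := line_factor R; have cF := circle_factor R.
have n3 : - 3^-1 < 0 :> R by lra.
have n12 : - 12^-1 < 0 :> R by lra.
move=> S6 A6 ML omegaL MC omegaC MLL PhiLL MCC PhiCC; split.
- have f6 := torsion_is_form 6 (S6_product (fun (i : 'I_0) (x v : 'rV[R]_7) => 0)).
  exact: (@su3_part R Psip Psim s s2 PsipE f6).
- have ts := g2_torsion_structure lF s2 PsipE; have g2s := g2_product_structure lF s2 PsipE fr6.
  split=> [//||T gT]; first exact: (torsion_exists ts).
  split; first by apply: (structure_nonzero ts gT (proj2 g2s)); exact: prodM_point S0 L0.
  (* The coordinate of the line factor times the slope that the Lee form dictates. *)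
  exists (fun x => - 2 * s * x 0 (rshift 7 0)).
  have sphi := @smooth_fun_coord R (7 + 1) 7 ML (- 2 * s) (rshift 7 0).
  have [|dil susy eom] := structure_global ts gT sphi.
    move=> U p e y m [[oU sp _ _ _] _] Uy.
    by rewrite (coord_dilaton e _ _ m oU sp Uy) eta1E /line_form mxE.
  split=> //; first by split=> //; exact: line_nonconstant.
  + by exists (- 3^-1); split=> //; exact: (structure_bianchi1 ts gT).
  + by exists (- 12^-1) => //; exact: (structure_bianchi2 ts gT).
- have ts := g2_torsion_structure cF s2 PsipE.
  split=> [|||T gT]; [exact: compact_sphere_circle|exact: (g2_product_structure cF s2 PsipE fr6)
    |exact: (torsion_exists ts)|].
  split; first exact: (structure_local ts gT (g2_arc_framed cF s2 PsipE fr6)).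
  + by exists (- 3^-1) => //; exact: (structure_bianchi1 ts gT).
  + by exists (- 12^-1) => //; exact: (structure_bianchi2 ts gT).
- have ts := spin7_torsion_structure lF s2 PsipE fr6; have sp7 := spin7_product_structure lF s2 PsipE fr6.
  split=> [//||T gT]; first exact: (torsion_exists ts).
  split; first by apply: (structure_nonzero ts gT (proj2 sp7)); exact: prodM_point (prodM_point S0 L0) L0.
  (* The coordinate of the first line, the e_7 direction; the dilaton is constant along the second
     line e_0. *)
  exists (fun x => - 2 * s * x 0 (lshift 1 (rshift 7 0))).
  have sphi := @smooth_fun_coord R (7 + 1 + 1) 8 MLL (- 2 * s) (lshift 1 (rshift 7 0)).
  have [|dil susy eom] := structure_global ts gT sphi.
    move=> U p e y m [[oU sp _ _ _] _] Uy.
    by rewrite (coord_dilaton e _ _ m oU sp Uy) eta2_0 eta1E /line_form !mxE.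
  split=> //; first by split=> //; exact: line_nonconstant2.
  + by exists (- 3^-1); split=> //; exact: (structure_bianchi1 ts gT).
  + by exists (- 12^-1) => //; exact: (structure_bianchi2 ts gT).
- have ts := spin7_torsion_structure cF s2 PsipE fr6.
  split=> [|||T gT]; [exact: compact_sphere_circle2|exact: (spin7_product_structure cF s2 PsipE fr6)
    |exact: (torsion_exists ts)|].
  split; first exact: (structure_local ts gT (spin7_arc_framed cF s2 PsipE fr6)).
  + by exists (- 3^-1) => //; exact: (structure_bianchi1 ts gT).
  + by exists (- 12^-1) => //; exact: (structure_bianchi2 ts gT).
Qed.
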